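(* Fix $t\in[0,1)$, $\eta>0$, $\beta\in(0,1]$, $L>0$, $\underline\lambda_r\ge0$, assume $r\in\{1,\ldots,d-1\}$ and consider the asymptotics $n\to\infty$, $h_n\to0$. Let $$v_n=\min\Big((\underline\lambda_r^{-1}L^2)^{1/(\beta+1)}n^{-\beta/(\beta+1)},\ L^{2/(\beta+2)}n^{-\beta/(\beta+2)}\Big).$$ When the local alternative $\mathcal H_1(I_{t,h_n},cv_n)$ is separated from the null hypothesis $\mathcal H_0([0,1],\beta,L,\underline\lambda_r)$ with rate $v_n$ and a small constant $c>0$, then no level-$\alpha$ test is consistent. More precisely, for any $\alpha'\in(0,1)$ there is a constant $c_{\alpha'}>0$ such that $$\liminf_{n\to\infty}\ \inf_{\varphi_n}\Big(\sup_{\Sigma\in\mathcal H_0([0,1],\beta,L,\underline\lambda_r)}\mathbb E_\Sigma[\varphi_n]+\sup_{\Sigma\in\mathcal H_1(I_{t,h_n},c_{\alpha'}v_n)}\mathbb E_\Sigma[1-\varphi_n]\Big)\ge\alpha',$$ where the infimum is taken over all tests $\varphi_n$ based on observing $(Y(s))_{s\in[0,1]}$ and the interval lengths $h_n>0$ satisfy $$h_n\le c_{\alpha'}^{1/(2\beta)}\max\Big((\underline\lambda_r^{-1}L^2n)^{-1/(2\beta+2)},\,(Ln)^{-1/(\beta+2)}\Big).$$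
   Context: Setting. Let $d\ge2$, $\eta>0$, $n\in\mathbb N$. $\mathbb R^{d\times d}_{spd}$ denotes the symmetric positive semi-definite $d\times d$ matrices; $\lambda_1(S)\ge\cdots\ge\lambda_d(S)$ are the ordered eigenvalues of a symmetric matrix $S$; $\|\cdot\|$ is the spectral norm. Let $X(t)=X(0)+\int_0^t\sigma(s)\,dB(s)$, $t\in[0,1]$, with a given initial value $X(0)$, a $p$-dimensional standard Brownian motion $B$, deterministic $\sigma\in L^2([0,1];\mathbb R^{d\times p})$, and $\Sigma(t)=\sigma(t)\sigma(t)^\top$. One observes $dY(t)=X(t)\,dt+\eta n^{-1/2}\,dW(t)$, $t\in[0,1]$, with a $d$-dimensional standard Brownian motion $W$ independent of $X$. $\mathbb E_\Sigma$ is expectation under the law of the observations when the spot covariance function is $\Sigma$. A test is a measurable function of the observations with values in $[0,1]$. $I_{t,h}=[t,t+h]$. $\mathcal H_0([0,1],\beta,L,\underline\lambda_r)$ is the set of $\Sigma:[0,1]\to\mathbb R^{d\times d}_{spd}$ with $\|\Sigma(u)-\Sigma(s)\|\le L|u-s|^\beta$, $\mathrm{rank}(\Sigma(s))\le r$ and $\lambda_r(\Sigma(s))\ge\underline\lambda_r$ for all $s,u\in[0,1]$. For $\underline\lambda_{r+1}>0$, $$\mathcal H_1(I_{t,h},\underline\lambda_{r+1})=\{\Sigma\in L^1([0,1];\mathbb R^{d\times d}_{spd})\,:\,\lambda_{r+1}(\Sigma(s))\ge\underline\lambda_{r+1}\ \forall s\in I_{t,h}\}.$$ Convention: $\underline\lambda_r^{-1}=+\infty$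 if $\underline\lambda_r=0$. *)

(* Defs.v *)
From HB Require Import structures.
From mathcomp Require Import all_boot all_order all_algebra.
From mathcomp Require Import all_classical all_reals all_analysis.

Set Implicit Arguments.
Unset Strict Implicit.
Unset Printing Implicit Defensive.

Import Order.TTheory GRing.Theory Num.Theory.
Import numFieldNormedType.Exports.

Local Open Scope classical_set_scope.
Local Open Scope ring_scope.

Section Matrices.
Context {R : realType}.

(* Eigenvalues in nonincreasing order, repeated with multiplicity; the default
   [::] only occurs for matrices whose characteristic polynomial does not
   split over R, in particular never for symmetric matrices. *)
Definition spectrum d (S : 'M[R]_d) : seq R :=
  xget [::] [set s : seq R | sorted >=%R s /\
                             char_poly S = \prod_(a <- s) ('X - a%:P)].

(* The k-th largest eigenvalue; k is counted from 1. *)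
Definition lambda d (k : nat) (S : 'M[R]_d) : R := nth 0 (spectrum S) k.-1.

Definition sqnorm m n (A : 'M[R]_(m, n)) : R := \sum_i \sum_j A i j ^+ 2.

Definition spectral_norm d (A : 'M[R]_d) : R :=
  sup [set Num.sqrt (sqnorm (A *m x)) | x in [set x : 'cV[R]_d | sqnorm x <= 1]].

(* Symmetric positive semi-definite. *)
Definition spd d (S : 'M[R]_d) : Prop :=
  S^T = S /\ forall x : 'cV[R]_d, 0 <= (x^T *m S *m x) 0 0.

End Matrices.

(* Functions of time are total on R; only their values on [0,1] matter. *)
Section CovarianceClasses.
Context {R : realType} (d : nat).

Definition L1_spd (Sigma : R -> 'M[R]_d) : Prop :=
  (forall s, s \in `[0, 1] -> spd (Sigma s)) /\
  forall i j, (@lebesgue_measure R).-integrable `[0, 1]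
                (fun s => (Sigma s i j)%:E).

Definition H0 (beta L : R) (r : nat) (lam : R) : set (R -> 'M[R]_d) :=
  [set Sigma |
    (forall s, s \in `[0, 1] -> spd (Sigma s)) /\
    (forall u s, u \in `[0, 1] -> s \in `[0, 1] ->
       spectral_norm (Sigma u - Sigma s) <= L * `|u - s| `^ beta) /\
    (forall s, s \in `[0, 1] -> (\rank (Sigma s) <= r)%N) /\
    (forall s, s \in `[0, 1] -> lam <= lambda r (Sigma s))].

Definition H1 (t h : R) (r : nat) (lam1 : R) : set (R -> 'M[R]_d) :=
  [set Sigma | L1_spd Sigma /\
    forall s, s \in `[t, t + h] -> lam1 <= lambda r.+1 (Sigma s)].

End CovarianceClasses.

Section Processes.
Context {R : realType} {disp : measure_display} {Omega : measurableType disp}.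
Variable P : probability Omega R.

(* An m-dimensional process with continuous paths on [0,1]. *)
Definition continuous_process m (U : R -> Omega -> 'cV[R]_m) : Prop :=
  (forall s i, s \in `[0, 1] -> measurable_fun setT (fun w => U s w i 0)) /\
  (forall w i, {within `[0, 1], continuous (fun s => U s w i 0)}).

(* The sigma-algebra generated by (U s) for s in T. *)
Definition sigma_process m (T : set R) (U : R -> Omega -> 'cV[R]_m) :
    set (set Omega) :=
  <<s [set A | exists (s : R) (i : 'I_m) (B : set R),
         T s /\ measurable B /\ A = (fun w => U s w i 0) @^-1` B] >>.

Definition independent (F G : set (set Omega)) : Prop :=
  forall A B, F A -> G B -> P (A `&` B) = (P A * P B)%E.

(* m-dimensional standard Brownian motion on [0,1]: the increments over [s,u]
   are independent of the past and distributed as N(0, (u - s) I_m); the second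
   argument of normal_prob is the standard deviation. *)
Definition brownian_motion m (U : R -> Omega -> 'cV[R]_m) : Prop :=
  continuous_process U /\
  (forall w, U 0 w = 0) /\
  (forall s u, 0 <= s -> s < u -> u <= 1 ->
     independent (sigma_process `[0, s] U)
                 (sigma_process [set u] (fun v w => U v w - U s w))) /\
  (forall s u, 0 <= s -> s < u -> u <= 1 ->
     forall A : 'I_m -> set R, (forall i, measurable (A i)) ->
       P [set w | forall i, A i ((U u w - U s w) i 0)] =
       (\prod_(i < m) normal_prob 0 (Num.sqrt (u - s)) (A i))%E).

(* The list of triples (a, b, xi) encodes the step function
   sum of xi 1_(a,b]. *)
Definition step m n := seq (R * R * 'M[R]_(m, n)).

Definition step_valid m n (S : step m n) : bool :=
  all (fun x => [&& 0 <= x.1.1, x.1.1 <= x.1.2 & x.1.2 <= 1]) S.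

Definition step_fun m n (S : step m n) (s : R) : 'M[R]_(m, n) :=
  \sum_(x <- S) (if x.1.1 < s <= x.1.2 then x.2 else 0).

Definition step_integral m n (S : step m n) (B : R -> Omega -> 'cV[R]_n)
    (s : R) (w : Omega) : 'cV[R]_m :=
  \sum_(x <- S) x.2 *m (B (Num.min x.1.2 s) w - B (Num.min x.1.1 s) w).

Definition L2_matrix m n (sigma : R -> 'M[R]_(m, n)) : Prop :=
  forall i j, measurable_fun (`[0, 1] : set R) (fun s => sigma s i j) /\
    (@lebesgue_measure R).-integrable `[0, 1] (fun s => (sigma s i j ^+ 2)%:E).

(* I s is the Wiener integral of sigma with respect to B over [0,s]: the
   L^2(P)-limit of integrals of step functions approximating sigma in L^2; by
   the isometry the limit does not depend on the approximation. *)
Definition wiener_integral m n (sigma : R -> 'M[R]_(m, n))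
    (B : R -> Omega -> 'cV[R]_n) (I : R -> Omega -> 'cV[R]_m) : Prop :=
  exists S : nat -> step m n,
    (forall k, step_valid (S k)) /\
    ((fun k => \int[lebesgue_measure]_(s in (`[0%R, 1%R] : set R))
                 (sqnorm (step_fun (S k) s - sigma s))%:E)%E @ \oo
       --> (0 : \bar R)) /\
    forall s, s \in `[0, 1] ->
      (fun k => \int[P]_w (sqnorm (step_integral (S k) B s w - I s w))%:E)%E
        @ \oo --> (0 : \bar R).

End Processes.

Section Observations.
Context {R : realType} (d : nat).

Definition cylinders : set (set (R -> 'cV[R]_d)) :=
  [set A | exists (s : R) (i : 'I_d) (B : set R), s \in `[0, 1] /\
     measurable B /\ A = (fun y : R -> 'cV[R]_d => y s i 0) @^-1` B].

End Observations.

(* Observation space: paths with the sigma-algebra generated by the coordinates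
   at times in [0,1]. Measurable functions on it are exactly the measurable
   functions of (Y(s)), s in [0,1]. *)
Notation path_space R d := (g_sigma_algebraType (@cylinders R d)).

Section Experiment.
Context {R : realType} (d : nat).

(* mu is the law of (Y(s)), s in [0,1], where Y(0) = 0 and
   dY = X dt + eta n^(-1/2) dW, X = x0 + int sigma dB, Sigma = sigma sigma^T.
   This law depends on sigma (and on the dimension p of B) only through Sigma. *)
Definition observation_law (x0 : 'cV[R]_d) (eta : R) (n : nat)
    (Sigma : R -> 'M[R]_d) (mu : probability (path_space R d) R) : Prop :=
  exists (disp : measure_display) (Omega : measurableType disp)
         (P : probability Omega R) (p : nat) (sigma : R -> 'M[R]_(d, p))
         (B : R -> Omega -> 'cV[R]_p) (X W Y : R -> Omega -> 'cV[R]_d),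
    L2_matrix sigma /\
    (forall s, s \in `[0, 1] -> Sigma s = sigma s *m (sigma s)^T) /\
    brownian_motion P B /\
    continuous_process X /\
    wiener_integral P sigma B (fun s w => X s w - x0) /\
    brownian_motion P W /\
    independent P (sigma_process `[0, 1] X) (sigma_process `[0, 1] W) /\
    (forall s w i, s \in `[0, 1] ->
       Y s w i 0 = \int[lebesgue_measure]_(u in (`[0, s] : set R)) X u w i 0
                   + eta / Num.sqrt n%:R * W s w i 0) /\
    (forall A : set (path_space R d), measurable A ->
       mu A = P [set w | A (fun s => Y s w)]).

Definition tests : set (path_space R d -> R) :=
  [set phi : path_space R d -> R | measurable_fun setT phi /\ forall y, 0 <= phi y <= 1].

End Experiment.

Section Rates.
Context {R : realType} (beta L lam : R) (n : nat).

(* The case lam = 0 implements the convention lam^-1 = +oo, under which the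
   first term of the minimum is +oo and the first term of the maximum is 0. *)
Definition separation_rate : R :=
  let v := L `^ (2 / (beta + 2)) * n%:R `^ (- (beta / (beta + 2))) in
  if lam == 0 then v
  else Num.min ((lam^-1 * L ^+ 2) `^ (1 / (beta + 1))
                * n%:R `^ (- (beta / (beta + 1)))) v.

Definition critical_length : R :=
  let l := (L * n%:R) `^ (- (1 / (beta + 2))) in
  if lam == 0 then l
  else Num.max ((lam^-1 * L ^+ 2 * n%:R) `^ (- (1 / (2 * beta + 2)))) l.

End Rates.

(* Main.v *)
(* Let [w] be the critical length and let [v] be the rate, so that [n v w^2] is bounded. The
   null covariances are [lam' (sum_(0 < i < r) e_i e_i^T + u u^T)] with [u = e_0 + z k(s) e_r],
   where [k] is a small tent function on [[t, t + w]] and [z] ranges over [[-1, 1]]; the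
   alternatives add [g 1_[t, t + w] e_r e_r^T] with [g = 3 c v], whose signal [B] is independent
   of the null signal [A]. A single [z] would be detected, but the mixture over [z] is not: in
   the null model the [r]-th component of the signal is [z A_r], and with [S = B(1) / A_r(1)]
   the alternative signal [z A_r + B] equals [(z + S) A_r + f], where [f = B - S A_r] vanishes
   off [[t, t + w]]. Conditionally on [A] and [B] the drift [f] shifts the noise by an amount
   whose energy is [O(n g w^2) = O(c)], which is a small total variation distance by the
   Cameron-Martin formula, and averaging over [z] in [[-1, 1]] changes by at most [|S|] when [z] is
   translated by [S], where [S = O(sqrt c)] with large probability. The laws of the observations
   are identified through the Gaussian cosine transforms of the paths. *)
From HB Require Import structures.
Require Import Defs.
From mathcomp Require Import all_boot all_order all_algebra.
From mathcomp Require Import all_classical all_reals all_analysis.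
From mathcomp Require Import measurable_realfun ring lra.
Import Order.TTheory GRing.Theory Num.Theory.
Import numFieldNormedType.Exports.
Set Implicit Arguments.
Unset Strict Implicit.
Unset Printing Implicit Defensive.
Local Open Scope classical_set_scope.
Local Open Scope ring_scope.

(** * Densities and Gaussian integrals *)

Section density.
Local Open Scope ereal_scope.
Context d (T : measurableType d) (R : realType) (mu : {measure set T -> \bar R}).
Context (g : T -> R) (g0 : forall x, (0 <= g x)%R) (mg : measurable_fun setT g).

(** Characteristic functions are replaced by cosines with a free phase, which stay real; [1 + cos]
    is nonnegative, so it can be integrated against unbounded exponential weights by Tonelli alone.
    No Brownian motion is constructed: the hypothesis on [law] supplies one model for the null path
    with [z = 1] and one for the added component, and a product of these sample spaces, with a
    second copy of the first one for the noise, carries [A], [B] and the noise independently. That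
    the observations built there have the prescribed laws for every [z] is a uniqueness statement,
    and this is what the transforms are for. The size of the construction comes from a balance: on a
    window of length [w] the Hoelder constraint permits a tilt of order [L w^beta / lam'], and
    [lam'] times its square, [v = (L w^beta)^2 / lam'], is the order of the variance that the tilted
    null puts into component [r]. The critical length is the [w] with [n v w^2 = 1]. If [lam] lies
    below [L w^beta], the null eigenvalues are raised to that level, which keeps the tilt bounded;
    this is the second regime of the rate. *)

Definition density (_ : forall x, (0 <= g x)%R) (_ : measurable_fun setT g)
  (A : set T) : \bar R := \int[mu]_(x in A) (g x)%:E.

Local Notation nu := (density g0 mg).

Let density0 : nu set0 = 0. Proof. exact: integral_set0. Qed.

Let density_ge0 A : 0 <= nu A.
Proof. by apply: integral_ge0 => x _; rewrite lee_fin. Qed.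

Let density_sigma_additive : semi_sigma_additive nu.
Proof.
move=> F mF tF mUF; rewrite /density ge0_integral_bigcup//.
- apply: is_cvg_ereal_nneg_natsum_cond => n _ _.
  by apply: integral_ge0 => x _; rewrite lee_fin.
- by apply/measurable_EFinP; exact: measurable_funTS.
- by move=> x _; rewrite lee_fin.
Qed.

HB.instance Definition _ := isMeasure.Build _ _ _ nu
  density0 density_ge0 density_sigma_additive.

Import HBNNSimple.

Lemma ge0_integral_density (f : T -> \bar R) : (forall x, 0 <= f x) ->
  measurable_fun setT f -> \int[nu]_x f x = \int[mu]_x (f x * (g x)%:E).
Proof.
move=> f0 mf; pose h := nnsfun_approx measurableT mf.
have hf x : (EFin \o h n) x @[n --> \oo] --> f x by exact: cvg_nnsfun_approx.
have mgE : measurable_fun setT (EFin \o g) by exact/measurable_EFinP.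
transitivity (limn (fun n => \int[nu]_x (EFin \o h n) x)).
  rewrite -monotone_convergence//.
  - by apply: eq_integral => x _; apply/esym/cvg_lim.
  - by move=> n; exact/measurable_EFinP.
  - by move=> n x _; rewrite lee_fin.
  - by move=> x _ m n mn; rewrite lee_fin; exact/lefP/nd_nnsfun_approx.
transitivity (limn (fun n => \int[mu]_x ((EFin \o h n) x * (g x)%:E))); last first.
  rewrite -monotone_convergence//.
  - apply: eq_integral => x _; apply/cvg_lim => //.
    by apply: cvgeZr.
  - by move=> n; apply: emeasurable_funM => //; exact/measurable_EFinP.
  - by move=> n x _; rewrite mule_ge0// lee_fin.
  - by move=> x _ m n mn; rewrite lee_wpmul2r ?lee_fin//; exact/lefP/nd_nnsfun_approx.
apply: congr_lim; apply/funext => n.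
transitivity (\int[nu]_x (\sum_(y \in range (h n))
    (y * \1_(h n @^-1` [set y]) x)%:E)).
  by apply: eq_integral => t tE; rewrite /= fimfunE -fsumEFin.
have indich r : measurable_fun setT (fun x => (r * \1_(h n @^-1` [set r]) x)%:E).
  by apply: (measurable_comp measurableT) => //; exact: measurable_funM.
rewrite ge0_integral_fsum//; last by move=> m y Ey; exact: nnfun_muleindic_ge0.
transitivity (\int[mu]_x (\sum_(y \in range (h n))
    ((y * \1_(h n @^-1` [set y]) x)%:E * (g x)%:E))); last first.
  apply: eq_integral => x _.
  rewrite -ge0_mule_fsuml => [|y]; last exact: nnfun_muleindic_ge0.
  by rewrite fsumEFin // -(fimfunE _ x).
rewrite ge0_integral_fsum//; last 2 first.
  - by move=> y; apply: emeasurable_funM.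
  - move=> m y Ey; apply: mule_ge0; last by rewrite lee_fin.
    exact: nnfun_muleindic_ge0.
apply: eq_fsbigr => r rhn.
under [LHS]eq_integral do rewrite EFinM.
rewrite integralZl_indic_nnsfun//.
under [RHS]eq_integral do rewrite EFinM -muleA.
rewrite ge0_integralZl//; last 3 first.
- by apply: emeasurable_funM => //; exact/measurable_EFinP/measurable_indic.
- by move=> x _; rewrite mule_ge0 ?lee_fin.
- by move: rhn => /set_mem [x _ <-]; rewrite lee_fin.
congr *%E; rewrite integral_indic//= setIT /density integral_mkcond.
apply: eq_integral => x _; rewrite epatch_indic//=.
by rewrite muleC.
Qed.

End density.

(** * Uniqueness of finite measures *)

Section uniq.
Context d (T : measurableType d) (R : realType).

(** The pi-system theorem with the whole space among the generators: this one set serves both as the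
    exhausting sequence and as the comparison of total masses. *)
Lemma finite_measure_unique (G : set (set T)) (m1 m2 : {measure set T -> \bar R}) :
  G `<=` measurable -> setI_closed G -> G setT ->
  (m1 setT < +oo)%E -> (forall A, G A -> m1 A = m2 A) ->
  forall E, <<s G >> E -> m1 E = m2 E.
Proof.
move=> Gm GI GT m1T m12 E GE.
apply: (@g_sigma_algebra_measure_unique _ _ _ G Gm (fun=> setT)) => //.
by rewrite bigcup_const.
Qed.

Lemma bounded_integrable (m : {measure set T -> \bar R}) (f : T -> R) (C : R) :
  (m setT < +oo)%E -> measurable_fun setT f -> (forall x, `|f x| <= C) ->
  m.-integrable setT (EFin \o f).
Proof.
move=> mT mf fC; apply: measurable_bounded_integrable => //.
exists C; split; first exact: num_real.
by move=> M CM x _ /=; exact: le_trans (fC x) (ltW CM).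
Qed.
End uniq.

(** * The cosine transform of a normal law and its exponential tilts *)

Section gaussian_transform.
Context (R : realType) (s : R) (s0 : s != 0).
Local Notation leb := (@lebesgue_measure R).
Local Notation p := (normal_pdf 0 s).

Let pE x : p x = normal_peak s * expR (- x ^+ 2 / (s ^+ 2 *+ 2)).
Proof. by rewrite normal_pdfE // /normal_fun subr0. Qed.

Let dp (x : R) : is_derive x 1 (p : R -> R) (- x / s ^+ 2 * p x).
Proof.
have -> : (p : R -> R) = fun x => normal_peak s * expR (- x ^+ 2 / (s ^+ 2 *+ 2)).
  by apply/funext => y; rewrite pE.
apply: is_derive_eq.
rewrite /GRing.scale /=; field.
by rewrite ?mulrn_eq0 ?expf_eq0 /= s0.
Qed.

Let int_bounded_pdf (f : R -> R) : measurable_fun setT f ->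
  (forall x, `|f x| <= 1) -> leb.-integrable setT (fun x => (f x * p x)%:E).
Proof.
move=> mf f1; apply: (le_integrable measurableT _ _ (integrable_normal_pdf 0 s)).
- apply/measurable_EFinP; apply: measurable_funM => //.
  exact: measurable_normal_pdf.
- move=> x _ /=; rewrite lee_fin normrM ler_piMl//.
Qed.

(** Doubling the standard deviation pays for the factor [|x|]: with [u = x / s] the claim is
    [|u| <= expR (3 / 8 * u ^+ 2)]. It makes [|x| * p x] integrable without computing a moment. *)
Let x_pdf_le x : `|x| * p x <= `|s| * (normal_peak s / normal_peak (2 * s)) *
  normal_pdf 0 (2 * s) x.
Proof.
have s20 : 2 * s != 0 by rewrite mulf_neq0.
rewrite pE normal_pdfE// /normal_fun subr0.
have pk := normal_peak_gt0 s0; have pk2 := normal_peak_gt0 s20.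
rewrite mulrCA -!mulrA [leRHS]mulrCA ler_pM2l// mulKf ?gt_eqF//.
rewrite -ler_pdivrMl ?normr_gt0//.
rewrite mulrA -normrV ?unitfE// -normrM.
rewrite -ler_pdivlMr ?expR_gt0// -expRN -expRD.
set u := s^-1 * x.
have -> : - x ^+ 2 / ((2 * s) ^+ 2 *+ 2) - - x ^+ 2 / (s ^+ 2 *+ 2) = 3 / 8 * u ^+ 2.
  by rewrite /u; field.
apply: le_trans (expR_ge1Dx _); rewrite -(@real_normK _ u) ?num_real//.
have := sqr_ge0 (`|u| - 4 / 3); nra.
Qed.

Let int_x_pdf : leb.-integrable setT (fun x => (`|x| * p x)%:E).
Proof.
have := integrable_normal_pdf 0 (2 * s) => /(integrableZl measurableT).
move=> /(_ (`|s| * (normal_peak s / normal_peak (2 * s)))).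
apply: le_integrable => //.
- apply/measurable_EFinP; apply: measurable_funM => //.
  exact: measurable_normal_pdf.
- move=> x _ /=; rewrite lee_fin ger0_norm ?mulr_ge0 ?normal_pdf_ge0//.
  by apply: le_trans (x_pdf_le x) _; exact: ler_norm.
Qed.

Let psi (u : R) := \int[leb]_x (cos (u * x) * p x).

Let mcos (u : R) : measurable_fun setT (fun x : R => cos (u * x)).
Proof.
apply: measurableT_comp; last exact: measurable_funM.
by apply: continuous_measurable_fun; exact: continuous_cos.
Qed.

Let msin (u : R) : measurable_fun setT (fun x : R => sin (u * x)).
Proof.
apply: measurableT_comp; last exact: measurable_funM.
by apply: continuous_measurable_fun; exact: continuous_sin.
Qed.

Let mxsin (u : R) : measurable_fun setT (fun x : R => x * sin (u * x)).
Proof. exact: measurable_funM. Qed.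

Let int_xsin (u : R) :
  leb.-integrable setT (fun x => (x * sin (u * x) * p x)%:E).
Proof.
apply: le_integrable int_x_pdf => //.
+ apply/measurable_EFinP; apply: measurable_funM.
    exact: mxsin.
  exact: measurable_normal_pdf.
+ move=> x _ /=; rewrite lee_fin !normrM ler_wpM2r// normr_id.
  by rewrite ler_piMr// sin_max.
Qed.

(** The difference [f] of the two integrands is the derivative of [F], which tends to 0 at both
    ends. The integral of [f] over the line is the limit of its integrals over [[-(n+1), n+1]] by
    dominated convergence, and these are increments of [F]. *)
Let ibp (u : R) : \int[leb]_x (x * sin (u * x) * p x) = u * s ^+ 2 * psi u.
Proof.
have ic : leb.-integrable setT (fun x => (cos (u * x) * p x)%:E).
  by apply: int_bounded_pdf => // x; exact: cos_max.
have is_ := int_xsin u.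
pose f x := u * s ^+ 2 * (cos (u * x) * p x) - x * sin (u * x) * p x.
have intf : leb.-integrable setT (EFin \o f).
  have -> : EFin \o f = (fun x => (u * s ^+ 2)%:E * (cos (u * x) * p x)%:E -
      (x * sin (u * x) * p x)%:E)%E by apply/funext => x /=.
  by apply: integrableB => //; exact: integrableZl.
suff If0 : \int[leb]_x f x = 0.
  move: If0; rewrite /f RintegralB//; last first.
    have -> : EFin \o (fun x => u * s ^+ 2 * (cos (u * x) * p x)) =
      (fun x => (u * s ^+ 2)%:E * (cos (u * x) * p x)%:E)%E by apply/funext => x /=.
    exact: integrableZl.
  by rewrite RintegralZl// => /eqP; rewrite subr_eq0 => /eqP <-.
pose F x := s ^+ 2 * (sin (u * x) * p x).
have dF (x : R) : is_derive x 1 F (f x).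
  have := dp x => dpx; apply: is_derive_eq.
  by rewrite /GRing.scale /= /f; field.
have cF : continuous F.
  by move=> x; apply: differentiable_continuous; apply/derivable1_diffP; case: (dF x).
have cf : continuous f.
  have cp : continuous p by exact: continuous_normal_pdf.
  move=> x; rewrite /f; apply: cvgB.
    apply: cvgM; first exact: cvg_cst.
    apply: cvgM; last exact: cp.
    by apply: (cvg_comp (fun x => u * x) cos); [apply: cvgMr; exact: cvg_id|exact: continuous_cos].
  apply: cvgM; last exact: cp.
  apply: cvgM; first exact: cvg_id.
  by apply: (cvg_comp (fun x => u * x) sin); [apply: cvgMr; exact: cvg_id|exact: continuous_sin].
have FTC n : (\int[leb]_(x in `[(- n.+1%:R)%R, n.+1%:R%R]) (f x)%:E =
    (F n.+1%:R)%:E - (F (- n.+1%:R))%:E)%E.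
  apply: continuous_FTC2.
  - by rewrite (@lt_trans _ _ 0)// oppr_lt0.
  - exact: continuous_subspaceT.
  - split.
    + by move=> x _; case: (dF x).
    + by apply: cvg_at_right_filter; exact: cF.
    + by apply: cvg_at_left_filter; exact: cF.
  - by move=> x _; rewrite derive1E; exact: derive_val.
have lim1 : (\int[leb]_x ((f \_ `[(- n.+1%:R)%R, n.+1%:R%R]) x)%:E @[n --> \oo]
    --> \int[leb]_x (f x)%:E)%E.
  have [] := @dominated_convergence _ _ _ leb setT measurableT
    (fun n x => ((f \_ `[(- n.+1%:R)%R, n.+1%:R%R]) x)%:E) (EFin \o f)
    (abse \o (EFin \o f)).
  - move=> n; apply/measurable_EFinP.
    apply/(measurable_restrictT f) => //; apply: measurable_funTS.
    exact: continuous_measurable_fun.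
  - by apply/measurable_EFinP; exact: continuous_measurable_fun.
  - apply: aeW => x _; apply: cvg_near_cst.
    near=> n; congr (_%:E); rewrite patchE mem_set//= in_itv/= -ler_norml.
    near: n.
    exists (Num.truncn `|x|) => // n /= xn.
    apply: ltW; apply: lt_le_trans (truncnS_gt _) _ => //.
    by rewrite ler_nat ltnS.
  - exact: integrable_abse.
  - apply: aeW => x n _ /=; rewrite patchE; case: ifP => //= _.
    by rewrite normr0 lee_fin.
  - by [].
have lim2 : (((F n.+1%:R)%:E - (F (- n.+1%:R))%:E)%E @[n --> \oo] --> 0%:E)%E.
  apply: cvg_EFin; first exact: nearW.
  apply: norm_cvg0.
  pose C := 2 * s ^+ 2 * (normal_peak s * (s ^+ 2 *+ 2)).
  have s2 : 0 < s ^+ 2 by rewrite exprn_even_gt0.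
  have pk := normal_peak_gt0 s0.
  apply: (@squeeze_cvgr _ _ _ _ (cst 0) (fun n => C * n.+1%:R^-1)); last 2 first.
  - exact: cvg_cst.
  - by rewrite -(mulr0 C); apply: cvgMr; exact: cvg_harmonic.
  apply: nearW => n; rewrite normr_ge0 /=.
  set m : R := n.+1%:R; have m1 : 1 <= m by rewrite /m ler1n.
  have m0 : 0 < m by lra.
  (* Decay of order [1 / m] is enough, and it follows from [1 + y <= expR y]. *)
  have pm : p m <= normal_peak s * (s ^+ 2 *+ 2) * m^-1.
    rewrite pE -mulrA ler_pM2l// mulNr expRN.
    rewrite -[leRHS]invrK lef_pV2 ?posrE ?expR_gt0 ?invr_gt0 ?divr_gt0 ?mulrn_wgt0//.
    rewrite invf_div; apply: le_trans (expR_ge1Dx _).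
    apply: (@le_trans _ _ (m ^+ 2 / (s ^+ 2 *+ 2))); last by rewrite lerDr.
    by rewrite ler_pM2r ?invr_gt0 ?mulrn_wgt0// expr2 ler_peMl//; lra.
  have pN : p (- m) = p m by rewrite !pE sqrrN.
  rewrite /F pN mulrN sinN mulNr mulrN opprK -mulr2n normrMn normrM.
  rewrite (ger0_norm (ltW s2)) normrM (ger0_norm (normal_pdf_ge0 _ _ _)).
  apply: (@le_trans _ _ (s ^+ 2 * p m *+ 2)).
    rewrite lerMn2r /= ler_wpM2l ?(ltW s2)//.
    by rewrite ler_piMl ?normal_pdf_ge0// sin_max.
  have -> : C / m = s ^+ 2 * (normal_peak s * (s ^+ 2 *+ 2) / m) *+ 2 by rewrite /C; ring.
  by rewrite lerMn2r /= ler_wpM2l ?(ltW s2)//.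
have : (\int[leb]_x (f x)%:E = 0)%E.
  have E : (fun n => \int[leb]_x ((f \_ `[(- n.+1%:R)%R, n.+1%:R%R]) x)%:E)%E =
      (fun n => (F n.+1%:R)%:E - (F (- n.+1%:R))%:E)%E.
    apply/funext => n; rewrite -FTC [in RHS]integral_mkcond.
    by apply: eq_integral => x _; rewrite restrict_EFin.
  by move: lim1; rewrite E => lim1; exact: (cvg_unique _ lim1 lim2).
by rewrite /Rintegral => ->.
Unshelve. all: end_near. Qed.

(** Differentiating under the integral, with dominating function [|x| * p x], brings out
    [- x * sin (a * x)]; integration by parts then turns this back into [psi]. *)
Let dpsi (a : R) : is_derive a 1 psi (- a * s ^+ 2 * psi a).
Proof.
pose f (u x : R) := cos (u * x) * p x.
pose G (x : R) : R := `|x| * p x.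
have df (u x : R) : is_derive u 1 (f ^~ x) (- (x * sin (u * x) * p x)).
  apply: is_derive_eq; rewrite /GRing.scale /=; ring.
pose J : set R := [set` `](a - 1), (a + 1)[].
have I : J a.
  by rewrite /J /= in_itv /= ltrDl ltr01 gtrDl ltrN10.
have h1 (x : R) : J x -> leb.-integrable setT (EFin \o f x).
  by move=> _; apply: int_bounded_pdf => // y; exact: cos_max.
have h2 (x y : R) : J x -> setT y -> derivable (f ^~ y) x 1.
  by move=> _ _; case: (df x y).
have h3 y : 0 <= G y by rewrite mulr_ge0 ?normal_pdf_ge0.
have h4 (x y : R) : J x -> setT y -> `|partial1of2 f x y| <= G y.
  move=> _ _; rewrite partial1of2E; have [_ ->] := df x y.
  rewrite normrN !normrM (ger0_norm (normal_pdf_ge0 _ _ _)) ler_wpM2r ?normal_pdf_ge0//.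
  by rewrite ler_piMr// sin_max.
apply: DeriveDef.
  exact: (derivable_under_integral measurableT I h1 h2 h3 int_x_pdf h4).
rewrite -derive1E (differentiation_under_integral measurableT I h1 h2 h3 int_x_pdf h4).
have dE x : partial1of2 f a x = - (x * sin (a * x) * p x).
  by rewrite partial1of2E; have [_ ->] := df a x.
under eq_Rintegral do rewrite dE.
transitivity (\int[leb]_x (-1 * (x * sin (a * x) * p x))).
  by apply: eq_Rintegral => x _; rewrite mulN1r.
by rewrite (RintegralZl _ measurableT (int_xsin a)) ibp mulN1r !mulNr.
Qed.

(** [D] is the quotient of [psi] by the claimed value. The differential equation [dpsi] makes its
    derivative vanish, and [D 0 = 1]. *)
Lemma normal_cos (u : R) : psi u = expR (- (u ^+ 2 * s ^+ 2 / 2)).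
Proof.
have psi0 : psi 0 = 1.
  rewrite /psi /Rintegral; under eq_integral do rewrite mul0r cos0 mul1r.
  by rewrite integral_normal_pdf.
pose D (v : R) := psi v * expR (v ^+ 2 * s ^+ 2 / 2).
have dD (v : R) : is_derive v 1 D 0.
  have := dpsi v => dv; apply: is_derive_eq.
  by rewrite /GRing.scale /=; field.
have : D u = D 0 by exact: is_derive_0_is_cst.
rewrite /D psi0 expr0n /= !mul0r expR0 mulr1 => h.
apply: (mulIf (lt0r_neq0 (expR_gt0 (u ^+ 2 * s ^+ 2 / 2)))).
by rewrite h -expRD addNr expR0.
Qed.

Lemma ge0_integral_translation (m : R) (f : R -> R) : continuous f -> (forall x, 0 <= f x) ->
  (\int[leb]_x (f x)%:E = \int[leb]_x (f (x + m))%:E)%E.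
Proof.
move=> cf f0.
have dF : (fun x : R => x + m)^`()%classic = cst 1.
  apply/funext => x; rewrite derive1E /=.
  have d : is_derive x 1 (fun x : R => x + m) 1.
    by apply: is_derive_eq; rewrite addr0.
  exact: derive_val.
rewrite (@increasing_ge0_integration_by_substitutionT _ (fun x : R => x + m) f)//.
- by apply: eq_integral => x _; rewrite /= dF /= mulr1.
- by move=> x y xy; rewrite ltrD2r.
- by rewrite dF => ?; exact: cvg_cst.
- by rewrite dF; exact: is_cvg_cst.
- by rewrite dF; exact: is_cvg_cst.
- exact: cvg_addrr_Ny.
- exact: cvg_addrr.
Qed.

Lemma ge0_integral_reflection (f : R -> R) : measurable_fun setT f -> (forall x, 0 <= f x) ->
  (\int[leb]_x (f x)%:E = \int[leb]_x (f (- x))%:E)%E.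
Proof.
move=> mf f0.
have mN : measurable_fun setT (-%R : measurableTypeR R -> measurableTypeR R).
  exact: oppr_measurable.
have := @ge0_integral_pushforward _ _ (measurableTypeR R) (measurableTypeR R) R
  -%R mN leb setT (fun x => (f x)%:E) measurableT.
rewrite preimage_setT => <-.
- by apply: eq_measure_integral => A mA _; exact/esym/lebesgue_measureN.
- by apply/measurable_EFinP.
- by move=> x _; rewrite lee_fin.
Qed.

(** Reflection replaces [c] by [- c]. In the sum of the integral and its reflection the sine terms
    of the addition formula cancel, which leaves [cos a] times the transform already known. *)
Let normal_cos_shift (a c : R) :
  (\int[leb]_x ((1 + cos (a + c * x)) * p x)%:E = (1 + cos a * expR (- (c ^+ 2 * s ^+ 2 / 2)))%:E)%E.
Proof.
have mc (a' c' : R) : measurable_fun setT (fun x : R => cos (a' + c' * x)).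
  apply: measurableT_comp; last by apply: measurable_funD => //; exact: measurable_funM.
  by apply: continuous_measurable_fun; exact: continuous_cos.
have mp : measurable_fun setT p := measurable_normal_pdf 0 s.
have ge0 (a' c' x : R) : 0 <= (1 + cos (a' + c' * x)) * p x.
  by rewrite mulr_ge0 ?normal_pdf_ge0// -lerBlDl sub0r; case/andP: (cos_geN1 (a' + c' * x)).
have m1 (a' c' : R) : measurable_fun setT (fun x => (1 + cos (a' + c' * x)) * p x).
  by apply: measurable_funM => //; exact: measurable_funD.
have E : (\int[leb]_x ((1 + cos (a + c * x)) * p x)%:E = \int[leb]_x ((1 + cos (a + (- c) * x)) * p x)%:E)%E.
  rewrite (ge0_integral_reflection (m1 a c) (ge0 a c)); apply: eq_integral => x _.
  by rewrite mulrN mulNr !pE sqrrN.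
have : (\int[leb]_x ((1 + cos (a + c * x)) * p x)%:E + \int[leb]_x ((1 + cos (a + c * x)) * p x)%:E =
  (2 * (1 + cos a * expR (- (c ^+ 2 * s ^+ 2 / 2))))%:E)%E.
  rewrite {2}E -ge0_integralD//; last 4 first.
  - by move=> x _; rewrite lee_fin.
  - by apply/measurable_EFinP; exact: m1.
  - by move=> x _; rewrite lee_fin.
  - by apply/measurable_EFinP; exact: m1.
  rewrite -normal_cos /psi.
  transitivity (\int[leb]_x ((2 * p x)%:E + (2 * cos a)%:E * (cos (c * x) * p x)%:E))%E.
    apply: eq_integral => x _; rewrite -EFinM -!EFinD; congr (_%:E).
    rewrite mulNr cosB cosD; ring.
  rewrite integralD//; last 2 first.
  - under eq_fun do rewrite EFinM.
    by apply: integrableZl => //; exact: integrable_normal_pdf.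
  - apply: integrableZl => //; apply: int_bounded_pdf => // x; exact: cos_max.
  rewrite (integralZl measurableT)//; last first.
    by apply: int_bounded_pdf => // x; exact: cos_max.
  under eq_integral do rewrite EFinM.
  rewrite integralZl//; last exact: integrable_normal_pdf.
  have I1 : (\int[leb]_x (cos (c * x) * p x)%:E = (psi c)%:E)%E.
    rewrite fineK//; apply: integrable_fin_num => //.
    by apply: int_bounded_pdf => // x; exact: cos_max.
  rewrite integral_normal_pdf I1 -!EFinM -EFinD; congr (_%:E).
  by rewrite /psi; ring.
have : (0 <= \int[leb]_x ((1 + cos (a + c * x)) * p x)%:E)%E.
  by apply: integral_ge0 => x _; rewrite lee_fin.
case: (\int[leb]_x _)%E => // r _.
by rewrite -EFinD => -[] h; congr (_%:E); lra.
Qed.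

(* completing the square: tilting by [expR (b * x)] translates the mean by [b * s ^+ 2] *)
Lemma normal_tilt (a c b : R) :
  (\int[normal_prob 0 s]_x ((1 + cos (a + c * x)) * expR (b * x))%:E =
   (expR (b ^+ 2 * s ^+ 2 / 2) *
     (1 + cos (a + c * b * s ^+ 2) * expR (- (c ^+ 2 * s ^+ 2 / 2))))%:E)%E.
Proof.
have mc (a' c' : R) : measurable_fun setT (fun x : R => cos (a' + c' * x)).
  apply: measurableT_comp; last by apply: measurable_funD => //; exact: measurable_funM.
  by apply: continuous_measurable_fun; exact: continuous_cos.
have mp : measurable_fun setT p := measurable_normal_pdf 0 s.
have ge0 (a' c' x : R) : 0 <= 1 + cos (a' + c' * x).
  by rewrite -lerBlDl sub0r cos_geN1.
have mf : measurable_fun setT (fun x => (1 + cos (a + c * x)) * expR (b * x)).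
  apply: measurable_funM; first exact: measurable_funD.
  by apply: measurableT_comp => //; exact: measurable_funM.
have m1 (a' c' : R) : measurable_fun setT (fun x => (1 + cos (a' + c' * x)) * p x).
  by apply: measurable_funM => //; exact: measurable_funD.
pose m := b * s ^+ 2.
transitivity (\int[leb]_x ((1 + cos (a + c * x)) * expR (b * x) * p x)%:E)%E.
  have pd := ge0_integral_density leb (normal_pdf_ge0 0 s) mp.
  under [RHS]eq_integral do rewrite EFinM.
  rewrite -pd//.
  by apply/measurable_EFinP.
rewrite (@ge0_integral_translation m).
- transitivity (\int[leb]_x ((expR (b ^+ 2 * s ^+ 2 / 2))%:E * ((1 + cos (a + c * m + c * x)) * p x)%:E))%E.
    apply: eq_integral => x _; rewrite -EFinM; congr (_%:E).
    rewrite !pE mulrDr addrA (addrAC a) [RHS]mulrCA -mulrA; congr (_ * _).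
    rewrite mulrCA [RHS]mulrCA; congr (_ * _).
    rewrite -!expRD; congr expR.
    by rewrite /m; field.
  rewrite ge0_integralZl//.
  + by rewrite normal_cos_shift /m -EFinM mulrA.
  + by apply/measurable_EFinP; exact: m1.
  + by move=> x _; rewrite lee_fin mulr_ge0 ?normal_pdf_ge0.
- move=> x; apply: cvgM; last exact: continuous_normal_pdf.
  apply: cvgM.
    apply: cvgD; first exact: cvg_cst.
    apply: (cvg_comp (fun x => a + c * x) cos); last exact: continuous_cos.
    by apply: cvgD; [exact: cvg_cst|apply: cvgMr; exact: cvg_id].
  apply: (cvg_comp (fun x => b * x) expR); last exact: continuous_expR.
  by apply: cvgMr; exact: cvg_id.
- by move=> x; rewrite mulr_ge0 ?normal_pdf_ge0// mulr_ge0// expR_ge0.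
Qed.

End gaussian_transform.

(** * Exponential tilting of Brownian motion *)

Section independence.
Context d (T : measurableType d) (R : realType) (P : probability T R).

(** Independence says that the joint law agrees with the product law on rectangles, hence
    everywhere; the rest is Tonelli. *)
Lemma ge0_integral_indep d1 d2 (T1 : measurableType d1) (T2 : measurableType d2)
    (U : T -> T1) (V : T -> T2) (f : T1 * T2 -> \bar R) :
  measurable_fun setT U -> measurable_fun setT V ->
  (forall A B, measurable A -> measurable B ->
    P (U @^-1` A `&` V @^-1` B) = (P (U @^-1` A) * P (V @^-1` B))%E) ->
  (forall x, 0 <= f x)%E -> measurable_fun setT f ->
  (\int[P]_w f (U w, V w) = \int[P]_w \int[P]_w' f (U w, V w'))%E.
Proof.
move=> mU mV indep f0 mf.
pose U' : {mfun T >-> T1} := mfun_Sub (mem_set mU).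
pose V' : {mfun T >-> T2} := mfun_Sub (mem_set mV).
have mUV : measurable_fun setT (fun w => (U w, V w)) by exact/measurable_fun_pair.
pose W : {mfun T >-> (T1 * T2)%type} := mfun_Sub (mem_set mUV).
transitivity (\int[distribution P W]_x f x)%E.
  by rewrite ge0_integral_pushforward.
transitivity (\int[distribution P U' \x distribution P V']_x f x)%E.
  apply: eq_measure_integral => A mA _.
  by apply/esym/product_measure_unique.
rewrite fubini_tonelli1//.
have mF := measurable_fun_fubini_tonelli_F (m2 := distribution P V') f mf f0.
rewrite ge0_integral_pushforward//; last first.
  by move=> x _; exact: integral_ge0.
rewrite preimage_setT; apply: eq_integral => w _ /=.
rewrite /fubini_F ge0_integral_pushforward//.
by apply: measurableT_comp => //; exact: measurable_pair1.
Qed.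

(** What a centred Gaussian pair [(U1, U2)] satisfies, with [m] the covariance, [k] half the
    variance of [U2] and [v] half the variance of [U1]: under the weight [expR U2] the variable [U1]
    has mean [m] and its old variance. The summand 1 keeps the integrand nonnegative, and the free
    phase [a] replaces the complex exponential. *)
Definition tilted (U1 U2 : T -> R) (m k v : R) := forall a : R,
  (\int[P]_w ((1 + cos (a + U1 w)) * expR (U2 w))%:E =
   (expR k * (1 + cos (a + m) * expR (- v)))%:E)%E.

Lemma measurable_cos_comp (D : set T) (f : T -> R) :
  measurable_fun D f -> measurable_fun D (fun x => cos (f x)).
Proof.
move=> mf; apply: (measurableT_comp _ mf).
by apply: continuous_measurable_fun; exact: continuous_cos.
Qed.

Lemma cosD1_ge0 (x : R) : 0 <= 1 + cos x.
Proof. by rewrite -lerBlDl sub0r cos_geN1. Qed.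

(** The phases 0 and [pi] give opposite cosines, so adding the two identities leaves twice the
    exponential moment. *)
Lemma tilted_expR U1 U2 m k v : measurable_fun setT U1 -> measurable_fun setT U2 ->
  tilted U1 U2 m k v -> (\int[P]_w (expR (U2 w))%:E = (expR k)%:E)%E.
Proof.
move=> mU1 mU2 h.
have mf a : measurable_fun setT (fun w => ((1 + cos (a + U1 w)) * expR (U2 w))%:E).
  apply/measurable_EFinP; apply: measurable_funM; last exact: measurableT_comp.
  by apply: measurable_funD => //; apply: measurable_cos_comp; exact: measurable_funD.
have : (2%:E * (\int[P]_w (expR (U2 w))%:E) = (2 * expR k)%:E)%E.
  rewrite -ge0_integralZl//; last first.
    by apply/measurable_EFinP; exact: measurableT_comp.
  transitivity (\int[P]_w ((1 + cos (0 + U1 w)) * expR (U2 w))%:E +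
                \int[P]_w ((1 + cos (pi + U1 w)) * expR (U2 w))%:E)%E.
    rewrite -ge0_integralD//.
      apply: eq_integral => w _; rewrite -EFinM -EFinD; congr (_%:E).
      by rewrite add0r (addrC pi) cosDpi; ring.
  rewrite !h -EFinD add0r (addrC pi) cosDpi; congr (_%:E); ring.
have : (0 <= \int[P]_w (expR (U2 w))%:E)%E.
  by apply: integral_ge0 => w _; rewrite lee_fin expR_ge0.
case: (\int[P]_w _)%E => [r| |] // _; last by rewrite gt0_muley// lte_fin.
by rewrite -EFinM => -[] e; congr (_%:E); lra.
Qed.

Lemma tilted_step U1 U2 V m k v s c b :
  measurable_fun setT U1 -> measurable_fun setT U2 -> measurable_fun setT V ->
  s != 0 ->
  (forall A B, measurable A -> measurable B ->
    P ((fun w => (U1 w, U2 w)) @^-1` A `&` V @^-1` B) =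
    (P ((fun w => (U1 w, U2 w)) @^-1` A) * normal_prob 0 s B)%E) ->
  tilted U1 U2 m k v ->
  tilted (fun w => U1 w + c * V w) (fun w => U2 w + b * V w)
    (m + c * b * s ^+ 2) (k + b ^+ 2 * s ^+ 2 / 2) (v + c ^+ 2 * s ^+ 2 / 2).
Proof.
move=> mU1 mU2 mV s0 indep h a.
have lawV B : measurable B -> P (V @^-1` B) = normal_prob 0 s B.
  move=> mB; have := indep setT B measurableT mB.
  by rewrite preimage_setT setTI probability_setT mul1e.
pose f (x : (R * R) * R) := ((1 + cos (a + (x.1.1 + c * x.2))) * expR (x.1.2 + b * x.2))%:E.
have f0 x : (0 <= f x)%E by rewrite lee_fin mulr_ge0 ?cosD1_ge0 ?expR_ge0.
have m11 : measurable_fun setT (fun x : (R * R) * R => x.1.1).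
  by apply: measurableT_comp; [exact: measurable_fst|exact: measurable_fst].
have m12 : measurable_fun setT (fun x : (R * R) * R => x.1.2).
  by apply: measurableT_comp; [exact: measurable_snd|exact: measurable_fst].
have m2 : measurable_fun setT (fun x : (R * R) * R => x.2) by exact: measurable_snd.
have mf : measurable_fun setT f.
  apply/measurable_EFinP; apply: measurable_funM.
    apply: measurable_funD => //; apply: (measurableT_comp (f := cos)).
      by apply: continuous_measurable_fun; exact: continuous_cos.
    apply: measurable_funD => //; apply: measurable_funD => //.
    exact: measurable_funM.
  apply: measurableT_comp => //; apply: measurable_funD => //.
  exact: measurable_funM.
have mUU : measurable_fun setT (fun w => (U1 w, U2 w)) by exact/measurable_fun_pair.
transitivity (\int[P]_w f ((U1 w, U2 w), V w))%E; first by [].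
rewrite (ge0_integral_indep mUU mV)//; last first.
  by move=> A B mA mB; rewrite indep// lawV.
set q := expR (- (c ^+ 2 * s ^+ 2 / 2)).
have q0 : 0 <= q by exact: expR_ge0.
have q1 : q <= 1.
  by rewrite -expR0 ler_expR oppr_le0 divr_ge0// mulr_ge0 ?sqr_ge0.
set e := expR (b ^+ 2 * s ^+ 2 / 2).
have e0 : 0 <= e by exact: expR_ge0.
(* Integrating out [V] produces [1 + q cos]. Written as [(1 - q) + q (1 + cos)] it is a sum of
   nonnegative terms: the first is covered by [tilted_expR], the second by the hypothesis with a
   shifted phase. *)
transitivity (\int[P]_w ((e * (1 - q))%:E * (expR (U2 w))%:E +
    (e * q)%:E * ((1 + cos (a + c * b * s ^+ 2 + U1 w)) * expR (U2 w))%:E))%E.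
  apply: eq_integral => w _.
  pose V' : {mfun T >-> measurableTypeR R} := mfun_Sub (mem_set mV).
  transitivity (\int[normal_prob 0 s]_x f ((U1 w, U2 w), x))%E.
    transitivity (\int[distribution P V']_x f ((U1 w, U2 w), x))%E.
      rewrite ge0_integral_pushforward//.
      by apply: measurableT_comp => //; exact: measurable_pair1.
    by apply: eq_measure_integral => A mA _; exact: lawV.
  rewrite /f /=.
  transitivity (\int[normal_prob 0 s]_x ((expR (U2 w))%:E *
      ((1 + cos (a + U1 w + c * x)) * expR (b * x))%:E))%E.
    apply: eq_integral => x _; rewrite -EFinM; congr (_%:E).
    by rewrite expRD addrA; ring.
  rewrite ge0_integralZl//; last first.
    apply/measurable_EFinP; apply: measurable_funM.
      apply: measurable_funD => //; apply: (measurableT_comp (f := cos)).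
        by apply: continuous_measurable_fun; exact: continuous_cos.
      apply: measurable_funD => //; exact: measurable_funM.
    apply: measurableT_comp => //; exact: measurable_funM.
  rewrite normal_tilt// -!EFinM -EFinD; congr (_%:E).
  by rewrite -/e -/q (addrAC a); ring.
rewrite ge0_integralD//; last 4 first.
- by move=> w _; rewrite -EFinM lee_fin !mulr_ge0 ?subr_ge0// expR_ge0.
- apply/measurable_EFinP; apply: measurable_funM => //; exact: measurableT_comp.
- by move=> w _; rewrite -EFinM lee_fin !mulr_ge0 ?cosD1_ge0// expR_ge0.
- apply/measurable_EFinP; apply: measurable_funM => //; apply: measurable_funM.
    apply: measurable_funD => //; apply: measurable_cos_comp; exact: measurable_funD.
  exact: measurableT_comp.
rewrite ge0_integralZl//; last 2 first.
- by apply/measurable_EFinP; exact: measurableT_comp.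
- by rewrite lee_fin mulr_ge0// subr_ge0.
rewrite ge0_integralZl//; last 2 first.
- apply/measurable_EFinP; apply: measurable_funM.
    apply: measurable_funD => //; apply: measurable_cos_comp; exact: measurable_funD.
  exact: measurableT_comp.
- by rewrite lee_fin mulr_ge0.
rewrite (tilted_expR mU1 mU2 h) h -!EFinM -EFinD; congr (_%:E).
rewrite expRD -/e opprD expRD -/q (addrAC a) -addrA (addrC m) addrA; ring.
Qed.

End independence.

Definition dot (R : realType) m (u v : 'cV[R]_m) : R := \sum_i u i 0 * v i 0.

Lemma measurable_bigsum d (T : measurableType d) (R : realType) (D : set T) I (s : seq I)
    (Q : pred I) (h : I -> T -> R) : (forall i, Q i -> measurable_fun D (h i)) ->
  measurable_fun D (fun x => \sum_(i <- s | Q i) h i x).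
Proof.
move=> mh; elim: s => [|i s IH].
  under eq_fun do rewrite big_nil.
  exact: measurable_cst.
have [Qi|/negbTE nQi] := boolP (Q i); last by under eq_fun do rewrite big_cons nQi.
under eq_fun do rewrite big_cons Qi.
by apply: measurable_funD => //; exact: mh.
Qed.

(** * Adding an independent Gaussian vector *)

Section brownian.
Context d (T : measurableType d) (R : realType) (P : probability T R).

(** A pi-system for what is known after the first [i] components of the increment [D]. The
    components are added one at a time, and component [i] is independent of the sigma-algebra that
    this family generates. *)
Definition extend_past (past : set (set T)) m (D : T -> 'cV[R]_m) (i : nat) : set (set T) :=
  [set E | exists F (A : 'I_m -> set R), past F /\ (forall j, measurable (A j)) /\
     E = F `&` [set w | forall j : 'I_m, (j < i)%N -> A j (D w j 0)]].

Section vector_step.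
Variables (past : set (set T)) (m : nat) (D : T -> 'cV[R]_m) (s : R).
Hypothesis s0 : s != 0.
Hypothesis past_meas : past `<=` measurable.
Hypothesis past_I : setI_closed past.
Hypothesis past_T : past setT.
Hypothesis mD : forall i, measurable_fun setT (fun w => D w i 0).
Hypothesis indep : forall F (A : 'I_m -> set R), past F -> (forall i, measurable (A i)) ->
  P (F `&` [set w | forall i, A i (D w i 0)]) = (P F * \prod_(i < m) normal_prob 0 s (A i))%E.

Let ext_meas i : extend_past past D i `<=` measurable.
Proof.
move=> E [F [A [pF [mA ->]]]]; apply: measurableI; first exact: past_meas.
have -> : [set w | forall j : 'I_m, (j < i)%N -> A j (D w j 0)] =
  \bigcap_(j in [set j : 'I_m | (j < i)%N]) ((fun w => D w j 0) @^-1` (A j)) by [].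
apply: fin_bigcap_measurable => // j _.
by rewrite -[X in measurable X]setTI; exact: mD.
Qed.

Let ext_I i : setI_closed (extend_past past D i).
Proof.
move=> _ _ [F [A [pF [mA ->]]]] [G [B [pG [mB ->]]]].
exists (F `&` G), (fun j => A j `&` B j); split; first exact: past_I.
split; first by move=> j; exact: measurableI.
rewrite setIACA; congr (_ `&` _); apply/seteqP; split => w /=.
  by move=> [h1 h2] j ji; split; [exact: h1|exact: h2].
by move=> h; split=> j ji; case: (h j ji).
Qed.

Let ext_T i : extend_past past D i setT.
Proof.
exists setT, (fun=> setT); split => //; split => //.
by apply/esym; rewrite setTI; apply/seteqP; split.
Qed.

(** As functions of [E] both sides are finite measures, a restriction of [P] and a multiple of [P].
    It suffices to compare them on the pi-system, where the product formula for the whole vector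
    applies with [setT] at the later components. *)
Let ext_indep (i : 'I_m) E B : <<s extend_past past D i>> E -> measurable B ->
  P (E `&` (fun w => D w i 0) @^-1` B) = (P E * normal_prob 0 s B)%E.
Proof.
move=> sE mB.
pose V := (fun w => D w i 0) @^-1` B.
have mV : measurable V by rewrite -[X in measurable X]setTI; exact: mD.
have r0 : 0 <= fine (normal_prob 0 s B) by exact: fine_ge0.
have rE : (normal_prob 0 s B = (NngNum r0)%:num%:E)%E.
  by rewrite /= fineK// fin_num_measure.
rewrite rE muleC -/V -[LHS]/(mrestr P mV E) -[RHS]/(mscale (NngNum r0) P E).
apply: (@finite_measure_unique _ _ _ (extend_past past D i)) => //.
  by rewrite /= /mrestr setTI (le_lt_trans (probability_le1 _ _))// ltry.
move=> _ [F [A [pF [mA ->]]]]; rewrite /= /mscale /mrestr /= -rE muleC.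
have -> : F `&` [set w | forall j : 'I_m, (j < i)%N -> A j (D w j 0)] `&` V =
  F `&` [set w | forall j : 'I_m, (if (j < i)%N then A j else if j == i then B else setT) (D w j 0)].
  rewrite -setIA; congr (_ `&` _); apply/seteqP; split => w /=.
    move=> [h1 h2] j; case: ifPn => [ji|_]; first exact: h1.
    by case: eqP => // ->.
  move=> h; split; first by move=> j ji; have := h j; rewrite ji.
  by have := h i; rewrite ltnn eqxx.
have -> : [set w | forall j : 'I_m, (j < i)%N -> A j (D w j 0)] =
  [set w | forall j : 'I_m, (if (j < i)%N then A j else setT) (D w j 0)].
  apply/seteqP; split => w /= h j; first by case: ifPn => // ji; exact: h.
  by move=> ji; have := h j; rewrite ji.
rewrite (indep (A := fun j : 'I_m => if (j < i)%N then A j else if j == i then B else setT))//; last first.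
  by move=> j; case: ifP => // _; case: ifP.
rewrite (indep (A := fun j : 'I_m => if (j < i)%N then A j else setT))//; last first.
  by move=> j; case: ifP.
rewrite -muleA; congr (_ * _)%E.
rewrite (bigD1 i)//= ltnn eqxx muleC; congr (_ * _)%E.
rewrite [RHS](bigD1 i)//= ltnn probability_setT mul1e.
by apply: eq_bigr => j /negbTE ->.
Qed.

(** Induction on the number of components already added: the partial sums are measurable for
    [extend_past], so [tilted_step] handles the next component. *)
Lemma tilted_vector U1 U2 mu k v (c b : 'cV[R]_m) :
  measurable_fun (setT : set (g_sigma_algebraType past)) U1 ->
  measurable_fun (setT : set (g_sigma_algebraType past)) U2 ->
  tilted P U1 U2 mu k v ->
  tilted P (fun w => U1 w + dot c (D w)) (fun w => U2 w + dot b (D w))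
    (mu + dot c b * s ^+ 2) (k + dot b b * s ^+ 2 / 2) (v + dot c c * s ^+ 2 / 2).
Proof.
move=> mU1 mU2 h.
suff H (i : nat) : (i <= m)%N ->
  tilted P (fun w => U1 w + \sum_(j < m | (j < i)%N) c j 0 * D w j 0)
    (fun w => U2 w + \sum_(j < m | (j < i)%N) b j 0 * D w j 0)
    (mu + (\sum_(j < m | (j < i)%N) c j 0 * b j 0) * s ^+ 2)
    (k + (\sum_(j < m | (j < i)%N) b j 0 * b j 0) * s ^+ 2 / 2)
    (v + (\sum_(j < m | (j < i)%N) c j 0 * c j 0) * s ^+ 2 / 2).
  have := H m (leqnn m) => + a => /(_ a).
  have S0 (f : 'I_m -> R) : \sum_(j < m | (j < m)%N) f j = \sum_j f j.
    by apply: eq_bigl => j; rewrite ltn_ord.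
  by rewrite /dot !S0; under eq_integral do rewrite !S0.
elim: i => [_|i IH im].
  by move=> a; under eq_integral do rewrite !big_pred0// !addr0; rewrite !big_pred0// !mul0r !addr0; exact: h.
pose i' := Ordinal im.
have S (f : 'I_m -> R) : \sum_(j < m | (j < i.+1)%N) f j = \sum_(j < m | (j < i)%N) f j + f i'.
  rewrite (bigD1 i')//= addrC; congr (_ + _); apply: eq_bigl => j.
  by rewrite ltnS -val_eqE /=; case: ltngtP.
have mp1 (f : T -> R) : measurable_fun (setT : set (g_sigma_algebraType past)) f ->
    measurable_fun (setT : set (g_sigma_algebraType (extend_past past D i))) f.
  move=> mf _ Y mY; have := mf measurableT Y mY.
  apply: sub_sigma_algebra2 => F pF; exists F, (fun=> setT); split => //; split => //.
  by apply/esym; rewrite -[RHS]setIT; congr (_ `&` _); apply/seteqP; split.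
have mDj (j : 'I_m) : (j < i)%N ->
    measurable_fun (setT : set (g_sigma_algebraType (extend_past past D i))) (fun w => D w j 0).
  move=> ji _ Y mY; apply: sub_sigma_algebra.
  exists setT, (fun l => if l == j then Y else setT); split => //; split.
    by move=> l; case: ifP.
  congr (_ `&` _); apply/seteqP; split => w /=.
    by move=> Yw l _; case: eqP => // ->.
  by move=> /(_ j ji); rewrite eqxx.
have mS (f : 'I_m -> R) : measurable_fun (setT : set (g_sigma_algebraType (extend_past past D i)))
    (fun w => \sum_(j < m | (j < i)%N) f j * D w j 0).
  apply: measurable_bigsum => j ji.
  by apply: measurable_funM => //; exact: mDj.
have lift (f : T -> R) : measurable_fun (setT : set (g_sigma_algebraType (extend_past past D i))) f ->
    measurable_fun setT f.
  move=> mf _ Y mY; have := mf measurableT Y mY.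
  by apply: (smallest_sub (@sigma_algebra_measurable _ T)); exact: ext_meas.
have mV1 : measurable_fun (setT : set (g_sigma_algebraType (extend_past past D i)))
    (fun w => U1 w + \sum_(j < m | (j < i)%N) c j 0 * D w j 0).
  by apply: measurable_funD; [exact: mp1|exact: mS].
have mV2 : measurable_fun (setT : set (g_sigma_algebraType (extend_past past D i)))
    (fun w => U2 w + \sum_(j < m | (j < i)%N) b j 0 * D w j 0).
  by apply: measurable_funD; [exact: mp1|exact: mS].
have H := @tilted_step _ _ _ P _ _ (fun w => D w i' 0) _ _ _ s (c i' 0) (b i' 0)
  (lift _ mV1) (lift _ mV2) (mD i') s0 _ (IH (ltnW im)).
move=> a.
under eq_integral do rewrite !S (addrA (U1 _)) (addrA (U2 _)).
rewrite !S H; last first.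
  move=> A B mA mB; apply: (@ext_indep i') => //.
  have := measurable_fun_pair mV1 mV2 => /(_ measurableT A mA).
  by rewrite setTI.
congr ((expR _ * (1 + cos (a + _) * expR (- _)))%:E); rewrite ?expr2; ring.
Qed.

End vector_step.
End brownian.

(** * Sums over the intervals of a grid *)

Section increments.
Context (R : realType).

Fixpoint isum (G : R -> R -> R) (s : R) (l : seq R) : R :=
  if l is t :: l' then G s t + isum G t l' else 0.

Lemma isum_sum I (r : seq I) (G : I -> R -> R -> R) s l :
  isum (fun s t => \sum_(i <- r) G i s t) s l = \sum_(i <- r) isum (G i) s l.
Proof.
elim: l s => [|t l IH] s /=; first by rewrite big1.
by rewrite IH big_split.
Qed.

Lemma isumZ a G s l : isum (fun s t => a * G s t) s l = a * isum G s l.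
Proof. by elim: l s => [|t l IH] s /=; rewrite ?mulr0// IH mulrDr. Qed.

Lemma eq_isum G H s l : (forall s t, G s t = H s t) -> isum G s l = isum H s l.
Proof. by move=> e; elim: l s => [|t l IH] s //=; rewrite e IH. Qed.

(** Intervals that end after [x] contribute nothing, and since [x] is itself a grid point, those
    before it telescope exactly to [x]. *)
Lemma isum_telescope (f : R -> R) s l x : path <%R s l -> x \in s :: l ->
  isum (fun s t => if t <= x then f t - f s else 0) s l = f x - f s.
Proof.
elim: l s => [|t l IH] s /=; first by rewrite inE => _ /eqP ->; rewrite subrr.
move=> /andP[st tl]; rewrite inE => /predU1P[->|xl]; last first.
  rewrite IH// ifT; first by rewrite addrC subrKA.
  move: xl; rewrite inE => /predU1P[->//|xl].
  by move/(order_path_min lt_trans)/allP : tl => /(_ _ xl)/ltW.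
rewrite leNgt st subrr add0r.
have {}tl : path <%R s (t :: l) by rewrite /= st.
elim: l t {IH} st tl => //= t l IH u su /and3P[_ ut tl].
rewrite leNgt (lt_trans su ut) add0r; apply: IH => //=; first exact: lt_trans ut.
by rewrite (lt_trans su ut).
Qed.

End increments.

Section dot.
Context (R : realType) (m : nat).
Implicit Types u v : 'cV[R]_m.

Lemma dotC u v : dot u v = dot v u.
Proof. by apply: eq_bigr => i _; rewrite mulrC. Qed.

Lemma dot_suml I (r : seq I) (Q : pred I) (F : I -> 'cV[R]_m) v :
  dot (\sum_(i <- r | Q i) F i) v = \sum_(i <- r | Q i) dot (F i) v.
Proof.
rewrite /dot exchange_big /=; apply: eq_bigr => j _.
by rewrite summxE mulr_suml.
Qed.

Lemma dot_sumr I (r : seq I) (Q : pred I) (F : I -> 'cV[R]_m) v :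
  dot v (\sum_(i <- r | Q i) F i) = \sum_(i <- r | Q i) dot v (F i).
Proof. by rewrite dotC dot_suml; apply: eq_bigr => i _; rewrite dotC. Qed.

Lemma dotBr u v w : dot u (v - w) = dot u v - dot u w.
Proof. by rewrite /dot -sumrB; apply: eq_bigr => i _; rewrite !mxE mulrBr. Qed.

Lemma dotDr u v w : dot u (v + w) = dot u v + dot u w.
Proof. by rewrite /dot -big_split; apply: eq_bigr => i _; rewrite !mxE mulrDr. Qed.

Lemma dot0r u : dot u 0 = 0.
Proof. by rewrite /dot big1// => i _; rewrite mxE mulr0. Qed.

Lemma dotZl a u v : dot (a *: u) v = a * dot u v.
Proof. by rewrite /dot mulr_sumr; apply: eq_bigr => i _; rewrite !mxE mulrA. Qed.

End dot.

(* [lincomb l U] is the linear functional [sum of x.2 . U(x.1)] of the path [U];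
   [bmcov l l'] is the covariance of two of them for a Brownian motion. *)
Definition lincomb (R : realType) (T : Type) m (l : seq (R * 'cV[R]_m))
    (U : R -> T -> 'cV[R]_m) (w : T) : R :=
  \sum_(x <- l) dot x.2 (U x.1 w).

Definition bmcov (R : realType) m (l l' : seq (R * 'cV[R]_m)) : R :=
  \sum_(x <- l) \sum_(y <- l') Num.min x.1 y.1 * dot x.2 y.2.

Definition times01 (R : realType) m (l : seq (R * 'cV[R]_m)) : bool :=
  all (fun x => x.1 \in `[0, 1]) l.

(** * Tilting by linear functionals of the path *)

Section brownian_tilt.
Context d (T : measurableType d) (R : realType) (P : probability T R).
Context m (U : R -> T -> 'cV[R]_m) (bmU : brownian_motion P U).

Local Notation past s := (sigma_process [set` `[0, s]] U).

Let mU s i : s \in `[0, 1] -> measurable_fun setT (fun w => U s w i 0).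
Proof. by case: bmU => -[h _] _ s01; exact: h. Qed.

Let past_meas s : s <= 1 -> past s `<=` measurable.
Proof.
move=> s1; apply: smallest_sub; first exact: sigma_algebra_measurable.
move=> _ [u [i [B [us [mB ->]]]]]; rewrite -[X in measurable X]setTI.
apply: mU => //; move: us; rewrite /= !in_itv /= => /andP[-> us].
exact: le_trans s1.
Qed.

Let past_mono s t : s <= t -> past s `<=` past t.
Proof.
move=> st; apply: sub_sigma_algebra2 => A [u [i [B [us [mB ->]]]]].
exists u, i, B; split => //; move: us; rewrite /= !in_itv /= => /andP[-> us].
exact: le_trans st.
Qed.

Let past_proc s u i : 0 <= u -> u <= s ->
  measurable_fun (setT : set (g_sigma_algebraType (past s))) (fun w => U u w i 0).
Proof.
move=> u0 us _ B mB; apply: sub_sigma_algebra; rewrite setTI; apply: sub_sigma_algebra.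
by exists u, i, B; split => //; rewrite /= in_itv /= u0.
Qed.

Let past_fun s t (f : T -> R) : s <= t ->
  measurable_fun (setT : set (g_sigma_algebraType (past s))) f ->
  measurable_fun (setT : set (g_sigma_algebraType (past t))) f.
Proof.
move=> st mf _ Y mY; have := mf measurableT Y mY.
by apply: sub_sigma_algebra2; exact: past_mono.
Qed.

(** A discrete Girsanov formula: on every grid interval the coefficients are constant and the
    increment is independent of the past, so means and variances accumulate interval by interval. *)
Lemma tilted_isum (g : seq R) s U1 U2 mu k v (c b : R -> 'cV[R]_m) :
  path <%R s g -> 0 <= s -> all (<= 1) g -> s <= 1 ->
  measurable_fun (setT : set (g_sigma_algebraType (past s))) U1 ->
  measurable_fun (setT : set (g_sigma_algebraType (past s))) U2 ->
  tilted P U1 U2 mu k v ->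
  tilted P (fun w => U1 w + isum (fun s t => dot (c t) (U t w - U s w)) s g)
    (fun w => U2 w + isum (fun s t => dot (b t) (U t w - U s w)) s g)
    (mu + isum (fun s t => dot (c t) (b t) * (t - s)) s g)
    (k + isum (fun s t => dot (b t) (b t) * (t - s) / 2) s g)
    (v + isum (fun s t => dot (c t) (c t) * (t - s) / 2) s g).
Proof.
elim: g s U1 U2 mu k v => [|t g IH] s U1 U2 mu k v /=.
  by move=> _ _ _ _ _ _ h a; rewrite !addr0; under eq_integral do rewrite !addr0; exact: h.
move=> /andP[st pg] s0 /andP[t1 g1] s1 mU1 mU2 h.
case: bmU => _ [U0 [ind law]].
pose D w := U t w - U s w.
have ts : 0 < t - s by rewrite subr_gt0.
have q0 : Num.sqrt (t - s) != 0 by rewrite gt_eqF// sqrtr_gt0.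
have s01 : s \in `[0, 1] by rewrite in_itv /= s0.
have t01 : t \in `[0, 1] by rewrite in_itv /= t1 (le_trans s0)// ltW.
have DE i : (fun w => D w i 0) = (fun w => U t w i 0 - U s w i 0).
  by apply/funext => w; rewrite !mxE.
have mD i : measurable_fun setT (fun w => D w i 0).
  rewrite DE.
  by apply: measurable_funB; exact: mU.
have H := @tilted_vector _ _ _ P (past s) m D (Num.sqrt (t - s)) q0 (past_meas s1)
  _ _ mD _ U1 U2 mu k v (c t) (b t) mU1 mU2 h.
have {}H : tilted P (fun w => U1 w + dot (c t) (D w)) (fun w => U2 w + dot (b t) (D w))
    (mu + dot (c t) (b t) * (t - s)) (k + dot (b t) (b t) * (t - s) / 2)
    (v + dot (c t) (c t) * (t - s) / 2).
  rewrite -[t - s](@sqr_sqrtr _ (t - s)) ?ltW//; apply: H.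
  - by move=> A B mA mB; exact: (@measurableI _ (g_sigma_algebraType _)).
  - exact: (@measurableT _ (g_sigma_algebraType _)).
  - move=> F A pF mA; rewrite -(law _ _ s0 st t1 _ mA); apply: (ind _ _ s0 st t1) => //.
    have -> : [set w | forall i, A i (D w i 0)] =
      \bigcap_(i in [set: 'I_m]) ((fun w => D w i 0) @^-1` (A i)).
      by apply/seteqP; split => w /= h' i; [move=> _|]; exact: h'.
    apply: (@fin_bigcap_measurable _ (g_sigma_algebraType _)) => // i _.
    apply: sub_sigma_algebra.
    by exists t, i, (A i).
have mdot (f : 'cV[R]_m) (V : T -> R) :
    measurable_fun (setT : set (g_sigma_algebraType (past s))) V ->
    measurable_fun (setT : set (g_sigma_algebraType (past t))) (fun w => V w + dot f (D w)).
  move=> mV; apply: measurable_funD; first by apply: past_fun mV; exact: ltW.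
  apply: measurable_bigsum => i _; apply: measurable_funM => //.
  rewrite [X in measurable_fun _ X](DE i).
  apply: measurable_funB; apply: past_proc => //; last exact: ltW.
  by rewrite (le_trans s0)// ltW.
have := IH t _ _ _ _ _ pg (le_trans s0 (ltW st)) g1 t1 (mdot (c t) _ mU1) (mdot (b t) _ mU2) H.
move=> {}H a; have := H a; rewrite -!addrA => <-.
by apply: eq_integral => w _; rewrite !addrA.
Qed.

(** On a grid containing all times of both lists, values of the path become sums of increments, and
    the sums of [t - s] over the common intervals recover [Num.min] in [bmcov]. *)
Lemma brownian_tilted (l l' : seq (R * 'cV[R]_m)) : times01 l -> times01 l' ->
  tilted P (lincomb l U) (lincomb l' U) (bmcov l l') (bmcov l' l' / 2) (bmcov l l / 2).
Proof.
move=> l01 l'01.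
pose g := sort <=%R (undup [seq x <- map fst (l ++ l') | 0 < x]).
(* [U x.1] contains every increment up to time [x.1], so the increment ending at [t] carries the
   coefficients of all later or equal times. *)
pose co (l : seq (R * 'cV[R]_m)) t : 'cV[R]_m := \sum_(x <- l | t <= x.1) x.2.
have memg x : 0 <= x -> x \in map fst (l ++ l') -> x \in 0 :: g.
  move=> x0 xl; rewrite inE mem_sort mem_undup mem_filter xl andbT.
  by move: x0; rewrite le_eqVlt eq_sym.
have g1 : all (<= 1) g.
  apply/allP => x; rewrite mem_sort mem_undup mem_filter => /andP[_ /mapP[y yl ->]].
  move: yl; rewrite mem_cat => /orP[yl|yl].
    by move/allP : l01 => /(_ _ yl); rewrite in_itv /= => /andP[].
  by move/allP : l'01 => /(_ _ yl); rewrite in_itv /= => /andP[].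
have pg : path <%R 0 g.
  rewrite path_min_sorted.
    by rewrite sort_lt_sorted undup_uniq.
  by apply/allP => x; rewrite mem_sort mem_undup mem_filter => /andP[].
have U0 w : U 0 w = 0 by case: bmU => _ [].
have lin (l0 : seq (R * 'cV[R]_m)) w : {subset map fst l0 <= map fst (l ++ l')} -> times01 l0 ->
    isum (fun s t => dot (co l0 t) (U t w - U s w)) 0 g = lincomb l0 U w.
  move=> sub l001.
  under eq_isum => s t do rewrite /co dot_suml big_mkcond /=.
  rewrite isum_sum; apply: eq_big_seq => x xl.
  have x0 : 0 <= x.1 by move/allP : l001 => /(_ _ xl); rewrite in_itv /= => /andP[].
  under eq_isum => s t do rewrite dotBr.
  rewrite (isum_telescope (fun t => dot x.2 (U t w))) ?U0 ?dot0r ?subr0//.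
  by apply: memg => //; apply: sub; apply: map_f.
have cov (l1 l2 : seq (R * 'cV[R]_m)) : {subset map fst l1 <= map fst (l ++ l')} -> times01 l1 ->
    {subset map fst l2 <= map fst (l ++ l')} -> times01 l2 ->
    isum (fun s t => dot (co l1 t) (co l2 t) * (t - s)) 0 g = bmcov l1 l2.
  move=> sub1 l101 sub2 l201.
  under eq_isum => s t.
    rewrite /co dot_suml big_mkcond mulr_suml /=; over.
  rewrite isum_sum; apply: eq_big_seq => x xl.
  under eq_isum => s t.
    rewrite (_ : _ * _ = \sum_(y <- l2) dot x.2 y.2 *
      (if t <= Num.min x.1 y.1 then t - s else 0)); last first.
      rewrite dot_sumr big_mkcond /=.
      case: ifPn => tx; last first.
        by rewrite mul0r big1// => y _; rewrite le_min (negbTE tx) mulr0.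
      rewrite mulr_suml; apply: eq_bigr => y _; rewrite le_min tx /=.
      by case: ifP; rewrite ?mul0r ?mulr0.
    over.
  rewrite isum_sum; apply: eq_big_seq => y yl.
  rewrite isumZ (isum_telescope id)//; first by rewrite subr0 mulrC.
  have x0 : 0 <= x.1 by move/allP : l101 => /(_ _ xl); rewrite in_itv /= => /andP[].
  have y0 : 0 <= y.1 by move/allP : l201 => /(_ _ yl); rewrite in_itv /= => /andP[].
  by case: leP => _; apply: memg => //; [apply: sub1|apply: sub2]; apply: map_f.
have subl : {subset map fst l <= map fst (l ++ l')}.
  by move=> x; rewrite map_cat mem_cat => ->.
have subl' : {subset map fst l' <= map fst (l ++ l')}.
  by move=> x; rewrite map_cat mem_cat => ->; rewrite orbT.
have h0 : tilted P (cst 0) (cst 0) 0 0 0.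
  move=> a; transitivity (\int[P]_w (cst (1 + cos a)%:E w))%E.
    by apply: eq_integral => w _ /=; rewrite addr0 expR0 mulr1.
  by rewrite integral_cst//= probability_setT mule1 !addr0 oppr0 expR0 mulr1 mul1r.
have H := @tilted_isum g 0 (cst 0) (cst 0) 0 0 0 (co l) (co l') pg (lexx _) g1 ler01
  (measurable_cst _) (measurable_cst _) h0.
have half G s : isum (fun s t : R => G s t / 2) s g = isum G s g / 2.
  by rewrite mulrC -isumZ; apply: eq_isum => *; rewrite mulrC.
move=> a; move: (H a).
rewrite !half !cov// !add0r => <-.
by apply: eq_integral => w _; rewrite !add0r !lin.
Qed.

End brownian_tilt.

(** * Wiener integrals are Gaussian *)

Section sums.
Context (R : realType).

Lemma cauchy_schwarz I (r : seq I) (u v : I -> R) :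
  (\sum_(i <- r) u i * v i) ^+ 2 <= (\sum_(i <- r) u i ^+ 2) * (\sum_(i <- r) v i ^+ 2).
Proof.
set A := \sum_(i <- r) u i ^+ 2; set B := \sum_(i <- r) v i ^+ 2; set C := \sum_(i <- r) _.
have B0 : 0 <= B by apply: sumr_ge0 => i _; exact: sqr_ge0.
have : 0 <= \sum_(i <- r) (B * u i - C * v i) ^+ 2.
  by apply: sumr_ge0 => i _; exact: sqr_ge0.
have -> : \sum_(i <- r) (B * u i - C * v i) ^+ 2 = B * (A * B - C ^+ 2).
  under eq_bigr => i _.
    rewrite (_ : _ ^+ 2 = B ^+ 2 * u i ^+ 2 - 2 * B * C * (u i * v i) + C ^+ 2 * v i ^+ 2); last by ring.
    over.
  rewrite big_split sumrB /= -!mulr_sumr -/A -/B -/C; ring.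
have [B00|B1] := eqVneq B 0; last first.
  by rewrite pmulr_rge0 ?subr_ge0// lt_neqAle eq_sym B1.
have C0 : C ^+ 2 <= 0.
  rewrite /C; have : \sum_(i <- r) v i ^+ 2 <= 0 by rewrite -/B B00.
  clear; elim: r => [|i r IH]; first by rewrite !big_nil expr0n.
  rewrite !big_cons => h.
  have h1 := sqr_ge0 (v i); have h2 : 0 <= \sum_(j <- r) v j ^+ 2.
    by apply: sumr_ge0 => j _; exact: sqr_ge0.
  have vi : v i = 0 by apply/eqP; rewrite -sqrf_eq0 eq_le h1 andbT; lra.
  by rewrite vi mulr0 add0r; apply: IH; lra.
by move=> _; rewrite B00 mulr0.
Qed.

Lemma sqr_sum_le I (r : seq I) (u : I -> R) :
  (\sum_(i <- r) u i) ^+ 2 <= (size r)%:R * \sum_(i <- r) u i ^+ 2.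
Proof.
have := cauchy_schwarz r (fun=> 1) u.
under eq_bigr do rewrite mul1r.
by rewrite [X in _ <= X * _ -> _]big_const_seq count_predT iter_addr_0 expr1n.
Qed.

Lemma dot_sqr_le m (u v : 'cV[R]_m) : dot u v ^+ 2 <= dot u u * dot v v.
Proof. exact: cauchy_schwarz. Qed.

Lemma sqnorm_dot m (u : 'cV[R]_m) : sqnorm u = dot u u.
Proof. by apply: eq_bigr => i _; rewrite big_ord_recl big_ord0 addr0 expr2. Qed.

Lemma dot_ge0 m (u : 'cV[R]_m) : 0 <= dot u u.
Proof. by apply: sumr_ge0 => i _; rewrite -expr2 sqr_ge0. Qed.

Lemma dot_mul m n (A : 'M[R]_(m, n)) u v : dot u (A *m v) = dot (A^T *m u) v.
Proof.
rewrite /dot; under eq_bigr do rewrite mxE mulr_sumr.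
rewrite exchange_big /=; apply: eq_bigr => j _; rewrite mxE mulr_suml.
by apply: eq_bigr => i _; rewrite mxE; ring.
Qed.

Lemma dot_mul_le m n (A : 'M[R]_(m, n)) v : dot (A *m v) (A *m v) <= sqnorm A * dot v v.
Proof.
rewrite {1}/dot /sqnorm mulr_suml; apply: ler_sum => i _; rewrite -expr2 mxE.
by rewrite -(sqnorm_dot v) /sqnorm; under [X in _ * X]eq_bigr do rewrite big_ord_recl big_ord0 addr0; exact: cauchy_schwarz.
Qed.

Lemma sqnorm_tr m n (A : 'M[R]_(m, n)) : sqnorm A^T = sqnorm A.
Proof. by rewrite /sqnorm exchange_big /=; apply: eq_bigr => i _; apply: eq_bigr => j _; rewrite mxE. Qed.

Lemma cos_lip (x y : R) : `|cos x - cos y| <= `|x - y|.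
Proof.
wlog xy : x y / x < y => [H|].
  have [/H//|/H|->] := ltgtP x y; last by rewrite !subrr.
  by rewrite distrC (distrC x).
have [c _] := @MVT R cos (fun x => - sin x) x y xy (fun z _ => is_derive_cos z)
  (continuous_subspaceT (@continuous_cos R)).
move=> h; rewrite distrC h normrM normrN (distrC x) ler_piMl//; exact: sin_max.
Qed.

(* The hypothesis is what Young's inequality gives when [q] is a mean square error. *)
Lemma cvg_young (u q : R^nat) (l C : R) : q @ \oo --> 0 -> 0 <= C ->
  (\forall k \near \oo, forall e, 0 < e -> `|u k - l| <= e * C + (1 + e^-1) * q k) ->
  u @ \oo --> l.
Proof.
move=> q0 C0 H; apply/cvgrPdist_le => /= e e0.
pose f := e / 2 / (C + 1).
have f0 : 0 < f by rewrite !divr_gt0// ltr_wpDl.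
have g0 : 0 < 1 + f^-1 by rewrite ltr_wpDl// invr_gt0.
have h0 : 0 < e / 2 / (1 + f^-1) by rewrite !divr_gt0.
have Hq : \forall k \near \oo, `|q k| <= e / 2 / (1 + f^-1).
  have /cvgrPdist_le /(_ _ h0) := q0.
  by apply: filterS => k; rewrite sub0r normrN.
apply: filterS2 H Hq => k h qk.
rewrite distrC; apply: le_trans (h f f0) _.
have h1 : f * C <= e / 2.
  rewrite /f -mulrA ler_piMr ?divr_ge0 ?ltW//.
  by rewrite ltr_pdivrMl ?ltr_wpDl// mulr1 ltrDl.
have h2 : (1 + f^-1) * q k <= e / 2.
  rewrite -ler_pdivlMl// mulrC; apply: le_trans (ler_norm _) _.
  exact: qk.
lra.
Qed.

End sums.

Section integral_lemmas.
Context d (T : measurableType d) (R : realType) (mu : {measure set T -> \bar R}).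

Lemma integrable_scale (D : set T) (c : R) (f : T -> R) : measurable D ->
  mu.-integrable D (EFin \o f) -> mu.-integrable D (EFin \o (fun x => c * f x)).
Proof. by move=> mD h; exact: (integrableZl mD c h). Qed.

Lemma integrable_add (D : set T) (f g : T -> R) : measurable D ->
  mu.-integrable D (EFin \o f) -> mu.-integrable D (EFin \o g) ->
  mu.-integrable D (EFin \o (fun x => f x + g x)).
Proof. by move=> mD h h'; exact: (integrableD mD h h'). Qed.

Lemma integrable_sub (D : set T) (f g : T -> R) : measurable D ->
  mu.-integrable D (EFin \o f) -> mu.-integrable D (EFin \o g) ->
  mu.-integrable D (EFin \o (fun x => f x - g x)).
Proof. by move=> mD h h'; exact: (integrableB mD h h'). Qed.

Lemma Rintegral_bigsum (D : set T) I (r : seq I) (f : I -> T -> R) : measurable D ->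
  (forall i, mu.-integrable D (EFin \o f i)) ->
  mu.-integrable D (EFin \o (fun x => \sum_(i <- r) f i x)) /\
  \int[mu]_(x in D) (\sum_(i <- r) f i x) = \sum_(i <- r) \int[mu]_(x in D) f i x.
Proof.
move=> mD fi; elim: r => [|i r [IH1 IH2]].
  have -> : (fun x => \sum_(i <- [::]) f i x) = cst 0 by apply/funext => x; rewrite big_nil.
  by rewrite big_nil Rintegral_cst// mul0r; split => //; exact: integrable0.
have E : (fun x => \sum_(j <- i :: r) f j x) = (fun x => f i x + \sum_(j <- r) f j x).
  by apply/funext => x; rewrite big_cons.
rewrite E big_cons -IH2; split; last by rewrite RintegralD//; exact: fi.
by apply: integrable_add => //; exact: fi.
Qed.

(** Pointwise [f ^+ 2 - g ^+ 2 = 2 * g * (f - g) + (f - g) ^+ 2], and Young's inequality splits the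
    cross term. It yields convergence of squared norms from mean square convergence in the form
    expected by [cvg_young]. *)
Lemma young_sqr_bound (D : set T) (f g : T -> R) (e : R) : measurable D -> 0 < e ->
  measurable_fun D f -> measurable_fun D g ->
  mu.-integrable D (fun x => (f x ^+ 2)%:E) -> mu.-integrable D (fun x => (g x ^+ 2)%:E) ->
  `| \int[mu]_(x in D) (f x ^+ 2) - \int[mu]_(x in D) (g x ^+ 2)| <=
  e * \int[mu]_(x in D) (g x ^+ 2) + (1 + e^-1) * \int[mu]_(x in D) ((f x - g x) ^+ 2).
Proof.
move=> mD e0 mf mg fi gi.
have fgi : mu.-integrable D (fun x => ((f x - g x) ^+ 2)%:E).
  have := integrable_add mD (integrable_scale 2 mD fi) (integrable_scale 2 mD gi).
  apply: le_integrable => //.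
  - by apply/measurable_EFinP; apply: measurable_funX; exact: measurable_funB.
  - move=> x _ /=; rewrite !lee_fin !ger0_norm ?sqr_ge0//; last first.
      by rewrite addr_ge0// mulr_ge0// sqr_ge0.
    have := sqr_ge0 (f x + g x); nra.
rewrite -(RintegralB mD fi gi) -(RintegralZl _ mD gi) -(RintegralZl _ mD fgi).
rewrite -(RintegralD mD (integrable_scale _ mD gi) (integrable_scale _ mD fgi)).
apply: le_trans (le_normr_Rintegral mD (integrable_sub mD fi gi)) _.
apply: le_Rintegral => //.
- exact: (integrable_norm (integrable_sub mD fi gi)).
- exact: (integrable_add mD (integrable_scale _ mD gi) (integrable_scale _ mD fgi)).
move=> x _.
set a := f x; set b := g x.
rewrite ler_norml; apply/andP; split.
  have : 0 <= e * (b + e^-1 * (a - b)) ^+ 2 by rewrite mulr_ge0 ?sqr_ge0 ?ltW.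
  have -> : e * (b + e^-1 * (a - b)) ^+ 2 = e * b ^+ 2 + 2 * b * (a - b) + e^-1 * (a - b) ^+ 2.
    by field; rewrite gt_eqF.
  by have := sqr_ge0 (a - b); nra.
have : 0 <= e * (b - e^-1 * (a - b)) ^+ 2 by rewrite mulr_ge0 ?sqr_ge0 ?ltW.
have -> : e * (b - e^-1 * (a - b)) ^+ 2 = e * b ^+ 2 - 2 * b * (a - b) + e^-1 * (a - b) ^+ 2.
  by field; rewrite gt_eqF.
nra.
Qed.

End integral_lemmas.

(** The cosine is 1-Lipschitz and [|z| <= e + e^-1 * z ^+ 2]. The factor [1 + e^-1] in place of
    [e^-1] matches the hypothesis of [cvg_young]. *)
Lemma cos_young_bound d (T : measurableType d) (R : realType) (P : probability T R) (Y Z : T -> R) (e a : R) : 0 < e ->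
  measurable_fun setT Y -> measurable_fun setT Z ->
  P.-integrable setT (fun x => ((Z x - Y x) ^+ 2)%:E) ->
  `| \int[P]_x cos (a + Z x) - \int[P]_x cos (a + Y x)| <=
  e + (1 + e^-1) * \int[P]_x ((Z x - Y x) ^+ 2).
Proof.
move=> e0 mY mZ i2.
have ci V : measurable_fun setT V -> P.-integrable setT (EFin \o (fun x => cos (a + V x))).
  move=> mV; apply: (@bounded_integrable _ _ _ _ _ 1).
  - by rewrite (le_lt_trans (probability_le1 _ _))// ltry.
  - by apply: measurable_cos_comp; exact: measurable_funD.
  - by move=> x; exact: cos_max.
rewrite -RintegralB//; [|exact: ci..].
have i1 : P.-integrable setT (fun x => e%:E + ((1 + e^-1)%:E * ((Z x - Y x) ^+ 2)%:E))%E.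
  by apply: integrableD => //; [exact: finite_measure_integrable_cst|exact: integrableZl].
apply: le_trans (le_normr_Rintegral measurableT _) _.
  exact: (integrable_sub measurableT (ci _ mZ) (ci _ mY)).
apply: (@le_trans _ _ (\int[P]_x (e + (1 + e^-1) * (Z x - Y x) ^+ 2))).
  apply: le_Rintegral => //.
    exact: (integrable_norm (integrable_sub measurableT (ci _ mZ) (ci _ mY))).
  move=> x _; apply: le_trans (cos_lip _ _) _.
  rewrite opprD addrACA subrr add0r; set z := Z x - Y x.
  apply: (@le_trans _ _ (e + e^-1 * z ^+ 2)); last first.
    by rewrite lerD2l ler_wpM2r ?sqr_ge0// lerDr.
  have : 0 <= e^-1 * (e - `|z|) ^+ 2 by rewrite mulr_ge0 ?sqr_ge0// invr_ge0 ltW.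
  have -> : e^-1 * (e - `|z|) ^+ 2 = e - 2 * `|z| + e^-1 * `|z| ^+ 2 by field; rewrite gt_eqF.
  rewrite real_normK ?num_real// => h; have := normr_ge0 z.
  have := h; lra.
rewrite RintegralD//; last 2 first.
- exact: finite_measure_integrable_cst.
- exact: (integrable_scale _ measurableT i2).
rewrite (RintegralZl _ measurableT i2) Rintegral_cst//.
by rewrite [X in fine X](_ : _ = 1%E) ?mulr1//; exact: probability_setT.
Qed.

(* [tail l s] is the integrand representing [lincomb l X] as an integral against [dX]. *)
Definition tail (R : realType) m (l : seq (R * 'cV[R]_m)) (s : R) : 'cV[R]_m :=
  \sum_(x <- l | s <= x.1) x.2.

Definition gcov (R : realType) m (Sigma : R -> 'M[R]_m) (l : seq (R * 'cV[R]_m)) : R :=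
  \int[lebesgue_measure]_(s in [set` `[0, 1]]) dot (tail l s) (Sigma s *m tail l s).

(** The finite-dimensional laws of the centred Gaussian process with independent increments and spot
    covariance [Sigma]. The phase lets the cosine carry the whole characteristic function: [a = 0]
    gives its real part and [a = - pi / 2] its imaginary part. *)
Definition gaussian d (T : measurableType d) (R : realType) (P : probability T R) m
    (X : R -> T -> 'cV[R]_m) (Sigma : R -> 'M[R]_m) : Prop :=
  forall l, times01 l -> forall a,
    \int[P]_w cos (a + lincomb l X w) = cos a * expR (- (gcov Sigma l / 2)).

Section tail.
Context (R : realType).
Local Notation leb := (@lebesgue_measure R).
Local Notation I01 := ([set` `[0%R, 1%R]] : set R).

Lemma lebesgue_I01 : leb I01 = 1%E.
Proof. by rewrite lebesgue_measure_itv /= lte_fin ltr01 sube0. Qed.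

Lemma integrable_I01 (f : R -> R) (C : R) : measurable_fun I01 f ->
  (forall x, I01 x -> `|f x| <= C) -> leb.-integrable I01 (EFin \o f).
Proof.
move=> mf fC; apply: measurable_bounded_integrable => //.
  apply: le_lt_trans (_ : (1 < +oo)%E); last exact: ltry.
  by have := lexx (leb I01); rewrite {2}lebesgue_I01.
exists C; split; first exact: num_real.
by move=> M CM x Ix; exact: le_trans (fC x Ix) (ltW CM).
Qed.

Lemma Rintegral_I01_bigsum I (r : seq I) (f : I -> R -> R) :
  (forall i, leb.-integrable I01 (EFin \o f i)) ->
  leb.-integrable I01 (EFin \o (fun x => \sum_(i <- r) f i x)) /\
  \int[leb]_(x in I01) (\sum_(i <- r) f i x) = \sum_(i <- r) \int[leb]_(x in I01) f i x.
Proof. exact: Rintegral_bigsum. Qed.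

Lemma integrable_I01_scale (c : R) (f : R -> R) :
  leb.-integrable I01 (EFin \o f) -> leb.-integrable I01 (EFin \o (fun x => c * f x)).
Proof. by apply: integrable_scale; exact: measurable_itv. Qed.

Lemma integrable_I01_add (f g : R -> R) :
  leb.-integrable I01 (EFin \o f) -> leb.-integrable I01 (EFin \o g) ->
  leb.-integrable I01 (EFin \o (fun x => f x + g x)).
Proof. by apply: integrable_add; exact: measurable_itv. Qed.

Lemma young_sqr_bound_I01 (f g : R -> R) (e : R) : 0 < e ->
  measurable_fun I01 f -> measurable_fun I01 g ->
  leb.-integrable I01 (fun x => (f x ^+ 2)%:E) -> leb.-integrable I01 (fun x => (g x ^+ 2)%:E) ->
  `| \int[leb]_(x in I01) (f x ^+ 2) - \int[leb]_(x in I01) (g x ^+ 2)| <=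
  e * \int[leb]_(x in I01) (g x ^+ 2) + (1 + e^-1) * \int[leb]_(x in I01) ((f x - g x) ^+ 2).
Proof.
move=> e0 mf mg fi gi.
exact: (@young_sqr_bound _ _ R leb I01 f g e (measurable_itv _) e0 mf mg fi gi).
Qed.

Lemma measurable_le_cst (D : set R) (x : R) : measurable_fun D (fun s : R => s <= x).
Proof. by apply: measurable_funTS; apply: measurable_fun_ler. Qed.

Lemma measurable_tail m (l : seq (R * 'cV[R]_m)) i (D : set R) :
  measurable_fun D (fun s => tail l s i 0).
Proof.
have -> : (fun s => tail l s i 0) =
    (fun s => \sum_(x <- l) (if s <= x.1 then x.2 i 0 else 0)).
  apply/funext => s; rewrite /tail summxE big_mkcond; apply: eq_bigr => x _.
  by case: ifP.
apply: measurable_funTS.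
apply: measurable_bigsum => x _; apply: measurable_fun_ifT => //.
exact: measurable_le_cst.
Qed.

Lemma tail_bound m (l : seq (R * 'cV[R]_m)) : exists2 M, 0 <= M & forall s, dot (tail l s) (tail l s) <= M.
Proof.
exists (\sum_i (\sum_(x <- l) `|x.2 i 0|) ^+ 2).
  by apply: sumr_ge0 => i _; exact: sqr_ge0.
move=> s; apply: ler_sum => i _; rewrite -expr2 /tail summxE.
rewrite -[leLHS]real_normK ?num_real// ler_sqr ?nnegrE//; last exact: sumr_ge0.
apply: le_trans (ler_norm_sum _ _ _) _; rewrite big_mkcond; apply: ler_sum => x _.
by case: ifP.
Qed.

(** [Num.min x y] is the integral over [[0, 1]] of the product of the indicators of [s <= x] and
    [s <= y]. This is the isometry that turns the variance of a functional of Brownian motion into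
    an L2 norm. *)
Lemma bmcov_tail m (l : seq (R * 'cV[R]_m)) : times01 l ->
  bmcov l l = \int[leb]_(s in I01) dot (tail l s) (tail l s).
Proof.
move=> l01.
have h (c : R) : leb.-integrable I01 (EFin \o (fun s : R => if s <= c then 1 else 0)).
  apply: (@integrable_I01 _ 1).
    by apply: measurable_funTS; apply: measurable_fun_ifT => //; exact: measurable_le_cst.
  by move=> x _; case: ifP; rewrite ?normr1 ?normr0.
have hI (c : R) : c \in `[0, 1] -> \int[leb]_(s in I01) (if s <= c then 1 else 0) = c.
  rewrite in_itv /= => /andP[c0 c1].
  have -> : \int[leb]_(s in I01) (if s <= c then 1 else 0) = \int[leb]_(s in I01) ((cst (1 : R) \_ [set` `]-oo, c]]) s).
    apply: eq_Rintegral => s _; rewrite patchE /=.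
    by rewrite (_ : (s \in _) = (s <= c)) //; apply/idP/idP; rewrite inE /= in_itv.
  rewrite -Rintegral_mkcondr Rintegral_cst//; last exact: measurableI.
  rewrite mul1r; transitivity (fine (leb [set` `[0, c]])).
    congr (fine (leb _)); apply/seteqP; split => s /=; rewrite !in_itv /=.
      by move=> [/andP[-> _] ->].
    by move=> /andP[-> sc]; rewrite sc (le_trans sc).
  rewrite lebesgue_measure_itv /= lte_fin; case: ltP => [_|c0'] /=; first by rewrite subr0.
  by apply/le_anti; rewrite c0 c0'.
have E s : dot (tail l s) (tail l s) =
  \sum_(x <- l) \sum_(y <- l) dot x.2 y.2 * (if s <= Num.min x.1 y.1 then 1 else 0).
  rewrite /tail dot_suml big_mkcond; apply: eq_bigr => x _.
  case: ifPn => sx; last by rewrite big1// => y _; rewrite le_min (negbTE sx) mulr0.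
  rewrite dot_sumr big_mkcond; apply: eq_bigr => y _; rewrite le_min sx /=.
  by case: ifP; rewrite ?mulr1 ?mulr0.
under eq_Rintegral do rewrite E.
have hxy (x y : R * 'cV[R]_m) : leb.-integrable I01 (EFin \o (fun s => dot x.2 y.2 * (if s <= Num.min x.1 y.1 then 1 else 0))).
  by apply: integrable_scale => //; exact: h.
rewrite (Rintegral_I01_bigsum l (fun x => (Rintegral_I01_bigsum l (hxy x)).1)).2.
rewrite /bmcov; apply: eq_big_seq => x xl.
rewrite (Rintegral_I01_bigsum l (hxy x)).2.
apply: eq_big_seq => y yl; rewrite RintegralZl ?hI 1?mulrC//.
by case: leP => _; [move/allP : l01 => /(_ _ xl)|move/allP : l01 => /(_ _ yl)].
Qed.

End tail.

(** * Step integrals and their limits *)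

Section wiener.
Context d (T : measurableType d) (R : realType) (P : probability T R).
Local Notation leb := (@lebesgue_measure R).
Local Notation I01 := ([set` `[0%R, 1%R]] : set R).

Lemma measurable_lincomb (D : set T) m (l : seq (R * 'cV[R]_m)) (U : R -> T -> 'cV[R]_m) : times01 l ->
  (forall s i, s \in `[0, 1] -> measurable_fun D (fun w => U s w i 0)) ->
  measurable_fun D (lincomb l U).
Proof.
move=> /allP l01 mU; rewrite /lincomb.
have -> : (fun w => \sum_(x <- l) dot x.2 (U x.1 w)) =
  (fun w => \sum_(x <- l | x.1 \in `[0, 1]) dot x.2 (U x.1 w)).
  apply/funext => w; rewrite [RHS]big_mkcond; apply: eq_big_seq => x xl.
  by rewrite l01.
apply: measurable_bigsum => x xl; apply: measurable_bigsum => i _.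
by apply: measurable_funM => //; exact: mU.
Qed.

Lemma brownian_cos m (U : R -> T -> 'cV[R]_m) l a : brownian_motion P U -> times01 l ->
  \int[P]_w cos (a + lincomb l U w) = cos a * expR (- (bmcov l l / 2)).
Proof.
move=> bmU l01; have := brownian_tilted bmU l01 (isT : times01 [::]) => /(_ a).
have -> : bmcov l [::] = 0 by rewrite /bmcov big1// => x _; rewrite big_nil.
have -> : @bmcov R m [::] [::] = 0 by rewrite /bmcov big_nil.
have mU s i : s \in `[0, 1] -> measurable_fun setT (fun w => U s w i 0).
  by case: bmU => -[+ _] _; apply.
have ci : P.-integrable setT (EFin \o (fun x => cos (a + lincomb l U x))).
  apply: (@bounded_integrable _ _ _ _ _ 1).
  - by rewrite (le_lt_trans (probability_le1 _ _))// ltry.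
  - by apply: measurable_cos_comp; apply: measurable_funD => //; exact: measurable_lincomb.
  - by move=> x; exact: cos_max.
rewrite mul0r expR0 mul1r addr0 => h.
have : \int[P]_w (1 + cos (a + lincomb l U w)) = 1 + cos a * expR (- (bmcov l l / 2)).
  rewrite /Rintegral -[RHS]/(fine (1 + cos a * expR (- (bmcov l l / 2)))%:E) -h.
  by congr fine; apply: eq_integral => w _; rewrite /lincomb big_nil expR0 mulr1.
rewrite RintegralD//; last exact: finite_measure_integrable_cst.
rewrite Rintegral_cst// [X in fine X](_ : _ = 1%E) ?mul1r; last exact: probability_setT.
by move/addrI.
Qed.

(* The functional [lincomb l] of the integral of the step function [S]. *)
Definition step_comb m n (S : step (R := R) m n) (l : seq (R * 'cV[R]_m)) : seq (R * 'cV[R]_n) :=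
  flatten [seq flatten [seq [:: (Num.min x.1.2 y.1, x.2^T *m y.2);
                                (Num.min x.1.1 y.1, - (x.2^T *m y.2))] | x <- S] | y <- l].

Lemma step_comb_times m n (S : step (R := R) m n) l : step_valid S -> times01 l ->
  times01 (step_comb S l).
Proof.
move=> /allP Sv /allP l01; apply/allP => z /flatten_mapP[y yl /flatten_mapP[x xS]].
have /and3P[a0 ab b1] := Sv _ xS.
have := l01 _ yl; rewrite in_itv /= => /andP[y0 y1].
rewrite in_cons mem_seq1 => /orP[|] /eqP -> /=; rewrite in_itv /= le_min y0 ge_min y1 orbT !andbT//.
by rewrite (le_trans a0).
Qed.

Lemma step_combE m n (S : step (R := R) m n) l (B : R -> T -> 'cV[R]_n) w :
  lincomb (step_comb S l) B w = lincomb l (step_integral S B) w.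
Proof.
rewrite /lincomb big_flatten big_map; apply: eq_bigr => y _.
rewrite big_flatten big_map /step_integral dot_sumr; apply: eq_bigr => x _.
rewrite !big_cons big_nil /= addr0 dot_mul dotBr; congr (_ + _).
by rewrite -scaleN1r dotZl mulN1r.
Qed.

(** Seen from the driving Brownian motion, the integrand of a step integral is the integrand of the
    functional multiplied by the transposed step function. With [bmcov_tail] this gives the variance
    of the functional. *)
Lemma tail_step_comb m n (S : step (R := R) m n) l s : step_valid S ->
  tail (step_comb S l) s = (step_fun S s)^T *m tail l s.
Proof.
move=> /allP Sv; rewrite /tail big_mkcond big_flatten big_map mulmx_sumr [RHS]big_mkcond.
apply: eq_bigr => y _; rewrite big_flatten big_map.
rewrite /step_fun; case: ifPn => sy; last first.
  rewrite big1// => x _; rewrite !big_cons big_nil /= !le_min (negbTE sy) !andbF !addr0//.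
rewrite linear_sum /= mulmx_suml; apply: eq_big_seq => x xS.
have /and3P[_ ab _] := Sv _ xS.
rewrite !big_cons big_nil /= !le_min sy !andbT addr0.
(* For [s <= a] the two endpoint terms of []a, b]] are both present and cancel, in accordance with
   the open left end in [step_fun]. *)
case: (leP s x.1.1) => sa; first by rewrite (le_trans sa ab) subrr trmx0 mul0mx.
by case: ifP; rewrite addr0// trmx0 mul0mx.
Qed.

Lemma cvge0_fine (u : nat -> \bar R) : (u @ \oo --> 0%E) ->
  (\forall k \near \oo, u k \is a fin_num) /\ (fine \o u) @ \oo --> 0.
Proof. by move=> /fine_cvgP[]. Qed.

Lemma cvge0_sum I (r : seq I) (Q : pred I) (q : I -> nat -> \bar R) :
  (forall i, Q i -> q i @ \oo --> 0%E) ->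
  (fun k => (\sum_(i <- r | Q i) q i k)%E) @ \oo --> 0%E.
Proof.
move=> q0; elim: r => [|i r IH].
  by under eq_fun do rewrite big_nil; exact: cvg_cst.
have [Qi|/negbTE nQi] := boolP (Q i); last by under eq_fun do rewrite big_cons nQi.
under eq_fun do rewrite big_cons Qi.
have h : ((0%E : \bar R) +? 0)%E by [].
have H := cvgeD h (q0 i Qi) IH; rewrite adde0 in H; exact: H.
Qed.

Lemma cvg_bigsum I (r : seq I) (f : I -> R^nat) (a : I -> R) :
  (forall i, f i @ \oo --> a i) ->
  (fun k => \sum_(i <- r) f i k) @ \oo --> \sum_(i <- r) a i.
Proof.
move=> fa; elim: r => [|i r IH].
  by rewrite big_nil; under eq_fun do rewrite big_nil; exact: cvg_cst.
rewrite big_cons; under eq_fun do rewrite big_cons.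
by apply: cvgD => //; exact: fa.
Qed.

Lemma le_fine_cvg0 (u : nat -> \bar R) (q : R^nat) (C : R) : 0 <= C ->
  (u @ \oo --> 0%E) -> (forall k, 0 <= q k) -> (forall k, ((q k)%:E <= C%:E * u k)%E) ->
  q @ \oo --> 0.
Proof.
move=> C0 /cvge0_fine[uf u0] q0 qu.
apply: (@squeeze_cvgr _ _ _ _ (cst 0) (fun k => C * fine (u k))).
- apply: filterS uf => k uk; rewrite q0 /=.
  by move: (qu k); rewrite -[in X in X -> _](fineK uk) -EFinM lee_fin.
- exact: cvg_cst.
- by rewrite -(mulr0 C); apply: cvgMr; exact: u0.
Qed.

Lemma measurable_step_fun m n (S : step (R := R) m n) i j (D : set R) :
  measurable_fun D (fun s => step_fun S s i j).
Proof.
apply: measurable_funTS.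
have -> : (fun s => step_fun S s i j) =
    (fun s => \sum_(x <- S) (if x.1.1 < s <= x.1.2 then x.2 i j else 0)).
  apply/funext => s; rewrite /step_fun summxE; apply: eq_bigr => x _.
  by case: ifP => _ //; rewrite mxE.
apply: measurable_bigsum => x _; apply: measurable_fun_ifT => //.
by apply: measurable_and; [exact: measurable_fun_ltr|exact: measurable_le_cst].
Qed.

Lemma step_fun_bound m n (S : step (R := R) m n) i j s :
  `|step_fun S s i j| <= \sum_(x <- S) `|x.2 i j|.
Proof.
rewrite /step_fun summxE; apply: le_trans (ler_norm_sum _ _ _) _; apply: ler_sum => x _.
by case: ifP => // _; rewrite mxE normr0.
Qed.

Lemma integrable_sqr_I01 (f g : R -> R) (C : R) : measurable_fun I01 f -> measurable_fun I01 g ->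
  leb.-integrable I01 (fun x => (f x ^+ 2)%:E) ->
  (forall x, `|g x| <= C) -> leb.-integrable I01 (fun x => ((g x * f x) ^+ 2)%:E).
Proof.
move=> mf mg fi gC.
have mI : measurable I01 by exact: measurable_itv.
have := integrable_I01_scale (C ^+ 2) fi; apply: le_integrable => //.
- by apply/measurable_EFinP; apply: measurable_funX; exact: measurable_funM.
- move=> x _ /=; rewrite lee_fin !ger0_norm ?sqr_ge0//; last by rewrite mulr_ge0 ?sqr_ge0.
  rewrite exprMn ler_wpM2r ?sqr_ge0// -[leLHS]real_normK ?num_real// ler_sqr ?nnegrE//.
  exact: le_trans (normr_ge0 _) (gC x).
Qed.

(** For step integrands the identity is [brownian_cos]. Both sides pass to the limit: the variances
    because the step functions converge in L2 and [tail l] is bounded, the cosines because the step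
    integrals converge in mean square. *)
Theorem wiener_gaussian m n (sigma : R -> 'M[R]_(m, n)) (B : R -> T -> 'cV[R]_n)
    (I : R -> T -> 'cV[R]_m) (Sigma : R -> 'M[R]_m) :
  brownian_motion P B -> L2_matrix sigma ->
  (forall s, s \in `[0, 1] -> Sigma s = sigma s *m (sigma s)^T) ->
  (forall s i, s \in `[0, 1] -> measurable_fun setT (fun w => I s w i 0)) ->
  wiener_integral P sigma B I -> gaussian P I Sigma.
Proof.
move=> bmB sL2 SE mI [S [Sv [Scvg Icvg]]] l l01 a.
have mI01 : measurable I01 by exact: measurable_itv.
have mB s i : s \in `[0, 1] -> measurable_fun setT (fun w => B s w i 0).
  by case: bmB => -[+ _] _; apply.
pose v k := bmcov (step_comb (S k) l) (step_comb (S k) l).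
pose f i s : R := ((sigma s)^T *m tail l s) i 0.
pose fk k i s : R := ((step_fun (S k) s)^T *m tail l s) i 0.
have [M M0 tM] := tail_bound l.
have tail_le j s : `|tail l s j 0| <= Num.sqrt M.
  rewrite -sqrtr_sqr ler_wsqrtr//; apply: le_trans (tM s).
  by rewrite /dot (bigD1 j)//= -expr2 lerDl sumr_ge0// => i _; rewrite -expr2 sqr_ge0.
have mf i : measurable_fun I01 (f i).
  have -> : f i = fun s => \sum_j sigma s j i * tail l s j 0.
    by apply/funext => s; rewrite /f mxE; apply: eq_bigr => j _; rewrite mxE.
  apply: measurable_bigsum => j _.
  by apply: measurable_funM; [exact: (sL2 j i).1|exact: measurable_tail].
have mfk k i : measurable_fun I01 (fk k i).
  have -> : fk k i = fun s => \sum_j step_fun (S k) s j i * tail l s j 0.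
    by apply/funext => s; rewrite /fk mxE; apply: eq_bigr => j _; rewrite mxE.
  apply: measurable_bigsum => j _.
  by apply: measurable_funM; [exact: measurable_step_fun|exact: measurable_tail].
have mf2 i : measurable_fun I01 (fun s => f i s ^+ 2) by exact: measurable_funX.
have md2 k i : measurable_fun I01 (fun s => (fk k i s - f i s) ^+ 2).
  by apply: measurable_funX; exact: measurable_funB.
have fi i : leb.-integrable I01 (fun s => (f i s ^+ 2)%:E).
  have h j := integrable_I01_scale (m%:R) (integrable_sqr_I01 (sL2 j i).1 (measurable_tail l j (D := I01)) (sL2 j i).2 (tail_le j)).
  have := (Rintegral_I01_bigsum (index_enum 'I_m) h).1; apply: le_integrable => //.
    by apply/measurable_EFinP; exact: mf2.
  move=> s _ /=; rewrite lee_fin !ger0_norm ?sqr_ge0//; last first.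
    by apply: sumr_ge0 => j _; rewrite mulr_ge0 ?sqr_ge0.
  rewrite /f mxE -mulr_sumr.
  apply: le_trans (sqr_sum_le _ _) _.
  have -> : (size (index_enum 'I_m))%:R = m%:R :> R.
    rewrite -[in RHS](card_ord m) -sumr_const big_const_seq count_predT iter_addr_0//.
  rewrite ler_wpM2l//; apply: ler_sum => j _; rewrite mxE mulrC//.
have fki k i : leb.-integrable I01 (fun s => (fk k i s ^+ 2)%:E).
  apply: (@integrable_I01 _ _ ((\sum_j (\sum_(x <- S k) `|x.2 j i|) * Num.sqrt M) ^+ 2)).
    exact: measurable_funX.
  move=> s _; rewrite normrX ler_sqr ?nnegrE//; last first.
    by apply: sumr_ge0 => j _; rewrite mulr_ge0 ?sqrtr_ge0 ?sumr_ge0.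
  rewrite /fk mxE; apply: le_trans (ler_norm_sum _ _ _) _; apply: ler_sum => j _.
  rewrite mxE normrM; apply: ler_pM => //; exact: step_fun_bound.
have vE k : v k = \sum_i \int[leb]_(s in I01) (fk k i s ^+ 2).
  rewrite /v bmcov_tail ?step_comb_times//.
  rewrite -(Rintegral_I01_bigsum (index_enum 'I_n) (fki k)).2; apply: eq_Rintegral => s _.
  by rewrite tail_step_comb//; apply: eq_bigr => i _; rewrite -expr2.
have gE : gcov Sigma l = \sum_i \int[leb]_(s in I01) (f i s ^+ 2).
  rewrite -(Rintegral_I01_bigsum (index_enum 'I_n) fi).2; apply: eq_Rintegral => s.
  rewrite inE => s01; rewrite SE// -mulmxA dot_mul; apply: eq_bigr => i _; by rewrite -expr2.
(* The error of each component is dominated by [M] times the L2 distance of the step function to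
   [sigma], where [M] bounds the squared norm of [tail l]. *)
have v_cvg : v @ \oo --> gcov Sigma l.
  rewrite (_ : v = fun k => \sum_i \int[leb]_(s in I01) (fk k i s ^+ 2)); last exact/funext.
  rewrite gE; apply: cvg_bigsum => i.
  apply: (@cvg_young _ _ (fun k => \int[leb]_(s in I01) ((fk k i s - f i s) ^+ 2)) _
    (\int[leb]_(s in I01) (f i s ^+ 2))).
  - apply: (le_fine_cvg0 M0 Scvg) => k.
      by apply: Rintegral_ge0 => s _; exact: sqr_ge0.
    have msq : measurable_fun I01 (fun s => sqnorm (step_fun (S k) s - sigma s)).
      apply: measurable_bigsum => p _; apply: measurable_bigsum => j _.
      have -> : (fun s => (step_fun (S k) s - sigma s) p j ^+ 2) =
          (fun s => (step_fun (S k) s p j - sigma s p j) ^+ 2).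
        by apply/funext => s; rewrite !mxE.
      by apply: measurable_funX; apply: measurable_funB; [exact: measurable_step_fun|exact: (sL2 p j).1].
    rewrite /Rintegral fineK; last first.
      apply: integrable_fin_num => //.
      have := integrable_I01_add (integrable_I01_scale 2 (fki k i)) (integrable_I01_scale 2 (fi i)).
      apply: le_integrable => //.
        by apply/measurable_EFinP; exact: md2.
      move=> s _ /=; rewrite !lee_fin !ger0_norm ?sqr_ge0//; last first.
        by rewrite addr_ge0// mulr_ge0// sqr_ge0.
      have := sqr_ge0 (fk k i s + f i s); nra.
    have mE : measurable_fun I01 (fun s => (sqnorm (step_fun (S k) s - sigma s))%:E).
      by apply/measurable_EFinP; exact: msq.
    have pE s : I01 s -> (0 <= (sqnorm (step_fun (S k) s - sigma s))%:E)%E.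
      by move=> _; rewrite lee_fin; apply: sumr_ge0 => ? _; apply: sumr_ge0 => ? _; exact: sqr_ge0.
    have M0E : (0 <= M%:E)%E by rewrite lee_fin.
    rewrite -(ge0_integralZl lebesgue_measure (measurable_itv _) mE pE M0E).
    apply: ge0_le_integral => //.
    + by move=> s _; rewrite lee_fin sqr_ge0.
    + by apply/measurable_EFinP; exact: md2.
    + by apply: emeasurable_funM => //; exact: measurable_cst.
    move=> s _; rewrite -EFinM lee_fin.
    have -> : fk k i s - f i s = ((step_fun (S k) s - sigma s)^T *m tail l s) i 0.
      by rewrite /fk /f linearB /= mulmxBl !mxE.
    apply: (@le_trans _ _ (dot ((step_fun (S k) s - sigma s)^T *m tail l s) ((step_fun (S k) s - sigma s)^T *m tail l s))).
      by rewrite /dot (bigD1 i)//= -expr2 lerDl sumr_ge0// => j _; rewrite -expr2 sqr_ge0.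
    apply: le_trans (dot_mul_le _ _) _; rewrite sqnorm_tr mulrC ler_wpM2r//.
    by apply: sumr_ge0 => ? _; apply: sumr_ge0 => ? _; exact: sqr_ge0.
  - by apply: Rintegral_ge0 => s _; exact: sqr_ge0.
  - by apply: nearW => k e e0; exact: young_sqr_bound_I01.
pose Z k := lincomb l (step_integral (S k) B).
have mZ k : measurable_fun setT (Z k).
  have -> : Z k = lincomb (step_comb (S k) l) B.
    by apply/funext => w; rewrite step_combE.
  by apply: measurable_lincomb => //; exact: step_comb_times.
have mY : measurable_fun setT (lincomb l I) by exact: measurable_lincomb.
have cE k : \int[P]_w cos (a + Z k w) = cos a * expR (- (v k / 2)).
  rewrite -(brownian_cos _ bmB)//; last exact: step_comb_times.
  by apply: eq_Rintegral => w _; rewrite step_combE.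
have c1 : (fun k => \int[P]_w cos (a + Z k w)) @ \oo --> cos a * expR (- (gcov Sigma l / 2)).
  rewrite (_ : (fun k => _) = (fun k => cos a * expR (- (v k / 2)))); last exact/funext.
  apply: cvgM; first exact: cvg_cst.
  apply: (cvg_comp (fun k => - (v k / 2)) expR); last exact: continuous_expR.
  by apply: cvgN; apply: cvgM => //; exact: cvg_cst.
suff c2 : (fun k => \int[P]_w cos (a + Z k w)) @ \oo --> \int[P]_w cos (a + lincomb l I w).
  exact: (cvg_unique _ c2 c1).
pose D k y w := step_integral (S k) B y w - I y w.
have mSI k y : y \in `[0, 1] -> measurable_fun setT (fun w => sqnorm (D k y w)).
  move=> y01.
  have -> : (fun w => sqnorm (D k y w)) = (fun w => \sum_i
    (lincomb (step_comb (S k) [:: (y, delta_mx i 0)]) B w - I y w i 0) ^+ 2).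
    apply/funext => w; rewrite sqnorm_dot; apply: eq_bigr => i _; rewrite -expr2; congr (_ ^+ 2).
    rewrite step_combE /lincomb big_cons big_nil addr0 /D !mxE; congr (_ - _).
    rewrite /dot (bigD1 i)//= mxE !eqxx mul1r big1 ?addr0// => j ji.
    by rewrite mxE (negbTE ji) mul0r.
  apply: measurable_bigsum => i _; apply: measurable_funX; apply: measurable_funB; last exact: mI.
  apply: measurable_lincomb => //; apply: step_comb_times => //.
  by rewrite /times01 /= y01.
(* The test on the time allows measurability and convergence of [h] to be stated for every pair, not
   only for the members of [l]. The factor [size l] comes from Cauchy-Schwarz for the sum over
   [l]. *)
pose h k (y : R * 'cV[R]_m) w : R :=
  if y.1 \in `[0, 1] then (size l)%:R * dot y.2 y.2 * sqnorm (D k y.1 w) else 0.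
have sq0 k y w : 0 <= sqnorm (D k y w).
  by apply: sumr_ge0 => ? _; apply: sumr_ge0 => ? _; exact: sqr_ge0.
have h0 k y w : 0 <= h k y w by rewrite /h; case: ifP => // _; rewrite !mulr_ge0 ?dot_ge0.
have mh k y : measurable_fun setT (h k y).
  rewrite /h; have [y01|y01] := boolP (y.1 \in `[0, 1]); last exact: measurable_cst.
  by apply: measurable_funM => //; exact: mSI.
pose u k := (\sum_(y <- l) \int[P]_w (h k y w)%:E)%E.
have u0 : u @ \oo --> 0%E.
  apply: (@cvge0_sum _ l xpredT (fun y k => \int[P]_w (h k y w)%:E)%E) => y _.
  rewrite /h; have [y01|y01] := boolP (y.1 \in `[0, 1]); last first.
    by rewrite (_ : (fun k => _) = cst 0%E); [exact: cvg_cst|apply/funext => k; rewrite integral0].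
  rewrite (_ : (fun k => _) = (fun k => ((size l)%:R * dot y.2 y.2)%:E * \int[P]_w (sqnorm (D k y.1 w))%:E))%E.
    by rewrite -(mule0 ((size l)%:R * dot y.2 y.2)%:E); apply: cvgeZl => //; exact: Icvg.
  apply/funext => k; rewrite -ge0_integralZl//.
  - by apply/measurable_EFinP; exact: mSI.
  - by move=> w _; rewrite lee_fin.
  - by rewrite lee_fin mulr_ge0 ?dot_ge0.
have uE k : (\int[P]_w ((Z k w - lincomb l I w) ^+ 2)%:E <= u k)%E.
  rewrite /u -ge0_integral_sum//; last 2 first.
  - by move=> y; apply/measurable_EFinP; exact: mh.
  - by move=> y w _; rewrite lee_fin.
  apply: ge0_le_integral => //.
  - by move=> w _; rewrite lee_fin sqr_ge0.
  - by apply/measurable_EFinP; apply: measurable_funX; exact: measurable_funB.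
  - by apply: emeasurable_sum => y; apply/measurable_EFinP; exact: mh.
  move=> w _; rewrite sumEFin lee_fin /Z /lincomb -sumrB.
  apply: le_trans (sqr_sum_le _ _) _; rewrite mulr_sumr big_seq [leRHS]big_seq; apply: ler_sum => y yl.
  rewrite /h (allP l01 _ yl) -mulrA ler_wpM2l// -dotBr sqnorm_dot.
  exact: dot_sqr_le.
have [uf _] := cvge0_fine u0.
apply: (@cvg_young _ _ (fun k => fine (u k)) _ 1).
- exact: (cvge0_fine u0).2.
- by [].
apply: filterS uf => k uk e e0.
have i2 : P.-integrable setT (fun w => ((Z k w - lincomb l I w) ^+ 2)%:E).
  apply/integrableP; split.
    by apply/measurable_EFinP; apply: measurable_funX; exact: measurable_funB.
  under eq_integral do rewrite gee0_abs ?lee_fin ?sqr_ge0//.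
  by apply: le_lt_trans (uE k) _; rewrite ltey_eq uk.
apply: le_trans (cos_young_bound _ e0 mY (mZ k) i2) _.
rewrite mulr1 lerD2l ler_wpM2l ?addr_ge0 ?invr_ge0 ?(ltW e0)//.
by rewrite fine_le//; exact: integrable_fin_num.
Qed.

End wiener.

(** * Laws on path space are determined by cosine transforms *)

Definition mfun_of d1 d2 (T1 : measurableType d1) (T2 : measurableType d2) (f : T1 -> T2)
  (mf : measurable_fun setT f) : {mfun T1 >-> T2} := mfun_Sub (mem_set mf).

Section real_integrals.
Context d (T : measurableType d) (R : realType) (mu : {measure set T -> \bar R}).
Variables (f g : T -> R).
Hypotheses (f0 : forall t, 0 <= f t) (mf : measurable_fun setT f).

Lemma ge0_integral_EFinZ (c : R) : 0 <= c ->
  (\int[mu]_t (c * f t)%:E = c%:E * \int[mu]_t (f t)%:E)%E.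
Proof.
move=> c0; rewrite -ge0_integralZl//.
- exact/measurable_EFinP.
- by move=> t _; rewrite lee_fin.
Qed.

Lemma ge0_integral_EFinD : (forall t, 0 <= g t) -> measurable_fun setT g ->
  (\int[mu]_t (f t + g t)%:E = \int[mu]_t (f t)%:E + \int[mu]_t (g t)%:E)%E.
Proof.
move=> g0 mg; rewrite -ge0_integralD//.
- by move=> t _; rewrite lee_fin.
- exact/measurable_EFinP.
- by move=> t _; rewrite lee_fin.
- exact/measurable_EFinP.
Qed.

End real_integrals.

(** * Normal tails *)

Section normal_tail.
Context (R : realType).
Local Notation leb := (@lebesgue_measure R).

Definition ntail (y : R) : \bar R := normal_prob 0 1 [set` `]y, +oo[].

Let id : measurableTypeR R -> R := idfun.

#[local] HB.instance Definition _ :=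
  @isMeasurableFun.Build _ _ _ _ id (@measurable_id _ _ setT).

Let idR : {RV (normal_prob 0 1 : probability (measurableTypeR R) R) >-> R} := id.

Let ntailE y : ntail y = ccdf (P := normal_prob 0 1) idR y.
Proof. by []. Qed.

Lemma measurable_ntail : measurable_fun setT ntail.
Proof. exact: (ccdf_measurable (P := normal_prob 0 1) idR). Qed.

Lemma ntail_ge0 y : (0 <= ntail y)%E.
Proof. exact: measure_ge0. Qed.

Lemma ntail_le1 y : (ntail y <= 1)%E.
Proof. by rewrite ntailE; exact: probability_le1. Qed.

Lemma cvg_ntaily (u : R^nat) : u @ \oo --> +oo -> (fun k => ntail (u k)) @ \oo --> 0%E.
Proof.
move=> uy; exact: (cvg_comp u ntail uy (cvg_ccdfy0 (P := normal_prob 0 1) idR)).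
Qed.

Lemma cvg_ntailNy (u : R^nat) : u @ \oo --> -oo -> (fun k => ntail (u k)) @ \oo --> 1%E.
Proof.
move=> uy; exact: (cvg_comp u ntail uy (cvg_ccdfNy1 (P := normal_prob 0 1) idR)).
Qed.

(** The substitution [y = a * (u - x)]. Read as a function of [x], the left-hand side is the
    indicator of [x > c] smoothed by a Gaussian kernel of width [1 / a]. *)
Lemma ntail_integral (a c x : R) : 0 < a ->
  ntail (a * (c - x)) =
  (\int[leb]_(u in [set` `]c, +oo[]) (a * normal_pdf 0 1 (a * (u - x)))%:E)%E.
Proof.
move=> a0; rewrite /ntail /normal_prob.
have cpdf : continuous (normal_pdf (0 : R) 1) by exact: continuous_normal_pdf.
have mpdf : measurable_fun setT (normal_pdf (0 : R) 1) by exact: measurable_normal_pdf.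
pose F (u : R) := a * (u - x).
have cF : continuous F.
  by move=> u; apply: cvgMr; apply: cvgB; [exact: @cvg_id _ _|exact: cvg_cst].
have dF (u : R) : is_derive u 1 F a.
  by apply: is_derive_eq; rewrite subr0 /GRing.scale /= mulr1.
have F' : F^`()%classic = cst a.
  by apply/funext => u; rewrite derive1E; have -> := @derive_val _ _ _ _ _ _ _ (dF u).
rewrite integral_itv_obnd_cbnd; last first.
  by apply/measurable_EFinP; exact: measurable_funTS.
rewrite (_ : a * (c - x) = F c)//.
rewrite increasing_ge0_integration_by_substitutiony; last 8 first.
- by move=> u v _ _ uv; rewrite /F ltr_pM2l// ltrD2r.
- by move=> u _; rewrite F'; exact: cvg_cst.
- by rewrite F'; exact: is_cvg_cst.
- by rewrite F'; exact: is_cvg_cst.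
- split; last by apply: cvg_at_right_filter; exact: cF.
  by move=> u _; case: (dF u).
- by apply: gt0_cvgMry => //; exact: cvg_addrr.
- exact: continuous_subspaceT.
- by move=> u _; exact: normal_pdf_ge0.
rewrite integral_itv_obnd_cbnd; last first.
  apply/measurable_EFinP; apply: measurable_funTS; apply: measurable_funM => //.
  apply: measurableT_comp => //; apply: continuous_measurable_fun; exact: cF.
by apply: eq_integral => u _; rewrite F' /= mulrC.
Qed.

End normal_tail.

(** * Gaussian smoothing of indicators *)

Section smoothing.
Context d (T : measurableType d) (R : realType) (P : probability T R).
Variables (w x : T -> R).
Hypotheses (w0 : forall t, 0 <= w t) (mw : measurable_fun setT w)
  (mx : measurable_fun setT x).
Local Notation leb := (@lebesgue_measure R).

(** The Gaussian kernel is itself the cosine transform of a normal law. By Tonelli its integral is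
    therefore an average of the cosine transforms of [x]. *)
Lemma smoothing_cos (a u : R) :
  (\int[P]_t (w t * (1 + expR (- ((a * (u - x t)) ^+ 2 / 2))))%:E =
   \int[normal_prob 0 1]_y \int[P]_t (w t * (1 + cos (a * u * y + (- a * y) * x t)))%:E)%E.
Proof.
pose f (z : T * measurableTypeR R) : \bar R :=
  (w z.1 * (1 + cos (a * u * z.2 + (- a * z.2) * x z.1)))%:E.
have f0 z : (0 <= f z)%E by rewrite lee_fin mulr_ge0// cosD1_ge0.
have m1 : measurable_fun setT (fun z : T * measurableTypeR R => z.1) by exact: measurable_fst.
have m2 : measurable_fun setT (fun z : T * measurableTypeR R => z.2 : R) by exact: measurable_snd.
have mf : measurable_fun setT f.
  apply/measurable_EFinP; apply: measurable_funM; first exact: measurableT_comp.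
  apply: measurable_funD => //; apply: measurable_cos_comp; apply: measurable_funD.
    by apply: measurable_funM.
  apply: measurable_funM; last exact: measurableT_comp.
  exact: measurable_funM.
rewrite -(@fubini_tonelli _ _ _ _ _ P (normal_prob 0 1) f mf f0).
apply: eq_integral => t _; rewrite /f /=.
have := @normal_tilt R 1 (oner_neq0 _) 0 (a * (u - x t)) 0.
rewrite expr0n /= !mul0r mulr0 mul0r addr0 expR0 mul1r cos0 mul1r expr1n mulr1 => h.
transitivity ((w t)%:E * (\int[normal_prob 0 1]_y ((1 + cos (0 + a * (u - x t) * y)) * expR (0 * y))%:E))%E.
  by rewrite h EFinM.
rewrite -ge0_integralZl//; last 2 first.
- apply/measurable_EFinP; apply: measurable_funM; last by apply: measurableT_comp => //; exact: measurable_funM.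
  apply: measurable_funD => //; apply: measurable_cos_comp; apply: measurable_funD => //; exact: measurable_funM.
- by rewrite lee_fin.
apply: eq_integral => y _; rewrite -EFinM mul0r expR0 mulr1; do 4 f_equal; ring.
Qed.

Lemma smoothing_tail (a c : R) : 0 < a ->
  (\int[P]_t ((w t)%:E * ntail (a * (c - x t))) =
   \int[leb]_(u in [set` `]c, +oo[]) \int[P]_t (w t * (a * normal_pdf 0 1 (a * (u - x t))))%:E)%E.
Proof.
move=> a0.
pose f (z : T * measurableTypeR R) : \bar R :=
  (w z.1 * (a * normal_pdf 0 1 (a * (z.2 - x z.1))))%:E.
have n0 y : 0 <= normal_pdf 0 1 y :> R by exact: normal_pdf_ge0.
have m1 : measurable_fun setT (fun z : T * measurableTypeR R => z.1) by exact: measurable_fst.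
have m2 : measurable_fun setT (fun z : T * measurableTypeR R => z.2 : R) by exact: measurable_snd.
have mf : measurable_fun setT f.
  apply/measurable_EFinP; apply: measurable_funM; first exact: measurableT_comp.
  apply: measurable_funM => //; apply: (measurableT_comp (f := normal_pdf 0 1)).
    exact: measurable_normal_pdf.
  by apply: measurable_funM => //; apply: measurable_funB => //; exact: measurableT_comp.
pose g (z : T * measurableTypeR R) := (f z * (\1_(`]c, +oo[%classic) z.2)%:E)%E.
have g0 z : (0 <= g z)%E by rewrite mule_ge0// lee_fin mulr_ge0// mulr_ge0// ltW.
have mg : measurable_fun setT g.
  apply: emeasurable_funM => //; apply/measurable_EFinP.
  rewrite (_ : (fun z => _) = \1_(snd @^-1` `]c, +oo[%classic)); last by apply/funext => z; rewrite !indicE.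
  by apply: measurable_indic; rewrite -[X in measurable X]setTI; exact: measurable_snd.
have mi : measurable `]c, +oo[%classic by exact: measurable_itv.
transitivity (\int[P]_t \int[leb]_u g (t, u))%E; last first.
  rewrite (@fubini_tonelli _ _ _ _ _ P leb g mg g0) [RHS]integral_mkcond.
  apply: eq_integral => u _; rewrite /g /= patchE indicE.
  case: ifPn => _; first by apply: eq_integral => t _; rewrite mule1.
  by rewrite integral0_eq// => t _; rewrite mule0.
apply: eq_integral => t _; rewrite ntail_integral//.
rewrite -ge0_integralZl//; last 3 first.
- apply/measurable_EFinP; apply: measurable_funTS; apply: measurable_funM => //.
  apply: (measurableT_comp (f := normal_pdf 0 1)); first exact: measurable_normal_pdf.
  by apply: measurable_funM => //; exact: measurable_funB.
- by move=> y _; rewrite lee_fin mulr_ge0// ltW.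
- by rewrite lee_fin.
rewrite integral_mkcond; apply: eq_integral => u _; rewrite /g /= patchE indicE.
by case: ifPn => _; rewrite ?mule0 ?mule1.
Qed.

(** With [K = k + 1] the kernel has width [1 / K ^+ 2] and the threshold is moved to the right by
    [1 / K]. The shift dominates the width, so the limit at the boundary point [x = b] is 0, as the
    open half-line requires. *)
Lemma cvg_smoothing (b : R) : P.-integrable setT (EFin \o w) ->
  (fun k => \int[P]_t ((w t)%:E * ntail (k.+1%:R ^+ 2 * (b + k.+1%:R^-1 - x t))))%E @ \oo -->
  (\int[P]_t ((w t)%:E * (\1_(x @^-1` [set` `]b, +oo[]) t)%:E))%E.
Proof.
move=> iw.
have m1 : measurable_fun setT (fun t => (w t)%:E) by exact/measurable_EFinP.
have mX : measurable (x @^-1` [set` `]b, +oo[]).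
  by rewrite -[X in measurable X]setTI; exact: mx.
pose y k t : R := k.+1%:R ^+ 2 * (b + k.+1%:R^-1 - x t).
have my k : measurable_fun setT (y k).
  by apply: measurable_funM => //; exact: measurable_funB.
have yE k t : y k t = k.+1%:R * (1 - k.+1%:R * (x t - b)).
  have : k.+1%:R != 0 :> R by rewrite pnatr_eq0.
  by rewrite /y; move: (k.+1%:R) => K K0; field.
have nat_infty : (fun k => k.+1%:R : R) @ \oo --> +oo.
  by apply/cvgryPge => A; near=> k; rewrite (le_trans _ (_ : k%:R <= _)) ?ler_nat//; near: k; exact: nbhs_infty_ger.
have cvg_pt t : (fun k => (w t)%:E * ntail (y k t))%E @ \oo -->
    ((w t)%:E * (\1_(x @^-1` [set` `]b, +oo[]) t)%:E)%E.
  apply: cvgeZl => //; rewrite indicE.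
  have [xt|xt] := ltP b (x t).
    rewrite mem_set /= ?in_itv /= ?xt//; apply: cvg_ntailNy.
    apply/cvgrNyPle => A; near=> k; rewrite yE.
    have k1 : 1 <= k.+1%:R :> R by rewrite ler1n.
    have kA : `|A| <= k.+1%:R by near: k; exact/(cvgryPge _).1.
    have kb : 2 * (x t - b)^-1 <= k.+1%:R by near: k; exact/(cvgryPge _).1.
    have xb : 0 < x t - b by rewrite subr_gt0.
    have {}kb : 2 <= k.+1%:R * (x t - b) by rewrite -ler_pdivrMr.
    have hA : - A <= `|A| by rewrite -normrN ler_norm.
    nra.
  rewrite memNset /= ?in_itv /= ?ltNge ?xt//; apply: cvg_ntaily.
  apply/cvgryPge => A; near=> k; rewrite yE.
  have k1 : 1 <= k.+1%:R :> R by rewrite ler1n.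
  have kA : A <= k.+1%:R by near: k; exact/(cvgryPge _).1.
  have : 0 <= k.+1%:R * (b - x t) by rewrite mulr_ge0// subr_ge0.
  nra.
have dom : {ae P, forall t k, setT t -> (`|(w t)%:E * ntail (y k t)| <= (EFin \o w) t)%E}.
  apply: aeW => t k _; rewrite gee0_abs; last by rewrite mule_ge0 ?lee_fin ?ntail_ge0.
  by rewrite -[leRHS]mule1 lee_wpmul2l ?lee_fin ?ntail_le1.
have [_ _ //] := @dominated_convergence _ T R P setT measurableT
  (fun k t => ((w t)%:E * ntail (y k t))%E)
  (fun t => ((w t)%:E * (\1_(x @^-1` [set` `]b, +oo[]) t)%:E)%E) (EFin \o w)
  (fun k => emeasurable_funM m1 (measurableT_comp (@measurable_ntail R) (my k)))
  (emeasurable_funM m1 ((measurable_EFinP _ _).2 (measurable_indic mX)))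
  (aeW _ (fun t _ => cvg_pt t)) iw dom.
Unshelve. all: end_near.
Qed.

End smoothing.

(** * Uniqueness for weighted laws on the line *)

Section levy_real.
Context d1 d2 (T1 : measurableType d1) (T2 : measurableType d2) (R : realType)
  (P1 : probability T1 R) (P2 : probability T2 R).
Variables (w1 x1 : T1 -> R) (w2 x2 : T2 -> R).
Hypotheses (w10 : forall t, 0 <= w1 t) (w20 : forall t, 0 <= w2 t)
  (mw1 : measurable_fun setT w1) (mw2 : measurable_fun setT w2)
  (iw1 : P1.-integrable setT (EFin \o w1)) (iw2 : P2.-integrable setT (EFin \o w2))
  (mx1 : measurable_fun setT x1) (mx2 : measurable_fun setT x2).
Hypothesis transform : forall a c : R,
  (\int[P1]_t (w1 t * (1 + cos (a + c * x1 t)))%:E =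
   \int[P2]_t (w2 t * (1 + cos (a + c * x2 t)))%:E)%E.

Let total : (\int[P1]_t (w1 t)%:E = \int[P2]_t (w2 t)%:E)%E.
Proof.
have E d (T : measurableType d) (P : probability T R) (w x : T -> R) :
    (forall t, 0 <= w t) -> measurable_fun setT w ->
    (\int[P]_t (w t * (1 + cos (0 + 0 * x t)))%:E = 2%:E * \int[P]_t (w t)%:E)%E.
  move=> w0 mw; rewrite -ge0_integral_EFinZ//.
  by apply: eq_integral => t _; rewrite mul0r addr0 cos0 mulrC.
have := transform 0 0; rewrite !E// => /(congr1 (fun z => ((2^-1)%:E * z)%E)).
by rewrite !muleA -EFinM mulVf// !mul1e.
Qed.

Let gauss (a u : R) : (\int[P1]_t (w1 t * expR (- ((a * (u - x1 t)) ^+ 2 / 2)))%:E =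
  \int[P2]_t (w2 t * expR (- ((a * (u - x2 t)) ^+ 2 / 2)))%:E)%E.
Proof.
have E d (T : measurableType d) (P : probability T R) (w x : T -> R) :
    (forall t, 0 <= w t) -> measurable_fun setT w -> measurable_fun setT x ->
    (\int[P]_t (w t * (1 + expR (- ((a * (u - x t)) ^+ 2 / 2))))%:E =
     \int[P]_t (w t)%:E + \int[P]_t (w t * expR (- ((a * (u - x t)) ^+ 2 / 2)))%:E)%E.
  move=> w0 mw mx; rewrite -ge0_integral_EFinD//.
  - by apply: eq_integral => t _; rewrite mulrDr mulr1.
  - by move=> t; rewrite mulr_ge0 ?expR_ge0.
  - apply: measurable_funM => //; apply: measurableT_comp => //.
    apply: measurableT_comp => //; apply: measurable_funM => //; apply: measurable_funX.
    by apply: measurable_funM => //; exact: measurable_funB.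
have : (\int[P1]_t (w1 t * (1 + expR (- ((a * (u - x1 t)) ^+ 2 / 2))))%:E =
  \int[P2]_t (w2 t * (1 + expR (- ((a * (u - x2 t)) ^+ 2 / 2))))%:E)%E.
  by rewrite !smoothing_cos//; apply: eq_integral => y _; exact: transform.
rewrite !E// total => /(congr1 (fun z => z - \int[P2]_t (w2 t)%:E)%E).
have fin : (\int[P2]_t (w2 t)%:E \is a fin_num)%E by exact: integrable_fin_num iw2.
by rewrite ![(\int[P2]_t (w2 t)%:E + _)%E]addeC !addeK.
Qed.

(** Equal cosine transforms give equal integrals of all Gaussian kernels, hence equal smoothed
    masses of half-lines, hence in the limit equal masses of half-lines, which form a generating
    pi-system. The weights are kept because the passage to processes needs them. *)
Lemma levy_real (B : set R) : measurable B ->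
  (\int[P1]_(t in x1 @^-1` B) (w1 t)%:E = \int[P2]_(t in x2 @^-1` B) (w2 t)%:E)%E.
Proof.
have kernel (a u : R) : 0 < a -> (\int[P1]_t (w1 t * (a * normal_pdf 0 1 (a * (u - x1 t))))%:E =
    \int[P2]_t (w2 t * (a * normal_pdf 0 1 (a * (u - x2 t))))%:E)%E.
  move=> a0; have E d (T : measurableType d) (P : probability T R) (w x : T -> R) :
      (forall t, 0 <= w t) -> measurable_fun setT w -> measurable_fun setT x ->
      (\int[P]_t (w t * (a * normal_pdf 0 1 (a * (u - x t))))%:E =
       (a * normal_peak 1)%:E * \int[P]_t (w t * expR (- ((a * (u - x t)) ^+ 2 / 2)))%:E)%E.
    move=> w0 mw mx; rewrite -ge0_integral_EFinZ//.
    - apply: eq_integral => t _; rewrite normal_pdfE// /normal_fun subr0 expr1n mulNr; congr EFin; ring.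
    - by move=> t; rewrite mulr_ge0 ?expR_ge0.
    - apply: measurable_funM => //; apply: measurableT_comp => //.
      apply: measurableT_comp => //; apply: measurable_funM => //; apply: measurable_funX.
      by apply: measurable_funM => //; exact: measurable_funB.
    - by rewrite mulr_ge0 ?normal_peak_ge0// ltW.
  by rewrite !E// gauss.
have tail (b : R) : (\int[P1]_(t in x1 @^-1` [set` `]b, +oo[]) (w1 t)%:E =
    \int[P2]_(t in x2 @^-1` [set` `]b, +oo[]) (w2 t)%:E)%E.
  have E d (T : measurableType d) (P : probability T R) (w x : T -> R) :
    (\int[P]_t ((w t)%:E * (\1_(x @^-1` [set` `]b, +oo[]) t)%:E) =
     \int[P]_(t in x @^-1` [set` `]b, +oo[]) (w t)%:E)%E.
    rewrite [RHS]integral_mkcond; apply: eq_integral => t _; rewrite patchE indicE.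
    by case: ifP => _; rewrite ?mule1 ?mule0.
  rewrite -!E; have c1 := cvg_smoothing w10 mw1 mx1 (b := b) iw1.
  have c2 := cvg_smoothing w20 mw2 mx2 (b := b) iw2.
  suff e : (fun k => \int[P1]_t ((w1 t)%:E * ntail (k.+1%:R ^+ 2 * (b + k.+1%:R^-1 - x1 t))))%E =
      (fun k => \int[P2]_t ((w2 t)%:E * ntail (k.+1%:R ^+ 2 * (b + k.+1%:R^-1 - x2 t))))%E.
    by rewrite e in c1; exact: (cvg_unique _ c1 c2).
  apply/funext => k.
  have k0 : 0 < k.+1%:R ^+ 2 :> R by rewrite exprn_gt0.
  by rewrite !smoothing_tail//; apply: eq_integral => u _; rewrite kernel.
move=> mB.
have mX1 : @measurable_fun _ _ T1 (measurableTypeR R) setT x1 := mx1.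
have mX2 : @measurable_fun _ _ T2 (measurableTypeR R) setT x2 := mx2.
pose X1 := @mfun_of _ _ T1 (measurableTypeR R) x1 mX1.
pose X2 := @mfun_of _ _ T2 (measurableTypeR R) x2 mX2.
pose G : set (set R) := [set A | A = setT \/ exists b, A = [set` `]b, +oo[]].
pose m1 := pushforward (density P1 w10 mw1) X1.
pose m2 := pushforward (density P2 w20 mw2) X2.
apply: (@finite_measure_unique _ (measurableTypeR R) R G m1 m2).
- by move=> _ [->|[b ->]]; [exact: measurableT|exact: measurable_itv].
- move=> _ _ [->|[b ->]] [->|[c ->]]; rewrite ?setTI ?setIT; first by left.
  + by right; exists c.
  + by right; exists b.
  + right; exists (Num.max b c); apply/seteqP; split => y /=; rewrite !in_itv /= !andbT gt_max.
      by move=> [-> ->].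
    by move=> /andP.
- by left.
- change ((\int[P1]_t (w1 t)%:E < +oo)%E); case/integrableP: iw1 => _.
  by under eq_integral do rewrite /= ger0_norm//.
- move=> _ [->|[b ->]]; last exact: tail.
  exact: total.
- have : (@ocitv R).-sigma.-measurable B := mB.
  rewrite RGenOInfty.measurableE; apply: sub_sigma_algebra2.
  by move=> _ [b ->]; right; exists b.
Qed.

End levy_real.

(** * Uniqueness for weighted laws of processes *)

Section levy_process.
Context (R : realType) (m : nat).

(** The set of times is a parameter because the densities of shifted Brownian motions are obtained
    for finitely many times only. *)
Definition cylinders_at (Tm : set R) : set (set (R -> 'cV[R]_m)) :=
  [set A | exists (s : R) (i : 'I_m) (B : set R), Tm s /\
     measurable B /\ A = (fun y : R -> 'cV[R]_m => y s i 0) @^-1` B].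

Lemma measurable_path d (T : measurableType d) (Tm : set R) (U : R -> T -> 'cV[R]_m) :
  (forall s i, Tm s -> measurable_fun setT (fun w => U s w i 0)) ->
  measurable_fun setT ((fun w s => U s w) : T -> g_sigma_algebraType (cylinders_at Tm)).
Proof.
move=> mU; apply: (measurability (rT := g_sigma_algebraType (cylinders_at Tm)) (cylinders_at Tm) (erefl _)).
move=> _ [_ [s [i [B [Ts [mB ->]]]]] <-].
exact: (mU s i Ts measurableT B mB).
Qed.

Lemma cosM (x y : R) : cos x * cos y = 2^-1 * cos (y + x) + 2^-1 * cos (y - x).
Proof. by rewrite cosD cosB; field. Qed.

Lemma integrable_weight d (T : measurableType d) (P : probability T R) (v g : T -> R) (C : R) :
  measurable_fun setT v -> P.-integrable setT (EFin \o v) ->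
  measurable_fun setT g -> (forall t, `|g t| <= C) ->
  P.-integrable setT (EFin \o (fun t => v t * g t)).
Proof.
move=> mv iv mg gC; have := integrable_scale C measurableT iv.
apply: le_integrable => //; first by apply/measurable_EFinP; exact: measurable_funM.
move=> t _ /=; rewrite lee_fin !normrM mulrC ler_wpM2r//.
exact: le_trans (gC t) (ler_norm _).
Qed.

Context d1 d2 (T1 : measurableType d1) (T2 : measurableType d2)
  (P1 : probability T1 R) (P2 : probability T2 R).
Variables (Tm : set R) (U1 : R -> T1 -> 'cV[R]_m) (U2 : R -> T2 -> 'cV[R]_m).
Hypothesis mU1 : forall s i, Tm s -> measurable_fun setT (fun w => U1 s w i 0).
Hypothesis mU2 : forall s i, Tm s -> measurable_fun setT (fun w => U2 s w i 0).

Definition times_in (l : seq (R * 'cV[R]_m)) : Prop := forall x, x \in l -> Tm x.1.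

Lemma measurable_lincomb_in d (T : measurableType d) (U : R -> T -> 'cV[R]_m) l :
  (forall s i, Tm s -> measurable_fun setT (fun w => U s w i 0)) -> times_in l ->
  measurable_fun setT (lincomb l U).
Proof.
move=> mU; elim: l => [|x l IH] lT.
  by rewrite (_ : lincomb _ _ = cst 0)//; apply/funext => w; rewrite /lincomb big_nil.
rewrite (_ : lincomb _ _ = (fun w => dot x.2 (U x.1 w) + lincomb l U w)); last first.
  by apply/funext => w; rewrite /lincomb big_cons.
apply: measurable_funD; last by apply: IH => y yl; apply: lT; rewrite in_cons yl orbT.
apply: measurable_bigsum => i _; apply: measurable_funM => //.
by apply: mU; apply: lT; rewrite mem_head.
Qed.

(** Weights make an induction over coordinates possible: restricting to a cylinder multiplies both
    weights by indicators, and this operation preserves the relation. *)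
Record levy_equal (v1 : T1 -> R) (v2 : T2 -> R) : Prop := LevyEqual {
  levy_ge01 : forall t, 0 <= v1 t;
  levy_ge02 : forall t, 0 <= v2 t;
  levy_meas1 : measurable_fun setT v1;
  levy_meas2 : measurable_fun setT v2;
  levy_int1 : P1.-integrable setT (EFin \o v1);
  levy_int2 : P2.-integrable setT (EFin \o v2);
  levy_cos : forall l, times_in l -> forall a,
    \int[P1]_t (v1 t * cos (a + lincomb l U1 t)) = \int[P2]_t (v2 t * cos (a + lincomb l U2 t)) }.

Section step.
Variables (v1 : T1 -> R) (v2 : T2 -> R) (H : levy_equal v1 v2).
Variables (s : R) (i : 'I_m) (B : set R).
Hypotheses (Ts : Tm s) (mB : measurable B).
Let x1 t := U1 s t i 0.
Let x2 t := U2 s t i 0.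

Let lincomb1 d (T : measurableType d) (U : R -> T -> 'cV[R]_m) (c : R) t :
  c * U s t i 0 = lincomb [:: (s, c *: delta_mx i 0)] U t.
Proof.
rewrite /lincomb big_cons big_nil addr0 /dot (bigD1 i)//= !mxE !eqxx mulr1 big1 ?addr0// => j ji.
by rewrite !mxE (negbTE ji) /= mulr0 mul0r.
Qed.

(** The product of two cosines is half the sum of the cosines of sum and difference, and both of
    these are transforms of linear functionals, given by [e ++ l] and [e ++ ln]. *)
Let levy_cosM l (lT : times_in l) (a a' c : R) :
  \int[P1]_t (v1 t * (cos (a' + lincomb l U1 t) * cos (a + c * x1 t))) =
  \int[P2]_t (v2 t * (cos (a' + lincomb l U2 t) * cos (a + c * x2 t))).
Proof.
pose e : seq (R * 'cV[R]_m) := [:: (s, c *: delta_mx i 0)].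
pose ln := [seq (y.1, - y.2) | y <- l].
have eT : times_in (e ++ l).
  by move=> y; rewrite mem_cat inE => /orP[/eqP ->//|]; exact: lT.
have enT : times_in (e ++ ln).
  move=> y; rewrite mem_cat inE => /orP[/eqP ->//|].
  by case/mapP => z zl ->; exact: (lT _ zl).
have E d (T : measurableType d) (P : probability T R) (v : T -> R) (U : R -> T -> 'cV[R]_m) :
    (forall s i, Tm s -> measurable_fun setT (fun w => U s w i 0)) ->
    measurable_fun setT v -> P.-integrable setT (EFin \o v) ->
    \int[P]_t (v t * (cos (a' + lincomb l U t) * cos (a + c * U s t i 0))) =
    2^-1 * \int[P]_t (v t * cos ((a + a') + lincomb (e ++ l) U t)) +
    2^-1 * \int[P]_t (v t * cos ((a - a') + lincomb (e ++ ln) U t)).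
  move=> mU mv iv.
  have ic b l' : times_in l' -> P.-integrable setT (EFin \o (fun t => v t * cos (b + lincomb l' U t))).
    move=> l'T; apply: (integrable_weight (C := 1)) => //.
      apply: measurable_cos_comp; apply: measurable_funD => //.
      exact: measurable_lincomb_in.
    by move=> t; exact: cos_max.
  rewrite -!RintegralZl//; [|exact: ic..].
  rewrite -RintegralD//; [|by apply: integrable_scale => //; exact: ic..].
  apply: eq_Rintegral => t _; rewrite cosM lincomb1 -/e.
  have -> : lincomb (e ++ l) U t = lincomb e U t + lincomb l U t by rewrite /lincomb big_cat.
  have -> : lincomb (e ++ ln) U t = lincomb e U t - lincomb l U t.
    rewrite /lincomb big_cat big_map -sumrN; congr (_ + _); apply: eq_bigr => y _ /=.
    by rewrite /dot -sumrN; apply: eq_bigr => j _; rewrite mxE mulNr.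
  rewrite [RHS](_ : _ = v t * (2^-1 * cos (a + a' + (lincomb e U t + lincomb l U t)) +
     2^-1 * cos (a - a' + (lincomb e U t - lincomb l U t)))); last by ring.
  by do 2 f_equal; [f_equal; f_equal; ring|f_equal; f_equal; ring].
case: H => v10 v20 mv1 mv2 iv1 iv2 cE.
by rewrite /x1 /x2 !E// !cE.
Qed.

Let levy_cos1 (a c : R) :
  \int[P1]_t (v1 t * cos (a + c * x1 t)) = \int[P2]_t (v2 t * cos (a + c * x2 t)).
Proof.
have := levy_cosM (l := [::]) (fun _ => ltac:(by [])) a 0 c.
rewrite /lincomb; under eq_Rintegral do rewrite big_nil addr0 cos0 mul1r.
by under [RHS]eq_Rintegral do rewrite big_nil addr0 cos0 mul1r.
Qed.

Let levy_cosl l (lT : times_in l) (a : R) :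
  \int[P1]_t (v1 t * cos (a + lincomb l U1 t)) = \int[P2]_t (v2 t * cos (a + lincomb l U2 t)).
Proof. exact: levy_cos H _ lT a. Qed.

Let EFin_Rintegral d (T : measurableType d) (P : probability T R) (f : T -> R) :
  P.-integrable setT (EFin \o f) -> (\int[P]_t (f t)%:E = (\int[P]_t f t)%:E)%E.
Proof. by move=> fi; rewrite /Rintegral fineK//; exact: integrable_fin_num. Qed.

Let levy_weight : (\int[P1]_(t in x1 @^-1` B) (v1 t)%:E = \int[P2]_(t in x2 @^-1` B) (v2 t)%:E)%E.
Proof.
have E d (T : measurableType d) (P : probability T R) (v x : T -> R) :
    measurable_fun setT x -> measurable_fun setT v -> P.-integrable setT (EFin \o v) -> forall a c,
    (\int[P]_t (v t * (1 + cos (a + c * x t)))%:E =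
     (\int[P]_t (v t * cos (0 + 0 * x t)) + \int[P]_t (v t * cos (a + c * x t)))%:E)%E.
  move=> mx mv iv a c.
  have ic a' c' : P.-integrable setT (EFin \o (fun t => v t * cos (a' + c' * x t))).
    apply: (integrable_weight (C := 1)) => //; last by move=> t; exact: cos_max.
    by apply: measurable_cos_comp; apply: measurable_funD => //; exact: measurable_funM.
  rewrite -RintegralD// -EFin_Rintegral; last exact: integrable_add.
  by apply: eq_integral => t _; rewrite mul0r addr0 cos0 mulrDr.
apply: levy_real; try by [case: H|exact: mU1|exact: mU2].
by move=> a c; case: H => *; rewrite !E ?levy_cos1//; [exact: mU2|exact: mU1].
Qed.

(** The one-dimensional theorem is applied to the weight [v * (1 + cos (a + lincomb l U))], which is
    nonnegative thanks to the summand 1. *)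
Let levy_weight_cos l (lT : times_in l) a :
  (\int[P1]_(t in x1 @^-1` B) (v1 t * (1 + cos (a + lincomb l U1 t)))%:E =
   \int[P2]_(t in x2 @^-1` B) (v2 t * (1 + cos (a + lincomb l U2 t)))%:E)%E.
Proof.
have E d (T : measurableType d) (P : probability T R) (v : T -> R) (U : R -> T -> 'cV[R]_m) :
    (forall s i, Tm s -> measurable_fun setT (fun w => U s w i 0)) ->
    measurable_fun setT v -> P.-integrable setT (EFin \o v) -> forall a' c,
    (\int[P]_t (v t * (1 + cos (a + lincomb l U t)) * (1 + cos (a' + c * U s t i 0)))%:E =
     (\int[P]_t (v t * cos (0 + 0 * U s t i 0)) + \int[P]_t (v t * cos (a' + c * U s t i 0)) +
      \int[P]_t (v t * cos (a + lincomb l U t)) +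
      \int[P]_t (v t * (cos (a + lincomb l U t) * cos (a' + c * U s t i 0))))%:E)%E.
  move=> mU mv iv a' c'.
  have mc a0 c0 : measurable_fun setT (fun t => cos (a0 + c0 * U s t i 0)).
    apply: measurable_cos_comp; apply: measurable_funD => //; apply: measurable_funM => //.
    exact: mU.
  have ml : measurable_fun setT (fun t => cos (a + lincomb l U t)).
    apply: measurable_cos_comp; apply: measurable_funD => //.
    exact: measurable_lincomb_in.
  have i1 a0 c0 : P.-integrable setT (EFin \o (fun t => v t * cos (a0 + c0 * U s t i 0))).
    by apply: (integrable_weight (C := 1)) => // t; exact: cos_max.
  have i2 : P.-integrable setT (EFin \o (fun t => v t * cos (a + lincomb l U t))).
    by apply: (integrable_weight (C := 1)) => // t; exact: cos_max.
  have i3 : P.-integrable setT (EFin \o (fun t => v t * (cos (a + lincomb l U t) * cos (a' + c' * U s t i 0)))).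
    apply: (integrable_weight (C := 1)) => //; first exact: measurable_funM.
    by move=> t; rewrite normrM mulr_ile1 ?cos_max.
  have i12 := integrable_add measurableT (i1 0 0) (i1 a' c').
  have i123 := integrable_add measurableT i12 i2.
  rewrite -RintegralD// -RintegralD// -RintegralD// -EFin_Rintegral; last exact: integrable_add.
  by apply: eq_integral => t _; congr EFin; rewrite mul0r addr0 cos0; ring.
case: (H) => v10 v20 mv1 mv2 iv1 iv2 cE.
have mw d (T : measurableType d) (P : probability T R) (v : T -> R) (U : R -> T -> 'cV[R]_m) :
    (forall s i, Tm s -> measurable_fun setT (fun w => U s w i 0)) ->
    measurable_fun setT v -> P.-integrable setT (EFin \o v) ->
    measurable_fun setT (fun t => v t * (1 + cos (a + lincomb l U t))) /\
    P.-integrable setT (EFin \o (fun t => v t * (1 + cos (a + lincomb l U t)))).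
  move=> mU mv iv; have mc : measurable_fun setT (fun t => 1 + cos (a + lincomb l U t)).
    apply: measurable_funD => //; apply: measurable_cos_comp; apply: measurable_funD => //.
    exact: measurable_lincomb_in.
  split; first exact: measurable_funM.
  apply: (integrable_weight (C := 2)) => // t.
  by apply: le_trans (ler_normD _ _) _; rewrite normr1 lerD2l cos_max.
have [mw1 iw1] := mw _ _ P1 v1 U1 mU1 mv1 iv1.
have [mw2 iw2] := mw _ _ P2 v2 U2 mU2 mv2 iv2.
apply: levy_real => //; try by [exact: mU1|exact: mU2|move=> t; rewrite mulr_ge0 ?cosD1_ge0].
by move=> a' c; rewrite !E// !levy_cos1 levy_cosl// levy_cosM.
Qed.

(** On the cylinder the cosine is [(1 + cos) - 1], a difference of the two weights for which the
    masses have been compared. *)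
Lemma levy_equal_step : levy_equal (fun t => v1 t * \1_(x1 @^-1` B) t) (fun t => v2 t * \1_(x2 @^-1` B) t).
Proof.
case: (H) => v10 v20 mv1 mv2 iv1 iv2 cE.
have mX d (T : measurableType d) (U : R -> T -> 'cV[R]_m) :
    (forall s i, Tm s -> measurable_fun setT (fun w => U s w i 0)) ->
    measurable ((fun t => U s t i 0) @^-1` B).
  by move=> mU; rewrite -[X in measurable X]setTI; exact: (mU s i Ts).
have mX1 : measurable (x1 @^-1` B) by exact: mX.
have mX2 : measurable (x2 @^-1` B) by exact: mX.
have ind1 (T : Type) (A : set T) t : `|\1_A t| <= 1 :> R.
  by rewrite ger0_norm// indicE lern1 leq_b1.
split.
- by move=> t; rewrite mulr_ge0.
- by move=> t; rewrite mulr_ge0.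
- by apply: measurable_funM => //; exact: measurable_indic.
- by apply: measurable_funM => //; exact: measurable_indic.
- by apply: (integrable_weight (C := 1)) => //; exact: measurable_indic.
- by apply: (integrable_weight (C := 1)) => //; exact: measurable_indic.
move=> l lT a.
have E d (T : measurableType d) (P : probability T R) (v : T -> R) (U : R -> T -> 'cV[R]_m) (D : set T) :
    (forall s i, Tm s -> measurable_fun setT (fun w => U s w i 0)) -> measurable D ->
    measurable_fun setT v -> P.-integrable setT (EFin \o v) ->
    \int[P]_t (v t * \1_D t * cos (a + lincomb l U t)) =
    fine (\int[P]_(t in D) (v t * (1 + cos (a + lincomb l U t)))%:E) - fine (\int[P]_(t in D) (v t)%:E).
  move=> mU mD mv iv.
  have mc : measurable_fun setT (fun t => 1 + cos (a + lincomb l U t)).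
    apply: measurable_funD => //; apply: measurable_cos_comp; apply: measurable_funD => //.
    exact: measurable_lincomb_in.
  have iw : P.-integrable setT (EFin \o (fun t => v t * (1 + cos (a + lincomb l U t)))).
    apply: (integrable_weight (C := 2)) => // t.
    by apply: le_trans (ler_normD _ _) _; rewrite normr1 lerD2l cos_max.
  rewrite -[RHS]RintegralB//; [|exact: integrableS iw|exact: integrableS iv].
  rewrite [RHS]Rintegral_mkcond; apply: eq_Rintegral => t _; rewrite patchE indicE.
  by case: ifP => _ /=; rewrite ?mulr1 ?mulr0 ?mul0r//; ring.
by rewrite !E// levy_weight levy_weight_cos.
Qed.

End step.

Fixpoint rectangle (C : seq (R * 'I_m * set R)) (y : R -> 'cV[R]_m) : Prop :=
  if C is c :: C' then c.2 (y c.1.1 c.1.2 0) /\ rectangle C' y else True.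

Fixpoint rectangle_ok (C : seq (R * 'I_m * set R)) : Prop :=
  if C is c :: C' then Tm c.1.1 /\ measurable c.2 /\ rectangle_ok C' else True.

Let path1 t : g_sigma_algebraType (cylinders_at Tm) := fun s => U1 s t.
Let path2 t : g_sigma_algebraType (cylinders_at Tm) := fun s => U2 s t.

Lemma levy_equal_rectangle v1 v2 (C : seq (R * 'I_m * set R)) : levy_equal v1 v2 -> rectangle_ok C ->
  levy_equal (fun t => v1 t * \1_(path1 @^-1` rectangle C) t) (fun t => v2 t * \1_(path2 @^-1` rectangle C) t).
Proof.
move=> H; elim: C => [|[[s i] B] C IH] /=.
  move=> _; have := H.
  by congr levy_equal; apply/funext => t; rewrite indicE mem_set// mulr1.
move=> [Ts [mB Cok]]; have := levy_equal_step (IH Cok) i Ts mB.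
congr levy_equal; apply/funext => t; rewrite -mulrA; congr (_ * _); rewrite -[LHS]/((_ \* _) t) -indicI;
  by rewrite setIC.
Qed.

(** One indicator at a time, the weights are restricted to any finite rectangle; the total masses
    then agree by the transform of the empty functional. Finite rectangles form a pi-system that
    generates the cylinder sigma-algebra. *)
Theorem levy_process v1 v2 : levy_equal v1 v2 -> forall A, <<s cylinders_at Tm >> A ->
  (\int[P1]_(t in path1 @^-1` A) (v1 t)%:E = \int[P2]_(t in path2 @^-1` A) (v2 t)%:E)%E.
Proof.
move=> H A mA; case: (H) => v10 v20 mv1 mv2 iv1 iv2 cE.
have mp1 : measurable_fun setT path1 by exact: measurable_path.
have mp2 : measurable_fun setT path2 by exact: measurable_path.
pose G : set (set (R -> 'cV[R]_m)) := [set D | exists2 C, rectangle_ok C & D = rectangle C].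
pose m1 := pushforward (density P1 v10 mv1) (mfun_of mp1).
pose m2 := pushforward (density P2 v20 mv2) (mfun_of mp2).
apply: (@finite_measure_unique _ (g_sigma_algebraType (cylinders_at Tm)) R G m1 m2).
- move=> _ [C Cok ->]; elim: C Cok => [|[[s i] B] C IH] /= => [_|[Ts [mB Cok]]]; first exact: measurableT.
  rewrite (_ : (fun y => _) = (fun y : R -> 'cV[R]_m => y s i 0) @^-1` B `&` rectangle C)//.
  apply: measurableI; last exact: IH.
  by apply: sub_sigma_algebra; exists s, i, B.
- move=> _ _ [C Cok ->] [C' Cok' ->]; exists (C ++ C').
    by elim: C Cok => //= c C IH [? [? ?]]; do 2 split => //; exact: IH.
  apply/seteqP; split => y /=.
    by elim: C {Cok} => //= [[]//|c C IH [[? ?] ?]]; split => //; exact: IH.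
  by elim: C {Cok} => //= c C IH [? /IH[]].
- by exists [::].
- change ((\int[P1]_t (v1 t)%:E < +oo)%E); case/integrableP: iv1 => _.
  by under eq_integral do rewrite /= ger0_norm//.
- move=> _ [C Cok ->].
  have [u10 u20 mu1 mu2 iu1 iu2 uE] := levy_equal_rectangle H Cok.
  have E d (T : measurableType d) (P : probability T R) (v : T -> R) (U : R -> T -> 'cV[R]_m) (D : set T) :
      P.-integrable setT (EFin \o (fun t => v t * \1_D t)) ->
      (\int[P]_(t in D) (v t)%:E = (\int[P]_t (v t * \1_D t * cos (0 + lincomb [::] U t)))%:E)%E.
    move=> iv; rewrite (_ : (\int[P]_t _)%R = (\int[P]_t (v t * \1_D t))%R); last first.
      by apply: eq_Rintegral => t _; rewrite /lincomb big_nil addr0 cos0 mulr1.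
    rewrite /Rintegral fineK; last exact: integrable_fin_num iv.
    rewrite [LHS]integral_mkcond; apply: eq_integral => t _; rewrite patchE indicE.
    by case: ifP => _; rewrite ?mulr1 ?mulr0.
  change ((\int[P1]_(t in path1 @^-1` rectangle C) (v1 t)%:E =
           \int[P2]_(t in path2 @^-1` rectangle C) (v2 t)%:E)%E).
  by rewrite (E _ _ P1 v1 U1)// (E _ _ P2 v2 U2)// uE.
- apply: sub_sigma_algebra2 mA => _ [s [i [B [Ts [mB ->]]]]].
  by exists [:: (s, i, B)] => //; apply/seteqP; split => y //= -[].
Qed.

End levy_process.

(** * Time integrals *)

Section step_approximation.
Context (R : realType).
Implicit Types (f : R -> R) (K k : nat) (s u : R).
Local Notation leb := (@lebesgue_measure R).
Local Notation I01 := ([set` `[0%R, 1%R]] : set R).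
Local Notation cell K k := (`[k%:R / K.+1%:R, k.+1%:R / K.+1%:R[%classic : set R).

Lemma leb_integrable_scale (D : set R) (c : R) f : measurable D ->
  leb.-integrable D (EFin \o f) -> leb.-integrable D (EFin \o (fun x => c * f x)).
Proof. by move=> mD; exact: (@integrable_scale _ _ _ leb D c f mD). Qed.

Lemma leb_Rintegral_bigsum (D : set R) I (r : seq I) (f : I -> R -> R) : measurable D ->
  (forall i, leb.-integrable D (EFin \o f i)) ->
  leb.-integrable D (EFin \o (fun x => \sum_(i <- r) f i x)) /\
  \int[leb]_(x in D) (\sum_(i <- r) f i x) = \sum_(i <- r) \int[leb]_(x in D) f i x.
Proof. by move=> mD; exact: (@Rintegral_bigsum _ _ _ leb D I r f mD). Qed.

Definition node K k : R := k%:R / K.+1%:R.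

Definition step_approx K f u : R := \sum_(k < K.+1) \1_(cell K k) u * f (node K k).

(** The length of the part of the cell that lies before [s]. With these weights the Riemann sums for
    all [s] use the same nodes, and every node lies in [[0, 1]]. *)
Definition cell_weight K k s : R := \int[leb]_(u in [set` `[0%R, s]]) \1_(cell K k) u.

Lemma node01 K k : (k <= K)%N -> node K k \in `[0, 1].
Proof.
move=> kK; rewrite in_itv /= divr_ge0//= ler_pdivrMr// mul1r ler_nat; exact: leqW.
Qed.

Lemma step_approxE K f u : 0 <= u < 1 -> exists2 k, (k <= K)%N &
  step_approx K f u = f (node K k) /\ `|node K k - u| <= K.+1%:R^-1.
Proof.
move=> /andP[u0 u1]; set N : R := K.+1%:R.
have N0 : 0 < N by rewrite ltr0n.
have Nu0 : 0 <= N * u by rewrite mulr_ge0// ltW.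
pose k := Num.truncn (N * u).
have /andP[k1 k2] : k%:R <= N * u < k.+1%:R by exact: truncn_itv.
have kK : (k < K.+1)%N.
  rewrite -(ltr_nat R); apply: le_lt_trans k1 _.
  by rewrite -[ltRHS]mulr1 ltr_pM2l.
exists k => //; split.
  rewrite /step_approx (bigD1 (Ordinal kK))//= big1 ?addr0.
    rewrite indicE mem_set ?mul1r//= in_itv /= ler_pdivrMr// ltr_pdivlMr// mulrC k1 /=.
    exact: k2.
  move=> j jk; rewrite indicE memNset ?mul0r//= in_itv /= ler_pdivrMr// ltr_pdivlMr// mulrC.
  move=> /andP[j1 j2]; move/negP : jk; apply; apply/eqP/val_inj => /=.
  apply/eqP; rewrite eqn_leq -ltnS -(ltr_nat R) (le_lt_trans j1 k2) /=.
  by rewrite -ltnS -(ltr_nat R) (le_lt_trans k1)// mulrC.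
rewrite /node distrC ger0_norm; last by rewrite subr_ge0 ler_pdivrMr// mulrC.
rewrite lerBlDr -[X in _ <= X + _]mul1r -mulrDl ler_pdivlMr// mulrC addrC natr1.
exact: ltW.
Qed.

Lemma cvg_step_approx f u : {within I01, continuous f} -> 0 <= u < 1 ->
  (fun K => step_approx K f u) @ \oo --> f u.
Proof.
move=> /subspace_continuousP cf u01.
pose k K := projT1 (cid2 (step_approxE K f u01)).
have kP K : [/\ (k K <= K)%N, step_approx K f u = f (node K (k K)) & `|node K (k K) - u| <= K.+1%:R^-1].
  by rewrite /k; case: cid2 => /= j ? [].
have uI : I01 u by rewrite /= in_itv /=; have /andP[-> /ltW ->] := u01.
rewrite (_ : (fun K => _) = (fun K => f (node K (k K)))); last first.
  by apply/funext => K; have [] := kP K.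
apply: (cvg_comp (fun K => node K (k K)) f _ (cf u uI)).
have nu : (fun K => node K (k K)) @ \oo --> u.
  apply/cvgrPdist_le => e e0; near=> K; rewrite distrC.
  have [_ _ h] := kP K; apply: le_trans h _.
  by apply/ltW; near: K; exact: (near_infty_natSinv_lt (PosNum e0)).
move=> A /= /nu; rewrite /nbhs /=; apply: filterS => K h.
by apply: h; have [kK _ _] := kP K; exact: node01.
Unshelve. all: end_near.
Qed.

Lemma continuous_bounded01 f : {within I01, continuous f} ->
  exists2 C, 0 <= C & forall u, u \in `[0, 1] -> `|f u| <= C.
Proof.
move=> cf.
have c1 : {within I01, continuous (fun u => `|f u|)}.
  by move=> x; apply: continuous_comp; [exact: cf|exact: norm_continuous].
have [c _ cC] := EVT_max ler01 c1.
by exists `|f c| => // u u01; exact: cC.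
Qed.

Lemma measurable_continuous01 f : {within I01, continuous f} -> measurable_fun I01 f.
Proof. by apply: subspace_continuous_measurable_fun; exact: measurable_itv. Qed.

Lemma measurable_cell K k : measurable (cell K k).
Proof. exact: measurable_itv. Qed.

Lemma measurable_step_approx K f (D : set R) : measurable_fun D (step_approx K f).
Proof.
apply: measurable_funTS; apply: measurable_bigsum => k _; exact: measurable_funM.
Qed.

(** The sum is the integral of [step_approx K f], which converges pointwise and is bounded by the
    maximum of the continuous function. The integral is taken over [[0, s[] because the half-open
    cells that contain nodes of [[0, 1]] as left ends give the approximation for [u < 1]. *)
Lemma cvg_riemann f s : {within I01, continuous f} -> s \in `[0, 1] ->
  (fun K => \sum_(k < K.+1) cell_weight K k s * f (node K k)) @ \oo -->
  \int[leb]_(u in [set` `[0%R, s]]) f u.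
Proof.
move=> cf s01; have /andP[s0 s1] : 0 <= s <= 1 by move: s01; rewrite in_itv.
have [C C0 fC] := continuous_bounded01 cf.
have mD : measurable `[0, s[%classic by exact: measurable_itv.
have sub : [set` `[0, s[] `<=` I01.
  by move=> u /=; rewrite !in_itv /= => /andP[-> /ltW us]; exact: le_trans us s1.
have mf : measurable_fun `[0, s[%classic f.
  exact: measurable_funS (measurable_itv _) sub (measurable_continuous01 cf).
have finD : (leb [set` `[0%R, s[] < +oo)%E.
  by rewrite lebesgue_measure_itv /=; case: ifP => _; rewrite ?oppr0 ?ltry.
have bi (g : R -> R) M0 : measurable_fun `[0, s[%classic g -> (forall u, [set` `[0, s[] u -> `|g u| <= M0) ->
    leb.-integrable `[0, s[%classic (EFin \o g).
  move=> mg gC; apply: measurable_bounded_integrable => //.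
  exists M0; split; first exact: num_real.
  by move=> M CM u uD /=; exact: le_trans (gC u uD) (ltW CM).
have sC K u : [set` `[0, s[] u -> `|step_approx K f u| <= C.
  rewrite /= in_itv /= => /andP[u0 us].
  have u01 : 0 <= u < 1 by rewrite u0 (lt_le_trans us).
  by have [j jK [-> _]] := step_approxE K f u01; apply: fC; exact: node01.
have fCD u : [set` `[0, s[] u -> `|f u| <= C by move=> /sub; exact: fC.
have E K : \sum_(k < K.+1) cell_weight K k s * f (node K k) = \int[leb]_(u in `[0, s[%classic) step_approx K f u.
  have ic k : leb.-integrable `[0, s[%classic (EFin \o \1_(cell K k)).
    apply: (bi _ 1) => [|u _]; first by apply: measurable_indic; exact: measurable_cell.
    by rewrite ger0_norm// indicE lern1 leq_b1.
  have icf (k : 'I_K.+1) : leb.-integrable `[0, s[%classic (EFin \o (fun u => \1_(cell K k) u * f (node K k))).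
    have := leb_integrable_scale (f (node K k)) mD (ic k).
    by congr (integrable _ _); apply/funext => u /=; rewrite mulrC.
  rewrite (leb_Rintegral_bigsum (index_enum 'I_K.+1) mD icf).2.
    apply: eq_bigr => k _; rewrite RintegralZr//; congr (_ * _); rewrite /cell_weight.
    by rewrite -Rintegral_itv_bndo_bndc//; exact: ic.
rewrite (_ : (fun K => _) = (fun K => \int[leb]_(u in `[0, s[%classic) step_approx K f u)); last exact/funext.
rewrite -(Rintegral_itv_bndo_bndc (f := f)); last exact: (bi _ C mf fCD).
apply: fine_cvg; rewrite /Rintegral fineK; last by apply: integrable_fin_num => //; exact: (bi _ C mf fCD).
have mfE : measurable_fun `[0, s[%classic (EFin \o f) by exact/measurable_EFinP.
have msE K : measurable_fun `[0, s[%classic (EFin \o step_approx K f).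
  by apply/measurable_EFinP; exact: measurable_step_approx.
have cvg_pt : {ae leb, forall u, [set` `[0, s[] u -> (fun K => (EFin \o step_approx K f) u) @ \oo --> (EFin \o f) u}.
  apply: aeW => u uD; apply: cvg_EFin; first exact: nearW.
  apply: cvg_step_approx => //.
  by move: uD; rewrite /= in_itv /= => /andP[-> us]; exact: lt_le_trans us s1.
have dom : {ae leb, forall u K, [set` `[0, s[] u -> (`|(EFin \o step_approx K f) u| <= C%:E)%E}.
  by apply: aeW => u K uD /=; rewrite lee_fin; exact: sC.
have iC : leb.-integrable `[0, s[%classic (EFin \o cst C).
  by apply: (bi _ C) => // u _; rewrite ger0_norm.
by have [_ _] := @dominated_convergence _ _ R leb _ mD _ _ _ msE mfE cvg_pt iC dom.
Qed.

End step_approximation.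

Section time_integral.
Context d (T : measurableType d) (R : realType).
Local Notation leb := (@lebesgue_measure R).
Local Notation I01 := ([set` `[0%R, 1%R]] : set R).

Definition time_integral m (X : R -> T -> 'cV[R]_m) (s : R) (w : T) : 'cV[R]_m :=
  \col_i \int[leb]_(u in [set` `[0%R, s]]) X u w i 0.

(** A functional of the path at finitely many nodes that approximates the functional [l] of its time
    integral. It reduces the transform of the integrated signal to transforms of the signal
    itself. *)
Definition riemann_comb m (l : seq (R * 'cV[R]_m)) (K : nat) : seq (R * 'cV[R]_m) :=
  flatten [seq [seq (node R K k, cell_weight K k x.1 *: x.2) | k <- iota 0 K.+1] | x <- l].

Lemma riemann_comb_times m (l : seq (R * 'cV[R]_m)) K : times01 (riemann_comb l K).
Proof.
apply/allP => y /flattenP[_ /mapP[x _ ->] /mapP[k]].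
by rewrite mem_iota /= add0n ltnS => kK ->; exact: node01.
Qed.

Lemma cvg_riemann_comb m (X : R -> T -> 'cV[R]_m) (l : seq (R * 'cV[R]_m)) w :
  (forall i, {within I01, continuous (fun s => X s w i 0)}) -> times01 l ->
  (fun K => lincomb (riemann_comb l K) X w) @ \oo --> lincomb l (time_integral X) w.
Proof.
move=> cX; elim: l => [|x l IH] /=.
  move=> _; rewrite (_ : (fun K => _) = cst 0); last by apply/funext => K; rewrite /lincomb big_nil.
  by rewrite /lincomb big_nil; exact: cvg_cst.
move=> /andP[x01 /IH{}IH].
rewrite (_ : (fun K => _) = (fun K => \sum_i x.2 i 0 * \sum_(k < K.+1) cell_weight K k x.1 * X (node R K k) w i 0
  + lincomb (riemann_comb l K) X w)); last first.
  apply/funext => K; rewrite /lincomb.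
  rewrite (_ : riemann_comb (x :: l) K = [seq (node R K k, cell_weight K k x.1 *: x.2) | k <- iota 0 K.+1] ++
    riemann_comb l K)// big_cat; congr (_ + _).
  rewrite big_map /dot exchange_big /=; apply: eq_bigr => i _.
  rewrite mulr_sumr -(big_mkord xpredT (fun k => x.2 i 0 * (cell_weight K k x.1 * X (node R K k) w i 0))).
  by rewrite /index_iota subn0; apply: eq_bigr => k _; rewrite mxE; ring.
rewrite /lincomb big_cons -/(lincomb l (time_integral X) w); apply: cvgD => //.
apply: cvg_bigsum => i; rewrite mxE; apply: cvgM; first exact: cvg_cst.
exact: (cvg_riemann (cX i)).
Qed.

Lemma measurable_time_integral m (X : R -> T -> 'cV[R]_m) s i : continuous_process X ->
  s \in `[0, 1] -> measurable_fun setT (fun w => time_integral X s w i 0).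
Proof.
move=> [mX cX] s01.
have mK (K : nat) : measurable_fun setT (fun w => \sum_(k < K.+1) cell_weight K k s * X (node R K k) w i 0).
  apply: measurable_bigsum => k _; apply: measurable_funM => //; apply: mX; apply: node01.
  by rewrite -ltnS.
apply: (measurable_fun_cvg mK) => // w _.
by rewrite mxE; exact: (cvg_riemann (cX w i)).
Qed.

End time_integral.

(** * Joint measurability in time and sample point *)

Section joint_measurability.
Context d (T : measurableType d) (R : realType).

(** A limit of step approximations, each a finite sum of products of a function of time and a
    function of the sample point. The limit is available for times below 1. *)
Lemma measurable_process m (X : R -> T -> 'cV[R]_m) i : continuous_process X ->
  measurable_fun ([set z | 0 <= z.2 < 1] : set (T * measurableTypeR R))
    (fun z : T * measurableTypeR R => X z.2 z.1 i 0).
Proof.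
move=> [mX cX]; set D := (X in measurable_fun X _).
have mD : measurable D.
  rewrite (_ : D = setT `&` snd @^-1` [set` `[0%R, 1%R[]); first exact: measurable_snd.
  by apply/seteqP; split => z /=; rewrite in_itv //= => -[].
have mK (K : nat) : measurable_fun D (fun z : T * measurableTypeR R => step_approx K (fun s => X s z.1 i 0) z.2).
  apply: measurable_funTS; apply: measurable_bigsum => k _; apply: measurable_funM.
    rewrite (_ : (fun z => _) = \1_(snd @^-1` [set` `[k%:R / K.+1%:R, k.+1%:R / K.+1%:R[])).
      by apply: measurable_indic; rewrite -[X in measurable X]setTI; exact: measurable_snd.
    by apply/funext => z; rewrite !indicE.
  apply: (measurableT_comp (f := fun w => X (node R K k) w i 0)); last exact: measurable_fst.
  by apply: mX; apply: node01; rewrite -ltnS.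
apply: (measurable_fun_cvg mK) => // -[w u] u01.
exact: (cvg_step_approx (cX w i)).
Qed.

End joint_measurability.

(** * The law of the observations *)

Section cos_limits.
Context d (T : measurableType d) (R : realType) (P : probability T R).

Lemma Rintegral_probability_cst (c : R) : \int[P]_t c = c.
Proof.
rewrite Rintegral_cst// [X in fine X](_ : _ = 1%E) ?mulr1//; exact: probability_setT.
Qed.

Lemma Rintegral_cosD1 (f : T -> R) : measurable_fun setT f ->
  (\int[P]_t (1 + cos (f t))%:E = (1 + \int[P]_t cos (f t))%:E)%E.
Proof.
move=> mf; have ic : P.-integrable setT (EFin \o (fun t => cos (f t))).
  apply: (bounded_integrable (C := 1)); [exact: fin_num_fun_lty|exact: measurable_cos_comp|].
  by move=> t; exact: cos_max.
have i1 : P.-integrable setT (EFin \o cst (1 : R)) by exact: finite_measure_integrable_cst.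
have -> : (1 + \int[P]_t cos (f t))%R = \int[P]_t (cst 1 t + cos (f t)).
  by rewrite RintegralD// Rintegral_probability_cst.
by rewrite /Rintegral fineK//; apply: integrable_fin_num => //; exact: integrable_add.
Qed.

Lemma cvg_Rintegral_cos (f : nat -> T -> R) (g : T -> R) :
  (forall k, measurable_fun setT (f k)) -> (forall t, f ^~ t @ \oo --> g t) ->
  (fun k => \int[P]_t cos (f k t)) @ \oo --> \int[P]_t cos (g t).
Proof.
move=> mf fg; have mg : measurable_fun setT g by apply: (measurable_fun_cvg mf) => t _; exact: fg.
have mfE k : measurable_fun setT (EFin \o (fun t => cos (f k t))).
  by apply/measurable_EFinP; exact: measurable_cos_comp.
have mgE : measurable_fun setT (EFin \o (fun t => cos (g t))).
  by apply/measurable_EFinP; exact: measurable_cos_comp.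
have pt : {ae P, forall t, setT t -> (fun k => (EFin \o (fun t => cos (f k t))) t) @ \oo --> (EFin \o (fun t => cos (g t))) t}.
  apply: aeW => t _; apply: cvg_EFin; first exact: nearW.
  change ((fun k => cos (f k t)) @ \oo --> cos (g t)).
  by apply: continuous_cvg; [exact: continuous_cos|exact: fg].
have i1 : P.-integrable setT (EFin \o cst (1 : R)) by exact: finite_measure_integrable_cst.
have dom : {ae P, forall t k, setT t -> (`|(EFin \o (fun t => cos (f k t))) t| <= (EFin \o cst 1%R) t)%E}.
  by apply: aeW => t k _ /=; rewrite lee_fin; exact: cos_max.
have [ig _ h] := dominated_convergence measurableT mfE mgE pt i1 dom.
by apply: fine_cvg; rewrite /Rintegral fineK//; exact: integrable_fin_num.
Qed.

(** For a frozen value of [U] the integral over [V] is the transform of [V] at the phase [a + U];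
    the function [1 + cos] makes the iterated integral legitimate. *)
Lemma cos_indep (U V : T -> R) (q : R) : measurable_fun setT U -> measurable_fun setT V ->
  (forall A B, measurable A -> measurable B ->
    P (U @^-1` A `&` V @^-1` B) = (P (U @^-1` A) * P (V @^-1` B))%E) ->
  (forall a, \int[P]_t cos (a + V t) = cos a * q) ->
  forall a, \int[P]_t cos (a + (U t + V t)) = q * \int[P]_t cos (a + U t).
Proof.
move=> mU mV ind VE a.
pose f (z : R * R) : \bar R := (1 + cos (a + (z.1 + z.2)))%:E.
have f0 z : (0 <= f z)%E by rewrite lee_fin cosD1_ge0.
have mf : measurable_fun setT f.
  apply/measurable_EFinP; apply: measurable_funD => //; apply: measurable_cos_comp.
  by apply: measurable_funD => //; apply: measurable_funD; [exact: measurable_fst|exact: measurable_snd].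
have h := ge0_integral_indep mU mV ind f0 mf.
have q1 : `|q| <= 1.
  have := VE 0; rewrite cos0 mul1r => <-.
  apply: le_trans (le_normr_Rintegral _ _) _ => //.
    apply: (bounded_integrable (C := 1)); [exact: fin_num_fun_lty| |by move=> t; exact: cos_max].
    by apply: measurable_cos_comp; exact: measurable_funD.
  have : \int[P]_t `|cos (0 + V t)| <= \int[P]_t (cst 1 t).
    apply: le_Rintegral => //.
    - apply: (bounded_integrable (C := 1)); [exact: fin_num_fun_lty| |by move=> t; rewrite normr_id; exact: cos_max].
      apply: measurableT_comp => //; by apply: measurable_cos_comp; exact: measurable_funD.
    - exact: finite_measure_integrable_cst.
    - by move=> t _; exact: cos_max.
  by rewrite Rintegral_probability_cst.
move: h; rewrite /f /=; under [X in _ = X -> _]eq_integral => t _.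
  under eq_integral do rewrite addrA.
  rewrite Rintegral_cosD1; last exact: measurable_funD.
  rewrite VE; over.
rewrite Rintegral_cosD1; last by apply: measurable_funD => //; exact: measurable_funD.
have ic : P.-integrable setT (EFin \o (fun t => cos (a + U t))).
  apply: (bounded_integrable (C := 1)); [exact: fin_num_fun_lty| |by move=> t; exact: cos_max].
  by apply: measurable_cos_comp; exact: measurable_funD.
have icq : P.-integrable setT (EFin \o (fun t => q * cos (a + U t))) by exact: integrable_scale.
have i1 : P.-integrable setT (EFin \o cst (1 : R)) by exact: finite_measure_integrable_cst.
have -> : (\int[P]_t (1 + cos (a + U t) * q)%:E = (1 + q * \int[P]_t cos (a + U t))%:E)%E.
  rewrite -RintegralZl//.
  have -> : (1 + \int[P]_t (q * cos (a + U t)))%R = \int[P]_t (cst 1 t + q * cos (a + U t)).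
    by rewrite RintegralD// Rintegral_probability_cst.
  rewrite /Rintegral fineK//; last by apply: integrable_fin_num => //; exact: integrable_add.
  by apply: eq_integral => t _; rewrite mulrC.
by move=> -[] /addrI.
Qed.

End cos_limits.

Section observation.
Context (R : realType).
Local Notation I01 := ([set` `[0%R, 1%R]] : set R).

(* What the law of the observation depends on: Gaussian signal and noise that
   are independent as far as linear functionals are concerned. *)
Record observed d (T : measurableType d) (P : probability T R) m (x0 : 'cV[R]_m) (kap : R)
    (Sigma : R -> 'M[R]_m) (X W Y : R -> T -> 'cV[R]_m) : Prop := Observed {
  observed_cont : continuous_process X;
  observed_gaussian : gaussian P (fun s w => X s w - x0) Sigma;
  observed_meas : forall s i, s \in `[0, 1] -> measurable_fun setT (fun w => W s w i 0);
  observed_noise : forall l a, times01 l ->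
    \int[P]_w cos (a + lincomb l W w) = cos a * expR (- (bmcov l l / 2));
  observed_indep : forall l l' A B, times01 l -> times01 l' -> measurable A -> measurable B ->
    P (lincomb l X @^-1` A `&` lincomb l' W @^-1` B) =
    (P (lincomb l X @^-1` A) * P (lincomb l' W @^-1` B))%E;
  observed_eq : forall s w, s \in `[0, 1] -> Y s w = time_integral X s w + kap *: W s w }.

Lemma sigma_process_lincomb d (T : measurableType d) m (U : R -> T -> 'cV[R]_m) l (A : set R) :
  times01 l -> measurable A -> sigma_process I01 U (lincomb l U @^-1` A).
Proof.
move=> l01 mA; pose G : set (set T) := [set A | exists (s : R) (i : 'I_m) (B : set R),
  I01 s /\ measurable B /\ A = (fun w => U s w i 0) @^-1` B].
have mU s i : s \in `[0, 1] -> measurable_fun setT ((fun w => U s w i 0) : g_sigma_algebraType G -> R).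
  move=> s01 _ B mB; rewrite setTI; apply: sub_sigma_algebra.
  by exists s, i, B.
have := @measurable_lincomb _ (g_sigma_algebraType G) R setT m l U l01 mU measurableT A mA.
by rewrite setTI.
Qed.

Lemma lincombD (T : Type) m l (U V : R -> T -> 'cV[R]_m) w :
  lincomb l (fun s w => U s w + V s w) w = lincomb l U w + lincomb l V w.
Proof. by rewrite /lincomb -big_split; apply: eq_bigr => x _; rewrite dotDr. Qed.

Lemma eq_lincomb (T : Type) m l (U V : R -> T -> 'cV[R]_m) w : times01 l ->
  (forall s, s \in `[0, 1] -> U s w = V s w) -> lincomb l U w = lincomb l V w.
Proof. by move=> /allP l01 UV; apply: eq_big_seq => x /l01 x01; rewrite UV. Qed.

Lemma lincomb_map (T : Type) m n l (D : 'M[R]_(n, m)) (U : R -> T -> 'cV[R]_m) w :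
  lincomb l (fun s w => D *m U s w) w = lincomb [seq (x.1, D^T *m x.2) | x <- l] U w.
Proof.
rewrite /lincomb big_map; apply: eq_bigr => x _ /=.
have dotE p (u v : 'cV[R]_p) : dot u v = (u^T *m v) 0 0.
  by rewrite mxE; apply: eq_bigr => i _; rewrite mxE.
by rewrite !dotE trmx_mul trmxK mulmxA.
Qed.

Lemma times01_map m n (g : 'cV[R]_m -> 'cV[R]_n) l :
  times01 [seq (x.1, g x.2) | x <- l] = times01 l.
Proof. by rewrite /times01 all_map. Qed.

Section transform.
Context d (T : measurableType d) (P : probability T R) m (x0 : 'cV[R]_m) (kap : R)
  (Sigma : R -> 'M[R]_m) (X W Y : R -> T -> 'cV[R]_m).
Hypothesis obs : observed P x0 kap Sigma X W Y.

Lemma measurable_observed s i : s \in `[0, 1] -> measurable_fun setT (fun w => Y s w i 0).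
Proof.
move=> s01; case: obs => cX _ mW _ _ YE.
rewrite (_ : (fun w => _) = (fun w => time_integral X s w i 0 + kap * W s w i 0)).
  apply: measurable_funD; first exact: measurable_time_integral.
  by apply: measurable_funM => //; exact: mW.
by apply/funext => w; rewrite YE// !mxE.
Qed.

(** The terms of the sequence are explicit and depend only on [x0], [kap], [Sigma] and [l]: the
    factors come from the noise, from the initial value and from the Gaussian signal at the nodes.
    The limit therefore depends only on these data. *)
Lemma cvg_observed_cos l a : times01 l ->
  let lK := riemann_comb l in let lW := [seq (x.1, kap *: x.2) | x <- l] in
  (fun K => expR (- (bmcov lW lW / 2)) *
     (cos (a + lincomb (lK K) (fun=> cst x0) tt) * expR (- (gcov Sigma (lK K) / 2)))) @ \oo -->
  \int[P]_w cos (a + lincomb l Y w).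
Proof.
move=> l01 lK lW; have [cX gX mW nW ind YE] := obs.
have lW01 : times01 lW by rewrite times01_map.
have lK01 K : times01 (lK K) := riemann_comb_times l K.
have mX s i : s \in `[0, 1] -> measurable_fun setT (fun w => X s w i 0) by case: cX => + _; apply.
rewrite (_ : \int[P]_w _ = \int[P]_w cos (a + (lincomb l (time_integral X) w + lincomb lW W w))); last first.
  apply: eq_Rintegral => w _; congr (cos (_ + _)).
  rewrite (eq_lincomb (V := fun s w => time_integral X s w + kap *: W s w))//; last by move=> s; exact: YE.
  rewrite lincombD; congr (_ + _); rewrite /lincomb big_map; apply: eq_bigr => x _ /=.
  by rewrite dotZl dotC dotZl dotC.
rewrite (_ : (fun K => _) = (fun K => \int[P]_w cos (a + (lincomb (lK K) X w + lincomb lW W w)))).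
  apply: cvg_Rintegral_cos => [K|w].
    apply: measurable_funD => //; apply: measurable_funD; exact: measurable_lincomb.
  apply: cvgD; first exact: cvg_cst.
  apply: cvgD; last exact: cvg_cst.
  by apply: cvg_riemann_comb => //; case: cX.
apply/funext => K; rewrite (@cos_indep _ _ _ P _ _ (expR (- (bmcov lW lW / 2)))).
- congr (_ * _); rewrite -(gX _ (lK01 K)); apply: eq_Rintegral => w _; congr cos.
  rewrite -addrA; congr (_ + _); rewrite /lincomb -big_split; apply: eq_bigr => x _ /=.
  by rewrite -dotDr addrC subrK.
- exact: measurable_lincomb.
- exact: measurable_lincomb.
- by move=> A B mA mB; exact: ind.
- by move=> b; exact: nW.
Qed.

End transform.

(** The cosine transforms of both observations are limits of one and the same sequence, so
    [levy_process] with weights 1 applies. *)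
Theorem observed_law d1 d2 (T1 : measurableType d1) (T2 : measurableType d2)
    (P1 : probability T1 R) (P2 : probability T2 R) m (x0 : 'cV[R]_m) (kap : R)
    (Sigma : R -> 'M[R]_m) (X1 W1 Y1 : R -> T1 -> 'cV[R]_m) (X2 W2 Y2 : R -> T2 -> 'cV[R]_m) :
  observed P1 x0 kap Sigma X1 W1 Y1 -> observed P2 x0 kap Sigma X2 W2 Y2 ->
  forall A : set (path_space R m), measurable A ->
  P1 [set w | A (fun s => Y1 s w)] = P2 [set w | A (fun s => Y2 s w)].
Proof.
move=> obs1 obs2 A mA.
have mY1 := measurable_observed obs1; have mY2 := measurable_observed obs2.
have one d (T : measurableType d) (P : probability T R) : P.-integrable setT (EFin \o (fun=> 1 : R)).
  exact: finite_measure_integrable_cst.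
have H : levy_equal P1 P2 I01 Y1 Y2 (fun=> 1) (fun=> 1).
  split => // l lT a.
  have l01 : times01 l by apply/allP => x xl; exact: lT.
  under eq_Rintegral do rewrite mul1r; under [RHS]eq_Rintegral do rewrite mul1r.
  exact: (cvg_unique _ (cvg_observed_cos obs1 l01) (cvg_observed_cos obs2 l01)).
have := levy_process mY1 mY2 H mA.
have mp1 : measurable ((fun w s => Y1 s w) @^-1` A).
  by rewrite -[X in measurable X]setTI; exact: (measurable_path mY1).
have mp2 : measurable ((fun w s => Y2 s w) @^-1` A).
  by rewrite -[X in measurable X]setTI; exact: (measurable_path mY2).
by rewrite !integral_cst// !mul1e.
Qed.

Lemma observation_law_observed m (x0 : 'cV[R]_m) (eta : R) n Sigma (mu : probability (path_space R m) R) :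
  observation_law x0 eta n Sigma mu ->
  exists (d : measure_display) (T : measurableType d) (P : probability T R)
         (X W Y : R -> T -> 'cV[R]_m),
    observed P x0 (eta / Num.sqrt n%:R) Sigma X W Y /\ brownian_motion P W /\
    (forall A, measurable A -> mu A = P [set w | A (fun s => Y s w)]).
Proof.
move=> [d [T [P [p [sigma [B [X [W [Y [s2 [SE [bB [cX [wi [bW [ind [YE muE]]]]]]]]]]]]]]]]].
exists d, T, P, X, W, Y; split; last by [].
have mX s i : s \in `[0, 1] -> measurable_fun setT (fun w => X s w i 0) by case: cX => + _; apply.
split => //.
- apply: wiener_gaussian bB s2 SE _ wi => s i s01.
  rewrite (_ : (fun w => _) = (fun w => X s w i 0 - x0 i 0)); last by apply/funext => w; rewrite !mxE.
  by apply: measurable_funB => //; exact: mX.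
- by case: bW => -[+ _] _; apply.
- by move=> l a l01; exact: brownian_cos.
- by move=> l l' A C l01 l'01 mA mC; apply: ind; exact: sigma_process_lincomb.
- by move=> s w s01; apply/colP => i; rewrite YE// !mxE.
Qed.

End observation.

(** * Approximation by finitely many times *)

Section finite_times.
Context (R : realType) (m : nat).

Lemma cylinders_at_sub (S S' : set R) : S `<=` S' ->
  <<s @cylinders_at R m S >> `<=` <<s cylinders_at S' >>.
Proof.
move=> SS'; apply: sub_sigma_algebra2 => _ [s [i [B [Ss [mB ->]]]]].
by exists s, i, B; split => //; exact: SS'.
Qed.

Let algebra : set (set (path_space R m)) :=
  [set A | exists2 S : seq R, all (fun s => s \in `[0, 1]) S &
                             <<s cylinders_at [set s | s \in S] >> A].

Let algebra_setring : setring algebra.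
Proof.
have lift A B : algebra A -> algebra B -> exists2 S : seq R, all (fun s => s \in `[0, 1]) S &
    <<s @cylinders_at R m [set s | s \in S] >> A /\ <<s @cylinders_at R m [set s | s \in S] >> B.
  move=> [S S01 SA] [S' S'01 SB]; exists (S ++ S'); first by rewrite all_cat S01.
  split; [move: SA|move: SB]; apply: cylinders_at_sub => s /= h; rewrite mem_cat h ?orbT//.
split.
- by exists [::] => //; exact: sigma_algebra0.
- move=> A B /lift h /h[S S01 [SA SB]]; exists S => //.
  exact: (@measurableU _ (g_sigma_algebraType (cylinders_at [set s | s \in S]))).
- move=> A B /lift h /h[S S01 [SA SB]]; exists S => //.
  exact: (@measurableD _ (g_sigma_algebraType (cylinders_at [set s | s \in S]))).
Qed.

Let sub_sigma_ring : <<s @cylinders R m >> `<=` <<sr algebra >>.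
Proof.
have algT : algebra setT by exists [::] => //; exact: (@measurableT _ (g_sigma_algebraType (cylinders_at [set s | s \in [::]]))).
have [r0 rD rU] : sigma_ring <<sr algebra >> by exact: smallest_sigma_ring.
apply: smallest_sub.
  split => // A rA; apply: rD => //.
  exact: sub_g_sigma_ring.
move=> A [s [i [B [s01 [mB ->]]]]]; apply: sub_g_sigma_ring; exists [:: s]; first by rewrite /= s01.
by apply: sub_sigma_algebra; exists s, i, B; split => //=; rewrite mem_head.
Qed.

Context d1 d2 (T1 : measurableType d1) (T2 : measurableType d2)
  (P1 : probability T1 R) (P2 : probability T2 R).
Variables (U1 : R -> T1 -> 'cV[R]_m) (U2 : R -> T2 -> 'cV[R]_m) (e : R).
Hypothesis mU1 : forall s i, s \in `[0, 1] -> measurable_fun setT (fun w => U1 s w i 0).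
Hypothesis mU2 : forall s i, s \in `[0, 1] -> measurable_fun setT (fun w => U2 s w i 0).
Hypothesis e0 : 0 <= e.

Let path1 t : path_space R m := fun s => U1 s t.
Let path2 t : path_space R m := fun s => U2 s t.
Let mp1 : measurable_fun setT path1. Proof. exact: (measurable_path mU1). Qed.
Let mp2 : measurable_fun setT path2. Proof. exact: (measurable_path mU2). Qed.

Hypothesis finite : forall S : seq R, all (fun s => s \in `[0, 1]) S ->
  forall A, <<s cylinders_at [set s | s \in S] >> A ->
  (P1 (path1 @^-1` A) <= P2 (path2 @^-1` A) + e%:E)%E.

(** Events depending on finitely many times form a ring that generates the sigma-algebra. An
    inequality with an additive error survives monotone limits but not complements in general, hence
    the monotone class theorem instead of a pi-lambda argument. *)
Lemma finite_times_set (A : set (path_space R m)) : measurable A ->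
  (P1 (path1 @^-1` A) <= P2 (path2 @^-1` A) + e%:E)%E.
Proof.
pose m1 := pushforward P1 (mfun_of mp1); pose m2 := pushforward P2 (mfun_of mp2).
pose G : set (set (path_space R m)) := [set A | measurable A /\ (m1 A <= m2 A + e%:E)%E].
suff : <<sr algebra >> `<=` G by move=> h mA; exact: (h A (sub_sigma_ring mA)).2.
apply: monotone_setring_sub_g_sigma_ring => //; last first.
  move=> B [S S01 SB]; split; last exact: finite SB.
  by move: SB; apply: cylinders_at_sub => s /= sS; exact: (allP S01).
have fin2 B : measurable B -> m2 B \is a fin_num.
  by move=> mB; apply: (fin_num_measure P2); rewrite -[X in measurable X]setTI; exact: mp2.
split=> F mono FG.
  have mF : measurable (\bigcup_n F n) by apply: bigcup_measurable => n _; exact: (FG n).1.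
  split => //.
  have c1 : m1 \o F @ \oo --> m1 (\bigcup_n F n) by apply: nondecreasing_cvg_mu => // n; exact: (FG n).1.
  rewrite -(cvg_lim _ c1)//; apply: lime_le; first by apply/cvg_ex; eexists; exact: c1.
  apply: nearW => n /=; apply: le_trans (FG n).2 _; rewrite leeD2r// le_measure ?inE//.
    exact: (FG n).1.
  exact: bigcup_sup.
have mF : measurable (\bigcap_n F n) by apply: bigcap_measurable => // n _; exact: (FG n).1.
split => //.
have c2 : m2 \o F @ \oo --> m2 (\bigcap_n F n).
  apply: nonincreasing_cvg_mu => // [|n]; last exact: (FG n).1.
  by rewrite ltey_eq fin2//; exact: (FG 0%N).1.
have c3 : (fun n => m2 (F n) + e%:E)%E @ \oo --> (m2 (\bigcap_n F n) + e%:E)%E.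
  by apply: cvgeD => //; [exact: fin_num_adde_defl|exact: cvg_cst].
rewrite -(cvg_lim _ c3)//; apply: lime_ge; first by apply/cvg_ex; eexists; exact: c3.
apply: nearW => n /=; apply: le_trans (FG n).2; rewrite le_measure ?inE//; first exact: (FG n).1.
exact: bigcap_inf.
Qed.

(** The integral of a test is the integral of the probabilities of [phi > r] over levels [r]. The
    error [e] is paid for levels in [[0, 1]] only, since above 1 the event is empty, and this
    amounts to [e] in total. *)
Lemma finite_times_test (phi : path_space R m -> R) : measurable_fun setT phi ->
  (forall y, 0 <= phi y <= 1) ->
  (\int[P1]_w (phi (path1 w))%:E <= \int[P2]_w (phi (path2 w))%:E + e%:E)%E.
Proof.
move=> mphi phi01.
pose X1 : {RV P1 >-> R} := mfun_of (measurableT_comp mphi mp1).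
pose X2 : {RV P2 >-> R} := mfun_of (measurableT_comp mphi mp2).
have X10 x : 0 <= X1 x by have /andP[] := phi01 (path1 x).
have X20 x : 0 <= X2 x by have /andP[] := phi01 (path2 x).
have := ge0_expectation_ccdf X10; rewrite expectation_def => h1.
have := ge0_expectation_ccdf X20; rewrite expectation_def => h2.
change ((\int[P1]_w (X1 w)%:E <= \int[P2]_w (X2 w)%:E + e%:E)%E).
rewrite h1 h2.
have mI : measurable [set` `[(0:R), +oo[] by exact: measurable_itv.
pose I0 : set R := [set` `[0, +oo[].
pose I1 : set R := [set` `[0, 1]].
have E : (\int[lebesgue_measure]_(r in I0) (e%:E * (\1_I1 r)%:E) = e%:E)%E.
  rewrite ge0_integralZl//; last first.
    by apply/measurable_EFinP; apply: measurable_indic; exact: measurable_itv.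
  rewrite integral_indic//; last exact: measurable_itv.
  rewrite (_ : _ `&` _ = I1).
    by rewrite -[RHS]mule1; congr (_ * _)%E; exact: lebesgue_I01.
  rewrite /I0 /I1; apply/seteqP; split => r /=; rewrite !in_itv /= ?andbT; first by case.
  by move=> /[dup] /andP[-> _].
rewrite -[X in (_ <= _ + X)%E]E -ge0_integralD//; last 3 first.
- by apply: measurable_funTS; exact: ccdf_measurable.
- by move=> r _; rewrite mule_ge0// lee_fin.
- apply: emeasurable_funM => //; apply/measurable_EFinP; apply: measurable_indic; exact: measurable_itv.
apply: ge0_le_integral => //.
- by apply: measurable_funTS; exact: ccdf_measurable.
- apply: emeasurable_funD; first by apply: measurable_funTS; exact: ccdf_measurable.
  apply: emeasurable_funM => //; apply/measurable_EFinP; apply: measurable_indic; exact: measurable_itv.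
move=> r /=; rewrite in_itv /= andbT => r0.
have [r1|r1] := leP r 1.
  have -> : \1_I1 r = 1 :> R by rewrite indicE mem_set// /I1 /= in_itv /= r0 r1.
  rewrite mule1.
  have mA : measurable (phi @^-1` [set` `]r, +oo[]).
    by rewrite -[X in measurable X]setTI; exact: (mphi measurableT _ (measurable_itv _)).
  exact: (finite_times_set mA).
have -> : \1_I1 r = 0 :> R by rewrite indicE memNset// /I1 /= in_itv /= => /andP[_]; rewrite leNgt r1.
rewrite mule0 adde0 /ccdf.
rewrite (_ : distribution P1 X1 _ = 0%E); first exact: measure_ge0.
rewrite /distribution /pushforward (_ : _ @^-1` _ = set0) ?measure0//.
apply/seteqP; split => w //=; rewrite in_itv /= andbT => h.
by have /andP[_] := phi01 (path1 w); rewrite leNgt (lt_trans r1 h).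
Qed.

End finite_times.

(** * Cameron-Martin shifts *)

Section energy.
Context (R : realType).
Variables (F E : R -> R).
Hypothesis energy : forall s t, 0 <= s -> s < t -> t <= 1 -> (F t - F s) ^+ 2 <= (t - s) * (E t - E s).

(* Piecewise linear interpolation of [F] at the times in [l], written as a
   combination of the kernels [min(t, .)]. *)
Lemma interpolation s l : 0 <= s -> path <%R s l -> (forall t, t \in l -> t <= 1) ->
  exists b : seq (R * R), [/\ (forall y, y \in b -> y.1 \in l),
    (forall t, t \in l -> \sum_(y <- b) (Num.min t y.1 - s) * y.2 = F t - F s) &
    \sum_(y <- b) y.2 * (F y.1 - F s) <= E (last s l) - E s].
Proof.
elim: l s => [|t1 l IH] s s0 /=.
  by move=> _ _; exists [::]; split => //; rewrite big_nil subrr.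
move=> /andP[st1 pl] l1.
have t11 : t1 <= 1 by apply: l1; rewrite mem_head.
have t10 : 0 <= t1 by exact: le_trans (ltW st1).
have [|b [bl bF bE]] := IH t1 t10 pl; first by move=> t tl; apply: l1; rewrite in_cons tl orbT.
have lt t : t \in l -> t1 < t by move=> tl; have /allP/(_ t tl) := order_path_min lt_trans pl.
pose c := (F t1 - F s) / (t1 - s).
have ts0 : t1 - s != 0 by rewrite subr_eq0 gt_eqF.
have cE : c * (t1 - s) = F t1 - F s by rewrite /c divfK.
pose B := \sum_(y <- b) y.2.
(* On [[s, t1]] the interpolation must have slope [c]; the kernels of later times already contribute
   the slope [B] there, and the kernel at [t1] supplies the rest. *)
exists ((t1, c - B) :: b); split.
- by move=> y; rewrite inE => /predU1P[->|/bl yl]; rewrite in_cons ?eqxx ?yl ?orbT.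
- move=> t; rewrite inE big_cons /= => /predU1P[->|tl].
    rewrite minxx (eq_big_seq (fun y => (t1 - s) * y.2)); last first.
      by move=> y /bl /lt /ltW t1y; rewrite min_l.
    rewrite -mulr_sumr -/B -cE; ring.
  rewrite min_r; last exact: ltW (lt _ tl).
  rewrite (eq_bigr (fun y => (Num.min t y.1 - t1) * y.2 + (t1 - s) * y.2)); last first.
    by move=> y _; ring.
  rewrite big_split -mulr_sumr -/B /= bF//.
  have -> : F t - F s = F t - F t1 + c * (t1 - s) by rewrite cE; ring.
  ring.
- rewrite big_cons /=.
  rewrite (eq_bigr (fun y => y.2 * (F y.1 - F t1) + (F t1 - F s) * y.2)); last first.
    by move=> y _; ring.
  rewrite big_split -mulr_sumr -/B /=.
  have h := energy s0 st1 t11.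
  have : c * (F t1 - F s) <= E t1 - E s.
    rewrite /c mulrAC -expr2 ler_pdivrMr ?subr_gt0// mulrC; exact: h.
  move: bE; lra.
Qed.

End energy.

(** * Total variation cost of a deterministic drift *)

Section shift.
Context d (T : measurableType d) (R : realType) (P : probability T R).
Variables (m : nat) (W : R -> T -> 'cV[R]_m) (i : 'I_m).
Hypothesis bW : brownian_motion P W.
Variables (kap : R) (F E : R -> R).
Hypotheses (kap0 : 0 < kap) (F0 : F 0 = 0).
Hypothesis energy : forall s t, 0 <= s -> s < t -> t <= 1 -> (F t - F s) ^+ 2 <= (t - s) * (E t - E s).
Let q := (E 1 - E 0) / kap ^+ 2.

Let mW s j : s \in `[0, 1] -> measurable_fun setT (fun w => W s w j 0).
Proof. by case: bW => -[+ _] _; apply. Qed.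

Lemma bmcov_singletons (b : seq (R * R)) (l : seq (R * 'cV[R]_m)) :
  bmcov l [seq (y.1, y.2 *: delta_mx i 0) | y <- b] =
  \sum_(x <- l) x.2 i 0 * \sum_(y <- b) Num.min x.1 y.1 * y.2.
Proof.
rewrite /bmcov; apply: eq_bigr => x _; rewrite big_map mulr_sumr; apply: eq_bigr => y _ /=.
rewrite dotC dotZl (_ : dot _ _ = x.2 i 0); first ring.
rewrite /dot (bigD1 i)//= mxE !eqxx mul1r big1 ?addr0// => j ji.
by rewrite mxE (negbTE ji) mul0r.
Qed.

Let energy_mono s t : 0 <= s -> s <= t -> t <= 1 -> E s <= E t.
Proof.
move=> s0; rewrite le_eqVlt => /predU1P[->//|st] t1.
have := le_trans (sqr_ge0 _) (energy s0 st t1).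
by rewrite pmulr_rge0 ?subr_gt0// subr_ge0.
Qed.

(** The functional [b] is the Riesz representation of the drift: its covariance with [kap * W]
    equals [F] at the times in [S], and its variance is the energy of the interpolated drift divided
    by [kap ^+ 2]. Interpolation does not increase the energy. *)
Lemma shift_direction (S : seq R) : all (fun s => s \in `[0, 1]) S ->
  exists b : seq (R * 'cV[R]_m), [/\ times01 b,
    (forall l, (forall x, x \in l -> x.1 \in S) -> kap * bmcov l b = \sum_(x <- l) x.2 i 0 * F x.1) &
    bmcov b b <= q].
Proof.
(* Time 0 is left out of the interpolation; there both sides vanish because [F 0 = 0]. *)
move=> /allP S01; pose l := sort <=%R (undup [seq s <- S | 0 < s]).
have lS t : (t \in l) = (t \in S) && (0 < t) by rewrite mem_sort mem_undup mem_filter andbC.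
have pl : path <%R 0 l.
  rewrite path_sortedE; last exact: lt_trans.
  apply/andP; split; first by apply/allP => t; rewrite lS => /andP[].
  by rewrite lt_sorted_uniq_le sort_uniq undup_uniq (sort_sorted le_total).
have l1 t : t \in l -> t <= 1.
  by rewrite lS => /andP[/S01]; rewrite in_itv => /andP[].
have [b [bl bF bE]] := interpolation energy (lexx 0) pl l1.
pose c := [seq (y.1, (y.2 / kap) *: (delta_mx i 0 : 'cV[R]_m)) | y <- b].
have cE l' : (forall x, x \in l' -> x.1 \in S) -> kap * bmcov l' c = \sum_(x <- l') x.2 i 0 * F x.1.
  move=> l'S; rewrite (_ : c = [seq (y.1, y.2 *: delta_mx i 0) | y <- [seq (y.1, y.2 / kap) | y <- b]]); last first.
    by rewrite -map_comp.
  rewrite bmcov_singletons mulr_sumr; apply: eq_big_seq => x xl'.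
  rewrite big_map mulrCA; congr (_ * _).
  have xS := l'S _ xl'; have := S01 _ xS; rewrite in_itv /= => /andP[x0 x1].
  transitivity (\sum_(y <- b) (Num.min x.1 y.1 - 0) * y.2).
    by rewrite mulr_sumr; apply: eq_bigr => y _ /=; rewrite subr0; field; rewrite gt_eqF.
  move: x0; rewrite le_eqVlt => /predU1P[x0|x0].
    rewrite -x0 F0 big_seq big1// => y /bl; rewrite lS => /andP[_ y0].
    by rewrite min_l ?subrr ?mul0r// ltW.
  by rewrite bF ?F0 ?subr0// lS xS x0.
exists c; split.
- apply/allP => _ /mapP[y /bl + ->] /=; rewrite lS => /andP[/S01].
  by [].
- exact: cE.
- have : kap * bmcov c c = \sum_(x <- c) x.2 i 0 * F x.1.
    by apply: cE => _ /mapP[y /bl + ->]; rewrite lS => /andP[].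
  rewrite big_map (eq_bigr (fun y => kap^-1 * (y.2 * (F y.1 - F 0)))); last first.
    by move=> y _ /=; rewrite !mxE !eqxx /= mulr1 F0 subr0; ring.
  rewrite -mulr_sumr => h.
  have {}h : bmcov c c = (kap ^+ 2)^-1 * \sum_(y <- b) y.2 * (F y.1 - F 0).
    by apply: (mulfI (lt0r_neq0 kap0)); rewrite h; field; rewrite gt_eqF.
  rewrite h /q mulrC ler_wpM2r ?invr_ge0 ?sqr_ge0//; apply: le_trans bE _.
  rewrite lerD2r; apply: energy_mono => //.
    have := mem_last 0 l; rewrite inE => /predU1P[->//|].
    by rewrite lS => /andP[_ /ltW].
  have := mem_last 0 l; rewrite inE => /predU1P[->//|]; exact: l1.
Qed.

Variable a : R -> 'cV[R]_m.
Let Y0 s w : 'cV[R]_m := a s + kap *: W s w.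
Let Y1 s w : 'cV[R]_m := a s + F s *: delta_mx i 0 + kap *: W s w.

Let mY0 s j : s \in `[0, 1] -> measurable_fun setT (fun w => Y0 s w j 0).
Proof.
move=> s01; rewrite (_ : (fun w => _) = (fun w => a s j 0 + kap * W s w j 0)).
  by apply: measurable_funD => //; apply: measurable_funM => //; exact: mW.
by apply/funext => w; rewrite !mxE.
Qed.

Let mY1 s j : s \in `[0, 1] -> measurable_fun setT (fun w => Y1 s w j 0).
Proof.
move=> s01; rewrite (_ : (fun w => _) = (fun w => (a s + F s *: delta_mx i 0) j 0 + kap * W s w j 0)).
  by apply: measurable_funD => //; apply: measurable_funM => //; exact: mW.
by apply/funext => w; rewrite !mxE.
Qed.

Let lincombW l w : lincomb l (fun s w => kap *: W s w) w = lincomb [seq (x.1, kap *: x.2) | x <- l] W w.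
Proof.
rewrite /lincomb big_map; apply: eq_bigr => x _ /=.
by rewrite dotZl dotC dotZl dotC.
Qed.

(** The Cameron-Martin density at finitely many times. Tilting by [expR (lincomb b W)] moves the
    mean of every functional of [kap * W] by its covariance with [b], that is, by the functional of
    [F]; the normalisation is [expR (- k)]. *)
Let shift_density (S : seq R) : all (fun s => s \in `[0, 1]) S ->
  exists D : T -> R, [/\ (forall w, 0 <= D w), measurable_fun setT D,
    (\int[P]_w (D w)%:E = 1)%E, (\int[P]_w (D w ^+ 2)%:E <= (expR q)%:E)%E &
    forall A, <<s cylinders_at [set s | s \in S] >> A ->
      P [set w | A (fun s => Y1 s w)] = (\int[P]_(w in [set w | A (fun s => Y0 s w)]) (D w)%:E)%E].
Proof.
move=> S01; have [b [b01 bF bq]] := shift_direction S01.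
pose k := bmcov b b / 2.
pose D w := expR (lincomb b W w) * expR (- k).
have mlin l : times01 l -> measurable_fun setT (lincomb l W) by move=> l01; exact: measurable_lincomb.
have mexp l : times01 l -> measurable_fun setT (fun w => expR (lincomb l W w)).
  by move=> l01; apply: measurableT_comp => //; exact: mlin.
have Eexp l : times01 l -> (\int[P]_w (expR (lincomb l W w))%:E = (expR (bmcov l l / 2))%:E)%E.
  move=> l01; have nil01 : times01 ([::] : seq (R * 'cV[R]_m)) by [].
  exact: tilted_expR (mlin _ nil01) (mlin _ l01) (brownian_tilted bW nil01 l01).
have mD : measurable_fun setT D by apply: measurable_funM => //; exact: mexp.
have D0 w : 0 <= D w by rewrite mulr_ge0 ?expR_ge0.
have D1 : (\int[P]_w (D w)%:E = 1)%E.
  rewrite (_ : 1%E = (expR (- k))%:E * (expR k)%:E)%E; last by rewrite -EFinM -expRD addNr expR0.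
  rewrite -Eexp// -(ge0_integral_EFinZ P (fun w => expR_ge0 _) (mexp _ b01) (expR_ge0 _)).
  by apply: eq_integral => w _; rewrite mulrC.
have iD : P.-integrable setT (EFin \o D).
  apply/integrableP; split; first exact/measurable_EFinP.
  by under eq_integral do rewrite /= ger0_norm//; rewrite D1 ltry.
exists D; split => //.
  (* The square of the density is again an exponential functional, with coefficients doubled. Its
     variance is four times as large, and [4 / 2 - 1 = 1] leaves [expR (bmcov b b)] as the second
     moment. *)
  pose b2 := [seq (x.1, 2 *: x.2) | x <- b].
  have b201 : times01 b2 by rewrite times01_map.
  have b2E : bmcov b2 b2 = 4 * bmcov b b.
    rewrite /bmcov big_map mulr_sumr; apply: eq_bigr => x _; rewrite big_map mulr_sumr.
    by apply: eq_bigr => y _ /=; rewrite dotZl (dotC x.2) dotZl (dotC y.2); ring.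
  have D2E w : D w ^+ 2 = expR (- bmcov b b) * expR (lincomb b2 W w).
    rewrite /D exprMn -!expRM_natl (_ : lincomb b2 W w = lincomb b W w *+ 2); last first.
      rewrite /lincomb big_map -sumrMnl; apply: eq_bigr => x _ /=.
      by rewrite dotZl mulr_natl.
    rewrite mulrC; congr (expR _ * expR _); last by rewrite mulr_natl.
    by rewrite /k; lra.
  under eq_integral do rewrite D2E.
  rewrite (ge0_integral_EFinZ P (fun w => expR_ge0 _) (mexp _ b201) (expR_ge0 _)).
  by rewrite Eexp// -EFinM -expRD lee_fin ler_expR b2E; move: bq; lra.
move=> A mA.
have S01' s : [set s | s \in S] s -> s \in `[0, 1] by move=> /(allP S01).
have mY0' s j : [set s | s \in S] s -> measurable_fun setT (fun w => Y0 s w j 0) by move=> /S01'; exact: mY0.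
have mY1' s j : [set s | s \in S] s -> measurable_fun setT (fun w => Y1 s w j 0) by move=> /S01'; exact: mY1.
have i1 : P.-integrable setT (EFin \o (fun=> 1 : R)) by exact: finite_measure_integrable_cst.
suff H : levy_equal P P [set s | s \in S] Y1 Y0 (fun=> 1) D.
  have := levy_process mY1' mY0' H mA.
  rewrite integral_cst ?mul1e//.
  by rewrite -[X in measurable X]setTI; exact: (measurable_path mY1').
split => // l lS al.
have l01 : times01 l by apply/allP => x xl; apply: S01'; exact: lS.
pose lk := [seq (x.1, kap *: x.2) | x <- l].
have lk01 : times01 lk by rewrite times01_map.
under eq_Rintegral do rewrite mul1r.
have mean : \sum_(x <- l) x.2 i 0 * F x.1 = bmcov lk b.
  rewrite -(bF l) => [|x xl]; last exact: lS.
  rewrite /bmcov big_map mulr_sumr; apply: eq_bigr => x _; rewrite mulr_sumr.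
  by apply: eq_bigr => y _ /=; rewrite dotZl; ring.
have Y0E w : lincomb l Y0 w = lincomb l (fun s _ => a s) w + lincomb lk W w.
  by rewrite -lincombW -lincombD.
have Y1E w : lincomb l Y1 w = lincomb l (fun s _ => a s) w + bmcov lk b + lincomb lk W w.
  rewrite /Y1 (lincombD l (fun s w => a s + F s *: delta_mx i 0)) lincombW; congr (_ + _).
  rewrite (lincombD l (fun s _ => a s)) -mean; congr (_ + _); rewrite /lincomb; apply: eq_bigr => x _.
  rewrite dotC dotZl mulrC; congr (_ * _); rewrite /dot (bigD1 i)//= mxE !eqxx mul1r big1 ?addr0// => j ji.
  by rewrite mxE (negbTE ji) mul0r.
set ma := lincomb l (fun s (_ : T) => a s) in Y0E Y1E.
have cst_ma w w' : ma w = ma w' by [].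
(* [ma] does not vary with the sample point. A sample point exists because the total mass is 1, and
   it turns [ma] into a number that can be part of the phase. *)
have [w0 _] : exists w : T, True.
  have [//|/forallNP hT] := pselect (exists w : T, True).
  have := probability_setT P; rewrite (_ : [set: T] = set0); last by apply/seteqP; split => // w; have := hT w.
  by rewrite measure0 => /eqP; rewrite lt_eqF.
have -> : \int[P]_w cos (al + lincomb l Y1 w) =
    cos (al + ma w0 + bmcov lk b) * expR (- (bmcov lk lk / 2)).
  rewrite -(brownian_cos _ bW)//; apply: eq_Rintegral => w _.
  by rewrite Y1E (cst_ma w w0) !addrA.
have tl := brownian_tilted bW lk01 b01 (al + ma w0).
have mc : measurable_fun setT (fun w => cos (al + ma w0 + lincomb lk W w)).
  by apply: measurable_cos_comp; apply: measurable_funD => //; exact: mlin.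
have iDc : P.-integrable setT (EFin \o (fun w => D w * cos (al + ma w0 + lincomb lk W w))).
  by apply: (integrable_weight (C := 1)) => // w; exact: cos_max.
have -> : \int[P]_w (D w * cos (al + lincomb l Y0 w)) = \int[P]_w (D w * cos (al + ma w0 + lincomb lk W w)).
  by apply: eq_Rintegral => w _; rewrite Y0E (cst_ma w w0) !addrA.
have : (\int[P]_w ((D w * (1 + cos (al + ma w0 + lincomb lk W w)))%:E) =
    (1 + cos (al + ma w0 + bmcov lk b) * expR (- (bmcov lk lk / 2)))%:E)%E.
  transitivity ((expR (- k))%:E * \int[P]_w ((1 + cos (al + ma w0 + lincomb lk W w)) * expR (lincomb b W w))%:E)%E.
    have f0 w : 0 <= (1 + cos (al + ma w0 + lincomb lk W w)) * expR (lincomb b W w).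
      by rewrite mulr_ge0 ?cosD1_ge0 ?expR_ge0.
    have mf : measurable_fun setT (fun w => (1 + cos (al + ma w0 + lincomb lk W w)) * expR (lincomb b W w)).
      by apply: measurable_funM; [exact: measurable_funD|exact: mexp].
    rewrite -(ge0_integral_EFinZ P f0 mf (expR_ge0 _)).
    by apply: eq_integral => w _; congr EFin; rewrite /D; ring.
  by rewrite tl -EFinM mulrA -expRD addNr expR0 mul1r.
have -> : (\int[P]_w (D w * (1 + cos (al + ma w0 + lincomb lk W w)))%:E =
    (1 + \int[P]_w (D w * cos (al + ma w0 + lincomb lk W w)))%:E)%E.
  have RD : \int[P]_w D w = 1 by rewrite /Rintegral D1.
  rewrite -{2}RD -RintegralD//.
  rewrite /Rintegral fineK; last by apply: integrable_fin_num => //; exact: integrable_add.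
  by apply: eq_integral => w _; congr EFin; ring.
by move=> -[] /addrI.
Qed.

(** The chi-square distance controls total variation: the density has mean 1 and second moment at
    most [expR q], so [(D - 1) ^+ 2] has mean at most [2 * q] for [q <= 1 / 2]. The bound is proved
    for events at finitely many times and extended to tests. *)
Lemma brownian_shift (phi : path_space R m -> R) (e : R) : 0 < e -> measurable_fun setT phi ->
  (forall y, 0 <= phi y <= 1) ->
  (\int[P]_w (phi (fun s => Y1 s w))%:E <= \int[P]_w (phi (fun s => Y0 s w))%:E + (e + q / e)%:E)%E.
Proof.
move=> e0 mphi phi01.
have q0 : 0 <= q by rewrite divr_ge0 ?sqr_ge0// subr_ge0 energy_mono.
have eq0 : 0 <= e + q / e by exact: addr_ge0 (ltW e0) (divr_ge0 q0 (ltW e0)).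
apply: finite_times_test => // S S01 A SA.
have mA : measurable (A : set (path_space R m)).
  by apply: cylinders_at_sub SA => s /(allP S01).
have mA0 : measurable ((fun w s => Y0 s w) @^-1` A).
  by rewrite -[X in measurable X]setTI; exact: (measurable_path mY0).
have mA1 : measurable ((fun w s => Y1 s w) @^-1` A).
  by rewrite -[X in measurable X]setTI; exact: (measurable_path mY1).
(* For [q > 1 / 2] the bound exceeds 1 whatever [e] is, since [e ^+ 2 + 1 / 2 >= e]. *)
have [q2|q2] := leP q (1 / 2); last first.
  apply: (@le_trans _ _ 1%E); first exact: probability_le1.
  apply: (@le_trans _ _ (e + q / e)%:E); last by rewrite leeDr// measure_ge0.
  rewrite lee_fin -(ler_pM2r e0) mul1r mulrDl divfK ?gt_eqF//.
  have := sqr_ge0 (e - 1 / 2); nra.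
have [D [D0 mD D1 D2 DA]] := shift_density S01.
rewrite [X in (X <= _)%E](DA _ SA).
have qe : expR q <= 1 + 2 * q.
  have h := expR_ge1Dx (- q); rewrite expRN in h.
  have eq1 := expR_gt0 q.
  have : (1 - q) * expR q <= 1 by rewrite -ler_pdivlMr// mul1r.
  nra.
(* Coefficients of Young's inequality [D - 1 <= u + v * (D - 1) ^+ 2]; with the mean [2 * q] the
   total is [e / 2 + q / e]. *)
pose u := e / 2; pose v := (2 * e)^-1.
have v0 : 0 < v by rewrite invr_gt0 mulr_gt0.
have key w : D w <= 1 + u + v * (D w - 1) ^+ 2.
  have : 0 <= v * (D w - 1 - e) ^+ 2 by rewrite mulr_ge0 ?sqr_ge0// ltW.
  have -> : v * (D w - 1 - e) ^+ 2 = v * (D w - 1) ^+ 2 - (D w - 1) + u.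
    by rewrite /u /v; field; rewrite gt_eqF.
  lra.
have mD2 : measurable_fun setT (fun w => (D w - 1) ^+ 2) by apply: measurable_funX; exact: measurable_funB.
have D21 : (\int[P]_w ((D w - 1) ^+ 2)%:E <= (2 * q)%:E)%E.
  have : (\int[P]_w ((D w - 1) ^+ 2)%:E + (2%:E * \int[P]_w (D w)%:E) = \int[P]_w (D w ^+ 2)%:E + 1)%E.
    rewrite -ge0_integral_EFinZ// -(probability_setT P) -[P setT]mul1e -integral_cst//.
    rewrite -!ge0_integral_EFinD//.
    - by apply: eq_integral => w _; congr EFin; ring.
    - by move=> w; exact: sqr_ge0.
    - exact: measurable_funX.
    - by move=> w; exact: sqr_ge0.
    - by move=> w; rewrite mulr_ge0.
    - exact: measurable_funM.
  rewrite D1 mule1 => h.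
  have : (\int[P]_w ((D w - 1) ^+ 2)%:E + 2%:E <= (1 + 2 * q)%:E + 1)%E.
    by rewrite h leeD2r//; apply: le_trans D2 _; rewrite lee_fin.
  rewrite (_ : (1 + 2 * q)%:E + 1 = (2 * q)%:E + 2%:E)%E; last by rewrite -!EFinD; congr EFin; ring.
  by rewrite leeD2rE.
apply: (@le_trans _ _ (\int[P]_(w in (fun w s => Y0 s w) @^-1` A) (1 + (u + v * (D w - 1) ^+ 2))%:E)%E).
  apply: ge0_le_integral => //.
  - by move=> w _; rewrite lee_fin.
  - by apply/measurable_EFinP; exact: measurable_funTS.
  - apply/measurable_EFinP; apply: measurable_funTS; apply: measurable_funD => //; apply: measurable_funD => //.
    exact: measurable_funM.
  - by move=> w _; rewrite lee_fin addrA.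
have u0 : 0 <= u by rewrite divr_ge0// ltW.
have vD0 w : 0 <= v * (D w - 1) ^+ 2 by rewrite mulr_ge0 ?sqr_ge0// ltW.
have g0 w : 0 <= u + v * (D w - 1) ^+ 2 by exact: addr_ge0 u0 (vD0 w).
have mg : measurable_fun setT (fun w => u + v * (D w - 1) ^+ 2).
  by apply: measurable_funD => //; exact: measurable_funM.
under eq_integral do rewrite EFinD.
rewrite ge0_integralD//; last 2 first.
- by move=> w _; rewrite lee_fin.
- by apply/measurable_EFinP; exact: measurable_funTS.
rewrite integral_cst// mul1e leeD2l//.
apply: (@le_trans _ _ (\int[P]_w (u + v * (D w - 1) ^+ 2)%:E)%E).
  apply: ge0_subset_integral => //; first exact/measurable_EFinP.
  by move=> w _; rewrite lee_fin.
have Eu : (\int[P]_w (u%:E) = u%:E)%E.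
  by have := integral_cst P measurableT u%:E; rewrite [X in (_ * X)%E]probability_setT mule1.
rewrite ge0_integral_EFinD//; last exact: measurable_funM.
rewrite Eu (ge0_integral_EFinZ P (fun w => sqr_ge0 (D w - 1)) mD2 (ltW v0)).
apply: (@le_trans _ _ (u%:E + v%:E * (2 * q)%:E)%E).
  by rewrite leeD2l// lee_wpmul2l// lee_fin ltW.
rewrite -EFinM -EFinD lee_fin /u /v; have : (2 * e)^-1 * (2 * q) = q / e by field; rewrite gt_eqF.
by move=> ->; lra.
Qed.

End shift.

(** * Independent Gaussian components *)

Section products.
Context d1 d2 (T1 : measurableType d1) (T2 : measurableType d2) (R : realType)
  (P1 : probability T1 R) (P2 : probability T2 R).
Local Notation P := (P1 \x P2)%E.

Lemma ge0_integral_fst (f : T1 -> \bar R) : measurable_fun setT f -> (forall x, 0 <= f x)%E ->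
  (\int[P]_z f z.1 = \int[P1]_x f x)%E.
Proof.
move=> mf f0.
have mg : measurable_fun setT (fun z : T1 * T2 => f z.1) by apply: measurableT_comp => //; exact: measurable_fst.
rewrite (fubini_tonelli1 (fun z : T1 * T2 => f z.1) mg)//; apply: eq_integral => x _.
by rewrite /fubini_F /= integral_cst// [X in (_ * X)%E]probability_setT mule1.
Qed.

Lemma ge0_integral_snd (f : T2 -> \bar R) : measurable_fun setT f -> (forall x, 0 <= f x)%E ->
  (\int[P]_z f z.2 = \int[P2]_x f x)%E.
Proof.
move=> mf f0.
have mg : measurable_fun setT (fun z : T1 * T2 => f z.2) by apply: measurableT_comp => //; exact: measurable_snd.
rewrite (fubini_tonelli2 (fun z : T1 * T2 => f z.2) mg)//; apply: eq_integral => x _.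
by rewrite /fubini_G /= integral_cst// [X in (_ * X)%E]probability_setT mule1.
Qed.

Lemma Rintegral_cos_fst (f : T1 -> R) : measurable_fun setT f ->
  \int[P]_z cos (f z.1) = \int[P1]_x cos (f x).
Proof.
move=> mf; have mg : measurable_fun setT (fun z : T1 * T2 => f z.1).
  by apply: measurableT_comp => //; exact: measurable_fst.
have := @ge0_integral_fst (fun x => (1 + cos (f x))%:E).
rewrite (Rintegral_cosD1 P mg) (Rintegral_cosD1 P1 mf) => h.
suff [] : (1 + \int[P]_z cos (f z.1))%:E = (1 + \int[P1]_x cos (f x))%:E by move/addrI.
apply: h; last by move=> x; rewrite lee_fin cosD1_ge0.
by apply/measurable_EFinP; apply: measurable_funD => //; exact: measurable_cos_comp.
Qed.

Lemma Rintegral_cos_snd (f : T2 -> R) : measurable_fun setT f ->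
  \int[P]_z cos (f z.2) = \int[P2]_x cos (f x).
Proof.
move=> mf; have mg : measurable_fun setT (fun z : T1 * T2 => f z.2).
  by apply: measurableT_comp => //; exact: measurable_snd.
have := @ge0_integral_snd (fun x => (1 + cos (f x))%:E).
rewrite (Rintegral_cosD1 P mg) (Rintegral_cosD1 P2 mf) => h.
suff [] : (1 + \int[P]_z cos (f z.2))%:E = (1 + \int[P2]_x cos (f x))%:E by move/addrI.
apply: h; last by move=> x; rewrite lee_fin cosD1_ge0.
by apply/measurable_EFinP; apply: measurable_funD => //; exact: measurable_cos_comp.
Qed.

Lemma product_indep (A : set T1) (B : set T2) : measurable A -> measurable B ->
  P (fst @^-1` A `&` snd @^-1` B) = (P (fst @^-1` A) * P (snd @^-1` B))%E.
Proof.
move=> mA mB.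
rewrite (_ : _ `&` _ = A `*` B)// product_measure1E//.
rewrite (_ : fst @^-1` A = A `*` setT); last by apply/seteqP; split => z //= [].
rewrite (_ : snd @^-1` B = setT `*` B); last by apply/seteqP; split => z //= [].
have e1 : P1 setT = 1%E := probability_setT P1.
have e2 : P2 setT = 1%E := probability_setT P2.
have E1 : P (A `*` setT) = P1 A by apply: etrans (product_measure1E _ _ mA measurableT) _; rewrite -[RHS]mule1; congr (_ * _)%E.
have E2 : P (setT `*` B) = P2 B by apply: etrans (product_measure1E _ _ measurableT mB) _; rewrite -[RHS]mul1e; congr (_ * _)%E.
by rewrite E1 E2.
Qed.

End products.

Section gaussian_processes.
Context (R : realType).
Local Notation leb := (@lebesgue_measure R).
Local Notation I01 := ([set` `[0%R, 1%R]] : set R).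

Definition process_measurable d (T : measurableType d) m (X : R -> T -> 'cV[R]_m) : Prop :=
  forall s i, s \in `[0, 1] -> measurable_fun setT (fun w => X s w i 0).

Lemma tail_map m n (D : 'M[R]_(n, m)) (l : seq (R * 'cV[R]_m)) s :
  tail [seq (x.1, D *m x.2) | x <- l] s = D *m tail l s.
Proof. by rewrite /tail big_map mulmx_sumr. Qed.

Lemma eq_gcov m (S1 S2 : R -> 'M[R]_m) l : (forall s, s \in `[0, 1] -> S1 s = S2 s) ->
  gcov S1 l = gcov S2 l.
Proof. by move=> S12; apply: eq_Rintegral => s; rewrite inE => /S12 ->. Qed.

Lemma gaussian_ext d (T : measurableType d) (P : probability T R) m (X : R -> T -> 'cV[R]_m) S1 S2 :
  (forall s, s \in `[0, 1] -> S1 s = S2 s) -> gaussian P X S1 -> gaussian P X S2.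
Proof. by move=> S12 gX l l01 a; rewrite -(eq_gcov l S12); exact: gX. Qed.

Lemma gaussian_linear d (T : measurableType d) (P : probability T R) m n (D : 'M[R]_(n, m))
    (X : R -> T -> 'cV[R]_m) Sigma :
  gaussian P X Sigma -> gaussian P (fun s w => D *m X s w) (fun s => D *m Sigma s *m D^T).
Proof.
move=> gX l l01 a; have l01' : times01 [seq (x.1, D^T *m x.2) | x <- l] by rewrite times01_map.
under eq_Rintegral do rewrite lincomb_map.
suff E : gcov Sigma [seq (x.1, D^T *m x.2) | x <- l] = gcov (fun s => D *m Sigma s *m D^T) l.
  by rewrite -E; exact: gX.
apply: eq_Rintegral => s _; rewrite tail_map -!mulmxA.
by rewrite (dot_mul D).
Qed.

Lemma integrable_tail_form m (Sigma : R -> 'M[R]_m) (l : seq (R * 'cV[R]_m)) i j :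
  leb.-integrable I01 (EFin \o (fun s => Sigma s i j)) ->
  leb.-integrable I01 (EFin \o (fun s => tail l s i 0 * (Sigma s i j * tail l s j 0))).
Proof.
move=> iS; have [M M0 tM] := tail_bound l.
have tail_le k s : `|tail l s k 0| <= Num.sqrt M.
  rewrite -sqrtr_sqr ler_wsqrtr//; apply: le_trans (tM s).
  by rewrite /dot (bigD1 k)//= -expr2 lerDl sumr_ge0// => p _; rewrite -expr2 sqr_ge0.
have mS : measurable_fun I01 (fun s => Sigma s i j).
  by case/integrableP : iS => /measurable_EFinP.
have := integrable_I01_scale M iS; apply: le_integrable; first exact: measurable_itv.
  apply/measurable_EFinP; apply: measurable_funM; first exact: measurable_tail.
  by apply: measurable_funM => //; exact: measurable_tail.
move=> s _ /=; rewrite lee_fin !normrM.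
rewrite [leLHS](_ : _ = `|tail l s i 0| * `|tail l s j 0| * `|Sigma s i j|); last by ring.
rewrite ler_wpM2r// (ger0_norm M0) -[leRHS]sqr_sqrtr// expr2.
exact: ler_pM.
Qed.

Lemma gcov_sum m (Sigma : R -> 'M[R]_m) (l : seq (R * 'cV[R]_m)) :
  (forall i j, leb.-integrable I01 (EFin \o (fun s => Sigma s i j))) ->
  gcov Sigma l = \sum_i \sum_j \int[leb]_(s in I01) (tail l s i 0 * (Sigma s i j * tail l s j 0)).
Proof.
move=> iS.
have h i := Rintegral_I01_bigsum (index_enum 'I_m) (fun j => integrable_tail_form l (iS i j)).
rewrite /gcov; transitivity (\int[leb]_(s in I01) (\sum_i \sum_j tail l s i 0 * (Sigma s i j * tail l s j 0))); last first.
  rewrite (Rintegral_I01_bigsum (index_enum 'I_m) (fun i => (h i).1)).2.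
  by apply: eq_bigr => i _; rewrite (h i).2.
apply: eq_Rintegral => s _; rewrite /dot; apply: eq_bigr => i _.
by rewrite mxE mulr_sumr.
Qed.

Lemma gcovD m (S1 S2 : R -> 'M[R]_m) (l : seq (R * 'cV[R]_m)) :
  (forall i j, leb.-integrable I01 (EFin \o (fun s => S1 s i j))) ->
  (forall i j, leb.-integrable I01 (EFin \o (fun s => S2 s i j))) ->
  gcov (fun s => S1 s + S2 s) l = gcov S1 l + gcov S2 l.
Proof.
move=> i1 i2.
have i12 i j : leb.-integrable I01 (EFin \o (fun s => (S1 s + S2 s) i j)).
  have := integrable_I01_add (i1 i j) (i2 i j).
  by congr (integrable _ _); apply/funext => s /=; rewrite mxE.
rewrite !gcov_sum// -big_split; apply: eq_bigr => i _; rewrite -big_split; apply: eq_bigr => j _ /=.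
rewrite -RintegralD//.
- by apply: eq_Rintegral => s _; rewrite mxE; ring.
- exact: integrable_tail_form.
- exact: integrable_tail_form.
Qed.

Lemma gaussian_add d (T : measurableType d) (P : probability T R) m
    (X V : R -> T -> 'cV[R]_m) (S1 S2 : R -> 'M[R]_m) :
  process_measurable X -> process_measurable V ->
  (forall l A B, times01 l -> measurable A -> measurable B ->
    P (lincomb l X @^-1` A `&` lincomb l V @^-1` B) =
    (P (lincomb l X @^-1` A) * P (lincomb l V @^-1` B))%E) ->
  (forall i j, leb.-integrable I01 (EFin \o (fun s => S1 s i j))) ->
  (forall i j, leb.-integrable I01 (EFin \o (fun s => S2 s i j))) ->
  gaussian P X S1 -> gaussian P V S2 ->
  gaussian P (fun s w => X s w + V s w) (fun s => S1 s + S2 s).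
Proof.
move=> mX mV ind i1 i2 gX gV l l01 a.
under eq_Rintegral do rewrite lincombD.
rewrite (@cos_indep _ _ _ P _ _ (expR (- (gcov S2 l / 2)))).
- rewrite (gX _ l01) (gcovD l i1 i2) mulrDl opprD expRD.
  by move: (expR _) (expR _) => u v; rewrite mulrCA (mulrC v).
- exact: measurable_lincomb.
- exact: measurable_lincomb.
- by move=> A B mA mB; exact: ind.
- by move=> b; exact: gV.
Qed.

Lemma gaussian_fst d1 d2 (T1 : measurableType d1) (T2 : measurableType d2)
    (P1 : probability T1 R) (P2 : probability T2 R) m (X : R -> T1 -> 'cV[R]_m) S :
  process_measurable X -> gaussian P1 X S ->
  gaussian (P1 \x P2)%E (fun s z => X s z.1) S.
Proof.
move=> mX gX l l01 a; rewrite -gX//.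
by rewrite -(Rintegral_cos_fst P1 P2)//; apply: measurable_funD => //; exact: measurable_lincomb.
Qed.

Lemma gaussian_snd d1 d2 (T1 : measurableType d1) (T2 : measurableType d2)
    (P1 : probability T1 R) (P2 : probability T2 R) m (X : R -> T2 -> 'cV[R]_m) S :
  process_measurable X -> gaussian P2 X S ->
  gaussian (P1 \x P2)%E (fun s z => X s z.2) S.
Proof.
move=> mX gX l l01 a; rewrite -gX//.
by rewrite -(Rintegral_cos_snd P1 P2)//; apply: measurable_funD => //; exact: measurable_lincomb.
Qed.

(** Signal and noise live on different factors of the product space, so their independence holds by
    construction. *)
Lemma observed_product d1 d2 (T1 : measurableType d1) (T2 : measurableType d2)
    (P1 : probability T1 R) (P2 : probability T2 R) m (x0 : 'cV[R]_m) (kap : R)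
    (Sigma : R -> 'M[R]_m) (X : R -> T1 -> 'cV[R]_m) (W : R -> T2 -> 'cV[R]_m) :
  continuous_process X -> gaussian P1 (fun s w => X s w - x0) Sigma -> brownian_motion P2 W ->
  observed (P1 \x P2)%E x0 kap Sigma (fun s z => X s z.1) (fun s z => W s z.2)
    (fun s z => time_integral X s z.1 + kap *: W s z.2).
Proof.
move=> [mX cX] gX bW.
have mW : process_measurable W by case: bW => -[+ _] _.
have mX0 : process_measurable (fun s w => X s w - x0).
  move=> s i s01; rewrite (_ : (fun w => _) = (fun w => X s w i 0 - x0 i 0)); last by apply/funext => w; rewrite !mxE.
  by apply: measurable_funB => //; exact: mX.
split.
- split; last by move=> z i; exact: cX.
  by move=> s i s01; apply: (measurableT_comp (mX s i s01)); exact: measurable_fst.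
- exact: (gaussian_fst P2 mX0 gX).
- by move=> s i s01; apply: (measurableT_comp (mW s i s01)); exact: measurable_snd.
- move=> l a l01; rewrite -(brownian_cos a bW l01).
  by rewrite -(Rintegral_cos_snd P1 P2)//; apply: measurable_funD => //; exact: measurable_lincomb.
- move=> l l' A B l01 l'01 mA mB.
  have mlX : measurable (lincomb l X @^-1` A).
    by rewrite -[Y in measurable Y]setTI; exact: (measurable_lincomb l01 mX).
  have mlW : measurable (lincomb l' W @^-1` B).
    by rewrite -[Y in measurable Y]setTI; exact: (measurable_lincomb l'01 mW).
  exact: (product_indep P1 P2 mlX mlW).
- by move=> s z s01; congr (_ + _); apply/colP => i; rewrite !mxE.
Qed.

End gaussian_processes.

(** * Bounds for lower limits *)

Section limits_inferior.
Context (R : realType).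
Local Open Scope ereal_scope.

Lemma limn_einf_le_bound (u : (\bar R)^nat) (V : \bar R) : (forall n, u n <= V) -> limn_einf u <= V.
Proof.
move=> uV; apply: le_trans (limn_einf_sup u) _; rewrite limn_esup_lim.
apply: lime_le; first exact: is_cvg_esups.
by apply: nearW => n; apply: ge_ereal_sup => _ [k _ <-].
Qed.

Lemma limn_einf_ge_near (u : (\bar R)^nat) (V : \bar R) :
  (\forall n \near \oo, V <= u n) -> V <= limn_einf u.
Proof.
move=> [N _ NV]; rewrite limn_einf_lim.
apply: lime_ge; first exact: is_cvg_einfs.
exists N => // n /= Nn; apply: le_ereal_inf_tmp => _ [k /= nk <-].
by apply: NV => /=; exact: leq_trans nk.
Qed.

End limits_inferior.

(** * Second moments and small balls of Gaussian variables *)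

Section gaussian_variables.
Context (R : realType).
Local Notation leb := (@lebesgue_measure R).

Lemma cvg_sin_scaled (x : R) : (fun n => n.+1%:R * sin (x / n.+1%:R)) @ \oo --> x.
Proof.
have [->|x0] := eqVneq x 0.
  rewrite (_ : (fun n => _) = cst 0); first exact: cvg_cst.
  by apply/funext => n; rewrite mul0r sin0 mulr0.
have d0 : is_derive (0:R) 1 sin (cos 0) by exact: is_derive_sin.
have [/cvg_ex[/= l hl]] := d0; rewrite /derive (cvg_lim _ hl)// cos0 => l1.
rewrite {}l1 in hl.
pose h (n : nat) : R := x / n.+1%:R.
have h0 : h @ \oo --> 0^'.
  have c0 : h @ \oo --> 0.
    by rewrite -(mulr0 x); apply: cvgMr; exact: cvg_harmonic.
  move=> A hA; have {}hA : nbhs (0 : R) (fun y => y != 0 -> A y) := hA.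
  have : \forall n \near \oo, h n != 0 -> A (h n) := c0 _ hA.
  apply: filterS => n; apply.
  by rewrite /h mulf_neq0// invr_neq0// pnatr_eq0.
rewrite (_ : (fun n => _) = (fun n => x * ((h n)^-1 *: (sin (h n *: (1 : R) + 0) - sin 0)))).
  rewrite -[X in _ --> X]mulr1; apply: cvgM; first exact: cvg_cst.
  exact: (cvg_comp h _ h0 hl).
apply/funext => n.
rewrite /h /GRing.scale /= mulr1 addr0 sin0 subr0 invfM invrK.
by rewrite mulrA mulrA mulfV// mul1r.
Qed.

Lemma cos_double (y : R) : 1 - cos (y + y) = 2 * sin y ^+ 2.
Proof. by rewrite cosD -!expr2 cos2sin2; ring. Qed.

Lemma cvg_cos_scaled (x : R) :
  (fun n => 2 * n.+1%:R ^+ 2 * (1 - cos (n.+1%:R^-1 * x))) @ \oo --> x ^+ 2.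
Proof.
have h := @cvg_sin_scaled (x / 2).
have h2 := cvgM (cvg_cst (4 : R)) (cvgM h h).
rewrite (_ : x ^+ 2 = 4 * (x / 2 * (x / 2))); last by field.
rewrite (_ : (fun n => _) = (fun n => 4 * (n.+1%:R * sin (x / 2 / n.+1%:R) * (n.+1%:R * sin (x / 2 / n.+1%:R))))).
  exact: h2.
apply/funext => n.
have -> : n.+1%:R^-1 * x = x / 2 / n.+1%:R + x / 2 / n.+1%:R.
  by rewrite -mulrDl -splitr mulrC.
by rewrite cos_double; ring.
Qed.

Context d (T : measurableType d) (P : probability T R).
Variables (X : T -> R) (V : R).
Hypothesis mX : measurable_fun setT X.
Hypothesis cosX : forall a c, \int[P]_w cos (a + c * X w) = cos a * expR (- (c ^+ 2 * V / 2)).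

(** With [K = n + 1], the nonnegative functions [2 * K ^+ 2 * (1 - cos (x / K))] converge to
    [x ^+ 2] and have known integrals, bounded through [1 - expR (- z) <= z]. Fatou's lemma gives
    the upper bound without prior integrability. *)
Lemma gaussian_second_moment : (\int[P]_w (X w ^+ 2)%:E <= V%:E)%E.
Proof.
pose f n w : R := 2 * n.+1%:R ^+ 2 * (1 - cos (n.+1%:R^-1 * X w)).
have mc n : measurable_fun setT (fun w => cos (n.+1%:R^-1 * X w)).
  by apply: measurable_cos_comp; exact: measurable_funM.
have mf n : measurable_fun setT (f n).
  by apply: measurable_funM => //; exact: measurable_funB.
have c1 y : 0 <= 1 - cos y :> R by rewrite subr_ge0 cos_le1.
have f0 n w : 0 <= f n w by rewrite mulr_ge0// mulr_ge0// exprn_ge0.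
have lim w : limn_einf (fun n => (f n w)%:E) = (X w ^+ 2)%:E.
  rewrite is_cvg_limn_einfE; last first.
    by apply/cvg_ex; exists (X w ^+ 2)%:E; apply: cvg_EFin; [exact: nearW|exact: cvg_cos_scaled].
  by apply/cvg_lim => //; apply: cvg_EFin; [exact: nearW|exact: cvg_cos_scaled].
under eq_integral do rewrite -lim.
apply: le_trans (fatou _ _ _ _) _ => //.
- by move=> n; exact/measurable_EFinP.
- by move=> n w _; rewrite lee_fin.
apply: limn_einf_le_bound => n.
have k0 : 0 <= 2 * n.+1%:R ^+ 2 :> R by rewrite mulr_ge0// exprn_ge0.
have m1c : measurable_fun setT (fun w => 1 - cos (n.+1%:R^-1 * X w)) by exact: measurable_funB.
rewrite (ge0_integral_EFinZ P (fun w => c1 (n.+1%:R^-1 * X w)) m1c k0).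
have ic : P.-integrable setT (EFin \o (fun w => cos (n.+1%:R^-1 * X w))).
  by apply: (bounded_integrable (C := 1)) => //; [exact: fin_num_fun_lty|move=> t; exact: cos_max].
have i1 : P.-integrable setT (EFin \o cst (1 : R)) by exact: finite_measure_integrable_cst.
have -> : (\int[P]_w (1 - cos (n.+1%:R^-1 * X w))%:E = (1 - \int[P]_w cos (n.+1%:R^-1 * X w))%:E)%E.
  rewrite -[X in _ = (X - _)%:E](Rintegral_probability_cst P) -RintegralB//.
  by rewrite /Rintegral fineK//; apply: integrable_fin_num => //; exact: integrable_sub.
have -> : \int[P]_w cos (n.+1%:R^-1 * X w) = expR (- ((n.+1%:R^-1) ^+ 2 * V / 2)).
  have := cosX 0 n.+1%:R^-1; rewrite cos0 mul1r => <-.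
  by apply: eq_Rintegral => w _; rewrite add0r.
rewrite -EFinM lee_fin.
have := expR_ge1Dx (- ((n.+1%:R^-1) ^+ 2 * V / 2)); set z := n.+1%:R^-1 ^+ 2 * V / 2 => hz.
apply: (@le_trans _ _ (2 * n.+1%:R ^+ 2 * z)); first by apply: ler_wpM2l => //; lra.
rewrite /z le_eqVlt; apply/orP; left; apply/eqP; field.
by rewrite nat1r pnatr_eq0.
Qed.

(** After normalisation the law is standard normal by uniqueness of transforms, and its density is
    at most 1 because [2 * pi >= 1]. *)
Lemma gaussian_small_ball (e : R) : 0 < V -> 0 <= e ->
  (P [set w | (`|X w| < e * Num.sqrt V)%R] <= (2 * e)%:E)%E.
Proof.
move=> V0 e0; have sV0 : 0 < Num.sqrt V by rewrite sqrtr_gt0.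
pose N : probability (measurableTypeR R) R := normal_prob 0 1.
pose Z w := (Num.sqrt V)^-1 * X w.
have mZ : measurable_fun setT Z by exact: measurable_funM.
have tZ a c : (\int[P]_w (1 * (1 + cos (a + c * Z w)))%:E =
    \int[N]_y (1 * (1 + cos (a + c * y)))%:E)%E.
  have -> : (\int[P]_w (1 * (1 + cos (a + c * Z w)))%:E = (1 + cos a * expR (- (c ^+ 2 / 2)))%:E)%E.
    under eq_integral do rewrite mul1r.
    rewrite Rintegral_cosD1; last by apply: measurable_funD => //; exact: measurable_funM.
    have -> : \int[P]_w cos (a + c * Z w) = \int[P]_w cos (a + (c / Num.sqrt V) * X w).
      by apply: eq_Rintegral => w _; rewrite /Z mulrA.
    rewrite cosX exprMn exprVn sqr_sqrtr ?(ltW V0)//; do 4 f_equal.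
    by field; rewrite gt_eqF.
  have := @normal_tilt R 1 (oner_neq0 _) a c 0.
  rewrite expr0n /= mulr0 !mul0r addr0 expR0 mul1r expr1n !mulr1 => <-.
  by apply: eq_integral => y _; rewrite mul0r expR0 mulr1 mul1r.
have mI : measurable [set` `]- e, e[] by exact: measurable_itv.
have i1 : P.-integrable setT (EFin \o (fun=> 1 : R)) by exact: finite_measure_integrable_cst.
have i2 : N.-integrable setT (EFin \o (fun=> 1 : R)) by exact: finite_measure_integrable_cst.
have := @levy_real _ _ T (measurableTypeR R) R P N (fun=> 1) Z (fun=> 1) id
  (fun=> ler01) (fun=> ler01) (measurable_cst _) (measurable_cst _) i1 i2 mZ (@measurable_id _ (measurableTypeR R) setT) tZ _ mI.
rewrite !integral_cst//; last first.
  by rewrite -[Y in measurable Y]setTI; exact: mZ.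
rewrite !mul1e => h.
rewrite (_ : [set w | _] = Z @^-1` [set` `]- e, e[]); last first.
  have zE w : (`|Z w| < e) = (`|X w| < e * Num.sqrt V).
    by rewrite /Z normrM gtr0_norm ?invr_gt0// mulrC ltr_pdivrMr.
  by apply/seteqP; split => w /=; rewrite in_itv /= -ltr_norml zE.
rewrite h preimage_id.
change ((\int[leb]_(y in [set` `](- e)%R, e[]) (normal_pdf 0 1 y)%:E <= (2 * e)%:E)%E).
apply: (@le_trans _ _ (\int[leb]_(y in [set` `](- e)%R, e[]) (cst 1 y))%E).
  apply: ge0_le_integral => //.
  - by move=> y _; rewrite lee_fin normal_pdf_ge0.
  - apply/measurable_EFinP; apply: measurable_funTS; exact: measurable_normal_pdf.
  move=> y _; rewrite lee_fin; apply: le_trans (normal_pdf_ub _ _ (oner_neq0 _)) _.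
  rewrite /normal_peak expr1n mul1r invf_le1; last by rewrite sqrtr_gt0 mulrn_wgt0// pi_gt0.
  rewrite -[leLHS]sqrtr1 ler_wsqrtr//.
  by have := pi_ge2 R; rewrite mulr2n; lra.
have le2 : (leb [set` `](- e)%R, e[] <= (2 * e)%:E)%E.
  rewrite lebesgue_measure_itv /= lte_fin.
  case: ifP => _; last by rewrite lee_fin mulr_ge0.
  by rewrite -EFinB lee_fin; lra.
by rewrite integral_cst// mul1e; exact: le2.
Qed.

End gaussian_variables.

(** * Translation of averages over [[-1, 1]] *)

Section translation.
Context (R : realType).
Local Notation leb := (@lebesgue_measure R).

Lemma lebesgue_translation (s : R) (A : set R) : measurable A ->
  leb ((fun x => x + s) @^-1` A) = leb A.
Proof.
move=> mA.
have mT : @measurable_fun _ _ (measurableTypeR R) (measurableTypeR R) setT (fun x : R => x + s).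
  by have : measurable_fun setT (fun x : R => x + s) by exact: measurable_funD.
pose mu := pushforward leb (mfun_of mT).
suff : leb A = mu A by move=> ->.
apply: lebesgue_measure_unique => // X /ocitvP[->|[[a b] /= ab ->]]; first by rewrite !measure0.
rewrite /mu /pushforward.
rewrite (_ : _ @^-1` _ = `]a - s, b - s]%classic).
  rewrite !lebesgue_measure_itv /= !lte_fin ltrD2r; case: ifP => // _.
  by rewrite -!EFinB; congr EFin; ring.
by apply/seteqP; split => x /=; rewrite !in_itv /= ltrBlDr lerBrDr.
Qed.

Lemma ge0_integral_translate (s : R) (f : R -> \bar R) : measurable_fun setT f -> (forall x, 0 <= f x)%E ->
  (\int[leb]_x f (x + s)%R = \int[leb]_x f x)%E.
Proof.
move=> mf f0.
have mT : @measurable_fun _ _ (measurableTypeR R) (measurableTypeR R) setT (fun x : R => x + s).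
  by have : measurable_fun setT (fun x : R => x + s) by exact: measurable_funD.
have := @ge0_integral_pushforward _ _ (measurableTypeR R) (measurableTypeR R) R
  (fun x => x + s) mT leb setT f measurableT.
rewrite preimage_setT => h; rewrite -[LHS]h//.
by apply: eq_measure_integral => A mA _; exact: lebesgue_translation.
Qed.

(** The translated interval leaves [[-1, 1]] on a set of measure at most [|s|], where the integrand
    is at most 1. *)
Lemma integral_translate_le (s : R) (G : R -> \bar R) : measurable_fun setT G ->
  (forall x, 0 <= G x <= 1)%E ->
  (\int[leb]_(x in [set` `[-1, 1]%R]) G (x + s)%R <= \int[leb]_(x in [set` `[-1, 1]%R]) G x + `|s|%:E)%E.
Proof.
move=> mG G01; have G0 x : (0 <= G x)%E by have /andP[] := G01 x.
have G1 x : (G x <= 1)%E by have /andP[] := G01 x.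
pose J : set R := [set` `[-1, 1]%R].
have mJ : measurable J by exact: measurable_itv.
pose Js : set R := [set` `[(-1 + s)%R, (1 + s)%R]].
have mJs : measurable Js by exact: measurable_itv.
have -> : (\int[leb]_(x in J) G (x + s)%R = \int[leb]_(x in Js) G x)%E.
  rewrite integral_mkcond [RHS]integral_mkcond.
  have mp : measurable_fun setT (G \_ Js).
    by apply/(measurable_restrictT _ mJs); exact: measurable_funTS.
  rewrite -(ge0_integral_translate s mp); last by move=> x; rewrite patchE; case: ifP.
  apply: eq_integral => x _; rewrite !patchE; congr (if _ then _ else _).
  apply/idP/idP; rewrite !inE /J /Js /= !in_itv /= => /andP[h1 h2]; apply/andP; split; lra.
have mD : measurable (Js `\` J) by exact: measurableD.
apply: (@le_trans _ _ (\int[leb]_(x in J `|` (Js `\` J)) G x)%E).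
  apply: ge0_subset_integral => //; first exact: measurableU.
    exact: measurable_funTS.
  by move=> x Jx; have [xJ|xJ] := pselect (J x); [left|right].
rewrite ge0_integral_setU//; last 2 first.
- exact: measurable_funTS.
- by rewrite disj_set2E; apply/eqP; rewrite setDE setIC -setIA setICl setI0.
rewrite leeD2l//; apply: (@le_trans _ _ (leb (Js `\` J))).
  rewrite -[leRHS]mul1e -integral_cst//; apply: ge0_le_integral => //.
  exact: measurable_funTS.
have [s0|s0] := leP 0 s.
  apply: (@le_trans _ _ (leb [set` `]1%R, (1 + s)%R]])).
    apply: le_measure; rewrite ?inE//.
    move=> x [] /=; rewrite /Js /J /= !in_itv /= => /andP[h1 h2] h3; rewrite h2 andbT ltNge.
    by apply/negP => x1; apply: h3; rewrite x1 andbT; lra.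
  rewrite lebesgue_measure_itv /= lte_fin; case: ifP => _; last by rewrite lee_fin.
  by rewrite -EFinB lee_fin ger0_norm//; lra.
apply: (@le_trans _ _ (leb [set` `[(-1 + s)%R, (-1)%R[])).
  apply: le_measure; rewrite ?inE//.
  move=> x [] /=; rewrite /Js /J /= !in_itv /= => /andP[h1 h2] h3; rewrite h1 /= ltNge.
  by apply/negP => x1; apply: h3; rewrite x1 /=; lra.
rewrite lebesgue_measure_itv /= lte_fin; case: ifP => _; last by rewrite lee_fin.
by rewrite -EFinB lee_fin ltr0_norm//; lra.
Qed.

End translation.

(** * Energies and increments *)

Section time_integrals.
Context (R : realType).
Local Notation leb := (@lebesgue_measure R).
Local Notation I01 := ([set` `[0%R, 1%R]] : set R).

Lemma integrable_continuous01 (f : R -> R) (s : R) : {within I01, continuous f} -> s \in `[0, 1] ->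
  leb.-integrable [set` `[0%R, s]] (EFin \o f).
Proof.
move=> cf s01; have /andP[s0 s1] : 0 <= s <= 1 by move: s01; rewrite in_itv.
have [C C0 fC] := continuous_bounded01 cf.
have mD : measurable [set` `[(0:R), s]] by exact: measurable_itv.
have sub : [set` `[0, s]] `<=` I01.
  by move=> u /=; rewrite !in_itv /= => /andP[-> us]; exact: le_trans us s1.
have mf : measurable_fun [set` `[0, s]] f.
  exact: measurable_funS (measurable_itv _) sub (measurable_continuous01 cf).
have finD : (leb [set` `[0%R, s]] < +oo)%E.
  by rewrite lebesgue_measure_itv /=; case: ifP => _; rewrite ?oppr0 ?ltry.
apply: measurable_bounded_integrable => //.
exists C; split; first exact: num_real.
by move=> M CM u uD /=; exact: le_trans (fC u (sub u uD)) (ltW CM).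
Qed.

Lemma Rintegral_affine (f g : R -> R) (a b c s : R) : {within I01, continuous f} ->
  {within I01, continuous g} -> s \in `[0, 1] ->
  \int[leb]_(u in [set` `[0%R, s]]) (a * f u + b * g u + c) =
  a * \int[leb]_(u in [set` `[0%R, s]]) f u + b * \int[leb]_(u in [set` `[0%R, s]]) g u + c * s.
Proof.
move=> cf cg s01; have /andP[s0 s1] : 0 <= s <= 1 by move: s01; rewrite in_itv.
have mD : measurable [set` `[(0:R), s]] by exact: measurable_itv.
have jf := integrable_continuous01 cf s01; have jg := integrable_continuous01 cg s01.
have cc : {within I01, continuous (cst c)} by apply: continuous_subspaceT; exact: cst_continuous.
have jc := integrable_continuous01 cc s01.
have jaf := leb_integrable_scale a mD jf.
have jbg := leb_integrable_scale b mD jg.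
have jab : leb.-integrable [set` `[0%R, s]] (EFin \o (fun u => a * f u + b * g u)).
  exact: (@integrable_add _ _ _ leb _ _ _ mD jaf jbg).
rewrite (@RintegralD _ _ _ leb _ (fun u => a * f u + b * g u) (fun=> c) mD jab jc).
rewrite (@RintegralD _ _ _ leb _ (fun u => a * f u) (fun u => b * g u) mD jaf jbg).
rewrite !RintegralZl//; congr (_ + _).
have h : fine (leb [set` `[0%R, s]]) = s.
  rewrite lebesgue_measure_itv /= lte_fin; case: ltP => [_|]; first by rewrite oppr0 adde0.
  by move=> s00; apply/eqP; rewrite eq_le s0 s00.
by rewrite Rintegral_cst// h.
Qed.

Lemma continuous_sqr01 (f : R -> R) : {within I01, continuous f} ->
  {within I01, continuous (fun u => f u ^+ 2)}.
Proof.
move=> cf; rewrite (_ : (fun u => f u ^+ 2) = (fun u => f u * f u)); last first.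
  by apply/funext => u; rewrite expr2.
by move=> u; exact: (cvgM (cf u) (cf u)).
Qed.

(** Cauchy-Schwarz, obtained by integrating [(f - c) ^+ 2] over the interval with [c] the mean of
    [f] there. Since all integrals start at 0, nonnegativity appears as monotonicity in the right
    endpoint. *)
Lemma integral_energy (f : R -> R) (s t : R) : {within I01, continuous f} ->
  0 <= s -> s < t -> t <= 1 ->
  let F u := \int[leb]_(x in [set` `[0%R, u]]) f x in
  let E u := \int[leb]_(x in [set` `[0%R, u]]) (f x ^+ 2) in
  is_true ((F t - F s) ^+ 2 <= (t - s) * (E t - E s)).
Proof.
move=> cf s0 st t1 F E.
have t0 : 0 <= t by exact: le_trans (ltW st).
have t01 : t \in `[0, 1] by rewrite in_itv /= t0.
have s01 : s \in `[0, 1] by rewrite in_itv /= s0 (le_trans (ltW st)).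
have cf2 := continuous_sqr01 cf.
have ts : 0 < t - s by rewrite subr_gt0.
pose c := (F t - F s) / (t - s).
have cE : c * (t - s) = F t - F s by rewrite /c divfK// gt_eqF.
have sqE u : (f u - c) ^+ 2 = 1 * f u ^+ 2 + (- (2 * c)) * f u + c ^+ 2 by ring.
have cg : {within I01, continuous (fun u => (f u - c) ^+ 2)}.
  by apply: continuous_sqr01 => u; apply: cvgB; [exact: cf|exact: cvg_cst].
have mono : \int[leb]_(x in [set` `[0%R, s]]) ((f x - c) ^+ 2) <= \int[leb]_(x in [set` `[0%R, t]]) ((f x - c) ^+ 2).
  have jt := integrable_continuous01 cg t01; have js := integrable_continuous01 cg s01.
  apply: fine_le; [exact: integrable_fin_num|exact: integrable_fin_num|].
  have mt : measurable_fun [set` `[0%R, t]] (fun u => ((f u - c) ^+ 2)%:E) by case/integrableP : jt.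
  have p0 u : [set` `[0%R, t]] u -> (0 <= ((f u - c) ^+ 2)%:E)%E by rewrite lee_fin sqr_ge0.
  have sub : [set` `[0%R, s]] `<=` [set` `[0%R, t]].
    by move=> u /=; rewrite !in_itv /= => /andP[-> us]; exact: le_trans us (ltW st).
  by apply: ge0_subset_integral => //; exact: measurable_itv.
have EE u : u \in `[0, 1] -> \int[leb]_(x in [set` `[0%R, u]]) ((f x - c) ^+ 2) =
    1 * E u + (- (2 * c)) * F u + c ^+ 2 * u.
  by move=> u01; rewrite -Rintegral_affine//; apply: eq_Rintegral => x _; rewrite sqE.
move: mono; rewrite !EE// => mono; rewrite -cE.
have : c ^+ 2 * (t - s) <= E t - E s.
  have : 2 * c * (F t - F s) = 2 * (c ^+ 2 * (t - s)) by rewrite -cE; ring.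
  move: mono; rewrite !mul1r; lra.
move=> h; rewrite [leLHS](_ : _ = (t - s) * (c ^+ 2 * (t - s))); last by ring.
by rewrite ler_wpM2l// ltW.
Qed.

End time_integrals.

(** * Moments of one coordinate of a Gaussian process *)

Section moments.
Context (R : realType) d (T : measurableType d) (P : probability T R) (m : nat).
Variables (X : R -> T -> 'cV[R]_m) (S : R -> 'M[R]_m) (i : 'I_m).
Hypotheses (mX : process_measurable X) (gX : gaussian P X S).
Local Notation leb := (@lebesgue_measure R).
Local Notation I01 := ([set` `[0%R, 1%R]] : set R).
Hypothesis iS : forall p q, leb.-integrable I01 (EFin \o (fun s => S s p q)).

Lemma gcovZ (l : seq (R * 'cV[R]_m)) (c : R) :
  gcov S [seq (x.1, c *: x.2) | x <- l] = c ^+ 2 * gcov S l.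
Proof.
rewrite !gcov_sum// mulr_sumr; apply: eq_bigr => p _; rewrite mulr_sumr; apply: eq_bigr => q _.
rewrite -RintegralZl//; last exact: integrable_tail_form.
apply: eq_Rintegral => s _.
have -> : tail [seq (x.1, c *: x.2) | x <- l] s = c *: tail l s.
  by rewrite /tail big_map scaler_sumr.
by rewrite !mxE; ring.
Qed.

Lemma lincomb_cos (l : seq (R * 'cV[R]_m)) (a c : R) : times01 l ->
  \int[P]_w cos (a + c * lincomb l X w) = cos a * expR (- (c ^+ 2 * gcov S l / 2)).
Proof.
move=> l01; rewrite -gcovZ -gX ?times01_map//.
apply: eq_Rintegral => w _; congr (cos (_ + _)).
by rewrite /lincomb big_map mulr_sumr; apply: eq_bigr => x _; rewrite dotZl.
Qed.

Lemma lincomb_moment (l : seq (R * 'cV[R]_m)) : times01 l ->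
  (\int[P]_w (lincomb l X w ^+ 2)%:E <= (gcov S l)%:E)%E.
Proof.
move=> l01; apply: gaussian_second_moment; first exact: measurable_lincomb.
by move=> a c; exact: lincomb_cos.
Qed.

Local Notation e := (delta_mx i 0 : 'cV[R]_m).

Lemma dot_delta (v : 'cV[R]_m) : dot e v = v i 0.
Proof.
rewrite /dot (bigD1 i)//= mxE !eqxx mul1r big1 ?addr0// => j ji.
by rewrite mxE (negbTE ji) mul0r.
Qed.

Lemma lincomb_coord s w : lincomb [:: (s, e)] X w = X s w i 0.
Proof. by rewrite /lincomb big_cons big_nil addr0 dot_delta. Qed.

Lemma lincomb_increment s w : lincomb [:: (1, e); (s, - e)] X w = X 1 w i 0 - X s w i 0.
Proof.
rewrite /lincomb !big_cons big_nil addr0 dot_delta; congr (_ + _).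
by rewrite dotC -scaleN1r dotC dotZl dot_delta mulN1r.
Qed.

Let form (v : R -> bool) l : (forall s, s \in `[0, 1] -> tail l s = (v s)%:R *: e) ->
  gcov S l = \int[leb]_(s in I01) ((v s)%:R * S s i i).
Proof.
move=> tE; apply: eq_Rintegral => s; rewrite inE => s01; rewrite tE// dotZl dot_delta -scalemxAr mxE.
rewrite (_ : (S s *m e) i 0 = S s i i).
  by case: (v s); rewrite ?mul1r ?mul0r.
by rewrite mxE (bigD1 i)//= mxE !eqxx mulr1 big1 ?addr0// => j ji; rewrite mxE (negbTE ji) mulr0.
Qed.

Lemma gcov_coord s : gcov S [:: (s, e)] = \int[leb]_(u in I01) ((u <= s)%R%:R * S u i i).
Proof.
apply: form => u _; rewrite /tail big_cons big_nil /=.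
by case: ifP => _; rewrite ?addr0 ?scale1r ?scale0r.
Qed.

Lemma gcov_increment s : s \in `[0, 1] ->
  gcov S [:: (1, e); (s, - e)] = \int[leb]_(u in I01) ((s < u)%R%:R * S u i i).
Proof.
move=> s01; apply: form => u; rewrite in_itv /= => /andP[u0 u1].
rewrite /tail !big_cons big_nil /= u1.
by case: leP => _; rewrite ?addr0 ?subrr ?scale1r ?scale0r.
Qed.

Variables (t1 t2 : R).
Hypotheses (S0 : forall s, s \in `[0, 1] -> 0 <= S s i i)
  (SJ : forall s, s \in `[0, 1] -> s \notin `[t1, t2] -> S s i i = 0).
Let V := \int[leb]_(u in I01) S u i i.

Lemma gcov_total : gcov S [:: (1, e)] = V.
Proof.
rewrite gcov_coord; apply: eq_Rintegral => u; rewrite inE /= in_itv /= => /andP[_ ->].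
by rewrite mul1r.
Qed.

(** A variable of mean square 0 whenever [s] is off [[t1, t2]]: the variance of coordinate [i]
    accumulates on the window only, so the centred path has not moved before it and agrees with its
    terminal value after it. *)
Definition off_window_increment s w : R := if s <= t2 then X s w i 0 else X s w i 0 - X 1 w i 0.

Lemma measurable_off_window s : s \in `[0, 1] -> measurable_fun setT (off_window_increment s).
Proof.
move=> s01; rewrite /off_window_increment; case: (s <= t2); first exact: mX.
by apply: measurable_funB; apply: mX => //; rewrite in_itv /= ler01 lexx.
Qed.

Let weighted_le (v : R -> bool) :
  measurable_fun I01 (fun u => (v u)%:R : R) -> \int[leb]_(u in I01) ((v u)%:R * S u i i) <= V.
Proof.
move=> mv; apply: le_Rintegral; [exact: measurable_itv| |exact: iS|].
  have := iS i i; apply: le_integrable; first exact: measurable_itv.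
    apply/measurable_EFinP; apply: measurable_funM => //.
    by case/integrableP : (iS i i) => /measurable_EFinP.
  move=> u _ /=; rewrite lee_fin normrM; case: (v u); rewrite ?normr1 ?mul1r ?normr0 ?mul0r//.
by move=> u u01; case: (v u); rewrite ?mul1r ?mul0r//; exact: S0.
Qed.

Let weighted0 (v : R -> bool) : (forall u, u \in `[t1, t2] -> v u = false) ->
  \int[leb]_(u in I01) ((v u)%:R * S u i i) = 0.
Proof.
move=> v0; rewrite (_ : \int[leb]_(u in I01) _ = \int[leb]_(u in I01) (cst 0 u)); last first.
  apply: eq_Rintegral => u; rewrite inE => u01 /=.
  have [uJ|uJ] := boolP (u \in `[t1, t2]); first by rewrite v0// mul0r.
  by rewrite SJ// mulr0.
by rewrite Rintegral_cst ?mul0r//; exact: measurable_itv.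
Qed.

Lemma off_window_moment s : s \in `[0, 1] ->
  (\int[P]_w (off_window_increment s w ^+ 2)%:E <= (V * \1_[set` `[t1, t2]] s)%:E)%E.
Proof.
move=> s01.
have m1 : measurable_fun I01 (fun u => (u <= s)%R%:R : R).
  rewrite (_ : (fun u => _) = \1_([set` `]-oo, s]])); first by apply: measurable_indic; exact: measurable_itv.
  apply/funext => u; rewrite indicE; congr (nat_of_bool _)%:R.
  by apply/idP/idP; rewrite inE /= in_itv.
have e1 : (1 : R) \in `[0, 1] by rewrite in_itv /= ler01 lexx.
rewrite /off_window_increment; have [st2|st2] := leP s t2.
  have h : (\int[P]_w (X s w i 0 ^+ 2)%:E <= (gcov S [:: (s, e)])%:E)%E.
    under eq_integral do rewrite -lincomb_coord.
    by apply: lincomb_moment; rewrite /times01 /= s01.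
  apply: le_trans h _; rewrite lee_fin gcov_coord indicE.
  have [st1|st1] := leP t1 s.
    rewrite mem_set /= ?in_itv /= ?st1//; rewrite mulr1; exact: weighted_le.
  rewrite memNset /= ?in_itv /=; last by rewrite leNgt st1.
  rewrite mulr0 weighted0// => u; rewrite in_itv /= => /andP[t1u _].
  by apply/negbTE; rewrite -ltNge (lt_le_trans st1).
have h : (\int[P]_w ((X s w i 0 - X 1 w i 0) ^+ 2)%:E <= (gcov S [:: (1, e); (s, - e)])%:E)%E.
  under eq_integral do rewrite -sqrrN opprB -lincomb_increment.
  by apply: lincomb_moment; rewrite /times01 /= s01 e1.
apply: le_trans h _; rewrite lee_fin gcov_increment// indicE memNset /= ?in_itv /=; last first.
  by rewrite [s <= t2]leNgt st2 andbF.
rewrite mulr0 weighted0// => u; rewrite in_itv /= => /andP[_ ut2].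
by apply/negbTE; rewrite -leNgt (le_trans ut2)// ltW.
Qed.

End moments.

(** * Comparison of two mixtures *)

Section auxiliary.
Context (R : realType).

(** The continuous functions [x / (x ^+ 2 + 1 / (n + 1))] converge to [x^-1] everywhere, including
    [x = 0], where the inverse is 0 by convention. *)
Lemma measurable_inv : measurable_fun setT (fun x : R => x^-1).
Proof.
pose g (n : nat) (x : R) : R := x * (x ^+ 2 + n.+1%:R^-1)^-1.
have p0 n (x : R) : 0 < x ^+ 2 + n.+1%:R^-1 by rewrite ltr_wpDl ?sqr_ge0// invr_gt0.
have mg n : measurable_fun setT (g n).
  apply: continuous_measurable_fun => x; apply: cvgM; first exact: cvg_id.
  apply: cvgV; first by rewrite gt_eqF.
  apply: cvgD; last exact: cvg_cst.
  exact: exprn_continuous.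
apply: (measurable_fun_cvg mg) => x _.
have [->|x0] := eqVneq x 0.
  rewrite invr0 (_ : g ^~ 0 = cst 0); first exact: cvg_cst.
  by apply/funext => n; rewrite /g mul0r.
have -> : x^-1 = x * (x ^+ 2 + 0)^-1 by rewrite addr0; field.
apply: cvgM; first exact: cvg_cst.
apply: cvgV; first by rewrite addr0 sqrf_eq0.
by apply: cvgD; [exact: cvg_cst|exact: cvg_harmonic].
Qed.

Lemma ge0_integral_prod d1 d2 (T1 : measurableType d1) (T2 : measurableType d2)
    (P1 : probability T1 R) (P2 : probability T2 R) (f : T1 -> R) (g : T2 -> R) :
  measurable_fun setT f -> measurable_fun setT g -> (forall x, 0 <= f x) -> (forall x, 0 <= g x) ->
  (\int[P1 \x P2]_z (f z.1 * g z.2)%:E = \int[P1]_x (f x)%:E * \int[P2]_y (g y)%:E)%E.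
Proof.
move=> mf mg f0 g0.
have mh : measurable_fun setT (fun z : T1 * T2 => (f z.1 * g z.2)%:E).
  apply/measurable_EFinP; apply: measurable_funM.
    by apply: (measurableT_comp mf); exact: measurable_fst.
  by apply: (measurableT_comp mg); exact: measurable_snd.
have h0 (z : T1 * T2) : (0 <= (f z.1 * g z.2)%:E)%E by rewrite lee_fin mulr_ge0.
rewrite (fubini_tonelli1 _ mh h0) /fubini_F /=.
transitivity (\int[P1]_x ((f x)%:E * \int[P2]_y (g y)%:E))%E.
  by apply: eq_integral => x _; rewrite (ge0_integral_EFinZ P2 g0 mg (f0 x)).
rewrite ge0_integralZr//.
- exact/measurable_EFinP.
- by move=> x _; rewrite lee_fin.
- by apply: integral_ge0 => y _; rewrite lee_fin.
Qed.

Lemma law_integral d (T : measurableType d) (P : probability T R) m (mu : probability (path_space R m) R)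
    (Y : R -> T -> 'cV[R]_m) (phi : path_space R m -> R) :
  process_measurable Y -> (forall A, measurable A -> mu A = P [set w | A (fun s => Y s w)]) ->
  measurable_fun setT phi -> (forall y, 0 <= phi y) ->
  (\int[mu]_y (phi y)%:E = \int[P]_w (phi (fun s => Y s w))%:E)%E.
Proof.
move=> mY muE mphi phi0.
have mp : measurable_fun setT ((fun w s => Y s w) : T -> path_space R m) by exact: (measurable_path mY).
transitivity (\int[pushforward P (mfun_of mp)]_y (phi y)%:E)%E.
  by apply: eq_measure_integral => A mA _; exact: muE.
rewrite ge0_integral_pushforward//.
- exact/measurable_EFinP.
- by move=> y _; rewrite lee_fin.
Qed.

Lemma probability_integral_le1 d (T : measurableType d) (P : probability T R) (f : T -> R) :
  measurable_fun setT f -> (forall w, 0 <= f w <= 1) -> (\int[P]_w (f w)%:E <= 1)%E.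
Proof.
move=> mf f01; apply: (@le_trans _ _ (\int[P]_w (cst 1%E w))%E); last first.
  by rewrite integral_cst// mul1e; exact: probability_le1.
apply: ge0_le_integral => //.
- by move=> w _; rewrite lee_fin; have /andP[] := f01 w.
- exact/measurable_EFinP.
- by move=> w _; rewrite lee_fin; have /andP[] := f01 w.
Qed.

Lemma tonelli_probability d1 d2 (T1 : measurableType d1) (T2 : measurableType d2)
    (P1 : probability T1 R) (P2 : probability T2 R) (f : T1 * T2 -> R) :
  measurable_fun setT f -> (forall y, 0 <= f y) ->
  (\int[P1 \x P2]_y (f y)%:E = \int[P1]_w \int[P2]_c (f (w, c))%:E)%E.
Proof.
move=> mf f0; have mfE : measurable_fun setT (fun y => (f y)%:E) by exact/measurable_EFinP.
by have := fubini_tonelli1 (m1 := P1) (m2 := P2) _ mfE => -> // y; rewrite lee_fin.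
Qed.

Section tonelli_lebesgue.
Context d (T : measurableType d) (P : probability T R).
Local Notation leb := (@lebesgue_measure R).
Variable f : T -> R -> \bar R.
Hypotheses (mf : measurable_fun setT (fun y : T * measurableTypeR R => f y.1 y.2)) (f0 : forall w s, (0 <= f w s)%E).

Lemma tonelli_lebesgue : (\int[P]_w \int[leb]_s f w s = \int[leb]_s \int[P]_w f w s)%E.
Proof. by have := fubini_tonelli (m1 := P) (m2 := leb) _ mf => /(_ (fun y => f0 y.1 y.2)). Qed.

Lemma measurable_integral_lebesgue : measurable_fun setT (fun w => \int[leb]_s f w s)%E.
Proof. by have := measurable_fun_fubini_tonelli_F (m2 := leb) _ mf => /(_ (fun y => f0 y.1 y.2)). Qed.

Lemma measurable_integral_time : measurable_fun setT (fun s => \int[P]_w f w s)%E.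
Proof. by have := measurable_fun_fubini_tonelli_G (m1 := P) _ mf => /(_ (fun y => f0 y.1 y.2)). Qed.

End tonelli_lebesgue.

Lemma tonelli_lebesgue_set d (T : measurableType d) (P : probability T R) (f : T -> R -> \bar R) (J : set R) :
  measurable_fun setT (fun y : T * measurableTypeR R => f y.1 y.2) -> (forall w s, (0 <= f w s)%E) ->
  measurable J ->
  (\int[P]_w \int[@lebesgue_measure R]_(s in J) f w s = \int[@lebesgue_measure R]_(s in J) \int[P]_w f w s)%E.
Proof.
move=> mf f0 mJ.
pose fJ w s := (f w s * (\1_J s)%:E)%E.
have fJ0 w s : (0 <= fJ w s)%E by rewrite mule_ge0// lee_fin.
have mfJ : measurable_fun setT (fun y : T * measurableTypeR R => fJ y.1 y.2).
  apply: emeasurable_funM => //; apply/measurable_EFinP.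
  by apply: (measurableT_comp (measurable_indic mJ)); exact: measurable_snd.
have fJE w s : fJ w s = (((f w) \_ J) s)%E.
  by rewrite /fJ patchE indicE; case: (s \in J); rewrite ?mule1 ?mule0.
have := tonelli_lebesgue P mfJ fJ0.
under eq_integral do under eq_integral do rewrite fJE.
under eq_integral do rewrite -integral_mkcond.
move=> ->; rewrite [RHS]integral_mkcond; apply: eq_integral => s _; rewrite patchE.
case: ifPn => sJ; first by apply: eq_integral => w _; rewrite /fJ indicE sJ mule1.
by rewrite integral0_eq// => w _; rewrite /fJ indicE (negbTE sJ) mule0.
Qed.

Lemma integral_le_loss d (T : measurableType d) (P : probability T R) (F H : T -> \bar R) (l : T -> R) (K : R) :
  measurable_fun setT F -> measurable_fun setT H -> measurable_fun setT l ->
  (forall w, (0 <= F w)%E) -> (forall w, (0 <= H w)%E) -> (forall w, 0 <= l w) ->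
  (forall w, (F w <= H w + (l w)%:E)%E) -> (\int[P]_w (l w)%:E <= K%:E)%E ->
  (\int[P]_w F w <= \int[P]_w H w + K%:E)%E.
Proof.
move=> mF mH ml F0 H0 l0 FH lK.
have mlE : measurable_fun setT (fun w => (l w)%:E) by exact/measurable_EFinP.
apply: (@le_trans _ _ (\int[P]_w (H w + (l w)%:E))%E).
  by apply: ge0_le_integral => //; exact: emeasurable_funD.
by rewrite ge0_integralD// ?leeD2l// => w _; rewrite lee_fin.
Qed.

(** Both bounds are integrated over [z] in [[-1, 1]] and the order of integration is exchanged. For
    a fixed sample point the translation by [rho] costs at most [|rho|]; dividing by the length 2
    leaves [K / 2]. *)
Lemma average_translate d (T : measurableType d) (P : probability T R) (G : T -> R -> \bar R) (rho : T -> R) (a b K : R) :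
  measurable_fun setT (fun y : T * measurableTypeR R => G y.1 y.2) -> measurable_fun setT rho ->
  (forall w z, (0 <= G w z <= 1)%E) -> 0 <= b ->
  (forall z, z \in `[-1, 1] -> (b%:E <= \int[P]_w G w (z + rho w)%R)%E) ->
  (forall z, z \in `[-1, 1] -> (\int[P]_w G w z <= a%:E)%E) ->
  (\int[P]_w (`|rho w|)%:E <= K%:E)%E -> b <= a + K / 2.
Proof.
move=> mG mrho G01 b0 bG Ga rK.
have G0 w z : (0 <= G w z)%E by have /andP[] := G01 w z.
pose J : set R := [set` `[(-1)%R, 1%R]].
have mJ : measurable J by exact: measurable_itv.
have J2 : (@lebesgue_measure R J = 2%:E)%E.
  have N11 : -1 < 1 :> R by lra.
  by rewrite lebesgue_measure_itv /= lte_fin N11 -EFinB opprK.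
have cJ (c : R) : (\int[@lebesgue_measure R]_(z in J) c%:E = (c * 2)%:E)%E.
  by rewrite integral_cst// EFinM [X in (_ * X)%E]J2.
have mH : measurable_fun setT (fun y : T * measurableTypeR R => G y.1 (y.2 + rho y.1)).
  apply: (measurableT_comp (f := fun y : T * measurableTypeR R => G y.1 y.2)
    (g := fun y : T * measurableTypeR R => (y.1, y.2 + rho y.1))) => //.
  apply/measurable_fun_pairP; split; first exact: measurable_fst.
  have m1 : measurable_fun setT (fun y : T * measurableTypeR R => (y.2 : R)) by exact: measurable_snd.
  have m2 : measurable_fun setT (fun y : T * measurableTypeR R => rho y.1).
    by apply: (measurableT_comp mrho); exact: measurable_fst.
  exact: (measurable_funD m1 m2).
have mGw w : measurable_fun setT (G w).
  exact: (measurableT_comp mG (pair1_measurable w)).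
have mGJ : measurable_fun setT (fun w => \int[@lebesgue_measure R]_(z in J) G w z)%E.
  pose GJ w z := (G w z * (\1_J z)%:E)%E.
  have GJ0 w z : (0 <= GJ w z)%E by rewrite mule_ge0// lee_fin.
  have mJ2 : measurable_fun setT (fun y : T * measurableTypeR R => GJ y.1 y.2).
    apply: emeasurable_funM => //; apply/measurable_EFinP.
    by apply: (measurableT_comp (measurable_indic mJ)); exact: measurable_snd.
  have := measurable_integral_lebesgue mJ2 GJ0; congr (measurable_fun _ _).
  apply/funext => w; rewrite [RHS]integral_mkcond; apply: eq_integral => z _.
  by rewrite /GJ patchE indicE; case: (z \in J); rewrite ?mule1 ?mule0.
have dbl : ((b * 2)%:E <= (a * 2)%:E + K%:E)%E.
  rewrite -(cJ b) -(cJ a).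
  apply: (@le_trans _ _ (\int[@lebesgue_measure R]_(z in J) \int[P]_w G w (z + rho w)%R)%E).
    apply: ge0_le_integral => //.
    - by apply: measurable_funTS; exact: (measurable_integral_time P mH (fun w z => G0 w _)).
  apply: (@le_trans _ _ (\int[@lebesgue_measure R]_(z in J) \int[P]_w G w z + K%:E)%E); last first.
    rewrite leeD2r//; apply: ge0_le_integral => //.
    - by move=> z _; apply: integral_ge0.
    - by apply: measurable_funTS; exact: (measurable_integral_time P mG G0).
  rewrite -(tonelli_lebesgue_set (f := fun w z => G w (z + rho w)%R) P mH (fun w z => G0 w _) mJ).
  rewrite -(tonelli_lebesgue_set P mG G0 mJ).
  apply: (integral_le_loss (l := fun w => `|rho w|)) => //.
  - pose GJ w z := (G w (z + rho w)%R * (\1_J z)%:E)%E.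
    have GJ0 w z : (0 <= GJ w z)%E by rewrite mule_ge0// lee_fin.
    have mJ2 : measurable_fun setT (fun y : T * measurableTypeR R => GJ y.1 y.2).
      apply: emeasurable_funM => //; apply/measurable_EFinP.
      by apply: (measurableT_comp (measurable_indic mJ)); exact: measurable_snd.
    have := measurable_integral_lebesgue mJ2 GJ0; congr (measurable_fun _ _).
    apply/funext => w; rewrite [RHS]integral_mkcond; apply: eq_integral => z _.
    by rewrite /GJ patchE indicE; case: (z \in J); rewrite ?mule1 ?mule0.
  - exact: measurableT_comp.
  - by move=> w; apply: integral_ge0.
  - by move=> w; apply: integral_ge0.
  - by move=> w; apply: integral_translate_le.
by move: dbl; rewrite -EFinD lee_fin; lra.
Qed.

End auxiliary.

(** What remains of [observation_law] once the volatility and its driving Brownian motion are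
    forgotten. It is all that uniqueness of the law requires. *)
Definition signal_law (R : realType) m (x0 : 'cV[R]_m) (kap : R) (S : R -> 'M[R]_m)
    (mu : probability (path_space R m) R) : Prop :=
  exists (d : measure_display) (T : measurableType d) (P : probability T R) (X W Y : R -> T -> 'cV[R]_m),
    observed P x0 kap S X W Y /\ (forall A, measurable A -> mu A = P [set w | A (fun s => Y s w)]).

(** * Null and alternative on one sample space *)

Section mixture.
Context (R : realType) (m : nat) (x0 : 'cV[R]_m) (i : 'I_m) (kap : R).
Context dA dB dC (TA : measurableType dA) (TB : measurableType dB) (TC : measurableType dC)
  (PA : probability TA R) (PB : probability TB R) (PC : probability TC R).
Variables (XA : R -> TA -> 'cV[R]_m) (XB : R -> TB -> 'cV[R]_m) (W : R -> TC -> 'cV[R]_m).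
Variables (SA SB : R -> 'M[R]_m).
Local Notation leb := (@lebesgue_measure R).
Local Notation I01 := ([set` `[0%R, 1%R]] : set R).
Hypotheses (kap0 : 0 < kap) (cA : continuous_process XA) (cB : continuous_process XB)
  (gA : gaussian PA (fun s w => XA s w - x0) SA) (gB : gaussian PB (fun s w => XB s w - x0) SB)
  (bW : brownian_motion PC W).
Hypotheses (iA : forall p q, leb.-integrable I01 (EFin \o (fun s => SA s p q)))
  (iB : forall p q, leb.-integrable I01 (EFin \o (fun s => SB s p q))).
Hypothesis SBE : forall s, s \in `[0, 1] -> delta_mx i i *m SB s *m (delta_mx i i)^T = SB s.

Local Notation P1 := (PA \x PB)%E.
Local Notation P := ((PA \x PB) \x PC)%E.

(** All null models are images of a single one under scaling of coordinate [i], so they can be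
    realised together on the sample space of [XA]. *)
Definition dilation (z : R) : 'M[R]_m := diag_mx (\row_j (if j == i then z else 1)).

Definition null_cov (z s : R) : 'M[R]_m := dilation z *m SA s *m (dilation z)^T.

(** The scaling acts on the centred signal, which leaves the initial value [x0] unchanged for every
    [z]. *)
Let Xn (z s : R) (w : TA * TB) : 'cV[R]_m := x0 + dilation z *m (XA s w.1 - x0).
Let Xa (z s : R) (w : TA * TB) : 'cV[R]_m := x0 + (dilation z *m (XA s w.1 - x0) + delta_mx i i *m (XB s w.2 - x0)).

Let v (z : R) (j : 'I_m) : R := if j == i then z else 1.

Let dilationE z (u : 'cV[R]_m) j : (dilation z *m u) j 0 = v z j * u j 0.
Proof. by rewrite mul_diag_mx !mxE. Qed.

Let deltaE (u : 'cV[R]_m) j : (delta_mx i i *m u) j 0 = (j == i)%:R * u i 0.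
Proof.
rewrite mxE (bigD1 i)//= mxE eqxx andbT big1 ?addr0// => k ki.
by rewrite mxE (negbTE ki) andbF mul0r.
Qed.

Let XnE z s w j : Xn z s w j 0 = v z j * XA s w.1 j 0 + (1 - v z j) * x0 j 0.
Proof. by rewrite /Xn mxE dilationE !mxE; ring. Qed.

Let XaE z s w j : Xa z s w j 0 =
  v z j * XA s w.1 j 0 + (j == i)%:R * XB s w.2 i 0 + ((1 - v z j) * x0 j 0 - (j == i)%:R * x0 i 0).
Proof. by rewrite /Xa mxE mxE dilationE deltaE !mxE; ring. Qed.

Let cAc w j : {within I01, continuous (fun s => XA s w j 0)}. Proof. by case: cA => _; apply. Qed.
Let cBc w j : {within I01, continuous (fun s => XB s w j 0)}. Proof. by case: cB => _; apply. Qed.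

Let mA1 s j : s \in `[0, 1] -> measurable_fun setT (fun w : TA * TB => XA s w.1 j 0).
Proof. by case: cA => mA _ s01; apply: (measurableT_comp (mA s j s01)); exact: measurable_fst. Qed.
Let mB1 s j : s \in `[0, 1] -> measurable_fun setT (fun w : TA * TB => XB s w.2 j 0).
Proof. by case: cB => mB _ s01; apply: (measurableT_comp (mB s j s01)); exact: measurable_snd. Qed.

Let cont_affine (f g : R -> R) (a b c : R) : {within I01, continuous f} -> {within I01, continuous g} ->
  {within I01, continuous (fun s => a * f s + b * g s + c)}.
Proof.
move=> cf cg s; apply: cvgD; last exact: cvg_cst.
by apply: cvgD; apply: cvgM; (try exact: cvg_cst); [exact: cf|exact: cg].
Qed.

Let Xn_cont z : continuous_process (Xn z).
Proof.
split=> [s j s01|w j].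
  rewrite (_ : (fun w => _) = (fun w => v z j * XA s w.1 j 0 + (1 - v z j) * x0 j 0)); last exact/funext.
  by apply: measurable_funD => //; apply: measurable_funM => //; exact: mA1.
rewrite (_ : (fun s => _) = (fun s => v z j * XA s w.1 j 0 + 0 * XA s w.1 j 0 + (1 - v z j) * x0 j 0)).
  exact: cont_affine.
by apply/funext => s; rewrite XnE mul0r addr0.
Qed.

Let Xa_cont z : continuous_process (Xa z).
Proof.
split=> [s j s01|w j].
  rewrite (_ : (fun w => _) = (fun w => v z j * XA s w.1 j 0 + (j == i)%:R * XB s w.2 i 0 +
    ((1 - v z j) * x0 j 0 - (j == i)%:R * x0 i 0))); last exact/funext.
  apply: measurable_funD => //; apply: measurable_funD; apply: measurable_funM => //; [exact: mA1|exact: mB1].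
rewrite (_ : (fun s => _) = (fun s => v z j * XA s w.1 j 0 + (j == i)%:R * XB s w.2 i 0 +
    ((1 - v z j) * x0 j 0 - (j == i)%:R * x0 i 0))); last exact/funext.
exact: cont_affine.
Qed.

Let mA0 : process_measurable (fun s w => XA s w - x0).
Proof.
move=> s j s01; rewrite (_ : (fun w => _) = (fun w => XA s w j 0 - x0 j 0)); last by apply/funext => w; rewrite !mxE.
by apply: measurable_funB => //; case: cA => + _; apply.
Qed.

Let mB0 : process_measurable (fun s w => XB s w - x0).
Proof.
move=> s j s01; rewrite (_ : (fun w => _) = (fun w => XB s w j 0 - x0 j 0)); last by apply/funext => w; rewrite !mxE.
by apply: measurable_funB => //; case: cB => + _; apply.
Qed.

Let measurable_linear d (T : measurableType d) (D : 'M[R]_m) (X : R -> T -> 'cV[R]_m) :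
  process_measurable X -> process_measurable (fun s w => D *m X s w).
Proof.
move=> mX s j s01; rewrite (_ : (fun w => _) = (fun w => \sum_k D j k * X s w k 0)); last first.
  by apply/funext => w; rewrite mxE.
by apply: measurable_bigsum => k _; apply: measurable_funM => //; exact: mX.
Qed.

Let null_gaussian z : gaussian P1 (fun s w => Xn z s w - x0) (null_cov z).
Proof.
rewrite (_ : (fun s w => _) = (fun s w => dilation z *m (XA s w.1 - x0))); last first.
  by apply/funext => s; apply/funext => w; rewrite /Xn addrC addKr.
exact: (gaussian_linear (dilation z) (gaussian_fst PB mA0 gA)).
Qed.

Let null_integrable z p q : leb.-integrable I01 (EFin \o (fun s => null_cov z s p q)).
Proof.
have := integrable_I01_scale (v z p * v z q) (iA p q).
congr (integrable _ _); apply/funext => s /=; congr EFin.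
rewrite /null_cov mul_diag_mx tr_diag_mx mul_mx_diag !mxE /v; ring.
Qed.

Let alt_gaussian z : gaussian P1 (fun s w => Xa z s w - x0) (fun s => null_cov z s + SB s).
Proof.
have -> : (fun s w => Xa z s w - x0) = (fun s w => dilation z *m (XA s w.1 - x0) + delta_mx i i *m (XB s w.2 - x0)).
  by apply/funext => s; apply/funext => w; rewrite /Xa addrC addKr.
have mA2 : process_measurable (fun s (w : TA * TB) => XA s w.1 - x0).
  by move=> s j s01; apply: (measurableT_comp (mA0 j s01)); exact: measurable_fst.
have mB2 : process_measurable (fun s (w : TA * TB) => XB s w.2 - x0).
  by move=> s j s01; apply: (measurableT_comp (mB0 j s01)); exact: measurable_snd.
have ind l A B : times01 l -> measurable A -> measurable B ->
    P1 (lincomb l (fun s w => dilation z *m (XA s w.1 - x0)) @^-1` A `&`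
        lincomb l (fun s w => delta_mx i i *m (XB s w.2 - x0)) @^-1` B) =
    (P1 (lincomb l (fun s w => dilation z *m (XA s w.1 - x0)) @^-1` A) *
     P1 (lincomb l (fun s w => delta_mx i i *m (XB s w.2 - x0)) @^-1` B))%E.
  move=> l01 mA mB.
  have mlA : measurable (lincomb l (fun s w => dilation z *m (XA s w - x0)) @^-1` A).
    by rewrite -[Y in measurable Y]setTI; exact: (measurable_lincomb l01 (measurable_linear (dilation z) mA0)).
  have mlB : measurable (lincomb l (fun s w => delta_mx i i *m (XB s w - x0)) @^-1` B).
    by rewrite -[Y in measurable Y]setTI; exact: (measurable_lincomb l01 (measurable_linear (delta_mx i i) mB0)).
  exact: (product_indep PA PB mlA mlB).
have gN := gaussian_linear (dilation z) (gaussian_fst PB mA0 gA).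
have gS := gaussian_ext SBE (gaussian_linear (delta_mx i i) (gaussian_snd PA mB0 gB)).
exact: (gaussian_add (measurable_linear (dilation z) mA2) (measurable_linear (delta_mx i i) mB2) ind
  (null_integrable z) iB gN gS).
Qed.

Let Yn z s (w : (TA * TB) * TC) : 'cV[R]_m := time_integral (Xn z) s w.1 + kap *: W s w.2.
Let Ya z s (w : (TA * TB) * TC) : 'cV[R]_m := time_integral (Xa z) s w.1 + kap *: W s w.2.

Let Yn_meas z : process_measurable (Yn z).
Proof. by move=> s j; exact: (measurable_observed (observed_product kap (Xn_cont z) (null_gaussian z) bW)). Qed.

Let Ya_meas z : process_measurable (Ya z).
Proof. by move=> s j; exact: (measurable_observed (observed_product kap (Xa_cont z) (alt_gaussian z) bW)). Qed.

(** By uniqueness of the law, expectations under the given law can be computed on the product space,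
    where null and alternative share their randomness. *)
Lemma signal_law_integral S (mu : probability (path_space R m) R) X (phi : path_space R m -> R) :
  signal_law x0 kap S mu -> continuous_process X -> gaussian P1 (fun s w => X s w - x0) S ->
  measurable_fun setT phi -> (forall y, 0 <= phi y) ->
  (\int[mu]_y (phi y)%:E = \int[P]_w (phi (fun s => time_integral X s w.1 + kap *: W s w.2))%:E)%E.
Proof.
move=> [d [T [Q [X' [W' [Y' [obs' muE]]]]]]] cX gX mphi phi0.
have obs := observed_product kap cX gX bW.
apply: law_integral => //; first by move=> s j; exact: (measurable_observed obs).
by move=> A mA; rewrite muE//; exact: (observed_law obs' obs).
Qed.

Variables (t1 t2 eps e : R).
Hypotheses (t10 : 0 <= t1) (t12 : t1 <= t2) (t21 : t2 <= 1) (eps0 : 0 < eps) (e0 : 0 < e).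
Hypotheses (SA0 : forall s, s \in `[0, 1] -> 0 <= SA s i i)
  (SAJ : forall s, s \in `[0, 1] -> s \notin `[t1, t2] -> SA s i i = 0)
  (SB0 : forall s, s \in `[0, 1] -> 0 <= SB s i i)
  (SBJ : forall s, s \in `[0, 1] -> s \notin `[t1, t2] -> SB s i i = 0).
Let VA := \int[leb]_(u in I01) SA u i i.
Let VB := \int[leb]_(u in I01) SB u i i.
Hypothesis VA0 : 0 < VA.

Let VB0 : 0 <= VB.
Proof. by apply: Rintegral_ge0 => u; exact: SB0. Qed.

Let one01 : (1 : R) \in `[0, 1]. Proof. by rewrite in_itv /= ler01 lexx. Qed.

Let Zc s (a : TA) : R := (XA s a - x0) i 0.
Let Bc s (b : TB) : R := (XB s b - x0) i 0.
(** The event on which division by the terminal value is under control. Off it [ratio] is 0 and the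
    trivial loss 1 is accepted, at the price of its probability, at most [2 * eps]. *)
Let good : set TA := [set a | eps * Num.sqrt VA <= `|Zc 1 a|].
(* Replacing [z] by [z + ratio] in the null signal reproduces the increment over [[0, 1]]
   of the additional component [Bc], so that the remaining drift [f] vanishes off [[t1, t2]]. *)
Let ratio (w : TA * TB) : R := \1_good w.1 * (Bc 1 w.2 / Zc 1 w.1).
Let f (w : TA * TB) s : R := Bc s w.2 - ratio w * Zc s w.1.

Let mgood : measurable good.
Proof.
rewrite (_ : good = Zc 1 @^-1` ((fun y : R => `|y|) @^-1` [set` `[eps * Num.sqrt VA, +oo[])); last first.
  by apply/seteqP; split => a /=; rewrite in_itv /= andbT.
rewrite -[Y in measurable Y]setTI; apply: (mA0 i one01) => //.
by rewrite -[Y in measurable Y]setTI; apply: normr_measurable => //; exact: measurable_itv.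
Qed.

Let mratio : measurable_fun setT ratio.
Proof.
apply: measurable_funM.
  by apply: (measurableT_comp (measurable_indic mgood)); exact: measurable_fst.
apply: measurable_funM.
  by apply: (measurableT_comp (mB0 i one01)); exact: measurable_snd.
apply: (measurableT_comp (@measurable_inv R)).
by apply: (measurableT_comp (mA0 i one01)); exact: measurable_fst.
Qed.

Let bad_le : (PA (~` good) <= (2 * eps)%:E)%E.
Proof.
have mZ : measurable_fun setT (Zc 1) := mA0 i one01.
have cosZ a c : \int[PA]_w cos (a + c * Zc 1 w) = cos a * expR (- (c ^+ 2 * VA / 2)).
  have l01 : times01 [:: (1, delta_mx i 0 : 'cV[R]_m)] by rewrite /times01 /= one01.
  rewrite /VA -(gcov_total SA i) -(lincomb_cos gA iA a c l01).
  by apply: eq_Rintegral => w _; rewrite lincomb_coord.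
have := gaussian_small_ball mZ cosZ VA0 (ltW eps0).
congr (PA _ <= _)%E; apply/seteqP; split => a /=; rewrite /good /= ltNge; first by move/negP.
by move=> h; apply/negP.
Qed.

Let DZ := off_window_increment (fun s a => XA s a - x0) i t2.
Let DB := off_window_increment (fun s b => XB s b - x0) i t2.

(** On [good] one has [ratio * Zc 1 = Bc 1], so after the window both terminal values can be
    subtracted without changing [f]. *)
Let f_good w s : good w.1 -> f w s = DB s w.2 - ratio w * DZ s w.1.
Proof.
move=> gw; have Z0 : Zc 1 w.1 != 0.
  by rewrite -normr_gt0; apply: lt_le_trans gw; rewrite mulr_gt0// sqrtr_gt0.
rewrite /f /DB /DZ /off_window_increment -/(Zc s w.1) -/(Zc 1 w.1) -/(Bc s w.2) -/(Bc 1 w.2).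
have rZ : ratio w * Zc 1 w.1 = Bc 1 w.2 by rewrite /ratio indicE mem_set// mul1r divfK.
by case: ifP => // _; rewrite mulrBr rZ; ring.
Qed.

Let ratio_sqr w : ratio w ^+ 2 <= (eps ^+ 2 * VA)^-1 * Bc 1 w.2 ^+ 2.
Proof.
have eV : 0 < eps ^+ 2 * VA by rewrite mulr_gt0// exprn_gt0.
rewrite /ratio indicE; have [/set_mem gw|_] := boolP (w.1 \in good); last first.
  by rewrite mul0r expr0n mulr_ge0 ?sqr_ge0// invr_ge0 ltW.
rewrite mul1r exprMn mulrC ler_wpM2r ?sqr_ge0// exprVn lef_pV2 ?posrE//.
  rewrite -(sqr_sqrtr (ltW VA0)) -exprMn -[leRHS]real_normK ?num_real//.
  by rewrite ler_sqr ?nnegrE// mulr_ge0// ?sqrtr_ge0// ltW.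
rewrite -real_normK ?num_real// exprn_gt0//.
by apply: lt_le_trans gw; rewrite mulr_gt0// sqrtr_gt0.
Qed.

Let second_B : (\int[PB]_b (Bc 1 b ^+ 2)%:E <= VB%:E)%E.
Proof.
have l01 : times01 [:: (1, delta_mx i 0 : 'cV[R]_m)] by rewrite /times01 /= one01.
have := lincomb_moment mB0 gB iB l01; rewrite gcov_total.
by under eq_integral do rewrite lincomb_coord.
Qed.

Let mBc1 : measurable_fun setT (Bc 1). Proof. exact: mB0. Qed.

Let ratio_moment : (\int[P1]_w (ratio w ^+ 2)%:E <= (VB / (eps ^+ 2 * VA))%:E)%E.
Proof.
have eV : 0 < eps ^+ 2 * VA by rewrite mulr_gt0// exprn_gt0.
have mb2 : measurable_fun setT (fun b => Bc 1 b ^+ 2) by exact: measurable_funX.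
apply: (@le_trans _ _ (\int[P1]_w ((fun b => (eps ^+ 2 * VA)^-1 * Bc 1 b ^+ 2) w.2)%:E)%E).
  apply: ge0_le_integral => //.
  - by move=> w _; rewrite lee_fin sqr_ge0.
  - by apply/measurable_EFinP; exact: measurable_funX.
  - apply/measurable_EFinP; apply: measurable_funM => //.
    by apply: (measurableT_comp mb2); exact: measurable_snd.
  - by move=> w _; rewrite lee_fin.
rewrite (ge0_integral_snd PA PB (f := fun b => ((eps ^+ 2 * VA)^-1 * Bc 1 b ^+ 2)%:E)).
- rewrite ge0_integral_EFinZ//; last 2 first.
  + by move=> b; exact: sqr_ge0.
  + by rewrite invr_ge0 ltW.
  rewrite [X in (_ <= X)%E](_ : _ = ((eps ^+ 2 * VA)^-1)%:E * VB%:E)%E; last by rewrite -EFinM mulrC.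
  by rewrite lee_wpmul2l// lee_fin invr_ge0 ltW.
- by apply/measurable_EFinP; apply: measurable_funM.
- by move=> b; rewrite lee_fin mulr_ge0 ?sqr_ge0// invr_ge0 ltW.
Qed.

(** Young's inequality [|r| <= e / 2 + r ^+ 2 / (2 * e)] reduces the first moment to the second. *)
Let ratio_abs : (\int[P1]_w (`|ratio w|)%:E <= (e / 2 + VB / (eps ^+ 2 * VA) / (2 * e))%:E)%E.
Proof.
have m2 : measurable_fun setT (fun w => ratio w ^+ 2) by exact: measurable_funX.
have v0 : 0 <= (2 * e)^-1 by rewrite invr_ge0 mulr_ge0// ltW.
have u0 : 0 <= e / 2 by rewrite divr_ge0// ltW.
apply: (@le_trans _ _ (\int[P1]_w (e / 2 + (2 * e)^-1 * ratio w ^+ 2)%:E)%E).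
  apply: ge0_le_integral => //.
  - by apply/measurable_EFinP; exact: measurableT_comp.
  - by apply/measurable_EFinP; apply: measurable_funD => //; exact: measurable_funM.
  move=> w _; rewrite lee_fin.
  have : 0 <= (2 * e)^-1 * (`|ratio w| - e) ^+ 2 by rewrite mulr_ge0// sqr_ge0.
  have -> : (2 * e)^-1 * (`|ratio w| - e) ^+ 2 = (2 * e)^-1 * `|ratio w| ^+ 2 + e / 2 - `|ratio w|.
    by field; rewrite gt_eqF.
  by rewrite real_normK ?num_real//; lra.
rewrite ge0_integral_EFinD//; last 2 first.
- by move=> w; rewrite mulr_ge0// sqr_ge0.
- exact: measurable_funM.
have Eu : (\int[P1]_w ((e / 2)%:E) = (e / 2)%:E)%E.
  by have := integral_cst P1 measurableT (e / 2)%:E; rewrite [X in (_ * X)%E]probability_setT mule1.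
rewrite Eu EFinD leeD2l// ge0_integral_EFinZ//; last by move=> w; exact: sqr_ge0.
rewrite [X in (_ <= X)%E](_ : _ = ((2 * e)^-1)%:E * (VB / (eps ^+ 2 * VA))%:E)%E; last first.
  by rewrite -EFinM mulrC.
by rewrite lee_wpmul2l// lee_fin.
Qed.

Let null_integral z s w j : s \in `[0, 1] -> time_integral (Xn z) s w j 0 =
  v z j * time_integral XA s w.1 j 0 + (1 - v z j) * x0 j 0 * s.
Proof.
move=> s01; rewrite !mxE.
transitivity (\int[leb]_(u in [set` `[0%R, s]]) (v z j * XA u w.1 j 0 + 0 * XA u w.1 j 0 + (1 - v z j) * x0 j 0)).
  by apply: eq_Rintegral => u _; rewrite XnE mul0r addr0.
by rewrite Rintegral_affine// mul0r addr0.
Qed.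

Let alt_integral z s w j : s \in `[0, 1] -> time_integral (Xa z) s w j 0 =
  v z j * time_integral XA s w.1 j 0 + (j == i)%:R * time_integral XB s w.2 i 0 +
  ((1 - v z j) * x0 j 0 - (j == i)%:R * x0 i 0) * s.
Proof.
move=> s01; rewrite !mxE -Rintegral_affine//.
by apply: eq_Rintegral => u _; rewrite XaE.
Qed.

Let f_cont w : {within I01, continuous (f w)}.
Proof.
rewrite (_ : f w = fun s => 1 * XB s w.2 i 0 + (- ratio w) * XA s w.1 i 0 + (ratio w * x0 i 0 - x0 i 0)).
  exact: cont_affine.
by apply/funext => s; rewrite /f /Bc /Zc !mxE; ring.
Qed.

Let f_integral w s : s \in `[0, 1] -> \int[leb]_(u in [set` `[0%R, s]]) f w u =
  time_integral XB s w.2 i 0 - ratio w * time_integral XA s w.1 i 0 + (ratio w * x0 i 0 - x0 i 0) * s.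
Proof.
move=> s01; rewrite !mxE.
transitivity (\int[leb]_(u in [set` `[0%R, s]])
    (1 * XB u w.2 i 0 + (- ratio w) * XA u w.1 i 0 + (ratio w * x0 i 0 - x0 i 0))).
  by apply: eq_Rintegral => u _; rewrite /f /Bc /Zc !mxE; ring.
by rewrite Rintegral_affine// mul1r mulNr.
Qed.

Let Q w : R := \int[leb]_(s in I01) (f w s ^+ 2).

(** From [(x - y) ^+ 2 <= 2 * x ^+ 2 + 2 * y ^+ 2]: the first term has mean at most [2 * VB]; in the
    second the factor [VA] of the signal cancels against the [eps ^+ 2 * VA] in the denominator of
    the squared ratio. *)
Let C : R := 2 * VB + 2 * VB / eps ^+ 2.

Let C0 : 0 <= C.
Proof. by apply: addr_ge0; [exact: mulr_ge0|apply: divr_ge0; [exact: mulr_ge0|exact: sqr_ge0]]. Qed.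

(** The squared ratio is bounded by a function of the second component alone. The product with the
    squared increment of the first component therefore factorises, and both factors of [A] and [B]
    type vanish in mean off the window. *)
Let f_moment s : s \in `[0, 1] ->
  (\int[P1]_w (\1_good w.1 * f w s ^+ 2)%:E <= (C * \1_[set` `[t1, t2]] s)%:E)%E.
Proof.
move=> s01; pose k := 2 / (eps ^+ 2 * VA).
have eV : 0 < eps ^+ 2 * VA by rewrite mulr_gt0// exprn_gt0.
have k0 : 0 <= k by rewrite divr_ge0// ltW.
have mDZ : measurable_fun setT (DZ s) := measurable_off_window i mA0 t2 s01.
have mDB : measurable_fun setT (DB s) := measurable_off_window i mB0 t2 s01.
have mDZ2 : measurable_fun setT (fun a => DZ s a ^+ 2) by exact: measurable_funX.
have mDB2 : measurable_fun setT (fun b => DB s b ^+ 2) by exact: measurable_funX.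
have mB12 : measurable_fun setT (fun b => Bc 1 b ^+ 2) by exact: measurable_funX.
have mf : measurable_fun setT (fun w => \1_good w.1 * f w s ^+ 2).
  apply: measurable_funM.
    by apply: (measurableT_comp (measurable_indic mgood)); exact: measurable_fst.
  apply: measurable_funX; apply: measurable_funB.
    by apply: (measurableT_comp (mB0 i s01)); exact: measurable_snd.
  apply: measurable_funM => //.
  by apply: (measurableT_comp (mA0 i s01)); exact: measurable_fst.
have ma : measurable_fun setT (fun w : TA * TB => 2 * DB s w.2 ^+ 2).
  by apply: measurable_funM => //; apply: (measurableT_comp mDB2); exact: measurable_snd.
have mb : measurable_fun setT (fun w : TA * TB => DZ s w.1 ^+ 2 * (k * Bc 1 w.2 ^+ 2)).
  apply: measurable_funM; first by apply: (measurableT_comp mDZ2); exact: measurable_fst.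
  by apply: measurable_funM => //; apply: (measurableT_comp mB12); exact: measurable_snd.
have a0 (w : TA * TB) : 0 <= 2 * DB s w.2 ^+ 2 by rewrite mulr_ge0// sqr_ge0.
have b0 (w : TA * TB) : 0 <= DZ s w.1 ^+ 2 * (k * Bc 1 w.2 ^+ 2).
  by apply: mulr_ge0; [exact: sqr_ge0|apply: mulr_ge0 => //; exact: sqr_ge0].
apply: (@le_trans _ _ (\int[P1]_w (2 * DB s w.2 ^+ 2 + DZ s w.1 ^+ 2 * (k * Bc 1 w.2 ^+ 2))%:E)%E).
  apply: ge0_le_integral => //.
  - by move=> w _; rewrite lee_fin mulr_ge0// sqr_ge0.
  - exact/measurable_EFinP.
  - by apply/measurable_EFinP; exact: measurable_funD.
  move=> w _; rewrite lee_fin indicE; have [/set_mem gw|_] := boolP (w.1 \in good); last first.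
    by rewrite mul0r addr_ge0.
  rewrite mul1r f_good//.
  apply: (@le_trans _ _ (2 * DB s w.2 ^+ 2 + 2 * (ratio w ^+ 2 * DZ s w.1 ^+ 2))).
    have := sqr_ge0 (DB s w.2 + ratio w * DZ s w.1); rewrite -exprMn; nra.
  rewrite lerD2l [leRHS](_ : _ = 2 * ((eps ^+ 2 * VA)^-1 * Bc 1 w.2 ^+ 2 * DZ s w.1 ^+ 2)); last first.
    by rewrite /k; ring.
  by rewrite ler_wpM2l// ler_wpM2r ?sqr_ge0.
rewrite (ge0_integral_EFinD P1 a0 ma b0 mb).
have h1 : (\int[P1]_w (2 * DB s w.2 ^+ 2)%:E <= (2 * (VB * \1_[set` `[t1, t2]] s))%:E)%E.
  rewrite (ge0_integral_snd PA PB (f := fun b => (2 * DB s b ^+ 2)%:E)); last 2 first.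
  - by apply/measurable_EFinP; exact: measurable_funM.
  - by move=> b; rewrite lee_fin mulr_ge0// sqr_ge0.
  rewrite (ge0_integral_EFinZ PB (fun b => sqr_ge0 (DB s b)) mDB2)// EFinM lee_wpmul2l//.
  exact: (off_window_moment mB0 gB iB SB0 SBJ s01).
have h2 : (\int[P1]_w (DZ s w.1 ^+ 2 * (k * Bc 1 w.2 ^+ 2))%:E <=
    (VA * \1_[set` `[t1, t2]] s * (k * VB))%:E)%E.
  have mk : measurable_fun setT (fun b => k * Bc 1 b ^+ 2) by exact: measurable_funM.
  have k0' b : 0 <= k * Bc 1 b ^+ 2 by rewrite mulr_ge0// sqr_ge0.
  rewrite (ge0_integral_prod PA PB mDZ2 mk (fun a => sqr_ge0 (DZ s a)) k0').
  rewrite EFinM; apply: lee_pmul.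
  - by apply: integral_ge0 => a _; rewrite lee_fin sqr_ge0.
  - by apply: integral_ge0 => b _; rewrite lee_fin.
  - exact: (off_window_moment mA0 gA iA SA0 SAJ s01).
  rewrite (ge0_integral_EFinZ PB (fun b => sqr_ge0 (Bc 1 b)) mB12 k0) [X in (_ <= X)%E]EFinM lee_wpmul2l//.
apply: le_trans (leeD h1 h2) _; rewrite -EFinD lee_fin.
rewrite (_ : 2 * (VB * \1_[set` `[t1, t2]] s) + VA * \1_[set` `[t1, t2]] s * (k * VB) = C * \1_[set` `[t1, t2]] s)//.
rewrite /C /k; field; apply/andP; split; first by rewrite gt_eqF.
by rewrite gt_eqF.
Qed.

(** Joint measurability of the signal is available for times in [[0, 1[]; extension by 0 gives
    functions measurable on the whole product, as Tonelli requires. The single time 1 does not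
    affect integrals. *)
Let window : set (TA * measurableTypeR R) := [set y | 0 <= y.2 < 1].
Let windowB : set (TB * measurableTypeR R) := [set y | 0 <= y.2 < 1].

Let XAt := (fun y : TA * measurableTypeR R => XA y.2 y.1 i 0) \_ window.
Let XBt := (fun y : TB * measurableTypeR R => XB y.2 y.1 i 0) \_ windowB.

Let measurable_window d (T : measurableType d) : measurable ([set y | 0 <= y.2 < 1] : set (T * measurableTypeR R)).
Proof.
rewrite (_ : [set y | _] = setT `&` snd @^-1` [set` `[0%R, 1%R[]); first exact: measurable_snd.
by apply/seteqP; split => z /=; rewrite in_itv //= => -[].
Qed.

Let mXAt : measurable_fun setT XAt.
Proof. by apply/(measurable_restrictT _ (@measurable_window _ _)); exact: measurable_process. Qed.

Let mXBt : measurable_fun setT XBt.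
Proof. by apply/(measurable_restrictT _ (@measurable_window _ _)); exact: measurable_process. Qed.

Let g (y : (TA * TB) * measurableTypeR R) : R :=
  \1_good y.1.1 * ((XBt (y.1.2, y.2) - x0 i 0) - ratio y.1 * (XAt (y.1.1, y.2) - x0 i 0)) ^+ 2 *
  \1_[set` `[0%R, 1%R[] y.2.

Let gE w s : g (w, s) = ((fun s => \1_good w.1 * f w s ^+ 2) \_ [set` `[0%R, 1%R[]) s.
Proof.
rewrite /g /= patchE indicE [\1_[set` `[0%R, 1%R[] s]indicE.
have [|_] := boolP (s \in _); last by rewrite mulr0.
rewrite inE /= in_itv /= => s01; rewrite mulr1.
have -> : XAt (w.1, s) = XA s w.1 i 0 by rewrite /XAt patchE mem_set.
have -> : XBt (w.2, s) = XB s w.2 i 0 by rewrite /XBt patchE mem_set.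
by rewrite /f /Bc /Zc !mxE.
Qed.

Let g0 y : 0 <= g y.
Proof. by apply: mulr_ge0 => //; apply: mulr_ge0 => //; exact: sqr_ge0. Qed.

Let mg : measurable_fun setT g.
Proof.
have m11 : measurable_fun setT (fun y : (TA * TB) * measurableTypeR R => y.1.1).
  by apply: measurableT_comp; [exact: measurable_fst|exact: measurable_fst].
have m12 : measurable_fun setT (fun y : (TA * TB) * measurableTypeR R => y.1.2).
  by apply: measurableT_comp; [exact: measurable_snd|exact: measurable_fst].
have m2 : measurable_fun setT (fun y : (TA * TB) * measurableTypeR R => y.2) by exact: measurable_snd.
apply: measurable_funM; last first.
  rewrite (_ : (fun y => _) = \1_(snd @^-1` [set` `[0%R, 1%R[])); last by apply/funext => y; rewrite !indicE.
  by apply: measurable_indic; rewrite -[X in measurable X]setTI; exact: measurable_snd.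
apply: measurable_funM; first exact: (measurableT_comp (measurable_indic mgood) m11).
apply: measurable_funX; apply: measurable_funB.
  by apply: measurable_funB => //; apply: (measurableT_comp mXBt); exact/measurable_fun_pair.
apply: measurable_funM; first by apply: (measurableT_comp mratio); exact: measurable_fst.
by apply: measurable_funB => //; apply: (measurableT_comp mXAt); exact/measurable_fun_pair.
Qed.

Let Q_sections w : (\int[leb]_s (g (w, s))%:E = (\1_good w.1 * Q w)%:E)%E.
Proof.
have cf2 := continuous_sqr01 (@f_cont w).
have cg2 : {within I01, continuous (fun s => \1_good w.1 * f w s ^+ 2)}.
  by move=> s; apply: cvgM; [exact: cvg_cst|exact: cf2].
have jf := integrable_continuous01 cf2 one01; have jg := integrable_continuous01 cg2 one01.
rewrite /Q -RintegralZl//.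
rewrite /Rintegral fineK; last exact: integrable_fin_num.
rewrite -integral_itv_bndo_bndc; last first.
  apply: measurable_funS (measurable_itv _) _ _; last by case/integrableP : jg => + _; exact.
  by move=> s /=; rewrite !in_itv /= => /andP[-> /ltW].
rewrite [RHS]integral_mkcond; apply: eq_integral => s _.
by rewrite gE !patchE; case: ifP.
Qed.

Let Q_moment : (\int[P1]_w (\1_good w.1 * Q w)%:E <= (C * (t2 - t1))%:E)%E.
Proof.
have mgE : measurable_fun setT (fun y => (g y)%:E) by exact/measurable_EFinP.
have gE0 y : (0 <= (g y)%:E)%E by rewrite lee_fin; exact: g0.
have mgE2 : measurable_fun setT (fun y : (TA * TB) * measurableTypeR R => (g (y.1, y.2))%:E).
  by rewrite (_ : (fun y => _) = (fun y => (g y)%:E))//; apply/funext => -[].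
have gE2 (w : TA * TB) (s : R) : (0 <= (g (w, s))%:E)%E by exact: gE0.
have -> : (\int[P1]_w (\1_good w.1 * Q w)%:E = \int[leb]_s \int[P1]_w (g (w, s))%:E)%E.
  by rewrite -(tonelli_lebesgue P1 mgE2 gE2); apply: eq_integral => w _; rewrite Q_sections.
apply: (@le_trans _ _ (\int[leb]_s (C%:E * (\1_[set` `[t1, t2]] s)%:E))%E).
  apply: ge0_le_integral => //.
  - by move=> s _; apply: integral_ge0 => w _; rewrite lee_fin.
  - exact: (measurable_integral_time P1 mgE2 gE2).
  - apply: emeasurable_funM => //; apply/measurable_EFinP; apply: measurable_indic; exact: measurable_itv.
  move=> s _; rewrite -EFinM; have [s01|s01] := boolP (s \in `[0, 1[).
    rewrite (eq_integral (fun w => (\1_good w.1 * f w s ^+ 2)%:E)); last first.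
      by move=> w _; rewrite gE patchE mem_set.
    by apply: f_moment; move: s01; rewrite !in_itv /= => /andP[-> /ltW].
  rewrite integral0_eq; first by rewrite lee_fin mulr_ge0.
  by move=> w _; rewrite gE patchE memNset//=; apply/negP.
have mJ : measurable [set` `[t1, t2]] by exact: measurable_itv.
have LJ : (leb [set` `[t1, t2]] = (t2 - t1)%:E)%E.
  rewrite lebesgue_measure_itv /= lte_fin; case: ltP => [_|]; first by rewrite -EFinB.
  by move=> h; have -> : t2 = t1 by [apply/eqP; rewrite eq_le h t12]; rewrite subrr.
rewrite ge0_integralZl//; last by apply/measurable_EFinP; exact: measurable_indic.
by rewrite integral_indic// setIT EFinM [X in (_ * X <= _)%E]LJ.
Qed.

Variable phi : path_space R m -> R.
Hypotheses (mphi : measurable_fun setT phi) (phi01 : forall y, 0 <= phi y <= 1).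

Let phi0 y : 0 <= phi y. Proof. by have /andP[] := phi01 y. Qed.

Let G z (w : TA * TB) : \bar R := (\int[PC]_c (phi (fun s => Yn z s (w, c)))%:E)%E.

(** For fixed signals the alternative with [z] and the null with [z + ratio w] differ by the
    deterministic drift obtained by integrating [f w] in coordinate [i]. Its energy is [Q w], and
    the Brownian shift bound applies conditionally. *)
Let shift_le z w :
  (\int[PC]_c (phi (fun s => Ya z s (w, c)))%:E <= G (z + ratio w) w + (e + Q w / kap ^+ 2 / e)%:E)%E.
Proof.
(* Defined as a difference, so that the two paths agree for every real [s]; it is identified with
   the integral of [f] on [[0, 1]], where the energy bound is needed. *)
pose F s : R := time_integral (Xa z) s w i 0 - time_integral (Xn (z + ratio w)) s w i 0.
pose E s : R := \int[leb]_(u in [set` `[0%R, s]]) (f w u ^+ 2).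
have FE s : s \in `[0, 1] -> F s = \int[leb]_(u in [set` `[0%R, s]]) f w u.
  move=> s01; rewrite f_integral// /F null_integral// alt_integral// /v eqxx /=; ring.
have zero01 : (0 : R) \in `[0, 1] by rewrite in_itv /= ler01 lexx.
have F0 : F 0 = 0 by rewrite FE// set_itv1 Rintegral_set1.
have E0 : E 0 = 0 by rewrite /E set_itv1 Rintegral_set1.
have energy s t : 0 <= s -> s < t -> t <= 1 -> (F t - F s) ^+ 2 <= (t - s) * (E t - E s).
  move=> s0 st t1'; have h := integral_energy (@f_cont w) s0 st t1'; cbv zeta in h.
  have s01 : s \in `[0, 1] by rewrite in_itv /= s0 (le_trans (ltW st)).
  have t01 : t \in `[0, 1] by rewrite in_itv /= t1' (le_trans s0 (ltW st)).
  by rewrite !FE.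
have := brownian_shift i bW kap0 F0 energy (fun s => time_integral (Xn (z + ratio w)) s w) e0 mphi phi01.
rewrite E0 subr0 -/(Q w) => h.
rewrite (_ : (fun c => (phi (fun s => Ya z s (w, c)))%:E) = (fun c => (phi (fun s =>
  time_integral (Xn (z + ratio w)) s w + F s *: delta_mx i 0 + kap *: W s c))%:E)) //.
apply/funext => c; congr (phi _)%:E; apply/funext => s; congr (_ + _).
have dE j : (F s *: (delta_mx i 0 : 'cV[R]_m)) j 0 = F s * (j == i)%:R by rewrite !mxE andbT.
apply/colP => j; rewrite [RHS]mxE dE /F.
have [->|ji] := eqVneq j i; first by rewrite mulr1 addrC subrK.
rewrite mulr0 addr0 !mxE; apply: eq_Rintegral => u _.
by rewrite XaE XnE /v (negbTE ji) !mul0r addr0 subr0.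
Qed.

(** Here [z] is a coordinate of the sample point. This gives the joint measurability of [G] in [z]
    and the signals that the averaging over [z] relies on. *)
Let YB s (b : (measurableTypeR R * (TA * TB)) * TC) : 'cV[R]_m := Yn b.1.1 s (b.1.2, b.2).

Let mYB : process_measurable YB.
Proof.
move=> s j s01.
rewrite (_ : (fun b => _) = (fun b => v b.1.1 j * time_integral XA s b.1.2.1 j 0 + (1 - v b.1.1 j) * x0 j 0 * s +
    kap * W s b.2 j 0)); last first.
  by apply/funext => b; rewrite /YB /Yn mxE [X in _ + X]mxE null_integral.
have mz : measurable_fun setT (fun b : (measurableTypeR R * (TA * TB)) * TC => v b.1.1 j).
  rewrite /v; case: (j == i) => //.
  by apply: measurableT_comp; [exact: measurable_fst|exact: measurable_fst].
have ma : measurable_fun setT (fun b : (measurableTypeR R * (TA * TB)) * TC => time_integral XA s b.1.2.1 j 0).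
  apply: (measurableT_comp (measurable_time_integral j cA s01)).
  apply: measurableT_comp; first exact: measurable_fst.
  by apply: measurableT_comp; [exact: measurable_snd|exact: measurable_fst].
have mw : measurable_fun setT (fun b : (measurableTypeR R * (TA * TB)) * TC => W s b.2 j 0).
  have mW : process_measurable W by case: bW => -[+ _] _.
  by apply: (measurableT_comp (mW s j s01)); exact: measurable_snd.
apply: measurable_funD; last exact: measurable_funM.
apply: measurable_funD; first exact: measurable_funM.
apply: measurable_funM => //; apply: measurable_funM => //.
exact: measurable_funB.
Qed.

Let mphiB : measurable_fun setT (fun b : (measurableTypeR R * (TA * TB)) * TC => (phi (fun s => YB s b))%:E).
Proof. by apply/measurable_EFinP; apply: (measurableT_comp mphi); exact: (measurable_path mYB). Qed.

Let mG : measurable_fun setT (fun y : measurableTypeR R * (TA * TB) => G y.1 y.2).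
Proof.
have := measurable_fun_fubini_tonelli_F (m2 := PC) _ mphiB.
by apply => b; rewrite lee_fin.
Qed.

Let G0 z w : (0 <= G z w)%E.
Proof. by apply: integral_ge0 => c _; rewrite lee_fin. Qed.

Let mphic z w : measurable_fun setT (fun c => phi (fun s => Yn z s (w, c))).
Proof.
apply: (measurableT_comp mphi); apply: (measurable_path (U := fun s c => Yn z s (w, c))) => s j s01.
by have := measurableT_comp (Yn_meas z j s01) (pair1_measurable w).
Qed.

Let G1 z w : (G z w <= 1)%E.
Proof. by apply: probability_integral_le1; [exact: mphic|move=> c; exact: phi01]. Qed.

Let mQ : measurable_fun setT (fun w => \1_good w.1 * Q w).
Proof.
have mgE : measurable_fun setT (fun y => (g y)%:E) by exact/measurable_EFinP.
have gE0 y : (0 <= (g y)%:E)%E by rewrite lee_fin; exact: g0.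
apply/measurable_EFinP.
have mgE2 : measurable_fun setT (fun y : (TA * TB) * measurableTypeR R => (g (y.1, y.2))%:E).
  by rewrite (_ : (fun y => _) = (fun y => (g y)%:E))//; apply/funext => -[].
have := measurable_integral_lebesgue mgE2 (fun w s => gE0 (w, s)).
by congr (measurable_fun _ _); apply/funext => w /=; rewrite -Q_sections.
Qed.

Let Q0 w : 0 <= \1_good w.1 * Q w.
Proof. by apply: mulr_ge0 => //; apply: Rintegral_ge0 => s _; exact: sqr_ge0. Qed.

Let loss (w : TA * TB) : R := \1_(~` good) w.1 + (e + (kap ^+ 2 * e)^-1 * (\1_good w.1 * Q w)).

Let k2e : 0 <= (kap ^+ 2 * e)^-1.
Proof. by rewrite invr_ge0 mulr_ge0 ?sqr_ge0// ltW. Qed.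

Let loss2 w : 0 <= e + (kap ^+ 2 * e)^-1 * (\1_good w.1 * Q w).
Proof. by apply: addr_ge0; [exact: ltW|exact: mulr_ge0]. Qed.

Let loss0 w : 0 <= loss w.
Proof. by apply: addr_ge0. Qed.

Let mbad : measurable_fun setT (fun w : TA * TB => \1_(~` good) w.1 : R).
Proof.
apply: (measurableT_comp (f := \1_(~` good) : TA -> R)); last exact: measurable_fst.
by apply: measurable_indic; exact: measurableC.
Qed.

Let mloss2 : measurable_fun setT (fun w => e + (kap ^+ 2 * e)^-1 * (\1_good w.1 * Q w)).
Proof. by apply: measurable_funD => //; apply: measurable_funM. Qed.

Let mloss : measurable_fun setT loss.
Proof. exact: measurable_funD. Qed.

Let loss_le : (\int[P1]_w (loss w)%:E <= (2 * eps + (e + (kap ^+ 2 * e)^-1 * (C * (t2 - t1))))%:E)%E.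
Proof.
have bad0 (w : TA * TB) : 0 <= (\1_(~` good) w.1 : R) by [].
rewrite (ge0_integral_EFinD P1 bad0 mbad loss2 mloss2) [X in (_ <= X)%E]EFinD; apply: leeD.
  rewrite (ge0_integral_fst PA PB (f := fun a => (\1_(~` good) a)%:E)); last 2 first.
  - by apply/measurable_EFinP; apply: measurable_indic; exact: measurableC.
  - by move=> a; rewrite lee_fin.
  by rewrite integral_indic// ?setIT//; exact: measurableC.
have Z0 (w : TA * TB) : 0 <= (kap ^+ 2 * e)^-1 * (\1_good w.1 * Q w) by exact: mulr_ge0.
have mZ : measurable_fun setT (fun w => (kap ^+ 2 * e)^-1 * (\1_good w.1 * Q w)) by exact: measurable_funM.
rewrite (ge0_integral_EFinD P1 (fun=> ltW e0) _ Z0 mZ)//.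
have -> : (\int[P1]_w e%:E = e%:E)%E.
  by have := integral_cst P1 measurableT e%:E; rewrite [X in (_ * X)%E]probability_setT mule1.
by rewrite EFinD leeD2l// (ge0_integral_EFinZ P1 Q0 mQ k2e) EFinM lee_wpmul2l// lee_fin.
Qed.

Let mGr : measurable_fun setT (fun y : (TA * TB) * measurableTypeR R => G y.2 y.1).
Proof.
apply: (measurableT_comp mG (g := fun y : (TA * TB) * measurableTypeR R => (y.2, y.1))).
by apply/measurable_fun_pairP; split; [exact: measurable_snd|exact: measurable_fst].
Qed.

Let mGratio z : measurable_fun setT (fun w => G (z + ratio w) w).
Proof.
apply: (measurableT_comp mG (g := fun w : TA * TB => (z + ratio w, w))).
apply/measurable_fun_pairP; split; last exact: measurable_id.
by apply: (measurable_funD (measurable_cst z) mratio).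
Qed.

Let alt_le z : (\int[P1]_w \int[PC]_c (phi (fun s => Ya z s (w, c)))%:E <=
  \int[P1]_w G (z + ratio w) w + (2 * eps + (e + (kap ^+ 2 * e)^-1 * (C * (t2 - t1))))%:E)%E.
Proof.
have mphia : measurable_fun setT (fun y : (TA * TB) * TC => (phi (fun s => Ya z s y))%:E).
  by apply/measurable_EFinP; apply: (measurableT_comp mphi); exact: (measurable_path (Ya_meas z)).
have phia0 (y : (TA * TB) * TC) : (0 <= (phi (fun s => Ya z s y))%:E)%E by rewrite lee_fin.
apply: (integral_le_loss _ (mGratio z) mloss _ _ loss0 _ loss_le).
- exact: (measurable_fun_fubini_tonelli_F (m2 := PC) _ mphia phia0).
- by move=> w; apply: integral_ge0 => c _; exact: phia0.
- by move=> w; exact: G0.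
move=> w; rewrite /loss !indicE in_setC; have [gw|gw] := boolP (w.1 \in good).
  rewrite add0r mul1r; apply: le_trans (shift_le z w) _; apply: leeD; first exact: lexx.
  rewrite (_ : Q w / kap ^+ 2 / e = (kap ^+ 2 * e)^-1 * Q w); first exact: lexx.
  by field; rewrite !gt_eqF.
apply: (@le_trans _ _ 1%E); last first.
  rewrite -[X in (X <= _)%E]add0e; apply: leeD; first exact: G0.
  by rewrite lee_fin mul0r mulr0 addr0 lerDl ltW.
apply: (@probability_integral_le1 _ _ _ PC (fun c => phi (fun s => Ya z s (w, c)))); last by move=> c; exact: phi01.
apply: (measurableT_comp mphi); apply: (measurable_path (U := fun s c => Ya z s (w, c))) => s j s01.
by have := measurableT_comp (Ya_meas z j s01) (pair1_measurable w).
Qed.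

(* Averaging over [z] absorbs the random shift [ratio]; the drift [f] costs its energy
   relative to the noise by the Cameron-Martin formula. *)
Lemma mixture_bound (mu mu' : R -> probability (path_space R m) R) (a b : R) :
  (forall z, z \in `[-1, 1] -> signal_law x0 kap (null_cov z) (mu z)) ->
  (forall z, z \in `[-1, 1] -> signal_law x0 kap (fun s => null_cov z s + SB s) (mu' z)) ->
  (forall z, z \in `[-1, 1] -> (\int[mu z]_y (phi y)%:E <= a%:E)%E) ->
  (forall z, z \in `[-1, 1] -> (b%:E <= \int[mu' z]_y (phi y)%:E)%E) ->
  b <= a + (2 * eps + (e + (kap ^+ 2 * e)^-1 * ((2 * VB + 2 * VB / eps ^+ 2) * (t2 - t1))) +
    (e / 2 + VB / (eps ^+ 2 * VA) / (2 * e)) / 2).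
Proof.
move=> smu smu' mua mub; rewrite -/C.
set K := 2 * eps + _; set K2 := e / 2 + _.
have lowz z : z \in `[-1, 1] -> ((b - K)%:E <= \int[P1]_w G (z + ratio w)%R w)%E.
  move=> z1; rewrite EFinB leeBlDr//.
  apply: le_trans (mub z z1) _; apply: le_trans (alt_le z).
  rewrite (signal_law_integral (smu' z z1) (Xa_cont z) (alt_gaussian z) mphi phi0).
  rewrite (@tonelli_probability _ _ _ _ _ P1 PC (fun y => phi (fun s => Ya z s y))); first exact: lexx.
    by apply: (measurableT_comp mphi); exact: (measurable_path (Ya_meas z)).
  by move=> y; exact: phi0.
have upz z : z \in `[-1, 1] -> (\int[P1]_w G z w <= a%:E)%E.
  move=> z1; apply: le_trans (mua z z1).
  rewrite (signal_law_integral (smu z z1) (Xn_cont z) (null_gaussian z) mphi phi0).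
  rewrite (@tonelli_probability _ _ _ _ _ P1 PC (fun y => phi (fun s => Yn z s y))); first exact: lexx.
    by apply: (measurableT_comp mphi); exact: (measurable_path (Yn_meas z)).
  by move=> y; exact: phi0.
have a0 : 0 <= a.
  have z1 : (0 : R) \in `[-1, 1] by rewrite in_itv /= lerN10 ler01.
  by rewrite -lee_fin; apply: le_trans (mua _ z1); apply: integral_ge0 => y _; rewrite lee_fin.
have K20 : 0 <= K2.
  apply: addr_ge0; first by rewrite divr_ge0// ltW.
  apply: divr_ge0; last by apply: mulr_ge0 => //; exact: ltW.
  by apply: divr_ge0 => //; apply: mulr_ge0; [exact: sqr_ge0|exact: ltW].
(* The averaging argument needs a nonnegative lower bound [b - K]; if [b <= K], the claim already
   follows from [0 <= a] and [0 <= K2]. *)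
have [bK|bK] := leP b K.
  by rewrite addrA (le_trans bK)// addrAC lerDr addr_ge0// divr_ge0.
have G01 w z : (0 <= G z w <= 1)%E by rewrite G0 G1.
have bK0 : 0 <= b - K by rewrite subr_ge0 ltW.
have := average_translate mGr mratio (fun w z => G01 w z) bK0 lowz upz ratio_abs.
by rewrite -/K2; lra.
Qed.

End mixture.

(** * Spectra of tilted low rank matrices *)

Section spectra.
Context (R : realType).

Lemma char_poly_conj n (A P Q : 'M[R]_n) : P *m Q = 1%:M -> char_poly (P *m A *m Q) = char_poly A.
Proof.
move=> PQ; pose C := map_mx (@polyC R).
have CPQ : C _ _ P *m C _ _ Q = 1%:M by rewrite /C -map_mxM PQ map_mx1.
rewrite /char_poly (_ : char_poly_mx _ = C _ _ P *m char_poly_mx A *m C _ _ Q); last first.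
  rewrite /char_poly_mx mulmxBr mulmxBl /C !map_mxM; congr (_ - _).
  by rewrite mul_mx_scalar -scalemxAl CPQ scalemx1.
by rewrite !det_mulmx mulrAC -det_mulmx CPQ det1 mul1r.
Qed.

Lemma card_lt_ord n k : (k <= n)%N -> #|[pred i : 'I_n | (i < k)%N]| = k.
Proof. by move=> kn; rewrite -sum1_card (big_ord_narrow kn) sum1_card card_ord. Qed.

Lemma spectrum_perm n (A : 'M[R]_n) (E : 'I_n -> R) :
  char_poly A = \prod_i ('X - (E i)%:P) ->
  sorted >=%R (spectrum A) /\ perm_eq (spectrum A) [seq E i | i <- enum 'I_n].
Proof.
move=> cA; pose s := sort >=%R [seq E i | i <- enum 'I_n].
have cE : char_poly A = \prod_(a <- [seq E i | i <- enum 'I_n]) ('X - a%:P).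
  by rewrite cA big_map big_enum.
have sP : [set s : seq R | sorted >=%R s /\ char_poly A = \prod_(a <- s) ('X - a%:P)] s.
  split; first by apply: sort_sorted => x y; exact: le_total.
  rewrite cE; apply: perm_big; rewrite perm_sym; exact: permEl (perm_sort _ _).
have [sorted_s cs] := xgetPex [::] (ex_intro _ s sP).
split=> //; apply/prod_XsubC_eq/esym; rewrite -cE; exact: cs.
Qed.

(** If the entry with index [k.-1] of the sorted spectrum were below [c], so would be all later
    ones, and at most [k.-1] eigenvalues would be [>= c], whereas those indexed by [D] number at
    least [k]. *)
Lemma lambda_ge n (A : 'M[R]_n) (E : 'I_n -> R) (c : R) (k : nat) (D : {pred 'I_n}) :
  char_poly A = \prod_i ('X - (E i)%:P) -> (forall i, i \in D -> c <= E i) ->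
  (0 < k <= #|D|)%N -> c <= lambda k A.
Proof.
move=> cA cE /andP[k0 kD]; have [sA pA] := spectrum_perm cA.
have : (k <= count (>= c) (spectrum A))%N.
  apply: leq_trans kD _; rewrite (permP pA) count_map cardE -size_filter.
  apply: uniq_leq_size; first exact: enum_uniq.
  by move=> i; rewrite mem_enum mem_filter mem_enum andbT => /cE.
rewrite /lambda => kc; rewrite leNgt; apply/negP => lt_c.
set s := spectrum A in sA kc lt_c *.
have : (count (>= c) (take k.-1 s) + count (>= c) (drop k.-1 s) <= k.-1)%N.
  rewrite [X in (_ + X)%N](_ : _ = 0)%N ?addn0.
    by apply: leq_trans (count_size _ _) _; rewrite size_take; case: ltnP.
  apply/eqP; rewrite -leqn0 leqNgt -has_count; apply/hasPn => x /(nthP 0) [j].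
  rewrite size_drop nth_drop => jlt <-; rewrite -ltNge; apply: le_lt_trans lt_c.
  have ge_trans : transitive (>=%R : rel R) by move=> y x' z yx zy; exact: le_trans zy yx.
  have h2 : (k.-1 + j < size s)%N by rewrite -ltn_subRL.
  have h1 : (k.-1 < size s)%N := leq_ltn_trans (leq_addr j _) h2.
  have hom := sorted_leq_nth ge_trans (@lexx _ R) 0 sA.
  exact: (hom k.-1 (k.-1 + j)%N h1 h2 (leq_addr _ _)).
by rewrite -count_cat cat_take_drop => h; have := leq_trans kc h; rewrite -ltnS prednK// ltnn.
Qed.

End spectra.

(** * Spiked matrices: a perturbation in one coordinate plane *)

Section spikes.
Context (R : realType) (n : nat) (p q : 'I_n).
Hypothesis pq : (p < q)%N.

Let pnq : p != q. Proof. by rewrite -val_eqE neq_ltn pq. Qed.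

(* The transvection by [-u] triangularises the only off-diagonal block. *)
Lemma char_poly_plane (A : 'M[R]_n) (b u : R) :
  (forall i j, i != j -> A i j = ((i == p) && (j == q) || (i == q) && (j == p))%:R * b) ->
  b + u * A p p - u * A q q - u ^+ 2 * b = 0 ->
  char_poly A = \prod_i ('X - (A i i + u * b * ((i == q)%:R - (i == p)%:R))%:P).
Proof.
move=> offA root_u.
pose P : 'M[R]_n := 1%:M - u *: delta_mx p q; pose Q : 'M[R]_n := 1%:M + u *: delta_mx p q.
have dd : delta_mx p q *m delta_mx p q = 0 :> 'M[R]_n by rewrite mul_delta_mx_0// eq_sym.
have PQ : P *m Q = 1%:M.
  by rewrite /P /Q mulmxBl mul1mx mulmxDr mulmx1 -scalemxAl -scalemxAr dd !scaler0 addr0 addrK.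
have dl (M : 'M[R]_n) i j : (delta_mx p q *m M) i j = (i == p)%:R * M q j.
  rewrite mxE (bigD1 q)//= mxE eqxx andbT big1 ?addr0// => k kq.
  by rewrite mxE (negbTE kq) andbF mul0r.
have dr (M : 'M[R]_n) i j : (M *m delta_mx p q) i j = M i p * (j == q)%:R.
  rewrite mxE (bigD1 p)//= mxE eqxx /= big1 ?addr0// => k kp.
  by rewrite mxE (negbTE kp) mulr0.
have TE i j : (P *m A *m Q) i j = A i j + u * A i p * (j == q)%:R - u * (i == p)%:R * A q j
    - u ^+ 2 * (i == p)%:R * A q p * (j == q)%:R.
  have aE (X Y : 'M[R]_n) k l : (X + Y) k l = X k l + Y k l by rewrite mxE.
  have nE (X : 'M[R]_n) k l : (- X) k l = - X k l by rewrite mxE.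
  have sE (X : 'M[R]_n) k l : (u *: X) k l = u * X k l by rewrite mxE.
  rewrite /P /Q mulmxDr mulmx1 -scalemxAr mulmxBl mul1mx -scalemxAl aE sE dr !(aE, nE, sE) !dl.
  by ring.
have Apq : A p q = b by rewrite offA// !eqxx mul1r.
have Aqp : A q p = b by rewrite offA 1?eq_sym// !eqxx orbT mul1r.
rewrite -(char_poly_conj A PQ) char_poly_trig.
  apply: eq_bigr => i _; congr ('X - _%:P); rewrite TE.
  have [->|iq] := eqVneq i q.
    by rewrite eq_sym (negbTE pnq) Aqp /= ?mulr1n ?mulr0n; ring.
  have [->|ip] := eqVneq i p; last by rewrite /= ?mulr1n ?mulr0n; ring.
  by rewrite Aqp /= ?mulr1n ?mulr0n; ring.
apply/is_trig_mxP => i j ij; rewrite TE.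
have inj : i != j by rewrite -val_eqE neq_ltn ij.
have [ip|ip] := eqVneq i p.
  subst i; have [->|jq] := eqVneq j q; first by rewrite Apq Aqp -root_u /= ?mulr1n; ring.
  have qj : q != j by rewrite eq_sym.
  rewrite (offA _ _ inj) (offA _ _ qj) eqxx (negbTE jq) (negbTE pnq) [q == p]eq_sym (negbTE pnq) eqxx.
  by rewrite [j == p]eq_sym (negbTE inj) /= ?mulr1n ?mulr0n; ring.
rewrite (offA _ _ inj) (negbTE ip) /=.
have [jq|jq] := eqVneq j q.
  subst j; rewrite (offA _ _ ip) (negbTE ip) (negbTE inj) /= ?mulr1n ?mulr0n; ring.
have -> : (i == q) && (j == p) = false.
  by apply/negP => /andP[/eqP iq /eqP jp]; move: ij; rewrite iq jp ltnNge (ltnW pq).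
by rewrite /= ?mulr1n ?mulr0n; ring.
Qed.

(** Supplies the transvection parameter for a symmetric 2 by 2 block: the discriminant is a sum of
    squares, hence nonnegative. *)
Lemma quadratic_root (a c b : R) : {u | b + u * a - u * c - u ^+ 2 * b = 0}.
Proof.
have [->|b0] := eqVneq b 0; first by exists 0; ring.
exists ((a - c + Num.sqrt ((a - c) ^+ 2 + (2 * b) ^+ 2)) / (2 * b)).
have D0 : 0 <= (a - c) ^+ 2 + (2 * b) ^+ 2 by rewrite addr_ge0 ?sqr_ge0.
set s := Num.sqrt _; have s2 : s ^+ 2 = (a - c) ^+ 2 + (2 * b) ^+ 2 by rewrite sqr_sqrtr.
have -> : b + (a - c + s) / (2 * b) * a - (a - c + s) / (2 * b) * c - ((a - c + s) / (2 * b)) ^+ 2 * b =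
  ((a - c) ^+ 2 + (2 * b) ^+ 2 - s ^+ 2) / (4 * b) by field.
by rewrite s2 subrr mul0r.
Qed.

Variable lam : R.

(* Rank [q], with eigenvalue [lam (1 + y^2)] along the tilted axis [e_p + y e_q]. *)
Definition spike (y : R) : 'M[R]_n :=
  lam *: ((1%:M + y *: delta_mx q p) *m pid_mx q *m (1%:M + y *: delta_mx q p)^T).

Lemma spikeE y i j : spike y i j = lam * (((i == j) && (i < q)%N)%:R +
  y * (((i == p) && (j == q)) || ((i == q) && (j == p)))%:R + y ^+ 2 * ((i == q) && (j == q))%:R).
Proof.
have dl (M : 'M[R]_n) k l : (delta_mx q p *m M) k l = (k == q)%:R * M p l.
  rewrite mxE (bigD1 p)//= mxE eqxx andbT big1 ?addr0// => h hp.
  by rewrite mxE (negbTE hp) andbF mul0r.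
have dr (M : 'M[R]_n) k l : (M *m delta_mx p q) k l = M k p * (l == q)%:R.
  rewrite mxE (bigD1 p)//= mxE eqxx /= big1 ?addr0// => h hp.
  by rewrite mxE (negbTE hp) mulr0.
have aE (X Y : 'M[R]_n) k l : (X + Y) k l = X k l + Y k l by rewrite mxE.
have sE u (X : 'M[R]_n) k l : (u *: X) k l = u * X k l by rewrite mxE.
have pidE k l : (pid_mx q : 'M[R]_n) k l = ((k == l) && (k < q)%N)%:R by rewrite mxE.
rewrite /spike linearD /= trmx1 linearZ /= trmx_delta mulmxDr mulmx1 -scalemxAr mulmxDl mul1mx -scalemxAl.
rewrite !(aE, sE) !dr !(aE, sE) !dl !pidE eqxx pq ![p == _]eq_sym.
have [->|iq] := eqVneq i q.
  rewrite [q == p]eq_sym (negbTE pnq) ltnn andbF /=.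
  have [->|jq] := eqVneq j q; first by rewrite [q == p]eq_sym (negbTE pnq) /= ?mulr1n ?mulr0n; ring.
  by have [jp|jp] := eqVneq j p; rewrite /= ?mulr1n ?mulr0n; ring.
have [->|ip] := eqVneq i p.
  have [->|jq] := eqVneq j q; first by rewrite (negbTE pnq) pq /= ?mulr1n ?mulr0n; ring.
  by rewrite pq ?andbT ?andbF /= ?mulr1n ?mulr0n; ring.
by rewrite /= ?mulr1n ?mulr0n; ring.
Qed.

Lemma dilate_spike (z y : R) :
  diag_mx (\row_j (if j == q then z else 1)) *m spike y *m (diag_mx (\row_j (if j == q then z else 1)))^T =
  spike (z * y).
Proof.
have dE (v : 'rV[R]_n) (M : 'M[R]_n) k l : (diag_mx v *m M *m (diag_mx v)^T) k l = v 0 k * M k l * v 0 l.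
  by rewrite mul_diag_mx tr_diag_mx mul_mx_diag !mxE.
apply/matrixP => i j; rewrite dE !spikeE ![(\row__ _) 0 _]mxE.
have [->|iq] := eqVneq i q; have [->|jq] := eqVneq j q; rewrite ?ltnn ?andbF ?andbT ?eqxx /= ?mulr1n ?mulr0n.
- by rewrite [q == p]eq_sym (negbTE pnq) /= ?mulr0n; ring.
- by rewrite /= ?mulr1n ?mulr0n; ring.
- by rewrite (negbTE iq) ?orbF /= ?mulr1n ?mulr0n; ring.
- by rewrite /= ?mulr1n ?mulr0n; ring.
Qed.

Hypothesis lam0 : 0 < lam.

Lemma spd_spike y : spd (spike y).
Proof.
split; first by rewrite /spike linearZ /= !trmx_mul trmxK tr_pid_mx mulmxA.
move=> x; rewrite /spike -scalemxAr -scalemxAl mxE; apply: mulr_ge0; first exact: ltW.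
set B := 1%:M + _; have -> : x^T *m (B *m pid_mx q *m B^T) *m x = (B^T *m x)^T *m (pid_mx q *m (B^T *m x)).
  by rewrite trmx_mul trmxK !mulmxA.
set w := B^T *m x; rewrite mxE; apply: sumr_ge0 => k _.
have pidE l : (pid_mx q : 'M[R]_n) k l = ((k == l) && (k < q)%N)%:R by rewrite mxE.
rewrite [w^T _ _]mxE [X in _ * X]mxE (bigD1 k)//= big1 ?addr0; last first.
  by move=> l lk; rewrite pidE eq_sym (negbTE lk) mul0r.
by rewrite pidE mulrCA -expr2; apply: mulr_ge0 => //; exact: sqr_ge0.
Qed.

Lemma rank_spike y : (\rank (spike y) <= q)%N.
Proof.
rewrite (leq_trans (mxrank_scale _ _))// (leq_trans (mxrankM_maxl _ _))// (leq_trans (mxrankM_maxr _ _))//.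
by rewrite rank_pid_mx// ltnW.
Qed.

Definition bump (g : R) : 'M[R]_n := g *: delta_mx q q.

Lemma bumpE g i j : bump g i j = g * ((i == q) && (j == q))%:R.
Proof. by rewrite !mxE. Qed.

Lemma spd_bump g : 0 <= g -> spd (bump g).
Proof.
move=> g0; split; first by rewrite /bump linearZ /= trmx_delta.
move=> x; rewrite /bump -scalemxAr -scalemxAl mxE mulr_ge0//.
have e k : (x^T *m delta_mx q q) 0 k = x q 0 * (k == q)%:R.
  rewrite mxE (bigD1 q)//= [delta_mx _ _ _ _]mxE eqxx [x^T _ _]mxE big1 ?addr0// => h hq.
  by rewrite [delta_mx _ _ _ _]mxE (negbTE hq) mulr0.
rewrite mxE; apply: sumr_ge0 => k _; rewrite e.
by have [->|_] := eqVneq k q; rewrite ?mulr1 -?expr2 ?sqr_ge0// mulr0 mul0r.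
Qed.

Lemma lambda_spike y : (0 < q)%N -> lam <= lambda q (spike y).
Proof.
move=> q0.
have off i j : i != j -> spike y i j = ((i == p) && (j == q) || (i == q) && (j == p))%:R * (lam * y).
  move=> ij; rewrite spikeE (negbTE ij) /=.
  have -> : (i == q) && (j == q) = false by apply: contraNF ij => /andP[/eqP-> /eqP->].
  by rewrite ?mulr0n; ring.
have App : spike y p p = lam by rewrite spikeE eqxx pq (negbTE pnq) /= ?mulr1n ?mulr0n; ring.
have Aqq : spike y q q = lam * y ^+ 2.
  by rewrite spikeE eqxx ltnn [q == p]eq_sym (negbTE pnq) /= ?mulr1n ?mulr0n; ring.
(* The root is explicit here: the parameter [- y] turns the diagonal entries of the block into
   [lam * (1 + y ^+ 2)] and 0. *)
have root_y : lam * y + - y * spike y p p - - y * spike y q q - (- y) ^+ 2 * (lam * y) = 0.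
  by rewrite App Aqq; ring.
apply: (lambda_ge (D := [pred i : 'I_n | (i < q)%N]) (char_poly_plane off root_y)).
- move=> i; rewrite inE => iq; have inq : i != q by rewrite -val_eqE neq_ltn iq.
  rewrite (negbTE inq); have [->|ip] := eqVneq i p.
    rewrite App /= ?mulr1n ?mulr0n (_ : _ + _ = lam + lam * y ^+ 2); last by ring.
    by rewrite lerDl mulr_ge0 ?sqr_ge0// ltW.
  rewrite spikeE eqxx iq (negbTE ip) (negbTE inq) /= ?mulr1n ?mulr0n (_ : _ + _ = lam)//; ring.
- by rewrite (card_lt_ord (ltnW (ltn_ord q))) q0 leqnn.
Qed.

(** The block on the coordinates [p] and [q] has determinant [lam * g] and trace
    [lam * (1 + y ^+ 2) + g <= 3 * lam]. Two numbers with positive product and sum are positive and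
    each is at most the sum, so each is at least [lam * g / (3 * lam)]. *)
Lemma lambda_spike_bump y g : y ^+ 2 <= 1 -> 0 < g -> g <= lam -> g / 3 <= lambda q.+1 (spike y + bump g).
Proof.
move=> y1 g0 glam; set A := spike y + bump g.
have AE i j : A i j = spike y i j + bump g i j by rewrite mxE.
have off i j : i != j -> A i j = ((i == p) && (j == q) || (i == q) && (j == p))%:R * (lam * y).
  move=> ij; rewrite AE bumpE spikeE (negbTE ij) /=.
  have -> : (i == q) && (j == q) = false by apply: contraNF ij => /andP[/eqP-> /eqP->].
  by rewrite ?mulr0n; ring.
have App : A p p = lam by rewrite AE bumpE spikeE eqxx pq (negbTE pnq) /= ?mulr1n ?mulr0n; ring.
have Aqq : A q q = lam * y ^+ 2 + g.
  by rewrite AE bumpE spikeE eqxx ltnn [q == p]eq_sym (negbTE pnq) /= ?mulr1n ?mulr0n; ring.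
have [u root_u] := quadratic_root lam (lam * y ^+ 2 + g) (lam * y).
have := char_poly_plane off (u := u); rewrite App Aqq => /(_ root_u) cE.
pose e1 := lam - u * (lam * y); pose e2 := lam * y ^+ 2 + g + u * (lam * y).
have sum12 : e1 + e2 = lam * (1 + y ^+ 2) + g by rewrite /e1 /e2; ring.
have prod12 : e1 * e2 = lam * g.
  have : lam * y * (lam * y + u * lam - u * (lam * y ^+ 2 + g) - u ^+ 2 * (lam * y)) = 0 by rewrite root_u mulr0.
  rewrite /e1 /e2 => h; rewrite -[RHS]addr0 -h; ring.
have y20 := sqr_ge0 y.
have sum0 : 0 < e1 + e2 <= 3 * lam by rewrite sum12; apply/andP; split; nra.
have both (a b : R) : 0 < a + b <= 3 * lam -> a * b = lam * g -> g / 3 <= a.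
  move=> /andP[s0 s3] ab; have lg : 0 < lam * g by rewrite mulr_gt0.
  have b0 : 0 < b by rewrite ltNge; apply/negP => b0; nra.
  have a0 : 0 < a by rewrite ltNge; apply/negP => a0; nra.
  nra.
have e1g := both _ _ sum0 prod12.
have e2g : g / 3 <= e2 by apply: (both e2 e1); rewrite 1?addrC// mulrC.
apply: (lambda_ge (D := [pred i : 'I_n | (i < q.+1)%N]) cE).
- move=> i; rewrite inE ltnS => iq.
  have [->|inq] := eqVneq i q.
    by rewrite Aqq [q == p]eq_sym (negbTE pnq) /= ?mulr1n ?mulr0n; rewrite /e2 in e2g; lra.
  have [->|ip] := eqVneq i p.
    by rewrite App /= ?mulr1n ?mulr0n; rewrite /e1 in e1g; lra.
  have iq' : (i < q)%N by rewrite ltn_neqAle val_eqE inq.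
  rewrite AE bumpE spikeE eqxx iq' (negbTE ip) (negbTE inq) /= ?mulr1n ?mulr0n; lra.
- by rewrite (card_lt_ord (ltn_ord q)) leqnn.
Qed.

Lemma spectral_norm_le (A : 'M[R]_n) c : 0 <= c ->
  (forall x : 'cV[R]_n, sqnorm x <= 1 -> sqnorm (A *m x) <= c ^+ 2) -> spectral_norm A <= c.
Proof.
move=> c0 Ac; apply: ge_sup.
  exists (Num.sqrt (sqnorm (A *m (0 : 'cV[R]_n)))); exists 0 => //=.
  rewrite /sqnorm big1// => i _; rewrite big1// => j _; by rewrite mxE expr0n.
move=> _ [x /= x1 <-]; rewrite -[leRHS]ger0_norm// -sqrtr_sqr.
by rewrite ler_wsqrtr// Ac.
Qed.

(** The difference is [lam * (y - y')] times a matrix supported on one coordinate plane, with zero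
    in the corner, ones off the diagonal and [y + y'] in the last entry; for [|y + y'| <= 1] its
    norm is at most 2. *)
Lemma spectral_norm_spike y y' : `|y| <= 1 / 4 -> `|y'| <= 1 / 4 ->
  spectral_norm (spike y - spike y') <= 2 * lam * `|y - y'|.
Proof.
move=> y4 y4'; apply: spectral_norm_le; first by rewrite !mulr_ge0// ltW.
move=> x; set A := spike y - spike y'.
have AE i j : A i j = lam * (y - y') *
    ((((i == p) && (j == q)) || ((i == q) && (j == p)))%:R + (y + y') * ((i == q) && (j == q))%:R).
  have -> : A i j = spike y i j - spike y' i j by rewrite mxE [X in _ + X]mxE.
  by rewrite !spikeE; ring.
have qp : q != p by rewrite eq_sym.
have Ap : (A *m x) p 0 = lam * (y - y') * x q 0.
  rewrite mxE (bigD1 q)//= big1 ?addr0 => [|k kq]; rewrite AE (negbTE pnq) eqxx /=.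
    by rewrite eqxx /= ?mulr1n ?mulr0n; ring.
  by rewrite (negbTE kq) /= ?mulr0n; ring.
have Aq : (A *m x) q 0 = lam * (y - y') * (x p 0 + (y + y') * x q 0).
  rewrite mxE (bigD1 p)//= (bigD1 q)//= big1 ?addr0 => [|k /andP[kp kq]]; rewrite !AE (negbTE qp) eqxx /=.
    by rewrite ?(negbTE pnq) ?(negbTE qp) ?eqxx /= ?mulr1n ?mulr0n; ring.
  by rewrite (negbTE kp) (negbTE kq) /= ?mulr0n; ring.
have An i : i != p -> i != q -> (A *m x) i 0 = 0.
  move=> ip iq; rewrite mxE big1// => k _.
  by rewrite AE (negbTE ip) (negbTE iq) /= ?mulr0n; ring.
have sE (v : 'cV[R]_n) : sqnorm v = v p 0 ^+ 2 + (v q 0 ^+ 2 + \sum_(i | (i != p) && (i != q)) v i 0 ^+ 2).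
  rewrite /sqnorm (bigD1 p)//= big_ord1 (bigD1 q)//= big_ord1; congr (_ + (_ + _)).
  by apply: eq_bigr => i _; rewrite big_ord1.
rewrite !sE [X in _ -> _ + (_ + X) <= _]big1 ?addr0; last by move=> i /andP[ip iq]; rewrite An// expr0n.
have : 0 <= \sum_(i | (i != p) && (i != q)) x i 0 ^+ 2 by apply: sumr_ge0 => i _; exact: sqr_ge0.
set S := \sum_(_ | _) _ => S0 xS.
rewrite Ap Aq.
set w := lam * (y - y').
have -> : (2 * lam * `|y - y'|) ^+ 2 = w ^+ 2 * 4.
  by rewrite !exprMn real_normK ?num_real//; ring.
have -> : (w * x q 0) ^+ 2 + (w * (x p 0 + (y + y') * x q 0)) ^+ 2 =
    w ^+ 2 * (x q 0 ^+ 2 + (x p 0 + (y + y') * x q 0) ^+ 2) by ring.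
rewrite ler_wpM2l ?sqr_ge0//.
have yy : (y + y') ^+ 2 <= 1.
  by move: y4 y4'; rewrite !ler_norml => /andP[? ?] /andP[? ?]; nra.
have yx : (y + y') ^+ 2 * x q 0 ^+ 2 <= x q 0 ^+ 2 by rewrite ler_piMl ?sqr_ge0.
have := sqr_ge0 (x p 0 - (y + y') * x q 0).
have := sqr_ge0 (x q 0); have := sqr_ge0 (x p 0); nra.
Qed.

End spikes.

(** * The covariance paths *)

Section indicator.
Context (R : realType).
Local Notation leb := (@lebesgue_measure R).
Local Notation I01 := ([set` `[0%R, 1%R]] : set R).

Lemma integrable_indic01 (a b c : R) : leb.-integrable I01 (EFin \o (fun s => c * \1_[set` `[a, b]] s)).
Proof.
apply: (@integrable_I01 _ _ `|c|).
  apply: measurable_funM; first exact: measurable_cst.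
  by apply: measurable_funTS; apply: measurable_indic; exact: measurable_itv.
by move=> s _; rewrite normrM indicE; case: (_ \in _); rewrite ?normr1 ?normr0 ?mulr1 ?mulr0.
Qed.

Lemma Rintegral_indic01 (a b c : R) : 0 <= a -> a <= b -> b <= 1 ->
  \int[leb]_(s in I01) (c * \1_[set` `[a, b]] s) = c * (b - a).
Proof.
move=> a0 ab b1; have mK : measurable ([set` `[a, b]] : set R) by exact: measurable_itv.
rewrite RintegralZl//; last first.
  by have := integrable_indic01 a b 1; congr (integrable _ _); apply/funext => s /=; rewrite mul1r.
congr (_ * _); rewrite /Rintegral integral_indic// setIidl; last first.
  move=> s /=; rewrite !in_itv /= => /andP[as_ sb].
  by rewrite (le_trans a0 as_) (le_trans sb b1).
have LK : (leb [set` `[a, b]] = (b - a)%:E)%E.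
  rewrite lebesgue_measure_itv /= lte_fin; case: ltP => [_|ba]; first by rewrite -EFinB.
  by have -> : b = a by [apply/eqP; rewrite eq_le ab ba]; rewrite subrr.
exact: (congr1 fine LK).
Qed.

End indicator.

(** * The tent function *)

Section tent.
Context (R : realType) (t w del : R).
Local Notation leb := (@lebesgue_measure R).
Local Notation I01 := ([set` `[0%R, 1%R]] : set R).
Hypotheses (w0 : 0 < w) (del0 : 0 <= del).

Definition tent (s : R) : R := del * Num.max 0 (1 / 2 - `|(s - t) / w - 1 / 2|).

Lemma tent_ge0 s : 0 <= tent s.
Proof. by rewrite /tent mulr_ge0// le_max lexx. Qed.

Lemma tent_le s : tent s <= del / 2.
Proof.
rewrite /tent; apply: ler_wpM2l => //; rewrite ge_max; apply/andP; split; first by lra.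
have := normr_ge0 ((s - t) / w - 1 / 2); lra.
Qed.

Lemma tent_off s : s \notin `[t, t + w] -> tent s = 0.
Proof.
have ? := w0; rewrite in_itv /= => sJ; rewrite /tent; set x := (s - t) / w.
have sE : s = t + x * w by rewrite /x divfK ?gt_eqF//; ring.
have -> : Num.max 0 (1 / 2 - `|x - 1 / 2|) = 0; last by rewrite mulr0.
apply/max_idPl; rewrite subr_le0 leNgt; apply: contra sJ; rewrite ltr_norml => /andP[h1 h2].
by rewrite sE lerDl; apply/andP; split; nra.
Qed.

Lemma tent_lipschitz s u : `|tent s - tent u| <= del * (`|s - u| / w).
Proof.
rewrite /tent -mulrBr normrM (ger0_norm del0); apply: ler_wpM2l => //.
set x := (s - t) / w; set y := (u - t) / w.
have -> : `|s - u| / w = `|x - y|.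
  by rewrite -[w in LHS]gtr0_norm// -normf_div /x /y -mulrBl; congr (`|_ / _|); ring.
have : `| (`|x - 1 / 2|) - (`|y - 1 / 2|) | <= `|x - y|.
  by apply: le_trans (ler_dist_dist _ _) _; rewrite (_ : x - 1 / 2 - (y - 1 / 2) = x - y)//; ring.
move: `|x - 1 / 2| `|y - 1 / 2| `|x - y| => a b c; rewrite !ler_norml => /andP[h1 h2].
by rewrite !maxElt; case: ifP => h3; case: ifP => h4; apply/andP; split; lra.
Qed.

(** Up to distance [w] the Lipschitz bound suffices, since [z <= z ^ beta] for [z] in [[0, 1]] and
    [beta <= 1]; farther apart the values differ by at most [del / 2]. *)
Lemma tent_holder beta s u : 0 < beta <= 1 -> `|tent s - tent u| <= del * (`|s - u| / w) `^ beta.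
Proof.
move=> /andP[b0 b1]; set z := `|s - u| / w.
have z0 : 0 <= z by rewrite divr_ge0// ltW.
have [z1|z1] := leP z 1.
  apply: le_trans (tent_lipschitz s u) _; apply: ler_wpM2l => //; rewrite -/z.
  have [->|zn] := eqVneq z 0; first by rewrite powR_ge0.
  by apply: ger1_powR => //; rewrite lt_neqAle eq_sym zn z0.
apply: (@le_trans _ _ (del * 1)).
  rewrite mulr1 ler_norml; have := tent_ge0 s; have := tent_ge0 u; have := tent_le s; have := tent_le u.
  by move=> *; apply/andP; split; lra.
by apply: ler_wpM2l => //; rewrite -[leLHS](powRr0 z); apply: ler_powR; exact: ltW.
Qed.

Lemma tent_continuous : continuous tent.
Proof.
pose a s := 1 / 2 - `|(s - t) / w - 1 / 2|.
have ca : continuous a.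
  move=> s; apply: cvgB; first exact: cvg_cst.
  apply: cvg_norm; apply: cvgB; last exact: cvg_cst.
  by apply: cvgM; [apply: cvgB; [exact: cvg_id|exact: cvg_cst]|exact: cvg_cst].
rewrite (_ : tent = fun s => del * ((0 + a s + `|0 - a s|) / 2)); last first.
  by apply/funext => s; rewrite /tent maxr_absE.
move=> s; apply: cvgM; first exact: cvg_cst.
apply: cvgM; last exact: cvg_cst.
apply: cvgD; first by apply: cvgD; [exact: cvg_cst|exact: ca].
by apply: cvg_norm; apply: cvgB; [exact: cvg_cst|exact: ca].
Qed.

(** On the middle half of the window the tent is at least [del / 4], and [(del / 4) ^+ 2 * (w / 2)]
    is the bound. *)
Lemma tent_energy : 0 <= t -> t + w <= 1 -> del ^+ 2 * w / 32 <= \int[leb]_(s in I01) (tent s ^+ 2).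
Proof.
have ? := w0; move=> t0 tw1; pose a := t + w / 4; pose b := t + 3 * w / 4.
have a0 : 0 <= a by rewrite /a; lra.
have ab : a <= b by rewrite /a /b; lra.
have b1 : b <= 1 by rewrite /b; lra.
have -> : del ^+ 2 * w / 32 = \int[leb]_(s in I01) (del ^+ 2 / 16 * \1_[set` `[a, b]] s).
  by rewrite Rintegral_indic01// /a /b; field.
apply: le_Rintegral => //.
- exact: integrable_indic01.
- by apply: integrable_continuous01; [apply: continuous_sqr01; exact/continuous_subspaceT/tent_continuous|rewrite in_itv /= ler01 lexx].
move=> s _; rewrite indicE; case: (boolP (s \in _)) => [|_]; last by rewrite mulr0 sqr_ge0.
rewrite inE /= in_itv /= /a /b mulr1 => /andP[as_ sb].
rewrite (_ : del ^+ 2 / 16 = (del * (1 / 4)) ^+ 2); last by rewrite exprMn; field.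
rewrite /tent ler_sqr ?nnegrE ?mulr_ge0 ?le_max ?lexx ?divr_ge0//.
apply: ler_wpM2l => //; rewrite le_max; apply/orP; right.
have xE : s = t + (s - t) / w * w by rewrite divfK ?gt_eqF//; ring.
move: ((s - t) / w) xE => x xE; rewrite xE in as_ sb.
have h : `|x - 1 / 2| <= 1 / 4; last by lra.
by rewrite ler_norml; apply/andP; split; nra.
Qed.

End tent.

(** * Null and alternative covariance paths *)

Section alternatives.
Context (R : realType) (d : nat) (p q : 'I_d).
Local Notation leb := (@lebesgue_measure R).
Local Notation I01 := ([set` `[0%R, 1%R]] : set R).
Variables (lam t w del g : R).
Hypotheses (pq : (p < q)%N) (lam0 : 0 < lam) (w0 : 0 < w) (del0 : 0 <= del) (del1 : del <= 1 / 2)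
  (g0 : 0 < g) (glam : g <= lam).

Definition null_path (z s : R) : 'M[R]_d := spike p q lam (z * tent t w del s).
Definition bump_path (s : R) : 'M[R]_d := bump q (g * \1_[set` `[t, (t + w)%R]] s).
Definition alt_path (z s : R) : 'M[R]_d := null_path z s + bump_path s.

Lemma spdD n (A B : 'M[R]_n) : spd A -> spd B -> spd (A + B).
Proof.
move=> [tA pA] [tB pB]; split; first by rewrite linearD /= tA tB.
by move=> x; rewrite mulmxDr mulmxDl mxE addr_ge0.
Qed.

Lemma null_path_integrable z i j : leb.-integrable I01 (EFin \o (fun s => null_path z s i j)).
Proof.
have ct : {within I01, continuous (tent t w del)} by apply: continuous_subspaceT; exact: tent_continuous.
apply: integrable_continuous01; last by rewrite in_itv /= ler01 lexx.
set A : R := ((i == j) && (i < q)%N)%:R.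
set B : R := (((i == p) && (j == q)) || ((i == q) && (j == p)))%:R.
set C : R := ((i == q) && (j == q))%:R.
rewrite (_ : (fun s => _) = fun s => lam * (A + z * tent t w del s * B + z ^+ 2 * tent t w del s ^+ 2 * C)); last first.
  by apply/funext => s; rewrite /null_path spikeE// exprMn.
have c2 := continuous_sqr01 ct.
move=> s; apply: cvgM; first exact: cvg_cst.
apply: cvgD.
  apply: cvgD; first exact: cvg_cst.
  by apply: cvgM; [apply: cvgM; [exact: cvg_cst|exact: ct]|exact: cvg_cst].
by apply: cvgM; [apply: cvgM; [exact: cvg_cst|exact: c2]|exact: cvg_cst].
Qed.

Lemma bump_path_integrable i j : leb.-integrable I01 (EFin \o (fun s => bump_path s i j)).
Proof.
have := integrable_indic01 t (t + w) (g * ((i == q) && (j == q))%:R); congr (integrable _ _).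
by apply/funext => s /=; rewrite /bump_path bumpE; congr EFin; ring.
Qed.

Lemma L1_null z : L1_spd (null_path z).
Proof. by split=> [s _|i j]; [exact: spd_spike|exact: null_path_integrable]. Qed.

Lemma L1_bump : L1_spd bump_path.
Proof.
split=> [s _|i j]; last exact: bump_path_integrable.
by apply: spd_bump; apply: mulr_ge0 => //; exact: ltW.
Qed.

Lemma L1_alt z : L1_spd (alt_path z).
Proof.
split=> [s s01|i j]; first by apply: spdD; [have [+ _] := L1_null z|have [+ _] := L1_bump]; exact.
have := integrable_I01_add (null_path_integrable z i j) (bump_path_integrable i j).
by congr (integrable _ _); apply/funext => s /=; congr EFin; rewrite /alt_path [RHS]mxE.
Qed.

Let tent4 z s : `|z| <= 1 -> `|z * tent t w del s| <= 1 / 4.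
Proof.
have d1 := del1; have t0 := tent_ge0 t w del0 s; have t1 := tent_le t w del0 s.
by move=> z1; rewrite normrM (ger0_norm t0); have := normr_ge0 z; nra.
Qed.

(** The tilt moves by at most [del * (|u - s| / w) ^ beta] and the spectral norm multiplies this by
    [2 * lam]. The scaling hypothesis is the choice of [del] for which the resulting Hoelder
    constant is [L]. *)
Lemma null_H0 beta L lam' z : 0 < beta <= 1 -> 2 * lam * del = L * w `^ beta -> lam' <= lam -> `|z| <= 1 ->
  H0 beta L q lam' (null_path z).
Proof.
move=> hb scale lam'lam z1; have /andP[b0 b1] := hb; split; first by have [] := L1_null z.
split; last split.
- move=> u s _ _; apply: le_trans (spectral_norm_spike pq lam0 (tent4 u z1) (tent4 s z1)) _.
  rewrite -mulrBr normrM.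
  apply: (@le_trans _ _ (2 * lam * (del * (`|u - s| / w) `^ beta))).
    apply: ler_wpM2l; first by rewrite mulr_ge0// ltW.
    apply: (@le_trans _ _ (1 * `|tent t w del u - tent t w del s|)); first by apply: ler_wpM2r.
    by rewrite mul1r; apply: tent_holder.
  rewrite mulrA scale -mulrA -powRM; last 2 first.
  + exact: ltW.
  + by apply: divr_ge0 => //; exact: ltW.
  by rewrite mulrCA mulfV ?gt_eqF// mulr1.
- by move=> s _; exact: rank_spike.
- move=> s _; apply: le_trans lam'lam _; apply: lambda_spike => //; exact: leq_ltn_trans pq.
Qed.

Lemma alt_H1 h lam' z : h <= w -> lam' <= g / 3 -> `|z| <= 1 -> H1 t h q lam' (alt_path z).
Proof.
move=> hw lam'g z1; split; first exact: L1_alt.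
move=> s; rewrite in_itv /= => /andP[ts sh]; apply: le_trans lam'g _.
rewrite /alt_path /null_path /bump_path indicE mem_set ?mulr1; last first.
  by rewrite /= in_itv /= ts (le_trans sh)// lerD2l.
apply: lambda_spike_bump => //.
have := tent4 s z1; rewrite ler_norml => /andP[h1 h2]; nra.
Qed.

Variables (x0 : 'cV[R]_d) (eta : R) (n : nat) (law : (R -> 'M[R]_d) -> probability (path_space R d) R).
Hypotheses (eta0 : 0 < eta) (n0 : (0 < n)%N) (t0 : 0 <= t) (tw1 : t + w <= 1) (del_gt0 : 0 < del).
Hypothesis lawP : forall Sigma, L1_spd Sigma -> observation_law x0 eta n Sigma (law Sigma).
Variable phi : path_space R d -> R.
Hypotheses (mphi : measurable_fun setT phi) (phi01 : forall y, 0 <= phi y <= 1).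

Let VA := \int[leb]_(s in I01) null_path 1 s q q.
Let VB := \int[leb]_(s in I01) bump_path s q q.

Let null_qq z s : null_path z s q q = lam * (z ^+ 2 * tent t w del s ^+ 2).
Proof.
have -> : null_path z s q q = _ := spikeE pq lam _ q q.
have pnq : p != q by rewrite -val_eqE neq_ltn pq.
by rewrite eqxx ltnn [q == p]eq_sym (negbTE pnq) exprMn /= ?mulr1n ?mulr0n; ring.
Qed.

Let VB_eq : VB = g * w.
Proof.
rewrite -[w in RHS](_ : t + w - t = w); last by ring.
rewrite -(Rintegral_indic01 g t0 _ tw1); last by rewrite lerDl ltW.
by apply: eq_Rintegral => s _; rewrite /bump_path bumpE !eqxx /= mulr1.
Qed.

Let VA_ge : lam * (del ^+ 2 * w / 32) <= VA.
Proof.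
have ct : {within I01, continuous (tent t w del)} by apply: continuous_subspaceT; exact: tent_continuous.
have -> : VA = lam * \int[leb]_(s in I01) (tent t w del s ^+ 2).
  rewrite -RintegralZl//; last first.
    by apply: integrable_continuous01; [exact: continuous_sqr01|rewrite in_itv /= ler01 lexx].
  by apply: eq_Rintegral => s _; rewrite null_qq expr1n mul1r.
apply: ler_wpM2l; first exact: ltW.
exact: tent_energy.
Qed.

(** The models assumed for the covariances [null_path 1] and [bump_path] provide the signals [A] and
    [B], and the first also provides the noise. In the bound, [VB = g * w] and the tent energy give
    [VB / VA <= 32 * g / (lam * del ^+ 2)]. *)
Lemma testing_bound (eps e a b : R) : 0 < eps -> 0 < e ->
  (forall z, z \in `[-1, 1] -> (\int[law (null_path z)]_y (phi y)%:E <= a%:E)%E) ->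
  (forall z, z \in `[-1, 1] -> (b%:E <= \int[law (alt_path z)]_y (phi y)%:E)%E) ->
  b <= a + (2 * eps + (e + n%:R / (eta ^+ 2 * e) * (2 * (g * w) + 2 * (g * w) / eps ^+ 2) * w) +
    (e / 2 + 32 * g / (eps ^+ 2 * (lam * del ^+ 2)) / (2 * e)) / 2).
Proof.
move=> eps0 e0 nulla altb.
have n0R : 0 < n%:R :> R by rewrite ltr0n.
pose kap := eta / Num.sqrt n%:R.
have kap0 : 0 < kap by rewrite divr_gt0// sqrtr_gt0.
have law_signal Sigma : L1_spd Sigma -> signal_law x0 kap Sigma (law Sigma).
  move=> /lawP/observation_law_observed [dd [T [P [X [W [Y [obs [_ muE]]]]]]]].
  by exists dd, T, P, X, W, Y.
have [dA [TA [PA [XA [W [YA [obsA [bW _]]]]]]]] := observation_law_observed (lawP (L1_null 1)).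
have [dB [TB [PB [XB [WB [YB [obsB _]]]]]]] := observation_law_observed (lawP L1_bump).
have VA0 : 0 < VA.
  by apply: lt_le_trans VA_ge; rewrite mulr_gt0// divr_gt0// mulr_gt0// exprn_gt0.
have nullE z : null_cov q (null_path 1) z = null_path z.
  by apply/funext => s; rewrite /null_cov /null_path mul1r; exact: dilate_spike.
have SBE s : s \in `[0, 1] -> delta_mx q q *m bump_path s *m (delta_mx q q)^T = bump_path s.
  by move=> _; rewrite /bump_path /bump trmx_delta -scalemxAr -scalemxAl !mul_delta_mx.
have off (s : R) (z : R) : s \notin `[t, t + w] -> null_path z s q q = 0.
  by move=> sJ; rewrite null_qq tent_off// expr0n !mulr0.
have offB (s : R) : s \notin `[t, t + w] -> bump_path s q q = 0.
  move=> sJ; rewrite /bump_path bumpE indicE memNset; first by rewrite mulr0 mul0r.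
  by move=> /= sJ'; rewrite sJ' in sJ.
have nullz z : z \in `[-1, 1] -> signal_law x0 kap (null_cov q (null_path 1) z) (law (null_path z)).
  by move=> _; rewrite nullE; apply: law_signal; exact: L1_null.
have altz z : z \in `[-1, 1] ->
    signal_law x0 kap (fun s => null_cov q (null_path 1) z s + bump_path s) (law (alt_path z)).
  by move=> _; rewrite nullE; apply: law_signal; exact: L1_alt.
have posA s : s \in `[0, 1] -> 0 <= null_path 1 s q q.
  by move=> _; rewrite null_qq; apply: mulr_ge0; [exact: ltW|apply: mulr_ge0; exact: sqr_ge0].
have posB s : s \in `[0, 1] -> 0 <= bump_path s q q.
  by move=> _; rewrite /bump_path bumpE; apply: mulr_ge0 => //; apply: mulr_ge0 => //; exact: ltW.
have tw : t <= t + w by rewrite lerDl ltW.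
have := mixture_bound kap0 (observed_cont obsA) (observed_cont obsB) (observed_gaussian obsA)
  (observed_gaussian obsB) bW (null_path_integrable 1) bump_path_integrable SBE tw eps0 e0
  posA (fun s _ => off s 1) posB (fun s _ => offB s) VA0 mphi phi01 nullz altz nulla altb.
move=> /le_trans; apply; rewrite -/VA -/VB VB_eq lerD2l; apply: lerD.
  rewrite 2!lerD2l (_ : (kap ^+ 2 * e)^-1 = n%:R / (eta ^+ 2 * e)); last first.
    by rewrite /kap expr_div_n sqr_sqrtr ?ltW//; field; rewrite !gt_eqF.
  by rewrite (_ : t + w - t = w) ?mulrA//; ring.
apply: ler_wpM2r => //; rewrite lerD2l; apply: ler_wpM2r; first by rewrite invr_ge0 mulr_ge0// ltW.
have ld : 0 < lam * del ^+ 2 by rewrite mulr_gt0// exprn_gt0.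
rewrite ler_pdivrMr; last by rewrite mulr_gt0// exprn_gt0.
rewrite [leRHS](_ : _ = 32 * g / (lam * del ^+ 2) * VA); last first.
  by field; rewrite !gt_eqF.
have -> : g * w = 32 * g / (lam * del ^+ 2) * (lam * (del ^+ 2 * w / 32)) by field; rewrite !gt_eqF.
apply: ler_wpM2l => //; apply: divr_ge0; last exact: ltW.
by apply: mulr_ge0 => //; exact: ltW.
Qed.

End alternatives.

(** * Rates *)

Section scales.
Context (R : realType).

Lemma powR_near_small (x a eps : R) : 0 < x -> 0 < a -> 0 < eps ->
  \forall n \near \oo, (x * n%:R) `^ (- a) <= eps.
Proof.
move=> x0 a0 e0; pose B := (eps^-1) `^ a^-1.
near=> n.
have Bn : B <= x * n%:R.
  rewrite mulrC -ler_pdivrMr//; near: n; exact: nbhs_infty_ger.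
have B0 : 0 < B by rewrite powR_gt0// invr_gt0.
have : eps^-1 <= (x * n%:R) `^ a.
  have aV : a^-1 * a = 1 by rewrite mulVf// gt_eqF.
  rewrite [leLHS](_ : _ = B `^ a); last by rewrite -powRrM aV powRr1// invr_ge0 ltW.
  by rewrite ge0_ler_powR ?nnegrE// ?(ltW a0)// (le_trans (ltW B0)).
rewrite powRN => h; rewrite -[eps]invrK lef_pV2 ?posrE ?invr_gt0//.
by rewrite powR_gt0// (lt_le_trans B0).
Unshelve. all: by end_near.
Qed.

Lemma critical_length_small (beta L lam eps : R) : 0 < beta -> 0 < L -> 0 <= lam -> 0 < eps ->
  \forall n \near \oo, critical_length beta L lam n <= eps.
Proof.
move=> b0 L0 l0 e0.
have a1 : 0 < 1 / (beta + 2) by rewrite divr_gt0// addr_gt0.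
have a2 : 0 < 1 / (2 * beta + 2) by rewrite divr_gt0// addr_gt0// mulr_gt0.
rewrite /critical_length; have [_|lam0] := eqVneq lam 0; first exact: powR_near_small.
have K0 : 0 < lam^-1 * L ^+ 2 by rewrite mulr_gt0 ?exprn_gt0// invr_gt0 lt_neqAle eq_sym lam0.
near=> n; rewrite ge_max; apply/andP; split; near: n; exact: powR_near_small.
Unshelve. all: by end_near.
Qed.

(** The length [l] solves [N * K * l ^ b = 1]. Both regimes have this form: [K = L], [a = beta],
    [b = beta + 2], and [K = lam^-1 * L ^+ 2], [a = 2 * beta], [b = 2 * beta + 2]. The last identity
    then expresses the rate through the length. *)
Lemma power_scale (K N a b : R) : 0 < K -> 0 < N -> 0 < b ->
  let l := (K * N) `^ (- (1 / b)) in
  [/\ 0 < l, N * (K * l `^ b) = 1 & K `^ (1 - a / b) * N `^ (- (a / b)) = K * l `^ a].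
Proof.
move=> K0 N0 b0 l; have KN : 0 < K * N by rewrite mulr_gt0.
have lb : l `^ b = (K * N)^-1.
  by rewrite /l -powRrM mulNr divfK ?gt_eqF// powRN powRr1// ltW.
split; first exact: powR_gt0.
  by rewrite lb; field; rewrite !gt_eqF.
rewrite /l -powRrM mulNr mulrAC mul1r powRM ?(ltW K0) ?(ltW N0)// mulrA.
congr (_ * _); rewrite powRD ?powRr1 ?ltW//.
by apply/implyP => _; rewrite gt_eqF.
Qed.

(** The level [lam'] is the larger of [lam] and [L * w ^ beta]. Which one it is agrees with which
    term attains the maximum in the critical length, and in either regime the balance [n v w^2 = 1]
    holds for [v = (L * w ^ beta) ^+ 2 / lam']. *)
Lemma scales (beta L lam : R) (n : nat) : 0 < beta <= 1 -> 0 < L -> 0 <= lam -> (0 < n)%N ->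
  let w := critical_length beta L lam n in
  exists lam' : R, [/\ 0 < lam', 0 < w, lam <= lam' & L * w `^ beta <= lam'] /\
    (n%:R * ((L * w `^ beta) ^+ 2 / lam') * w ^+ 2 = 1 /\
     separation_rate beta L lam n <= (L * w `^ beta) ^+ 2 / lam').
Proof.
move=> /andP[b0 b1] L0 l0 n0; have N0 : 0 < n%:R :> R by rewrite ltr0n.
have bb : 0 < beta + 2 by rewrite addr_gt0.
have b22 : 0 < 2 * beta + 2 by rewrite addr_gt0// mulr_gt0.
have b1' : 0 < beta + 1 by rewrite addr_gt0.
have [l2p l2n l2v] := power_scale beta L0 N0 bb.
set l2 := (L * n%:R) `^ _ in l2p l2n l2v.
have v2E : L `^ (2 / (beta + 2)) * n%:R `^ (- (beta / (beta + 2))) = L * l2 `^ beta.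
  by rewrite -l2v; congr (_ `^ _ * _); field; rewrite gt_eqF.
have split2 (x : R) : 0 < x -> x `^ (beta + 2) = x `^ beta * x ^+ 2.
  by move=> x0; rewrite powRD ?powR_mulrn ?(ltW x0)//; apply/implyP => _; rewrite gt_eqF.
have caseB (w := l2) : lam <= L * w `^ beta ->
    exists lam' : R, [/\ 0 < lam', 0 < w, lam <= lam' & L * w `^ beta <= lam'] /\
    (n%:R * ((L * w `^ beta) ^+ 2 / lam') * w ^+ 2 = 1 /\
     L `^ (2 / (beta + 2)) * n%:R `^ (- (beta / (beta + 2))) <= (L * w `^ beta) ^+ 2 / lam').
  move=> lamw; exists (L * w `^ beta).
  have p0 : 0 < L * w `^ beta by rewrite mulr_gt0// powR_gt0.
  split=> //; rewrite expr2 mulfK ?gt_eqF// v2E; split=> //.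
  by rewrite /w -[RHS]l2n split2//; ring.
rewrite /critical_length /separation_rate; have [lam0|lam0] := eqVneq lam 0.
  by apply: caseB; rewrite lam0 mulr_ge0 ?powR_ge0// ltW.
have lp : 0 < lam by rewrite lt_neqAle eq_sym lam0.
have K0 : 0 < lam^-1 * L ^+ 2 by rewrite mulr_gt0 ?exprn_gt0// invr_gt0.
have [l1p l1n l1v] := power_scale (2 * beta) K0 N0 b22.
set l1 := (lam^-1 * L ^+ 2 * n%:R) `^ _ in l1p l1n l1v *.
have v1E : (lam^-1 * L ^+ 2) `^ (1 / (beta + 1)) * n%:R `^ (- (beta / (beta + 1))) =
    lam^-1 * L ^+ 2 * l1 `^ (2 * beta).
  rewrite -l1v (_ : 1 / (beta + 1) = 1 - 2 * beta / (2 * beta + 2)); last by field; rewrite !gt_eqF.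
  by rewrite (_ : beta / (beta + 1) = 2 * beta / (2 * beta + 2))//; field; rewrite !gt_eqF.
have sq (x : R) : 0 < x -> x `^ (2 * beta) = (x `^ beta) ^+ 2.
  by move=> x0; rewrite mulrC powRrM powR_mulrn// powR_ge0.
have split22 (x : R) : 0 < x -> x `^ (2 * beta + 2) = (x `^ beta) ^+ 2 * x ^+ 2.
  by move=> x0; rewrite powRD ?powR_mulrn ?(ltW x0) ?sq//; apply/implyP => _; rewrite gt_eqF.
rewrite v1E; have [l12|l12] := leP l1 l2.
  have lamw : lam <= L * l2 `^ beta.
    have h : n%:R * (lam^-1 * L ^+ 2 * l1 `^ (2 * beta + 2)) <= n%:R * (lam^-1 * L ^+ 2 * l2 `^ (2 * beta + 2)).
      apply: ler_wpM2l; first exact: ltW.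
      by apply: ler_wpM2l; [exact: ltW|apply: ge0_ler_powR => //; rewrite ?nnegrE; exact: ltW].
    (* The two balance expressions differ by the factor [L * l2 ^ beta / lam]. As [l2] balances the
       second and is not shorter than [l1], the first is at least 1 at [l2], and so is the
       factor. *)
    have E : n%:R * (lam^-1 * L ^+ 2 * l2 `^ (2 * beta + 2)) =
        L * l2 `^ beta / lam * (n%:R * (L * l2 `^ (beta + 2))) by rewrite split2// split22//; ring.
    have : 1 <= L * l2 `^ beta / lam.
      by move: h; rewrite [X in X <= _]l1n [X in _ <= X]E [X in _ * X]l2n mulr1.
    by rewrite ler_pdivlMr// mul1r.
  have [lam' [h1 [h2 h3]]] := caseB lamw; exists lam'; split=> //; split=> //.
  by apply: le_trans h3; rewrite ge_min lexx orbT.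
exists lam; split; first split=> //.
  have h : n%:R * (L * l2 `^ (beta + 2)) <= n%:R * (L * l1 `^ (beta + 2)).
    apply: ler_wpM2l; first exact: ltW.
    by apply: ler_wpM2l; [exact: ltW|apply: ge0_ler_powR => //; rewrite ?nnegrE; exact: ltW].
  have E : n%:R * (lam^-1 * L ^+ 2 * l1 `^ (2 * beta + 2)) =
      L * l1 `^ beta / lam * (n%:R * (L * l1 `^ (beta + 2))) by rewrite split2// split22//; ring.
  move: h; rewrite [X in X <= _]l2n => h; move: E; rewrite [LHS]l1n => E.
  have x0 : 0 <= L * l1 `^ beta / lam by rewrite divr_ge0 ?mulr_ge0 ?powR_ge0 ?ltW.
  have : L * l1 `^ beta / lam <= 1 by rewrite E; apply: ler_peMr.
  by rewrite ler_pdivrMr// mul1r.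
have vE : (L * l1 `^ beta) ^+ 2 / lam = lam^-1 * L ^+ 2 * l1 `^ (2 * beta) by rewrite sq// exprMn; ring.
rewrite vE; split; last by rewrite ge_min lexx.
by rewrite -[RHS]l1n split22// sq//; ring.
Qed.

End scales.

(** * The lower bound for a fixed sample size *)

Section lower_bound.
Context (R : realType) (d : nat) (p q : 'I_d) (pq : (p < q)%N) (x0 : 'cV[R]_d).
Variables (t eta beta L lam : R) (n : nat) (law : (R -> 'M[R]_d) -> probability (path_space R d) R).
Hypotheses (t0 : 0 <= t) (eta0 : 0 < eta) (hbeta : 0 < beta <= 1) (L0 : 0 < L) (lam_ge0 : 0 <= lam) (n0 : (0 < n)%N).
Hypothesis lawP : forall Sigma, L1_spd Sigma -> observation_law x0 eta n Sigma (law Sigma).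
Variables (e c h : R).
Hypotheses (e0 : 0 < e) (c0 : 0 < c) (c3 : c <= 1 / 3)
  (ce : c * (6 * (1 + 1 / e ^+ 2) / (eta ^+ 2 * e) + 96 / e ^+ 3) <= 4 * e).
Hypotheses (hw : h <= critical_length beta L lam n) (tw1 : t + critical_length beta L lam n <= 1).
Variable phi : path_space R d -> R.
Hypothesis tphi : @tests R d phi.

(** The suprema over the two classes dominate every member of the two families, so the comparison of
    mixtures applies. The threshold for [A] and the parameter of Young's inequality are both set to
    [e]. *)
Lemma test_lower_bound : ((1 - 8 * e)%:E <=
  ereal_sup [set \int[law Sigma]_y (phi y)%:E | Sigma in @H0 R d beta L q lam] +
  ereal_sup [set \int[law Sigma]_y (1 - phi y)%:E | Sigma in
    @H1 R d t h q (c * separation_rate beta L lam n)])%E.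
Proof.
have [mphi phi01] := tphi; have ? := e0; have ? := c0; have ? := c3.
have [lam' [[lam'0 w0 lamlam' Lw] [nw rate]]] := scales hbeta L0 lam_ge0 n0.
have hw' := hw; have tw1' := tw1.
set w := critical_length beta L lam n in hw' tw1' w0 Lw nw rate.
set v := (L * w `^ beta) ^+ 2 / lam' in nw rate.
have Lw0 : 0 < L * w `^ beta by rewrite mulr_gt0// powR_gt0.
have v0 : 0 < v by rewrite divr_gt0// exprn_gt0.
(* The largest tilt scale that the Hoelder bound permits; it is at most [1 / 2] because
   [L * w ^ beta <= lam'], which keeps the tent below [1 / 4]. *)
pose del := L * w `^ beta / (2 * lam').
have del_gt0 : 0 < del by rewrite divr_gt0// mulr_gt0.
have del1 : del <= 1 / 2 by rewrite /del ler_pdivrMr ?mulr_gt0//; lra.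
have scale : 2 * lam' * del = L * w `^ beta by rewrite /del; field; rewrite gt_eqF.
have vlam : v <= lam' by rewrite /v ler_pdivrMr// -expr2 ler_pXn2r// ?nnegrE; exact: ltW.
(* The factor 3 compensates the loss in [lambda_spike_bump], and [c <= 1 / 3] keeps
   [g <= v <= lam']. *)
pose g := 3 * c * v.
have g0 : 0 < g by apply: mulr_gt0 => //; exact: mulr_gt0.
have glam : g <= lam' by rewrite /g; nra.
have gv : c * separation_rate beta L lam n <= g / 3.
  rewrite /g (_ : 3 * c * v / 3 = c * v); last by field.
  by apply: ler_wpM2l => //; exact: ltW.
have z1 (z : R) : z \in `[-1, 1] -> `|z| <= 1 by rewrite in_itv /= ler_norml.
have H0z z : z \in `[-1, 1] -> H0 beta L q lam (null_path p q lam' t w del z).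
  by move=> zI; apply: null_H0 => //; [exact: ltW|exact: z1].
have H1z z : z \in `[-1, 1] -> H1 t h q (c * separation_rate beta L lam n) (alt_path p q lam' t w del g z).
  by move=> zI; apply: alt_H1 => //; [exact: ltW|exact: z1].
have I0 : (0 : R) \in `[-1, 1] by rewrite in_itv /=; apply/andP; split; lra.
have m1phi : measurable_fun setT (fun y => 1 - phi y) by exact: measurable_funB.
have phi10 y : 0 <= 1 - phi y <= 1 by have /andP[? ?] := phi01 y; apply/andP; split; lra.
(* The suprema are real numbers: all integrals lie in [[0, 1]], and each class is nonempty since it
   contains the path with [z = 0]. *)
have supP (f : path_space R d -> R) (D : set (R -> 'M[R]_d)) S0 : measurable_fun setT f ->
    (forall y, 0 <= f y <= 1) -> D S0 ->
    exists2 a : R, (ereal_sup [set \int[law Sigma]_y (f y)%:E | Sigma in D] = a%:E)%E &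
      forall Sigma, D Sigma -> (\int[law Sigma]_y (f y)%:E <= a%:E)%E.
  move=> mf f01 DS0; set s := ereal_sup _.
  have sub Sigma : D Sigma -> (\int[law Sigma]_y (f y)%:E <= s)%E.
    by move=> DS; apply: ereal_sup_ubound; exists Sigma.
  have s1 : (s <= 1)%E.
    by apply: ge_ereal_sup => _ [Sigma _ <-]; exact: probability_integral_le1.
  have s0 : (0 <= s)%E.
    by apply: le_trans (sub _ DS0); apply: integral_ge0 => y _; rewrite lee_fin; have /andP[] := f01 y.
  have sfin : s \is a fin_num by rewrite ge0_fin_numE// (le_lt_trans s1)// ltry.
  by exists (fine s) => [|Sigma DS]; rewrite fineK//; exact: sub.
have [a -> aP] := supP phi _ _ mphi phi01 (H0z 0 I0).
have [b -> bP] := supP _ _ _ m1phi phi10 (H1z 0 I0).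
rewrite -EFinD lee_fin.
have nulla z : z \in `[-1, 1] -> (\int[law (null_path p q lam' t w del z)]_y (phi y)%:E <= a%:E)%E.
  by move=> zI; apply: aP; exact: H0z.
have altb z : z \in `[-1, 1] -> ((1 - b)%:E <= \int[law (alt_path p q lam' t w del g z)]_y (phi y)%:E)%E.
  move=> zI; have := bP _ (H1z z zI); set P := law _.
  have := ge0_integral_EFinD P (fun y => proj1 (andP (phi01 y))) mphi (fun y => proj1 (andP (phi10 y))) m1phi.
  have -> : (\int[P]_y (phi y + (1 - phi y))%:E = 1)%E.
    under eq_integral do rewrite subrKC.
    by have := integral_cst P measurableT 1%:E; rewrite [X in (_ * X)%E]probability_setT mule1.
  by move=> sum1 bz; rewrite [(1 - b)%:E]EFinB leeBlDr// [X in (X <= _)%E]sum1 leeD2l.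
have := testing_bound pq lam'0 w0 (ltW del_gt0) g0 eta0 n0 t0 tw1' del_gt0 lawP mphi phi01 e0 e0 nulla altb.
have -> : n%:R / (eta ^+ 2 * e) * (2 * (g * w) + 2 * (g * w) / e ^+ 2) * w =
    c * (6 * (1 + 1 / e ^+ 2) / (eta ^+ 2 * e)) * (n%:R * v * w ^+ 2).
  by rewrite /g; field; rewrite !gt_eqF.
have -> : 32 * g / (e ^+ 2 * (lam' * del ^+ 2)) / (2 * e) = 2 * (c * (96 / e ^+ 3)).
  have -> : lam' * del ^+ 2 = v / 4 by rewrite /del /v; field; rewrite gt_eqF.
  by rewrite /g; field; rewrite !gt_eqF.
rewrite nw mulr1 => bound.
(* The budget: [2 * e] for small terminal values, [e] and [e / 4] from Young's inequality, and at
   most [4 * e] for the terms proportional to [c], less than [8 * e] in total. *)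
have ce' : c * (6 * (1 + 1 / e ^+ 2) / (eta ^+ 2 * e)) + c * (96 / e ^+ 3) <= 4 * e by rewrite -mulrDr.
move: ce' bound; lra.
Qed.

End lower_bound.

Unset Implicit Arguments.

Theorem theorem6p1 (R : realType) (d : nat) (hd : (2 <= d)%N) (x0 : 'cV[R]_d)
  (t eta beta L lam : R) (r : nat)
  (ht : 0 <= t < 1) (heta : 0 < eta) (hbeta : 0 < beta <= 1) (hL : 0 < L)
  (hlam : 0 <= lam) (hr : (1 <= r <= d.-1)%N)
  (law : nat -> (R -> 'M[R]_d) -> probability (path_space R d) R)
  (hlaw : forall (n : nat) (Sigma : R -> 'M[R]_d), (0 < n)%N -> L1_spd Sigma ->
     observation_law x0 eta n Sigma (law n Sigma))
  (alpha : R) (halpha : 0 < alpha < 1) :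
  exists c : R, 0 < c /\
    forall h : nat -> R,
      h @ \oo --> (0 : R) ->
      (forall n : nat, (0 < n)%N ->
         0 < h n /\ h n <= c `^ (1 / (2 * beta)) * critical_length beta L lam n) ->
      (alpha%:E <=
       limn_einf (fun n : nat =>
         ereal_inf
           [set (ereal_sup [set \int[law n Sigma]_y (phi y)%:E
                           | Sigma in @H0 R d beta L r lam]
                 + ereal_sup [set \int[law n Sigma]_y (1 - phi y)%:E
                             | Sigma in @H1 R d t (h n) r
                                 (c * separation_rate beta L lam n)])%E
           | phi in @tests R d]))%E.
Proof.
have /andP[r1 rd] := hr; have /andP[t0 t1] := ht; have /andP[al0 al1] := halpha.
have /andP[be0 be1] := hbeta.
have lt_r : (r < d)%N by rewrite (leq_ltn_trans rd)// prednK// ltnW.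
have lt_0 : (0 < d)%N by exact: ltnW.
pose p := Ordinal lt_0; pose q := Ordinal lt_r; have pq : (p < q)%N by [].
(* Chosen so that [1 - 8 * e = alpha]. *)
pose e := (1 - alpha) / 8; have e0 : 0 < e by rewrite /e; lra.
pose M := 6 * (1 + 1 / e ^+ 2) / (eta ^+ 2 * e) + 96 / e ^+ 3.
have M0 : 0 < M.
  rewrite addr_gt0// divr_gt0// ?exprn_gt0// mulr_gt0// ?exprn_gt0//.
  by rewrite addr_gt0// divr_gt0// exprn_gt0.
(* The first bound keeps the additional eigenvalue below [lam'], the second makes the terms
   proportional to [c] at most [4 * e]. *)
pose c := Num.min (1 / 3) (4 * e / M).
have c0 : 0 < c by rewrite lt_min; apply/andP; split; [lra|rewrite divr_gt0// mulr_gt0].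
have c3 : c <= 1 / 3 by rewrite ge_min lexx.
have ce : c * M <= 4 * e by rewrite -ler_pdivlMr// ge_min lexx orbT.
exists c; split=> // h _ hP; apply: limn_einf_ge_near.
have t1' : 0 < 1 - t by rewrite subr_gt0.
near=> n; have n0 : (0 < n)%N by near: n; exact: nbhs_infty_gt.
have wt : critical_length beta L lam n <= 1 - t by near: n; exact: critical_length_small.
apply: le_ereal_inf_tmp => _ [phi tphi <-].
have -> : alpha = 1 - 8 * e by rewrite /e; field.
apply: (@test_lower_bound R d p q pq x0 t eta beta L lam n (law n) t0 heta hbeta hL hlam n0
  (fun Sigma => hlaw n Sigma n0) e c (h n) e0 c0 c3 ce) => //; last by rewrite addrC -lerBrDr.
have [_ hn] := hP n n0; apply: le_trans hn _.
have w0 : 0 <= critical_length beta L lam n.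
  by have [? [[_ /ltW]]] := scales hbeta hL hlam n0.
(* Since [c <= 1], the factor [c ^ (1 / (2 * beta))] is at most 1, so the interval of length [h n]
   fits into the window of critical length. *)
rewrite ler_piMl// [leRHS](_ : 1 = 1 `^ (1 / (2 * beta))); last by rewrite powR1.
apply: ge0_ler_powR; rewrite ?nnegrE ?ler01 ?(ltW c0)//; last by lra.
by rewrite divr_ge0// mulr_ge0// ltW.
Unshelve. all: by end_near.
Qed.
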